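(* For each $\lambda\in(0,\infty)$, let $\Phi_\lambda=\sum_{n=1}^\infty\delta_{X_n}$ be a stationary and isotropic determinantal point process on $\mathbb{R}^d$ with intensity $\lambda$ and kernel $K_\lambda$ satisfying the assumptions listed in the context, and let $I_\lambda(z)=\sum_{n=1}^\infty P_n\,\ell(z-X_n)$, $z\in\mathbb{R}^d$, be the associated shot-noise field with i.i.d. amplitudes $P_n$ and response function $\ell$ as in the context. Suppose that $\mathbb{E}[P_1^2]<\infty$, and set $$\widetilde{I_\lambda}(z)=\frac{I_\lambda(z)-\mathbb{E}[I_\lambda(z)]}{\lambda^{1/2}},\qquad z\in\mathbb{R}^d.$$ In addition, assume that $$\int_{\mathbb{R}^d}|K_\lambda(0,x)|^2\,\mathrm{d}x=o(\lambda)\quad\text{as }\lambda\to\infty.$$ Then, as $\lambda\to\infty$, $\{\widetilde{I_\lambda}(z)\}_{z\in\mathbb{R}^d}$ converges in finite dimensional distributions to a zero-mean Gaussian random field $\{N(z)\}_{z\in\mathbb{R}^d}$ with covariance function $$\mathrm{Cov}[N(z_1),N(z_2)]=\mathbb{E}[P_1^2]\int_{\mathbb{R}^d}\ell(z_1-x)\,\ell(z_2-x)\,\mathrm{d}x,\qquad z_1,z_2\in\mathbb{R}^d.$$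
   Context: Here $d\in\mathbb{N}=\{1,2,\ldots\}$. The amplitudes $P_n$, $n\in\mathbb{N}$, are i.i.d. nonnegative random variables, independent of $\Phi_\lambda$, whose common distribution function $F_P$ does not depend on $\lambda$ and has finite mean $p=\int_0^\infty t\,\mathrm{d}F_P(t)<\infty$. The response function $\ell:\mathbb{R}^d\to[0,\infty)$ does not depend on $\lambda$, is bounded, and satisfies $\int_{\mathbb{R}^d}\ell(x)\,\mathrm{d}x<\infty$. Under these conditions $\mathbb{E}[I_\lambda(z)]=\lambda p\int_{\mathbb{R}^d}\ell(x)\,\mathrm{d}x<\infty$ for every $z\in\mathbb{R}^d$. Determinantal point process: $\Phi_\lambda$ is a simple point process whose $n$th product density (correlation function) $\rho_n$ with respect to the Lebesgue measure is, for every $n\in\mathbb{N}$, $\rho_n(x_1,\ldots,x_n)=\det\bigl(K_\lambda(x_i,x_j)\bigr)_{i,j=1,\ldots,n}$, $x_1,\ldots,x_n\in\mathbb{R}^d$, where the kernel $K_\lambda:\mathbb{R}^d\times\mathbb{R}^d\to\mathbb{C}$ satisfies: (i) $K_\lambda$ is continuous on $\mathbb{R}^d\times\mathbb{R}^d$ with $K_\lambda(x,x)=\lambda$ for all $x\in\mathbb{R}^d$; (ii) $K_\lambda$ is Hermitian, i.e. $K_\lambda(x,y)$ is the complex conjugate of $K_\lambda(y,x)$ for all $x,y\in\mathbb{R}^d$; (iii) the integral operator $\mathcal{K}_\lambda$ on $L^2(\mathbb{R}^d,\mathrm{d}x)$ given by $\mathcal{K}_\lambda f(x)=\int_{\mathbb{R}^d}K_\lambda(x,y)f(y)\,\mathrm{d}y$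 has its spectrum in $[0,1]$; and moreover (iv) $|K_\lambda(x,y)|^2=|K_\lambda(0,y-x)|^2$ for all $x,y\in\mathbb{R}^d$, and this quantity depends only on the distance $\|x-y\|$. Convergence in finite dimensional distributions means that for every $m\in\mathbb{N}$ and $z_1,\ldots,z_m\in\mathbb{R}^d$, the random vector of values of the field at $z_1,\ldots,z_m$ converges in distribution. *)

(* Defs.v *)
From HB Require Import structures.
From mathcomp Require Import all_boot all_order all_algebra.
From mathcomp Require Import complex.
From mathcomp Require Import all_classical all_reals all_analysis.

Set Implicit Arguments.
Unset Strict Implicit.
Unset Printing Implicit Defensive.

Import Order.TTheory GRing.Theory Num.Theory.
Import numFieldNormedType.Exports.

Local Open Scope classical_set_scope.
Local Open Scope ring_scope.

(** R^d is 'rV[R]_d, and (R^d)^n is 'M[R]_(n, d), one point per row.  The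
    sigma-algebra generated by the entries is the Borel one. *)
Definition matrix_display : measure_display -> measure_display.
Proof. exact. Qed.

Section measurable_matrix.
Context (R : realType) (m n : nat).

Definition mx_entry_preimages : set (set 'M[R]_(m, n)) :=
  \bigcup_(ij in [set: 'I_m * 'I_n])
    preimage_set_system setT (fun A : 'M[R]_(m, n) => A ij.1 ij.2) measurable.

Let measurable_mxC (A : set 'M[R]_(m, n)) :
  <<s mx_entry_preimages >> A -> <<s mx_entry_preimages >> (~` A).
Proof. exact: sigma_algebraC. Qed.

HB.instance Definition _ :=
  @isMeasurable.Build (matrix_display default_measure_display)
    'M[R]_(m, n) <<s mx_entry_preimages >>
    (@sigma_algebra0 _ setT mx_entry_preimages) measurable_mxC
    (@sigma_algebra_bigcup _ setT mx_entry_preimages).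

End measurable_matrix.

Definition mpushforward d1 d2 (T1 : measurableType d1) (T2 : measurableType d2)
    (R : realType) (mu : {measure set T1 -> \bar R}) (f : T1 -> T2)
    (mf : measurable_fun setT f) : {measure set T2 -> \bar R}.
Proof. by unshelve refine (pushforward mu f : {measure set T2 -> \bar R}). Defined.

Section lebesgue_measure_matrix.
Context (R : realType).

Lemma measurable_cons_pair k :
  measurable_fun setT
    (fun xv : R * k.-tuple R => [the k.+1.-tuple R of xv.1 :: xv.2]).
Proof. exact: measurable_cons. Qed.

Fixpoint lebesgue_tuple (k : nat) : {measure set (k.-tuple R) -> \bar R} :=
  match k with
  | 0 => \d_([tuple] : 0.-tuple R)
  | k'.+1 => mpushforward (lebesgue_measure \x^ lebesgue_tuple k')%E
               (@measurable_cons_pair k')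
  end.

Definition mx_of_tuple m n (t : (m * n).-tuple R) : 'M[R]_(m, n) :=
  \matrix_(i, j) tnth t (mxvec_index i j).

Lemma measurable_mx_of_tuple m n : measurable_fun setT (@mx_of_tuple m n).
Proof.
apply: (@measurability _ _ _ _ _ _ (@mx_entry_preimages R m n)) => //.
move=> _ [_ [[i j] _ [B mB <-]] <-]; rewrite !setTI /=.
rewrite (_ : _ @^-1` _ = (@tnth _ R ^~ (mxvec_index i j)) @^-1` B).
  by rewrite -[X in measurable X]setTI; exact: measurable_tnth.
by apply/seteqP; split=> t; rewrite /= mxE.
Qed.

Definition lebesgue_mx m n : {measure set 'M[R]_(m, n) -> \bar R} :=
  mpushforward (lebesgue_tuple (m * n)) (@measurable_mx_of_tuple m n).

End lebesgue_measure_matrix.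

Arguments lebesgue_mx {R m n}.

Definition enorm (R : realType) d (x : 'rV[R]_d) : R :=
  Num.sqrt (\sum_i x 0 i ^+ 2).

Section integral_operator.
Context (R : realType) (d : nat).
Local Notation leb := (@lebesgue_mx R 1 d).
Implicit Types (f g : 'rV[R]_d -> R[i]) (K : 'rV[R]_d -> 'rV[R]_d -> R[i]).

Definition L2_sqnorm f : \bar R := (\int[leb]_x (Normc.normc (f x) ^+ 2)%:E)%E.

(** Elements of L^2 are represented by functions, so that equality and
    injectivity below are stated almost everywhere. *)
Definition L2 : set ('rV[R]_d -> R[i]) :=
  [set f | [/\ measurable_fun setT (fun x => complex.Re (f x)),
               measurable_fun setT (fun x => complex.Im (f x)) &
               (L2_sqnorm f < +oo)%E]].

Definition integral_op K f (x : 'rV[R]_d) : R[i] :=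
  ((\int[leb]_y complex.Re (K x y * f y)) +i*
   (\int[leb]_y complex.Im (K x y * f y)))%C.

Definition bounded_L2_operator K : Prop :=
  (forall f, L2 f -> {ae leb, forall x,
     leb.-integrable setT (fun y => (complex.Re (K x y * f y))%:E) /\
     leb.-integrable setT (fun y => (complex.Im (K x y * f y))%:E)}) /\
  exists M : R, forall f, L2 f ->
    L2 (integral_op K f) /\
    (L2_sqnorm (integral_op K f) <= M%:E * L2_sqnorm f)%E.

Definition L2_resolvent K : set R[i] :=
  [set z | (forall f, L2 f ->
              {ae leb, forall x, integral_op K f x - z * f x = 0} ->
              {ae leb, forall x, f x = 0}) /\
           exists M : R, forall g, L2 g -> exists f,
             [/\ L2 f, {ae leb, forall x, integral_op K f x - z * f x = g x} &
                 (L2_sqnorm f <= M%:E * L2_sqnorm g)%E]].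

Definition L2_spectrum K : set R[i] := ~` L2_resolvent K.

End integral_operator.

(** ** Point processes, given by a measurable enumeration of their points *)
Section point_process.
Context (R : realType) (d : nat).
Context (dO : measure_display) (Omega : measurableType dO).
Variable P : probability Omega R.
Implicit Types X Y : nat -> Omega -> 'rV[R]_d.

Definition count_points X (w : Omega) (B : set 'rV[R]_d) : \bar R :=
  (\sum_(0 <= k <oo) (\1_B (X k w))%:E)%E.

Definition simple_process X : Prop :=
  {ae P, forall w, injective (fun k => X k w)}.

Definition locally_finite X : Prop :=
  {ae P, forall w, forall r : R,
    (count_points X w [set x | (enorm x <= r)%R] < +oo)%E}.

Definition same_process_law X Y : Prop :=
  forall m (B : 'I_m -> set 'rV[R]_d) (k : 'I_m -> \bar R),
    (forall i, measurable (B i)) ->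
    P [set w | forall i, count_points X w (B i) = k i] =
    P [set w | forall i, count_points Y w (B i) = k i].

Definition stationary X : Prop :=
  forall t : 'rV[R]_d, same_process_law (fun k w => X k w + t) X.

Definition isotropic X : Prop :=
  forall Q : 'M[R]_d, Q *m Q^T = 1%:M -> \det Q = 1 ->
    same_process_law (fun k w => X k w *m Q) X.

Definition has_intensity X (lam : R) : Prop :=
  forall B : set 'rV[R]_d, measurable B ->
    (\int[P]_w count_points X w B = lam%:E * lebesgue_mx B)%E.

(** The factorial moment measure sums over all n-tuples of distinct indices. *)
Definition factorial_moment X n (B : set 'M[R]_(n, d)) : \bar R :=
  (\int[P]_w \esum_(s in [set s : n.-tuple nat | uniq s])
     (\1_B (\matrix_(i < n, j < d) X (tnth s i) w 0 j))%:E)%E.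

Definition product_density X n (rho : 'M[R]_(n, d) -> R) : Prop :=
  [/\ measurable_fun setT rho, forall x, 0 <= rho x &
      forall B, measurable B ->
        factorial_moment X B = (\int[lebesgue_mx]_(x in B) (rho x)%:E)%E].

Definition determinantal X (K : 'rV[R]_d -> 'rV[R]_d -> R[i]) : Prop :=
  forall n, (0 < n)%N -> exists rho : 'M[R]_(n, d) -> R,
    product_density X rho /\
    forall x, (rho x)%:C%C = \det (\matrix_(i < n, j < n) K (row i x) (row j x)).

(** [normc z] is the real-valued modulus of [z : R[i]]; [R[i]^o] carries the
    metric topology of the complex plane. *)
Definition dpp_kernel (lam : R) (K : 'rV[R]_d -> 'rV[R]_d -> R[i]) : Prop :=
  [/\ continuous (fun xy : 'rV[R]_d * 'rV[R]_d => K xy.1 xy.2 : R[i]^o) /\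
        (forall x, K x x = lam%:C%C),
      forall x y, K x y = ((K y x)^*)%C,
      bounded_L2_operator K /\
        L2_spectrum K `<=` [set (t%:C)%C | t in `[0, 1]],
      forall x y, Normc.normc (K x y) ^+ 2 = Normc.normc (K 0 (y - x)) ^+ 2 &
      exists kappa : R -> R, forall x y,
        Normc.normc (K x y) ^+ 2 = kappa (enorm (x - y))].

Definition stationary_isotropic_dpp X (lam : R)
    (K : 'rV[R]_d -> 'rV[R]_d -> R[i]) : Prop :=
  [/\ simple_process X /\ locally_finite X, stationary X, isotropic X,
      has_intensity X lam & dpp_kernel lam K /\ determinantal X K].

End point_process.

Section independence.
Context (R : realType) (dO : measure_display) (Omega : measurableType dO).
Variable P : probability Omega R.

Definition mutually_independent d' (T : measurableType d')
    (Y : nat -> Omega -> T) : Prop :=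
  forall (s : seq nat) (B : nat -> set T), uniq s ->
    (forall k, measurable (B k)) ->
    P (\bigcap_(k in [set` s]) (Y k @^-1` B k)) =
    (\prod_(k <- s) P (Y k @^-1` B k))%E.

Definition sigma_of_seq d' (T : measurableType d')
    (Y : nat -> Omega -> T) : set (set Omega) :=
  <<s \bigcup_k preimage_set_system setT (Y k) measurable >>.

Definition independent_sequences d1 d2 (T1 : measurableType d1)
    (T2 : measurableType d2) (Y : nat -> Omega -> T1) (Z : nat -> Omega -> T2) :
    Prop :=
  forall A B, sigma_of_seq Y A -> sigma_of_seq Z B ->
    (P (A `&` B) = P A * P B)%E.

End independence.

Section shot_noise.
Context (R : realType) (d : nat).
Context (dO : measure_display) (Omega : measurableType dO).
Variable P : probability Omega R.

Definition shot_noise (A : nat -> Omega -> R) (ell : 'rV[R]_d -> R)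
    (X : nat -> Omega -> 'rV[R]_d) (z : 'rV[R]_d) (w : Omega) : \bar R :=
  (\sum_(0 <= k <oo) (A k w * ell (z - X k w))%:E)%E.

Definition normalized_shot_noise (lam : R) (A : nat -> Omega -> R)
    (ell : 'rV[R]_d -> R) (X : nat -> Omega -> 'rV[R]_d) (z : 'rV[R]_d)
    (w : Omega) : R :=
  (fine (shot_noise A ell X z w) -
   fine (\int[P]_w' (shot_noise A ell X z w'))%E) / Num.sqrt lam.

End shot_noise.

Section gaussian.
Context (R : realType).

(** [normal_prob m 0] is not the degenerate law, hence the case split. *)
Definition gaussian_law (mu : set R -> \bar R) : Prop :=
  exists m s : R, forall B : set R, measurable B ->
    mu B = if s == 0 then \d_m B else normal_prob m s B.

Definition gaussian_field (I : Type) (dO : measure_display)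
    (Omega : measurableType dO) (P : probability Omega R)
    (N : I -> {RV P >-> R}) : Prop :=
  forall m (z : 'I_m -> I) (a : 'I_m -> R),
    gaussian_law (pushforward P (fun w => \sum_(i < m) a i * N (z i) w)).

(** Convergence in distribution, as the parameter tends to infinity, of random
    vectors that may live on different probability spaces. *)
Definition cvg_in_distribution m (dO : R -> measure_display)
    (Omega : forall lam, measurableType (dO lam))
    (P : forall lam, probability (Omega lam) R)
    (Y : forall lam, Omega lam -> 'rV[R]_m)
    (dO' : measure_display) (Omega' : measurableType dO')
    (P' : probability Omega' R) (Y' : Omega' -> 'rV[R]_m) : Prop :=
  forall g : 'rV[R]_m -> R, continuous g ->
    (exists M : R, forall y, `|g y| <= M) ->
    ('E_(P lam)[fun w => g (Y lam w)])%E @[lam --> +oo%R] -->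
    ('E_P'[fun w => g (Y' w)])%E.

End gaussian.

(* Main.v *)
(* The characteristic function of the shot noise at intensity [lam] is
   E prod_i (1 + u (X_i)) with 1 + u = phi_P o g, where phi_P is the
   characteristic function of the amplitudes and g a linear combination of
   translates of [ell] divided by [sqrt lam]. It expands as
   sum_n 1/n! int u(x_1)...u(x_n) det K. Restoring the diagonal of K one entry
   at a time shows that the product of the diagonal entries contributes
   exp (lam int u), while a permutation with a cycle of length at least 2 is
   bounded through the Hilbert-Schmidt norm of |u|^(1/2) K |u|^(1/2), whose
   square is at most sup |u| * int |u| * int |K(0, x)|^2 = o(1) by hypothesis.
   After centering, lam int u tends to - E[P^2] / 2 * int f^2, and Levy's
   continuity theorem concludes.

   The limit field is N(z) = sum_k c_k(z) xi_k, where the c_k are Cholesky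
   coordinates in L^2 of the translates of [ell], so that
   sum_k c_k(z1) c_k(z2) is the covariance, and the xi_k are independent normal
   variables on the unit interval obtained from the binary digits of a uniform
   variable. *)
Require Import Defs.
From HB Require Import structures.
From mathcomp Require Import all_boot all_order all_algebra.
From mathcomp Require Import perm complex.
From mathcomp Require Import all_classical all_reals all_analysis.
From mathcomp Require Import measurable_realfun.
From mathcomp Require Import zify ring lra.

Set Implicit Arguments.
Unset Strict Implicit.
Unset Printing Implicit Defensive.

Import Order.TTheory GRing.Theory Num.Theory.
Import numFieldNormedType.Exports.

Local Open Scope classical_set_scope.
Local Open Scope ring_scope.

(** * Integration preliminaries *)

(** The obstacle is that [lam * int |u|] may grow like [sqrt lam], so bounding the determinantal
    series term by term is hopeless. Splitting off the diagonal factors it, as a Cauchy product,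
    into [exp c] with [c = lam * int u] and the series of permutations without fixed points. If [h]
    bounds the Hilbert-Schmidt norm, the [n]-th coefficient of the latter is at most [2 n! h^n];
    after division by [n!] a geometric series remains, which starts with 1 and 0 and therefore is 1
    up to [4 h^2]. The error is thus relative to [|exp c|], which is at most 1 because [Re u <= 0];
    only the imaginary part of [c] can diverge, and centering removes its divergent part. With
    [|u| <= 4 p |f| / sqrt lam], where [f] combines the translates of [ell], both [sup |u|] and
    [int |u|] are of order [lam^(-1/2)], so [h^2] is of order [int |K(0, x)|^2 / lam]. Tightness is
    never discussed: the limit law is exhibited beforehand, and approximation of test functions from
    below is enough. *)

Section matrix_measurability.
Context (R : realType) (m n : nat).

Lemma measurable_mx_entry i j :
  measurable_fun setT (fun A : 'M[R]_(m, n) => A i j).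
Proof.
move=> _ B mB; rewrite setTI; apply: sub_sigma_algebra.
by exists (i, j) => //; exists B => //; rewrite setTI.
Qed.

Lemma measurable_mx d (T : measurableType d) (f : T -> 'M[R]_(m, n)) :
  (forall i j, measurable_fun setT (fun x => f x i j)) -> measurable_fun setT f.
Proof.
move=> mf; apply: (@measurability _ _ _ _ _ _ (@mx_entry_preimages R m n)) => //.
move=> _ [_ [[i j] _ [B mB <-]] <-]; rewrite !setTI /=.
by rewrite -[X in measurable X]setTI; exact: (mf i j _ B mB).
Qed.

Lemma measurable_mx_ball (A : 'M[R]_(m, n)) (e : R) : measurable (ball A e).
Proof.
(* Balls of matrices carry the condition [0 < e], so they are empty for the other radii. *)
have [e0|e0] := ltP 0 e; last first.
  rewrite (_ : ball A e = set0)//; apply/seteqP; split => // B [].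
  by rewrite ltNge e0.
have -> : ball A e = \bigcap_(ij in [set: 'I_m * 'I_n])
    ((fun B : 'M[R]_(m, n) => B ij.1 ij.2) @^-1` (ball (A ij.1 ij.2) e)).
  apply/seteqP; split=> B /= h; first by case: h => _ h ij _; exact: h.
  by split => // i j; exact: (h (i, j)).
apply: fin_bigcap_measurable; first exact: finite_finset.
move=> ij _; rewrite -[X in measurable X]setTI.
by apply: measurable_mx_entry => //; apply: open_measurable; exact: ball_open.
Qed.

(** The sigma-algebra is generated by the entries, not by the open sets. The link is that an open
    set is the union of the countably many balls with rational centre and radius [1 / (k + 1)] that
    it contains. *)
Lemma open_measurable_mx (U : set 'M[R]_(m, n)) : open U -> measurable U.
Proof.
move=> oU.
pose q2m (q : 'M[rat]_(m, n)) : 'M[R]_(m, n) := map_mx ratr q.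
pose D := [set qk : 'M[rat]_(m, n) * nat | ball (q2m qk.1) (qk.2.+1%:R^-1) `<=` U].
have -> : U = \bigcup_(qk in D) ball (q2m qk.1) (qk.2.+1%:R^-1).
  apply/seteqP; split => [A UA|A [qk Dqk Aqk]]; last exact: Dqk.
  move: oU; rewrite openE => /(_ _ UA); rewrite /interior/= -nbhs_ballE => -[e /= e0 eU].
  have [k ke] : exists k : nat, k.+1%:R^-1 < e / 2.
    have /ltr_add_invr[k] : 0 < e / 2 by rewrite divr_gt0.
    by rewrite add0r => ?; exists k.
  have hq ij : exists q : rat, ratr q \in `](A ij.1 ij.2 - k.+1%:R^-1), (A ij.1 ij.2)[.
    by apply: rat_in_itvoo; rewrite gtrBl invr_gt0.
  have [q Hq'] := choice hq.
  have Hq i j : A i j - k.+1%:R^-1 < ratr (q (i, j)) /\ ratr (q (i, j)) < A i j.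
    by have := Hq' (i, j); rewrite in_itv/= => /andP.
  exists (\matrix_(i, j) q (i, j), k); last first.
    split; rewrite ?invr_gt0// => i j; rewrite /ball/= !mxE/=.
    have k0 : 0 < k.+1%:R^-1 :> R by rewrite invr_gt0.
    move: k0 (Hq i j) => + [+ +]; move: (k.+1%:R^-1) (ratr _) (A i j) => u v w k0 h1 h2.
    by rewrite ltr_norml; apply/andP; split; lra.
  move=> B [_ hB]; apply: eU; split => // i j; have := hB i j; rewrite /ball/= !mxE/=.
  move: ke (Hq i j) => + [+ +]; move: (k.+1%:R^-1) (ratr _) (A i j) => u v w ke h1 h2.
  by rewrite !ltr_norml => /andP[h3 h4]; apply/andP; split; lra.
rewrite bigcup_mkcond; apply: countable_bigcupT_measurable; first exact: countableP.
by move=> qk; case: ifPn => // _; exact: measurable_mx_ball.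
Qed.

Lemma continuous_measurable_mx (f : 'M[R]_(m, n) -> R) :
  continuous f -> measurable_fun setT f.
Proof.
move=> cf; apply: (measurability _ (RGenOpens.measurableE R)) => //.
move=> _ [_ [a [b ->]] <-]; rewrite setTI; apply: open_measurable_mx.
by apply: open_comp => // x _; exact: cf.
Qed.

Lemma continuous_mx_ball (f : 'M[R]_(m, n) -> R) : continuous f ->
  forall A e, 0 < e -> exists2 r, 0 < r & forall B, ball A r B -> `|f A - f B| < e.
Proof.
move=> cf A e e0; have := cf A _ (nbhsx_ballx (f A) e e0).
by move=> /nbhs_ballP[r /= r0 hr]; exists r => // B /hr.
Qed.

Lemma ball_continuous_mx (f : 'M[R]_(m, n) -> R) :
  (forall A e, 0 < e -> exists2 r, 0 < r & forall B, ball A r B -> `|f A - f B| < e) ->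
  continuous f.
Proof.
move=> H A U /nbhs_ballP[e /= e0 eU]; have [r r0 hr] := H A e e0.
by apply/nbhs_ballP; exists r => // B /hr ?; exact: eU.
Qed.

End matrix_measurability.

Lemma measurable_cosR (R : realType) : measurable_fun setT (@cos R).
Proof. by apply: continuous_measurable_fun; exact: continuous_cos. Qed.

Lemma measurable_sinR (R : realType) : measurable_fun setT (@sin R).
Proof. by apply: continuous_measurable_fun; exact: continuous_sin. Qed.

Section real_integrals.
Context d (T : measurableType d) (R : realType).
Implicit Types (mu : {measure set T -> \bar R}) (f g : T -> R).

Lemma dominated_Rintegral mu (f_ : nat -> T -> R) f g :
  (forall n, measurable_fun setT (f_ n)) -> measurable_fun setT f ->
  {ae mu, forall x, f_ ^~ x @ \oo --> f x} ->
  mu.-integrable setT (EFin \o g) ->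
  (forall n x, `|f_ n x| <= g x) ->
  \int[mu]_x f_ n x @[n --> \oo] --> \int[mu]_x f x.
Proof.
move=> mf_ mf cf ig fg.
have [] := @dominated_convergence _ T R mu setT measurableT (fun n => EFin \o f_ n)
  (EFin \o f) (EFin \o g).
- by move=> n; exact/measurable_EFinP.
- exact/measurable_EFinP.
- case: cf => N [mN N0 sN]; exists N; split => // x /= h; apply: sN => /= h2.
  by apply: h => _; apply: cvg_EFin => //; exact: nearW.
- exact: ig.
- by apply: aeW => x n _ /=; rewrite lee_fin.
move=> intf _ cv; apply: fine_cvg; rewrite fineK//.
exact: integrable_fin_num.
Qed.

End real_integrals.

Section integrable_real.
Context d (T : measurableType d) (R : realType) (mu : {measure set T -> \bar R}).
Implicit Types f g : T -> R.

Lemma integrable_RZ c f : mu.-integrable setT (fun x => (f x)%:E) ->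
  mu.-integrable setT (fun x => (c * f x)%:E).
Proof. by move=> fi; have := integrableZl measurableT c fi. Qed.

Lemma integrable_RD f g : mu.-integrable setT (fun x => (f x)%:E) ->
  mu.-integrable setT (fun x => (g x)%:E) ->
  mu.-integrable setT (fun x => (f x + g x)%:E).
Proof. by move=> fi gi; have := integrableD measurableT fi gi. Qed.

Lemma integrable_RB f g : mu.-integrable setT (fun x => (f x)%:E) ->
  mu.-integrable setT (fun x => (g x)%:E) ->
  mu.-integrable setT (fun x => (f x - g x)%:E).
Proof. by move=> fi gi; have := integrableB measurableT fi gi. Qed.

Lemma integrable_R_sum (I : Type) (s : seq I) (f : I -> T -> R) :
  (forall i, mu.-integrable setT (fun x => (f i x)%:E)) ->
  mu.-integrable setT (fun x => (\sum_(i <- s) f i x)%:E).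
Proof.
move=> fi; under eq_fun do rewrite -sumEFin.
by apply: integrable_sum => // i _; exact: fi.
Qed.

Lemma le_integrable_R f g : measurable_fun setT f -> (forall x, `|f x| <= g x) ->
  mu.-integrable setT (fun x => (g x)%:E) -> mu.-integrable setT (fun x => (f x)%:E).
Proof.
move=> mf fg gi; apply: le_integrable gi => //; first exact/measurable_EFinP.
by move=> x _; rewrite lee_fin (le_trans (fg x))// ler_norm.
Qed.

End integrable_real.

Section probability_integrals.
Context d (T : measurableType d) (R : realType) (P : probability T R).
Implicit Types f : T -> R.

Lemma bounded_integrable f (M : R) : measurable_fun setT f ->
  (forall x, `|f x| <= M) -> P.-integrable setT (EFin \o f).
Proof.
move=> mf fM; apply: (@le_integrable _ T R P setT measurableT _ (EFin \o cst M)).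
- exact/measurable_EFinP.
- by move=> x _ /=; rewrite lee_fin (le_trans (fM x))// ler_norm.
- exact: finite_measure_integrable_cst.
Qed.

Lemma Rintegral_probability_cst (r : R) : \int[P]_x r = r.
Proof. by rewrite /Rintegral integral_cst//= probability_setT mule1. Qed.

Lemma normr_Rintegral_le f (M : R) : measurable_fun setT f ->
  (forall x, `|f x| <= M) -> `|\int[P]_x f x| <= M.
Proof.
move=> mf fM; apply: (le_trans (le_normr_Rintegral measurableT (bounded_integrable mf fM))).
rewrite -[leRHS]Rintegral_probability_cst; apply: le_Rintegral => //.
  apply: (@bounded_integrable _ M) => [|x]; last by rewrite normr_id.
  exact: measurableT_comp.
exact: finite_measure_integrable_cst.
Qed.

End probability_integrals.

Section fubini_probability.
Context d1 d2 (T1 : measurableType d1) (T2 : measurableType d2) (R : realType).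
Variables (P1 : probability T1 R) (P2 : probability T2 R).
Variables (F : T1 * T2 -> R) (M : R).
Hypotheses (mF : measurable_fun setT F) (FM : forall xy, `|F xy| <= M).

Let iF : (P1 \x P2)%E.-integrable setT (EFin \o F).
Proof. exact: (@bounded_integrable _ _ _ (P1 \x P2)%E _ M). Qed.

Let F1E : (fun x => \int[P2]_y (F (x, y))%:E)%E = (fun x => (\int[P2]_y F (x, y))%:E).
Proof.
apply/funext => x; rewrite fineK//; apply: integrable_fin_num => //.
apply: (@bounded_integrable _ _ _ _ _ M) => //; exact: measurableT_comp.
Qed.

Let F2E : (fun y => \int[P1]_x (F (x, y))%:E)%E = (fun y => (\int[P1]_x F (x, y))%:E).
Proof.
apply/funext => y; rewrite fineK//; apply: integrable_fin_num => //.
apply: (@bounded_integrable _ _ _ _ _ M) => //; exact: measurableT_comp.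
Qed.

Lemma measurable_Rintegral1 : measurable_fun setT (fun x => \int[P2]_y F (x, y)).
Proof.
apply/measurable_EFinP; rewrite -[X in measurable_fun _ X]F1E.
exact: (measurable_fubini_F iF).
Qed.

Lemma measurable_Rintegral2 : measurable_fun setT (fun y => \int[P1]_x F (x, y)).
Proof.
apply/measurable_EFinP; rewrite -[X in measurable_fun _ X]F2E.
exact: (measurable_fubini_G iF).
Qed.

Lemma Rintegral_swap :
  \int[P1]_x \int[P2]_y F (x, y) = \int[P2]_y \int[P1]_x F (x, y).
Proof. by have := Fubini iF; rewrite F1E F2E /Rintegral => ->. Qed.

Lemma Rintegral_prod :
  \int[(P1 \x P2)%E]_xy F xy = \int[P1]_x \int[P2]_y F (x, y).
Proof. by have := integral12_prod_meas1 iF; rewrite /fubini_F F1E /Rintegral => <-. Qed.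

End fubini_probability.

(** * Change of measure by a density *)

Section integral_density.
Local Open Scope ereal_scope.
Context d (T : measurableType d) (R : realType).
Variables (mu nu : {measure set T -> \bar R}) (h : T -> R).
Hypotheses (mh : measurable_fun setT h) (h0 : forall x, (0 <= h x)%R).
Hypothesis nuE : forall A, measurable A -> nu A = \int[mu]_(x in A) (h x)%:E.

Import HBNNSimple.

Let integral_density_nnsfun (g : {nnsfun T >-> R}) :
  \int[nu]_x (g x)%:E = \int[mu]_x ((g x)%:E * (h x)%:E).
Proof.
under [LHS]eq_integral do rewrite fimfunE -fsumEFin//.
rewrite [LHS]ge0_integral_fsum//; last 2 first.
  - by move=> r; exact/measurable_EFinP/measurableT_comp.
  - by move=> n x _; rewrite EFinM nnfun_muleindic_ge0.
under [RHS]eq_integral.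
  move=> x xD; rewrite fimfunE -fsumEFin// ge0_mule_fsuml; last first.
    by move=> r; rewrite EFinM nnfun_muleindic_ge0.
  over.
rewrite [RHS]ge0_integral_fsum//; last 2 first.
  - move=> r; apply: emeasurable_funM; last exact/measurable_EFinP.
    by apply/measurable_EFinP; do 2 apply/measurableT_comp => //.
  - move=> n x _; rewrite EFinM mule_ge0//; last by rewrite lee_fin.
    exact: nnfun_muleindic_ge0.
apply: eq_fsbigr => r _; rewrite integralZl_indic_nnsfun// integral_indic// setIT.
under [RHS]eq_integral do rewrite EFinM -muleA.
have [r0|r0] := leP 0%R r; last first.
  rewrite preimage_nnfun0// measure0 mule0 integral0_eq// => x _.
  by rewrite indic0 mul0e mule0.
rewrite [RHS]ge0_integralZl//; last 2 first.
  - by apply: emeasurable_funM; apply/measurable_EFinP.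
  - by move=> x _; rewrite mule_ge0// lee_fin.
rewrite nuE//; congr (_ * _); rewrite integral_mkcond.
apply: eq_integral => x _; rewrite /patch indicE.
by case: ifPn => _; rewrite ?mul1e ?mul0e.
Qed.

(** [nuE] is the statement for indicators; simple functions and monotone convergence extend it. *)
Lemma ge0_integral_density (f : T -> \bar R) : measurable_fun setT f ->
  (forall x, 0 <= f x) -> \int[nu]_x f x = \int[mu]_x (f x * (h x)%:E).
Proof.
move=> mf f0; pose f_ := nnsfun_approx measurableT mf.
have ndf x : {homo (fun n => (f_ n x)%:E) : a b / (a <= b)%N >-> a <= b}.
  by move=> a b ab; rewrite lee_fin//; exact/lefP/nd_nnsfun_approx.
have cf x : (f_ n x)%:E @[n --> \oo] --> f x by exact: cvg_nnsfun_approx.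
transitivity (limn (fun n => \int[nu]_x (f_ n x)%:E)).
  rewrite -monotone_convergence//=.
  - by apply: eq_integral => x _; apply/esym/cvg_lim.
  - by move=> n; exact/measurable_EFinP.
  - by move=> n x _; rewrite lee_fin.
under eq_fun do rewrite integral_density_nnsfun.
rewrite -monotone_convergence//=.
- apply: eq_integral => x _; apply/cvg_lim => //.
  by apply: cvgeZr => //; exact: cf.
- by move=> n; apply: emeasurable_funM; apply/measurable_EFinP.
- by move=> n x _; rewrite mule_ge0// lee_fin.
- by move=> x _ a b ab; rewrite lee_wpmul2r ?lee_fin//; exact/lefP/nd_nnsfun_approx.
Qed.

(** Multiplication by the nonnegative [h] commutes with taking positive and negative parts, so both
    sides are differences of the same two nonnegative integrals. *)
Lemma integral_density (f : T -> \bar R) : measurable_fun setT f ->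
  \int[nu]_x f x = \int[mu]_x (f x * (h x)%:E).
Proof.
move=> mf; rewrite [LHS]integralE [RHS]integralE.
rewrite !ge0_integral_density//; [|exact: measurable_funeneg|exact: measurable_funepos].
congr (_ - _); apply: eq_integral => x _.
- by rewrite !funeposE maxe_pMl ?mul0e// lee_fin.
- by rewrite !funenegE maxe_pMl ?mul0e ?mulNe// lee_fin.
Qed.

End integral_density.

(** * The standard normal law *)

Section standard_normal.
Context (R : realType).
Notation leb := (@lebesgue_measure R).
Local Notation N01 := (normal_prob (0 : R) 1).
Local Notation phi := (normal_pdf (0 : R) 1).

Lemma normal_pdf01E x : phi x = normal_peak (1 : R) * expR (- x ^+ 2 / 2).
Proof.
by rewrite normal_pdfE ?oner_neq0// /normal_fun subr0 expr1n.
Qed.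

Lemma integral_normal01 (f : R -> R) : measurable_fun setT f ->
  (\int[N01]_x (f x)%:E = \int[leb]_x (f x * phi x)%:E)%E.
Proof.
move=> mf.
rewrite (@integral_density _ (measurableTypeR R) R leb N01 phi)//.
- exact: measurable_normal_pdf.
- by move=> x; exact: normal_pdf_ge0.
- exact/measurable_EFinP.
Qed.

Lemma Rintegral_normal01 (f : R -> R) : measurable_fun setT f ->
  \int[N01]_x f x = \int[leb]_x (f x * phi x).
Proof. by move=> mf; rewrite /Rintegral integral_normal01. Qed.

Lemma Rintegral_opp (f : R -> R) : leb.-integrable setT (fun x => (f x)%:E) ->
  \int[leb]_x f x = \int[leb]_x f (- x).
Proof.
move=> fi; have mN : measurable_fun setT (-%R : measurableTypeR R -> measurableTypeR R).
  exact: oppr_measurable.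
have E (g : R -> \bar R) : (\int[leb]_x g x = \int[pushforward leb (-%R : _ -> measurableTypeR R)]_x g x)%E.
  by apply: eq_measure_integral => A mA _; exact/esym/lebesgue_measureN.
have mf := measurable_int leb fi.
congr fine; rewrite E integral_pushforward//.
apply/integrableP; split; first exact: measurableT_comp.
move/integrableP: fi => [_]; rewrite E ge0_integral_pushforward//.
exact: measurableT_comp.
Qed.

Lemma is_derive_normal_pdf01 (x : R) : is_derive x 1 phi (- x * phi x).
Proof.
have -> : phi = (fun x => normal_peak (1 : R) * expR (- x ^+ 2 / 2)).
  by apply/funext => y; exact: normal_pdf01E.
have h : is_derive x 1 (fun y : R => - y ^+ 2 / 2) (- x).
  by apply: is_derive_eq; rewrite /GRing.scale/=; field.
have := @is_derive1_comp _ expR (fun y : R => - y ^+ 2 / 2) x _ _ (is_derive_expR _) h.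
by move=> h2; apply: is_derive_eq; rewrite /GRing.scale/=; ring.
Qed.

Lemma continuous_normal_pdf01 : continuous phi.
Proof. by apply: continuous_normal_pdf; exact: oner_neq0. Qed.

(* [x phi(x)] is dominated by a multiple of a wider Gaussian. *)
Lemma integrable_id_normal_pdf01 : leb.-integrable setT (fun x => (`|x| * phi x)%:E).
Proof.
pose c := normal_peak (1 : R) * 4 / normal_peak (2 : R).
have i2 : leb.-integrable setT (fun x => (c * normal_pdf (0 : R) 2 x)%:E).
  exact: (integrable_RZ c (integrable_normal_pdf (0 : R) 2)).
apply: le_integrable i2 => //.
  apply/measurable_EFinP; apply: measurable_funM; first exact: normr_measurable.
  exact: measurable_normal_pdf.
move=> x _; rewrite lee_fin.
have p1 : 0 < normal_peak (1 : R) by apply: normal_peak_gt0; exact: oner_neq0.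
have p2 : 0 < normal_peak (2 : R) by apply: normal_peak_gt0.
have c0 : 0 <= c by rewrite /c divr_ge0 ?mulr_ge0 ?ltW.
rewrite (normrM `|x|) (normrM c) normr_id (ger0_norm c0) !(ger0_norm (normal_pdf_ge0 _ _ _)).
rewrite normal_pdf01E normal_pdfE ?pnatr_eq0// /normal_fun subr0.
rewrite /c.
have -> : - x ^+ 2 / (2 ^+ 2 *+ 2) = - x ^+ 2 / 8 by congr (_ / _); rewrite expr2 -mulr_natr; ring.
have -> : - x ^+ 2 / 2 = - x ^+ 2 / 8 + - (3 / 8 * x ^+ 2) by field.
rewrite expRD.
have h : `|x| * expR (- (3 / 8 * x ^+ 2)) <= 4.
  rewrite expRN ler_pdivrMr ?expR_gt0//.
  have := expR_ge1Dx (3 / 8 * x ^+ 2).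
  rewrite -[x ^+ 2]real_normK ?num_real//; move: (expR _) => E.
  have := normr_ge0 x; move: (`|x|) => a; nra.
have -> : normal_peak 1 * 4 / normal_peak 2 * (normal_peak 2 * expR (- x ^+ 2 / 8)) =
   normal_peak 1 * (expR (- x ^+ 2 / 8) * 4) :> R.
  by field; rewrite gt_eqF.
have -> : `|x| * (normal_peak 1 * (expR (- x ^+ 2 / 8) * expR (- (3 / 8 * x ^+ 2)))) =
  normal_peak 1 * (expR (- x ^+ 2 / 8) * (`|x| * expR (- (3 / 8 * x ^+ 2)))) by ring.
apply: ler_wpM2l; first exact: ltW.
by apply: ler_wpM2l => //; exact: expR_ge0.
Qed.

Lemma integrable_bounded_pdf (f : R -> R) : measurable_fun setT f ->
  (forall x, `|f x| <= 1) -> leb.-integrable setT (fun x => (f x * phi x)%:E).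
Proof.
move=> mf f1; apply: le_integrable (integrable_normal_pdf (0:R) 1) => //.
  by apply/measurable_EFinP; apply: measurable_funM => //; exact: measurable_normal_pdf.
by move=> x _; rewrite lee_fin normrM ler_piMl.
Qed.

Lemma integrable_bounded_id_pdf (f : R -> R) : measurable_fun setT f ->
  (forall x, `|f x| <= 1) -> leb.-integrable setT (fun x => (x * f x * phi x)%:E).
Proof.
move=> mf f1; apply: le_integrable integrable_id_normal_pdf01 => //.
  apply/measurable_EFinP; apply: measurable_funM; last exact: measurable_normal_pdf.
  exact: measurable_funM.
move=> x _; rewrite lee_fin !normrM normr_id ler_wpM2r//.
by rewrite ler_piMr.
Qed.

(* Integration by parts, as the fundamental theorem of calculus for
   [sin (t x) phi(x)] on [[-n, n]]. *)
Lemma normal01_by_parts (t : R) :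
  \int[leb]_x (x * sin (t * x) * phi x) = t * \int[leb]_x (cos (t * x) * phi x).
Proof.
have ms : measurable_fun setT (fun x : R => sin (t * x)).
  by apply: measurableT_comp; [exact: measurable_sinR|exact: measurable_funM].
have mc : measurable_fun setT (fun x : R => cos (t * x)).
  by apply: measurableT_comp; [exact: measurable_cosR|exact: measurable_funM].
have is_ : leb.-integrable setT (fun x => (x * sin (t * x) * phi x)%:E).
  by apply: (integrable_bounded_id_pdf ms) => x; rewrite ler_norml sin_geN1 sin_le1.
have ic : leb.-integrable setT (fun x => (cos (t * x) * phi x)%:E).
  by apply: (integrable_bounded_pdf mc) => x; rewrite ler_norml cos_geN1 cos_le1.
pose G (x : R) := sin (t * x) * phi x.
pose g (x : R) := t * (cos (t * x) * phi x) - x * sin (t * x) * phi x.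
have dG (x : R) : is_derive x 1 G (g x).
  have h1 : is_derive x 1 (fun y : R => t * y) t.
    by apply: is_derive_eq; rewrite /GRing.scale/= mulr1.
  have h2 := @is_derive1_comp _ sin (fun y : R => t * y) x _ _ (is_derive_sin _) h1.
  have h3 := is_derive_normal_pdf01 x.
  have := @is_deriveM _ _ _ _ _ _ _ _ h2 h3; rewrite /GRing.scale/= => h4.
  by apply: (is_derive_eq h4); rewrite /g; ring.
have ig : leb.-integrable setT (fun x => (g x)%:E).
  by apply: integrable_RB is_; exact: integrable_RZ.
have cg : continuous g.
  move=> x; apply: cvgB.
    apply: cvgM; first exact: cvg_cst.
    apply: cvgM; last exact: continuous_normal_pdf01.
    apply: (continuous_comp (f := fun x : R => t * x)); last exact: continuous_cos.
    by apply: cvgM; [exact: cvg_cst|exact: cvg_id].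
  apply: cvgM; last exact: continuous_normal_pdf01.
  apply: cvgM; first exact: cvg_id.
  apply: (continuous_comp (f := fun x : R => t * x)); last exact: continuous_sin.
  by apply: cvgM; [exact: cvg_cst|exact: cvg_id].
suff g0 : \int[leb]_x g x = 0.
  apply/esym/eqP; rewrite -subr_eq0; apply/eqP; rewrite -[RHS]g0 RintegralB//.
    by rewrite RintegralZl.
  exact: integrable_RZ.
pose gn n := g \_ (`[- n.+1%:R, n.+1%:R]%classic : set R).
have h1 : \int[leb]_x gn n x @[n --> \oo] --> \int[leb]_x g x.
  apply: (@dominated_Rintegral _ (measurableTypeR R) _ leb _ _ (fun x => `|g x|)).
  - move=> n; apply/(measurable_restrictT _ _).1 => //.
    by apply: measurable_funTS; exact: continuous_measurable_fun.
  - exact: continuous_measurable_fun.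
  - apply: aeW => x; apply/cvgrPdist_le => e e0; near=> n.
    rewrite /gn patchE mem_set ?subrr ?normr0 ?ltW//= in_itv/= -ler_norml.
    rewrite (le_trans (y := n%:R)) ?ler_nat//; near: n; exact: nbhs_infty_ger.
  - exact: integrable_norm.
  - by move=> n x; rewrite /gn patchE; case: ifP => //; rewrite normr0.
have cG : continuous G.
  move=> x; apply: cvgM; last exact: continuous_normal_pdf01.
  apply: (continuous_comp (f := fun x : R => t * x)); last exact: continuous_sin.
  by apply: cvgM; [exact: cvg_cst|exact: cvg_id].
have h2 n : \int[leb]_x gn n x = 2 * sin (t * n.+1%:R) * phi n.+1%:R.
  rewrite /gn -Rintegral_mkcond /Rintegral.
  rewrite (@continuous_FTC2 _ g G)//.
  - rewrite /G mulrN sinN -EFinB/= normal_pdf01E normal_pdf01E sqrrN; ring.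
  - by rewrite gtrN.
  - exact: continuous_subspaceT.
  - split.
    + by move=> x _; exact: ex_derive.
    + by apply: cvg_at_right_filter; exact: cG.
    + by apply: cvg_at_left_filter; exact: cG.
  - by move=> x _; rewrite derive1E; exact: derive_val.
have h3 : \int[leb]_x gn n x @[n --> \oo] --> (0 : R).
  under eq_fun do rewrite h2.
  have hb n : `|2 * sin (t * n.+1%:R) * phi n.+1%:R| <= 4 * normal_peak (1 : R) * harmonic n.
    rewrite !normrM (ger0_norm (normal_pdf_ge0 _ _ _)) normal_pdf01E.
    have p1 : 0 < normal_peak (1 : R) by apply: normal_peak_gt0; exact: oner_neq0.
    have s1 : `|sin (t * n.+1%:R)| <= 1 by rewrite ler_norml sin_geN1 sin_le1.
    (* A crude decay suffices for the boundary terms: [exp y >= 1 + y] at [y = N^2 / 2] gives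
       [exp (- N^2 / 2) <= 2 / N]. *)
    have e1 : expR (- n.+1%:R ^+ 2 / 2) <= 2 * harmonic n :> R.
      rewrite mulNr expRN -[harmonic n]/(n.+1%:R^-1).
      have n1 : 1 <= n.+1%:R :> R by rewrite ler1n.
      have := expR_ge1Dx (n.+1%:R ^+ 2 / 2 : R).
      move: (n.+1%:R) n1 => N n1; move: (expR _) => E hE.
      have E0 : 0 < E by apply: lt_le_trans hE; nra.
      rewrite -[E^-1]mul1r ler_pdivrMr// mulrAC ler_pdivlMr; nra.
    rewrite gtr0_norm//.
    apply: (@le_trans _ _ (2 * 1 * (normal_peak 1 * (2 * harmonic n)))); last by lra.
    apply: ler_pM; [by rewrite mulr_ge0|by rewrite mulr_ge0 ?expR_ge0 ?ltW| |].
      by rewrite ler_wpM2l.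
    by apply: ler_wpM2l => //; exact: ltW.
  apply/cvgr0Pnorm_le => e e0.
  have : 4 * normal_peak (1 : R) * harmonic n @[n --> \oo] --> 4 * normal_peak (1 : R) * 0.
    by apply: cvgM; [exact: cvg_cst|exact: cvg_harmonic].
  rewrite mulr0 => /cvgr0Pnorm_le/(_ _ e0); apply: filterS => n; apply: le_trans.
  by apply: (le_trans (hb n)); exact: ler_norm.
exact: (cvg_unique _ h1 h3).
Unshelve. all: by end_near. Qed.

(** Differentiation under the integral followed by the integration by parts above gives
    [F' = - s F]. Hence [F s * exp (s^2 / 2)] is constant, and [F 0 = 1]. *)
Lemma normal01_cos (t : R) : \int[N01]_x cos (t * x) = expR (- t ^+ 2 / 2).
Proof.
have mc s : measurable_fun setT (fun x : R => cos (s * x)).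
  by apply: measurableT_comp; [exact: measurable_cosR|exact: measurable_funM].
have ms s : measurable_fun setT (fun x : R => sin (s * x)).
  by apply: measurableT_comp; [exact: measurable_sinR|exact: measurable_funM].
pose f (s x : R) := cos (s * x) * phi x.
pose F s := \int[leb]_x f s x.
have df (s x : R) : is_derive s 1 (f ^~ x) (- (x * sin (s * x) * phi x)).
  have h1 : is_derive s 1 (fun y : R => y * x) x.
    by apply: is_derive_eq; rewrite /GRing.scale/= mulr0 add0r mulr1.
  have h2 := @is_derive1_comp _ cos (fun y : R => y * x) s _ _ (is_derive_cos _) h1.
  have h3 : is_derive s 1 (fun _ : R => phi x) 0 by exact: is_derive_cst.
  have := @is_deriveM _ _ _ _ _ _ _ _ h2 h3; rewrite /GRing.scale/= => h4.
  by apply: (is_derive_eq h4); ring.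
have dF (s : R) : is_derive s (1 : R) F (- (s * F s)).
  have intf x : leb.-integrable setT (EFin \o f x).
    by apply: (integrable_bounded_pdf (mc x)) => y; rewrite ler_norml cos_geN1 cos_le1.
  have Gub x y : `|partial1of2 f x y| <= `|y| * phi y.
    rewrite partial1of2E (@derive_val _ _ _ _ _ _ _ (df x y)) normrN !normrM.
    rewrite (ger0_norm (normal_pdf_ge0 _ _ _)) ler_wpM2r ?normal_pdf_ge0//.
    by rewrite ler_piMr// ler_norml sin_geN1 sin_le1.
  have Is : `](s - 1), (s + 1)[%classic s by rewrite /= in_itv/= ltrBlDr ltrDl ltr01.
  have ddf x y : derivable (f ^~ y) x 1 by exact: (@ex_derive _ _ _ _ _ _ _ (df x y)).
  have G0 (y : R) : 0 <= `|y| * phi y by rewrite mulr_ge0// normal_pdf_ge0.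
  have dv := @derivable_under_integral R _ (measurableTypeR R) leb f setT measurableT s _ _ Is
    (fun x _ => intf x) (fun x y _ _ => ddf x y) _ G0 integrable_id_normal_pdf01 (fun x y _ _ => Gub x y).
  have ev := @differentiation_under_integral R _ (measurableTypeR R) leb f setT measurableT s _ _ Is
    (fun x _ => intf x) (fun x y _ _ => ddf x y) _ G0 integrable_id_normal_pdf01 (fun x y _ _ => Gub x y).
  apply: DeriveDef; first exact: dv.
  rewrite -derive1E ev.
  under eq_Rintegral do rewrite partial1of2E (@derive_val _ _ _ _ _ _ _ (df _ _)) -mulN1r.
  rewrite RintegralZl//; last first.
    by apply: (integrable_bounded_id_pdf (ms s)) => y; rewrite ler_norml sin_geN1 sin_le1.
  by rewrite normal01_by_parts mulN1r.
have dE (s : R) : is_derive s 1 (fun s => expR (s ^+ 2 / 2)) (s * expR (s ^+ 2 / 2)).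
  have h1 : is_derive s 1 (fun y : R => y ^+ 2 / 2) s.
    by apply: is_derive_eq; rewrite /GRing.scale/=; field.
  have h2 := @is_derive1_comp _ expR (fun y : R => y ^+ 2 / 2) s _ _ (is_derive_expR _) h1.
  by apply: (is_derive_eq h2); rewrite mulrC.
have dG (s : R) : is_derive s (1 : R) (fun s => F s * expR (s ^+ 2 / 2)) 0.
  have := @is_deriveM _ _ _ _ _ _ _ _ (dF s) (dE s); rewrite /GRing.scale/= => h4.
  by apply: (is_derive_eq h4); ring.
have := is_derive_0_is_cst t 0 dG.
have F0 : F 0 = 1.
  rewrite /F /f; under eq_Rintegral do rewrite mul0r cos0 mul1r.
  by rewrite /Rintegral integral_normal_pdf.
rewrite F0 expr0n/= mul0r expR0 mulr1 => H.
rewrite Rintegral_normal01// -/(F t) mulNr expRN.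
apply: (mulIf (lt0r_neq0 (expR_gt0 (t ^+ 2 / 2)))).
by rewrite H mulVf// gt_eqF// expR_gt0.
Qed.

(** The addition formula leaves a cosine integral and a sine integral; the latter vanishes because
    its integrand is odd. *)
Lemma normal01_cosD (t th : R) :
  \int[N01]_x cos (t * x + th) = cos th * expR (- t ^+ 2 / 2).
Proof.
have mc : measurable_fun setT (fun x : R => cos (t * x)).
  by apply: measurableT_comp; [exact: measurable_cosR|exact: measurable_funM].
have ms : measurable_fun setT (fun x : R => sin (t * x)).
  by apply: measurableT_comp; [exact: measurable_sinR|exact: measurable_funM].
have ic : N01.-integrable setT (fun x => (cos (t * x))%:E).
  by apply: (@bounded_integrable _ _ _ N01 _ 1) => // x; rewrite ler_norml cos_geN1 cos_le1.
have is_ : N01.-integrable setT (fun x => (sin (t * x))%:E).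
  by apply: (@bounded_integrable _ _ _ N01 _ 1) => // x; rewrite ler_norml sin_geN1 sin_le1.
under eq_Rintegral do rewrite cosD [X in X - _]mulrC [X in _ - X]mulrC.
rewrite RintegralB//; [|exact: integrable_RZ|exact: integrable_RZ].
rewrite !RintegralZl// normal01_cos.
suff -> : \int[N01]_x sin (t * x) = 0 by rewrite mulr0 subr0.
rewrite Rintegral_normal01//.
have : \int[leb]_x (sin (t * x) * phi x) = - \int[leb]_x (sin (t * x) * phi x).
  rewrite -[RHS]mulN1r -RintegralZl//; last first.
    by apply: (integrable_bounded_pdf ms) => y; rewrite ler_norml sin_geN1 sin_le1.
  rewrite [LHS]Rintegral_opp//; last first.
    by apply: (integrable_bounded_pdf ms) => y; rewrite ler_norml sin_geN1 sin_le1.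
  by apply: eq_Rintegral => y _; rewrite mulrN sinN !normal_pdf01E sqrrN mulN1r mulNr.
by lra.
Qed.

End standard_normal.

(** * Lévy's continuity theorem *)

Section levy_continuity.
Context (R : realType) (m : nat).
Local Notation V := 'rV[R]_m.

Definition dotv (t x : V) : R := \sum_i t 0 i * x 0 i.

Lemma measurable_dotv t : measurable_fun setT (dotv t).
Proof.
apply: measurable_sum => i; apply: measurable_funM => //.
exact: measurable_mx_entry.
Qed.

Lemma measurable_cos_dotv t (th : R) : measurable_fun setT (fun x => cos (dotv t x + th)).
Proof.
apply: measurableT_comp; first exact: measurable_cosR.
by apply: measurable_funD => //; exact: measurable_dotv.
Qed.

Lemma normr_cos_le1 (x : R) : `|cos x| <= 1.
Proof. by rewrite ler_norml cos_geN1 cos_le1. Qed.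

Lemma dotvDdelta t i (z : R) (x : V) :
  dotv (t + z *: delta_mx 0 i) x = dotv t x + z * x 0 i.
Proof.
rewrite /dotv (bigD1 i)//= [X in _ = X + _](bigD1 i)//= !mxE !eqxx /= mulr1.
rewrite mulrDl -!addrA; congr (_ + _); rewrite addrC; congr (_ + _).
by apply: eq_bigr => j ji; rewrite !mxE (negbTE ji) /= mulr0 addr0.
Qed.

Variables (mu_ : nat -> probability V R) (mu : probability V R).

Hypothesis cf : forall t th, \int[mu_ n]_x cos (dotv t x + th) @[n --> \oo] -->
  \int[mu]_x cos (dotv t x + th).

Definition bounded_measurable (g : V -> R) :=
  measurable_fun setT g /\ exists M, forall x, `|g x| <= M.

Definition cvg_int (g : V -> R) :=
  \int[mu_ n]_x g x @[n --> \oo] --> \int[mu]_x g x.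

(** The phase [th] carries the real and the imaginary part of the characteristic function together,
    which keeps this section real-valued. Testing against every character makes the class stable
    under multiplication by characters. *)
Definition trig_class (g : V -> R) := bounded_measurable g /\
  forall t th, cvg_int (fun x => g x * cos (dotv t x + th)).

(** Multipliers are closed under products by construction, which is not apparent for [trig_class]
    itself; this makes the Weierstrass-type approximation of [|h|] possible. *)
Definition multiplier (h : V -> R) := bounded_measurable h /\
  forall g, trig_class g -> trig_class (fun x => h x * g x).

Lemma bounded_measurableM g h : bounded_measurable g -> bounded_measurable h ->
  bounded_measurable (fun x => g x * h x).
Proof.
move=> [mg [M gM]] [mh [N hN]]; split; first exact: measurable_funM.
by exists (M * N) => x; rewrite normrM ler_pM.
Qed.

Lemma bounded_measurableD g h : bounded_measurable g -> bounded_measurable h ->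
  bounded_measurable (fun x => g x + h x).
Proof.
move=> [mg [M gM]] [mh [N hN]]; split; first exact: measurable_funD.
by exists (M + N) => x; rewrite (le_trans (ler_normD _ _))// lerD.
Qed.

Lemma bounded_measurable_cst c : bounded_measurable (fun=> c).
Proof. by split; [exact: measurable_cst|exists `|c|]. Qed.

Lemma bounded_measurable_cos t th :
  bounded_measurable (fun x => cos (dotv t x + th)).
Proof.
by split; [exact: measurable_cos_dotv|exists 1 => x; exact: normr_cos_le1].
Qed.

Lemma cvg_intD g h : bounded_measurable g -> bounded_measurable h ->
  cvg_int g -> cvg_int h -> cvg_int (fun x => g x + h x).
Proof.
move=> [mg [M gM]] [mh [N hN]] cg ch; rewrite /cvg_int.
have E (P : probability V R) : \int[P]_x (g x + h x) = \int[P]_x g x + \int[P]_x h x.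
  by rewrite RintegralD//; apply: bounded_integrable; eauto.
by under eq_fun do rewrite E; rewrite E; exact: cvgD.
Qed.

Lemma cvg_intZ c g : bounded_measurable g -> cvg_int g -> cvg_int (fun x => c * g x).
Proof.
move=> [mg [M gM]] cg; rewrite /cvg_int.
have E (P : probability V R) : \int[P]_x (c * g x) = c * \int[P]_x g x.
  by rewrite RintegralZl//; apply: bounded_integrable; eauto.
by under eq_fun do rewrite E; rewrite E; apply: cvgM => //; exact: cvg_cst.
Qed.

Lemma cvg_int_unif g : bounded_measurable g ->
  (forall e, 0 < e -> exists h, [/\ bounded_measurable h, cvg_int h &
     forall x, `|g x - h x| <= e]) -> cvg_int g.
Proof.
move=> [mg [M gM]] H; apply/cvgrPdist_le => e e0.
have e3 : 0 < e / 3 by rewrite divr_gt0.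
have [h [[mh [N hN]] /cvgrPdist_le/(_ _ e3) ch gh]] := H _ e3.
have E (P : probability V R) : `|\int[P]_x g x - \int[P]_x h x| <= e / 3.
  rewrite -RintegralB//; [|exact: bounded_integrable gM|exact: bounded_integrable hN].
  by apply: normr_Rintegral_le => //; exact: measurable_funB.
near=> n.
have h1 : `|\int[mu]_x h x - \int[mu_ n]_x h x| <= e / 3 by near: n.
have h2 := E mu; have h3 := E (mu_ n).
rewrite (_ : _ - _ = (\int[mu]_x g x - \int[mu]_x h x) +
  (\int[mu]_x h x - \int[mu_ n]_x h x) - (\int[mu_ n]_x g x - \int[mu_ n]_x h x)); last by ring.
apply: (le_trans (ler_normB _ _)).
apply: (le_trans (lerD (ler_normD _ _) (lexx _))).
apply: (le_trans (lerD (lerD h2 h1) h3)); lra.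
Unshelve. all: by end_near. Qed.

Lemma multiplier_cst c : multiplier (fun=> c).
Proof.
split; first exact: bounded_measurable_cst.
move=> g [bg cg]; split.
  by apply: bounded_measurableM => //; exact: bounded_measurable_cst.
move=> t th; rewrite (_ : (fun x => _) = (fun x => c * (g x * cos (dotv t x + th)))).
  apply: cvg_intZ; last exact: cg.
  by apply: bounded_measurableM => //; exact: bounded_measurable_cos.
by apply/funext => x; rewrite mulrA.
Qed.

Lemma multiplierD h k : multiplier h -> multiplier k -> multiplier (fun x => h x + k x).
Proof.
move=> [bh ch] [bk ck]; split; first exact: bounded_measurableD.
move=> g cg; have [bhg chg] := ch _ cg; have [bkg ckg] := ck _ cg; split.
  rewrite (_ : (fun x => _) = (fun x => h x * g x + k x * g x)).
    exact: bounded_measurableD.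
  by apply/funext => x; rewrite mulrDl.
move=> t th; rewrite (_ : (fun x => _) = (fun x => h x * g x * cos (dotv t x + th) +
   k x * g x * cos (dotv t x + th))).
  apply: cvg_intD; [| |exact: chg|exact: ckg];
  by apply: bounded_measurableM => //; exact: bounded_measurable_cos.
by apply/funext => x; rewrite !mulrDl.
Qed.

Lemma multiplierM h k : multiplier h -> multiplier k -> multiplier (fun x => h x * k x).
Proof.
move=> [bh ch] [bk ck]; split; first exact: bounded_measurableM.
move=> g cg; rewrite (_ : (fun x => _) = (fun x => h x * (k x * g x))).
  by apply: ch; exact: ck.
by apply/funext => x; rewrite mulrA.
Qed.

Lemma multiplierZ c h : multiplier h -> multiplier (fun x => c * h x).
Proof. by move=> mh; apply: multiplierM => //; exact: multiplier_cst. Qed.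

Lemma multiplier_sum (I : Type) (s : seq I) (h : I -> V -> R) :
  (forall i, multiplier (h i)) -> multiplier (fun x => \sum_(i <- s) h i x).
Proof.
move=> mh; elim: s => [|i s ih].
  by under eq_fun do rewrite big_nil; exact: multiplier_cst.
by under eq_fun do rewrite big_cons; exact: multiplierD.
Qed.

Lemma multiplier_unif h : bounded_measurable h ->
  (forall e, 0 < e -> exists2 k, multiplier k & forall x, `|h x - k x| <= e) ->
  multiplier h.
Proof.
move=> bh H; split => // g [bg cg]; have [mg [M gM]] := bg; split; first exact: bounded_measurableM.
move=> t th; apply: cvg_int_unif => [|e e0].
  by apply: bounded_measurableM; [exact: bounded_measurableM|exact: bounded_measurable_cos].
have M0 : 0 <= M by exact: (le_trans (normr_ge0 _) (gM 0)).
(* Dividing by [M + 1] rather than by [M] covers the case [M = 0]. *)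
have [|k [bk ck] hk] := H (e / (M + 1)); first by rewrite divr_gt0// ltr_wpDl.
exists (fun x => k x * g x * cos (dotv t x + th)); split.
- by apply: bounded_measurableM; [exact: bounded_measurableM|exact: bounded_measurable_cos].
- by have [|_ ckg] := ck g; last exact: ckg.
- move=> x; rewrite -!mulrBl !normrM -mulrA.
  apply: (@le_trans _ _ (e / (M + 1) * (M * 1))).
    by rewrite ler_pM ?mulr_ge0// ler_pM// normr_cos_le1.
  by rewrite mulr1 mulrAC ler_pdivrMr ?ltr_wpDl// ler_wpM2l ?lerDl// ltW.
Qed.

(* Averaging the characters [x |-> cos (z x_i + c)] over a standard normal [z]
   produces the Gaussian bump. *)
Lemma multiplier_bump i (y : R) :
  multiplier (fun x => expR (- (x 0 i - y) ^+ 2 / 2)).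
Proof.
have mb : measurable_fun setT (fun x : V => expR (- (x 0 i - y) ^+ 2 / 2)).
  apply: measurableT_comp => //; apply: measurable_funM => //.
  apply: measurableT_comp => //; apply: measurable_funX.
  by apply: measurable_funB => //; exact: measurable_mx_entry.
have bb : bounded_measurable (fun x : V => expR (- (x 0 i - y) ^+ 2 / 2)).
  split => //; exists 1 => x; rewrite ger0_norm ?expR_ge0// -[leRHS]expR0 ler_expR.
  by rewrite mulNr oppr_le0 divr_ge0// sqr_ge0.
split => // g [bg cg]; split; first exact: bounded_measurableM.
move=> t th; have [mg [M gM]] := bg.
pose F (xz : V * R) := g xz.1 * cos (dotv t xz.1 + th) * cos ((xz.1 0 i - y) * xz.2).
have mF : measurable_fun setT F.
  apply: measurable_funM.
    apply: (measurableT_comp (f := fun x : V => g x * cos (dotv t x + th))) => //.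
    by apply: measurable_funM => //; exact: measurable_cos_dotv.
  apply: measurableT_comp; first exact: measurable_cosR.
  apply: measurable_funM => //; apply: measurable_funB => //.
  by apply: (measurableT_comp (f := fun x : V => x 0 i)) => //; exact: measurable_mx_entry.
have FM xz : `|F xz| <= M.
  rewrite !normrM -[leRHS]mulr1; apply: ler_pM; rewrite ?normr_cos_le1//.
  by rewrite -[leRHS]mulr1; apply: ler_pM; rewrite ?normr_cos_le1.
have E (P : probability V R) :
    \int[P]_x (expR (- (x 0 i - y) ^+ 2 / 2) * g x * cos (dotv t x + th)) =
    \int[normal_prob 0 1]_z \int[P]_x F (x, z).
  rewrite -(Rintegral_swap P (normal_prob 0 1) mF FM); apply: eq_Rintegral => x _.
  rewrite /F /= RintegralZl//; last first.
    apply: (@bounded_integrable _ _ _ _ _ 1) => [|z]; last exact: normr_cos_le1.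
    by apply: measurableT_comp; [exact: measurable_cosR|exact: measurable_funM].
  by rewrite normal01_cos [RHS]mulrC mulrA.
rewrite /cvg_int; under eq_fun do rewrite E; rewrite E.
apply: (@dominated_Rintegral _ _ _ _ _ _ (cst M)).
- by move=> n; exact: (measurable_Rintegral2 (mu_ n) (normal_prob 0 1) mF FM).
- exact: (measurable_Rintegral2 mu (normal_prob 0 1) mF FM).
- apply: aeW => z.
  (* Product-to-sum: for fixed [z] the two cosines in [F] combine into two characters, with
     frequency [t] shifted by [z] and by [- z] in coordinate [i]. *)
  pose G s := (fun x => 2^-1 * (g x * cos (dotv (t + s *: delta_mx 0 i) x + (th - s * y)))).
  have FE : (fun x => F (x, z)) = (fun x => G z x + G (- z) x).
    apply/funext => x; rewrite /F /G /= !dotvDdelta.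
    have -> : dotv t x + z * x 0 i + (th - z * y) =
      (dotv t x + th) + ((x 0 i - y) * z) by ring.
    have -> : dotv t x + - z * x 0 i + (th - - z * y) =
      (dotv t x + th) - ((x 0 i - y) * z) by ring.
    by move: (dotv t x + th) ((x 0 i - y) * z) => a b; rewrite cosD cosB; field.
  under eq_fun do rewrite FE; rewrite FE.
  have bG s : bounded_measurable (fun x => g x * cos (dotv (t + s *: delta_mx 0 i) x + (th - s * y))).
    by apply: bounded_measurableM => //; exact: bounded_measurable_cos.
  have bG' s : bounded_measurable (G s).
    by apply: bounded_measurableM => //; exact: bounded_measurable_cst.
  by apply: cvg_intD => //; apply: cvg_intZ => //; exact: cg.
- exact: finite_measure_integrable_cst.
- move=> n z; apply: normr_Rintegral_le => // .
  by apply: (measurableT_comp mF); exact: pair2_measurable.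
Qed.

(* [p_(n+1) = p_n + (s^2 - p_n^2) / 2] increases to [|s|] on [[-1, 1]]. *)
Fixpoint abs_approx (h : V -> R) n : V -> R :=
  if n is n'.+1 then fun x => abs_approx h n' x + 2^-1 * (h x * h x + - 1 * (abs_approx h n' x * abs_approx h n' x))
  else fun=> 0.

Lemma multiplier_abs_approx h n : multiplier h -> multiplier (abs_approx h n).
Proof.
move=> mh; elim: n => [|n ih] /=; first exact: multiplier_cst.
apply: multiplierD => //; apply: multiplierZ; apply: multiplierD; first exact: multiplierM.
by apply: multiplierZ; exact: multiplierM.
Qed.

(** With [a = |h x|] and [p] the approximant, the last inequality gives [a - p <= 2 / n] uniformly
    in [a], also near 0 where the convergence is slow. It is inductive: the new gap is [(a - p) (1 -
    (a + p) / 2) <= (a - p) (1 - a / 2)], and [(1 - a / 2) (1 + (n + 1) a / 2) <= 1 + n a / 2]. *)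
Lemma abs_approxP h n x : `|h x| <= 1 ->
  0 <= abs_approx h n x <= `|h x| /\
  (`|h x| - abs_approx h n x) * (1 + n%:R * (`|h x| / 2)) <= `|h x|.
Proof.
set a := `|h x| => a1; have a0 : 0 <= a by exact: normr_ge0.
have ha : h x * h x = a * a by rewrite -!expr2 /a real_normK ?num_real.
elim: n => [|n [/andP[p0 pa] ih]] /=; first by rewrite lexx a0 subr0 mul0r addr0 mulr1.
rewrite ha -[n.+1%:R]natr1; move: ih p0 pa; move: (abs_approx h n x) => p ih p0 pa.
have h0 : 0 <= (a - p) * (a + p) by rewrite mulr_ge0 ?subr_ge0// addr_ge0.
have h2 : 0 <= (a - p) * (2 - a - p) by rewrite mulr_ge0 ?subr_ge0//; lra.
split; first by apply/andP; split; lra.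
have n0 : 0 <= n%:R :> R by [].
move: n0 ih; move: (n%:R) => N N0 ih.
have -> : a - (p + 2^-1 * (a * a + -1 * (p * p))) = (a - p) * (1 - (a + p) / 2) by field.
have h1 : (a - p) * (1 - (a + p) / 2) <= (a - p) * (1 - a / 2).
  by rewrite ler_wpM2l ?subr_ge0//; lra.
apply: (@le_trans _ _ ((a - p) * (1 - a / 2) * (1 + (N + 1) * (a / 2)))).
  by rewrite ler_wpM2r// addr_ge0// mulr_ge0 ?divr_ge0 ?addr_ge0.
apply: le_trans ih; rewrite -mulrA ler_wpM2l ?subr_ge0//.
have : 0 <= N * a * a by rewrite !mulr_ge0.
have : 0 <= a * a by rewrite mulr_ge0.
move=> ? ?; nra.
Qed.

Lemma multiplier_norm h : multiplier h -> multiplier (fun x => `|h x|).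
Proof.
move=> mh; have [[meh [M hM]] _] := mh.
have bn : bounded_measurable (fun x => `|h x|).
  by split; [exact: measurableT_comp|exists M => x; rewrite normr_id].
have M0 : 0 <= M by exact: (le_trans (normr_ge0 _) (hM 0)).
have M1 : 0 < M + 1 by rewrite ltr_wpDl.
pose k x := (M + 1)^-1 * h x.
have k1 x : `|k x| <= 1.
  rewrite normrM gtr0_norm ?invr_gt0// ler_pdivrMl// mulr1.
  by rewrite (le_trans (hM x))// lerDl.
apply: multiplier_unif => // e e0.
(* The gap [2 / n] of the approximation of [|k|] is multiplied by [M + 1] when scaling back to
   [h]. *)
pose n := (Num.truncn (2 * (M + 1) / e)).+1.
have nP : 2 * (M + 1) / e < n%:R by exact: truncnS_gt.
exists (fun x => (M + 1) * abs_approx k n x).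
  by apply: multiplierZ; apply: multiplier_abs_approx; exact: multiplierZ.
move=> x; have [/andP[p0 pa] H] := abs_approxP n (k1 x).
have hx : `|h x| = (M + 1) * `|k x|.
  by rewrite /k normrM gtr0_norm ?invr_gt0// mulrA mulfV ?mul1r// gt_eqF.
rewrite {}hx; move: p0 pa H (normr_ge0 (k x)).
move: (abs_approx k n x) (`|k x|) => p a p0 pa H a0.
rewrite -mulrBr normrM gtr0_norm// ger0_norm ?subr_ge0//.
move: nP; rewrite ltr_pdivrMr// => nP.
have n0 : 0 < n%:R :> R by rewrite ltr0n.
have [->|an0] := eqVneq a 0.
  by rewrite sub0r mulrN (le_trans _ (ltW e0))// oppr_le0 mulr_ge0// ltW.
have {an0}a0 : 0 < a by rewrite lt_neqAle eq_sym an0.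
have H2 : (a - p) * n%:R <= 2.
  rewrite -(ler_pM2r a0).
  have : 0 <= a - p by rewrite subr_ge0.
  by move: H; move: (n%:R) => N H ?; nra.
rewrite -(ler_pM2r n0) -mulrA.
apply: (le_trans (ler_wpM2l (ltW M1) H2)); rewrite mulrC; apply: ltW.
by rewrite mulrC [e * _]mulrC mulrC.
Qed.

Lemma multiplier_max h k : multiplier h -> multiplier k ->
  multiplier (fun x => Num.max (h x) (k x)).
Proof.
move=> mh mk.
rewrite (_ : (fun x => _) = (fun x => 2^-1 * (h x + k x + `|h x + -1 * k x|))).
  apply: multiplierZ; apply: multiplierD; first exact: multiplierD.
  by apply: multiplier_norm; apply: multiplierD => //; exact: multiplierZ.
apply/funext => x; rewrite mulN1r; have [hk|kh] := leP (h x) (k x).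
  by rewrite ler0_norm ?subr_le0//; field.
by rewrite gtr0_norm ?subr_gt0//; field.
Qed.

Lemma multiplier_cvg h : multiplier h -> cvg_int h.
Proof.
move=> [bh ch].
have c1 : trig_class (fun=> 1).
  split; first exact: bounded_measurable_cst.
  move=> t th; rewrite (_ : (fun x => _) = (fun x => cos (dotv t x + th))); first exact: cf.
  by apply/funext => x; rewrite mul1r.
have [_ /(_ 0 0)] := ch _ c1.
have -> // : (fun x => h x * 1 * cos (dotv 0 x + 0)) = h.
  apply/funext => x; rewrite /dotv big1 ?addr0 ?cos0 ?mulr1// => i _.
  by rewrite mxE mul0r.
Qed.

(** A substitute for the distance from [y] to [x] that is a multiplier: it vanishes at [y], and
    outside the ball of radius [radius k] at least one coordinate contributes [defect_gap k]. *)
Definition bump_defect (y x : V) : R :=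
  \sum_i (1 + - 1 * expR (- (x 0 i - y 0 i) ^+ 2 / 2)).

Definition radius (k : nat) : R := k.+1%:R^-1.

Definition defect_gap (k : nat) : R := 1 - expR (- radius k ^+ 2 / 2).

(** For [c >= 0], a tent of height [c] at [y] that vanishes outside the ball of radius
    [radius k]. *)
Definition peak (y : V) (c : R) (k : nat) (x : V) : R :=
  Num.max 0 (c + - 1 * (c / defect_gap k * bump_defect y x)).

Lemma radius_gt0 k : 0 < radius k.
Proof. by rewrite invr_gt0. Qed.

Lemma defect_gap_gt0 k : 0 < defect_gap k.
Proof.
rewrite subr_gt0 -[ltRHS]expR0 ltr_expR mulNr oppr_lt0 divr_gt0//.
by rewrite exprn_gt0// radius_gt0.
Qed.

Lemma bump_term_ge0 (u : R) : 0 <= 1 + - 1 * expR (- u ^+ 2 / 2).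
Proof.
rewrite mulN1r subr_ge0 -[leRHS]expR0 ler_expR mulNr oppr_le0 divr_ge0//.
exact: sqr_ge0.
Qed.

Lemma bump_defect_ge0 y x : 0 <= bump_defect y x.
Proof. by apply: sumr_ge0 => i _; exact: bump_term_ge0. Qed.

Lemma peak_ge0 y c k x : 0 <= peak y c k x.
Proof. by rewrite le_max lexx. Qed.

Lemma peak_le y c k x : 0 <= c -> peak y c k x <= c.
Proof.
move=> c0; rewrite ge_max c0/= mulN1r lerBlDr lerDl.
by rewrite mulr_ge0 ?bump_defect_ge0// divr_ge0// ltW// defect_gap_gt0.
Qed.

Lemma peak_out y c k x : 0 <= c -> ~ ball y (radius k) x -> peak y c k x = 0.
Proof.
move=> c0 nb.
have [i hi] : exists i, radius k <= `|x 0 i - y 0 i|.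
  apply: contrapT => /forallNP h; apply: nb; split; first exact: radius_gt0.
  move=> i j; rewrite (ord1 i) /ball/= distrC.
  by rewrite ltNge; apply/negP; exact: h.
apply/eqP; rewrite eq_le peak_ge0 andbT ge_max lexx/=.
rewrite mulN1r subr_le0.
have [->|cn0] := eqVneq c 0; first by rewrite mul0r mul0r.
have {cn0}c0 : 0 < c by rewrite lt_neqAle eq_sym cn0.
rewrite -mulrA ler_peMr//; first exact: ltW.
rewrite mulrC ler_pdivlMr ?defect_gap_gt0// mul1r.
rewrite /bump_defect (bigD1 i)//= -[leLHS]addr0; apply: lerD; last first.
  by apply: sumr_ge0 => j _; exact: bump_term_ge0.
rewrite mulN1r lerD2l lerN2 ler_expR ler_pM2r// lerN2.
rewrite -[leRHS]real_normK ?num_real// lerXn2r ?nnegrE//.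
by rewrite ltW// radius_gt0.
Qed.

Lemma multiplier_peak y c k : multiplier (peak y c k).
Proof.
apply: multiplier_max; first exact: multiplier_cst.
apply: multiplierD; first exact: multiplier_cst.
do 2 apply: multiplierZ; apply: multiplier_sum => i.
apply: multiplierD; first exact: multiplier_cst.
by apply: multiplierZ; exact: multiplier_bump.
Qed.

Section lower_approximation.
Variable g : V -> R.
Hypotheses (cg : continuous g) (g0 : forall x, 0 <= g x).

(** A condition under which the peak coded by [i] lies below [g]. All data are rational, so there
    are countably many such peaks. *)
Definition below (i : 'rV[rat]_m * rat * nat) :=
  let: (y, c, k) := i in 0 <= (ratr c : R) /\
  forall x, ball (map_mx ratr y : V) (radius k) x -> ratr c <= g x.

Definition rational_peak (n : nat) : V -> R :=
  if unpickle n is Some i then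
    if `[< below i >] then peak (map_mx ratr i.1.1) (ratr i.1.2) i.2 else fun=> 0
  else fun=> 0.

Fixpoint lower_approx n : V -> R :=
  if n is n'.+1 then fun x => Num.max (lower_approx n' x) (rational_peak n' x)
  else fun=> 0.

Lemma multiplier_lower_approx n : multiplier (lower_approx n).
Proof.
elim: n => [|n ih] /=; first exact: multiplier_cst.
apply: multiplier_max => //; rewrite /rational_peak.
case: unpickle => [i|]; last exact: multiplier_cst.
by case: ifP => _; [exact: multiplier_peak|exact: multiplier_cst].
Qed.

Lemma rational_peak_le n x : rational_peak n x <= g x.
Proof.
rewrite /rational_peak; case: unpickle => [[[y c] k]|] //=.
case: ifPn => // /asboolP[c0 h].
have [b|nb] := pselect (ball (map_mx ratr y : V) (radius k) x).
  by rewrite (le_trans (peak_le _ _ _ c0))// h.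
by rewrite peak_out.
Qed.

Lemma lower_approx_le n x : 0 <= lower_approx n x <= g x.
Proof.
elim: n => [|n /andP[ih1 ih2]] /=; first by rewrite lexx g0.
by rewrite le_max ih1/= ge_max ih2 rational_peak_le.
Qed.

Lemma lower_approx_nd x : nondecreasing_seq (lower_approx ^~ x).
Proof. by apply/nondecreasing_seqP => n /=; rewrite le_max lexx. Qed.

(** The peaks below [g] have supremum [g]: by continuity [g] exceeds a rational [c] in []g x - e, g
    x[] near [x], and a small ball with rational centre close to [x] carries a peak whose value at
    [x] is almost [c]. *)
Lemma rational_peak_sup x e : 0 < e -> exists n, g x - e < rational_peak n x.
Proof.
move=> e0.
(* If [g x - e] is negative any index works, since the peaks are nonnegative. *)
have [ge|ge] := ltP (g x - e) 0.
  exists (pickle (0 : 'rV[rat]_m, 0 : rat, 0%N)); rewrite /rational_peak pickleK.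
  by case: ifP => //= _; exact: (lt_le_trans ge (peak_ge0 _ _ _ _)).
have [|c] := @rat_in_itvoo R (g x - e) (g x); first by rewrite gtrBl.
rewrite in_itv/= => /andP[c1 c2]; move: c1 c2.
set cR : R := ratr c => c1 c2.
have c0 : 0 <= cR by rewrite ltW// (le_lt_trans ge).
have : \forall z \near x, cR < g z.
  have [|r r0 hr] := continuous_mx_ball cg x (e := g x - cR); first by rewrite subr_gt0.
  apply/nbhs_ballP; exists r => // z /hr; rewrite ltr_norml => /andP[_]; lra.
move=> /nbhs_ballP[d /= d0 hd].
have [k hk] : exists k, radius k < d / 2.
  have /ltr_add_invr[k] : 0 < d / 2 by rewrite divr_gt0.
  by rewrite add0r => ?; exists k.
(* [eta] bounds the distance from [x] to the rational centre. The bound 1 makes squares of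
   coordinate differences at most [eta]; [radius k] keeps the ball around the centre inside the ball
   of radius [d] around [x]; the third term makes the loss [cR / defect_gap k * (m * eta)] of the
   peak at [x] smaller than [cR - (g x - e)]. *)
pose eta : R := Num.min 1 (Num.min (radius k) ((cR - (g x - e)) * defect_gap k / (cR * m%:R + 1))).
have cm : 0 < cR * m%:R + 1 by rewrite ltr_wpDl// mulr_ge0.
have eta0 : 0 < eta.
  by rewrite !lt_min ltr01 radius_gt0/= divr_gt0// mulr_gt0 ?defect_gap_gt0// subr_gt0.
have hq (i : 'I_m) : exists q : rat, ratr q \in `](x 0 i - eta), (x 0 i)[.
  by apply: rat_in_itvoo; rewrite gtrBl.
have [q Hq] := choice hq.
pose y : 'rV[rat]_m := \row_i q i; pose yR : V := map_mx ratr y.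
have hy i : `|x 0 i - yR 0 i| < eta.
  rewrite !mxE; have := Hq i; rewrite in_itv/= => /andP[h1 h2].
  rewrite gtr0_norm ?subr_gt0// ltrBlDr -ltrBlDl//.
have etak : eta <= radius k by rewrite !ge_min lexx /= orbT.
have eta1 : eta <= 1 by rewrite ge_min lexx.
have gb : below (y, c, k).
  split => // z [_ bz]; apply/ltW/hd; split => // i j.
  have := bz i j; have := hy j; rewrite !(ord1 i) /ball/=.
  move: hk etak; move: (radius k) (x 0 j) (z 0 j) (yR 0 j) => r u v w h1 h2.
  by rewrite !ltr_norml => /andP[h3 h4] /andP[h5 h6]; apply/andP; split; lra.
exists (pickle (y, c, k)); rewrite /rational_peak pickleK asboolT//= lt_max.
apply/orP; right; rewrite -/yR -/cR mulN1r ltrBrDr -ltrBrDl.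
have bd : bump_defect yR x <= m%:R * eta.
  rewrite /bump_defect (le_trans (y := \sum_(i < m) eta))//; last first.
    by rewrite sumr_const card_ord mulr_natl.
  apply: ler_sum => i _; rewrite mulN1r.
  have := expR_ge1Dx (- (x 0 i - yR 0 i) ^+ 2 / 2).
  have : (x 0 i - yR 0 i) ^+ 2 <= eta.
    rewrite -real_normK ?num_real// expr2.
    have := hy i; have := normr_ge0 (x 0 i - yR 0 i).
    by move: (`|_|) => u u0 ue; nra.
  by move=> h1 h2; have := eta0; lra.
have [cz|cn0] := eqVneq cR 0; first by move: c1; rewrite cz !mul0r; lra.
have {cn0}c0' : 0 < cR by rewrite lt_neqAle eq_sym cn0.
apply: (@le_lt_trans _ _ (cR / defect_gap k * (m%:R * eta))).
  by rewrite ler_wpM2l// divr_ge0// ltW// defect_gap_gt0.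
rewrite mulrAC ltr_pdivrMr ?defect_gap_gt0//.
have : eta <= (cR - (g x - e)) * defect_gap k / (cR * m%:R + 1) by rewrite !ge_min lexx !orbT.
rewrite ler_pdivlMr// => h.
apply: lt_le_trans h; rewrite mulrA mulrC ltr_pM2l// ltrDl//.
Qed.

Lemma lower_approx_cvg x : lower_approx n x @[n --> \oo] --> g x.
Proof.
apply/cvgrPdist_le => e e0; have [n hn] := rational_peak_sup x e0.
near=> N; have [_ hN] := andP (lower_approx_le N x).
rewrite ger0_norm ?subr_ge0// lerBlDr -lerBlDl; apply: (le_trans (ltW hn)).
apply: (@le_trans _ _ (lower_approx n.+1 x)); first by rewrite /= le_max lexx orbT.
by apply: lower_approx_nd; near: N; exact: nbhs_infty_ge.
Unshelve. all: by end_near. Qed.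

(** One half of weak convergence. A single approximant with [mu]-integral close to that of [g] is
    fixed first; it is a multiplier, so its integrals converge, and it lies below [g] for every
    [mu_ n]. Mass escaping to infinity could only spoil the other inequality. *)
Lemma cvg_int_lower M e : (forall x, g x <= M) -> 0 < e ->
  \forall n \near \oo, \int[mu]_x g x - e <= \int[mu_ n]_x g x.
Proof.
move=> gM e0; have e2 : 0 < e / 2 by rewrite divr_gt0.
have gM' x : `|g x| <= M by rewrite ger0_norm.
have mg : measurable_fun setT g by exact: continuous_measurable_mx.
have bl n x : `|lower_approx n x| <= M.
  by have /andP[l0 lg] := lower_approx_le n x; rewrite ger0_norm// (le_trans lg).
have ml n : measurable_fun setT (lower_approx n) by have [[]] := multiplier_lower_approx n.
have : \int[mu]_x lower_approx n x @[n --> \oo] --> \int[mu]_x g x.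
  apply: (@dominated_Rintegral _ _ _ _ _ _ (cst M)) => //.
  - by apply: aeW => x; exact: lower_approx_cvg.
  - exact: finite_measure_integrable_cst.
move=> /cvgrPdist_le/(_ _ e2)[N _ /(_ N (leqnn N)) hN].
have /cvgrPdist_le/(_ _ e2) hc := multiplier_cvg (multiplier_lower_approx N).
near=> n.
have h1 : `|\int[mu]_x lower_approx N x - \int[mu_ n]_x lower_approx N x| <= e / 2 by near: n.
have h2 : \int[mu_ n]_x lower_approx N x <= \int[mu_ n]_x g x.
  apply: le_Rintegral => //; [exact: bounded_integrable (bl N)|exact: bounded_integrable gM'|].
  by move=> x _; have /andP[] := lower_approx_le N x.
move: hN h1 h2; rewrite !ler_norml => /andP[a1 a2] /andP[a3 a4] a5; lra.
Unshelve. all: by end_near. Qed.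

End lower_approximation.

(** The one-sided bound applied to the nonnegative functions [M + g] and [M - g] gives both
    inequalities. Here it enters that all the measures have total mass 1. *)
Theorem levy_continuity g : continuous g -> (exists M, forall x, `|g x| <= M) -> cvg_int g.
Proof.
move=> cg [M gM]; apply/cvgrPdist_le => e e0.
have M0 : 0 <= M by exact: (le_trans (normr_ge0 _) (gM 0)).
have mg : measurable_fun setT g by exact: continuous_measurable_mx.
have lb (s : R) : s = 1 \/ s = - 1 ->
    \forall n \near \oo, s * \int[mu]_x g x - e <= s * \int[mu_ n]_x g x.
  move=> hs; have sg x : `|s * g x| <= M by case: hs => ->; rewrite ?mul1r ?mulN1r ?normrN.
  have c1 : continuous (fun x => M + s * g x).
    apply: ball_continuous_mx => x r r0; have [q q0 hq] := continuous_mx_ball cg x r0.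
    exists q => // y /hq; rewrite opprD addrACA subrr add0r -mulrBr.
    by case: hs => ->; rewrite ?mul1r// mulN1r normrN.
  have p1 x : 0 <= M + s * g x by have := sg x; rewrite ler_norml => /andP[]; lra.
  have p2 x : M + s * g x <= M + M by have := sg x; rewrite ler_norml => /andP[]; lra.
  have E (P : probability V R) : \int[P]_x (M + s * g x) = M + s * \int[P]_x g x.
    rewrite RintegralD//; last 2 first.
    - exact: finite_measure_integrable_cst.
    - by apply: (@bounded_integrable _ _ _ P _ M) => //; exact: measurable_funM.
    by rewrite Rintegral_probability_cst RintegralZl//; exact: (@bounded_integrable _ _ _ P _ M).
  have := cvg_int_lower c1 p1 p2 e0.
  apply: filterS => n; rewrite !E; lra.
near=> n; rewrite ler_norml.
have h1 : 1 * \int[mu]_x g x - e <= 1 * \int[mu_ n]_x g x by near: n; apply: lb; left.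
have h2 : - 1 * \int[mu]_x g x - e <= - 1 * \int[mu_ n]_x g x by near: n; apply: lb; right.
by apply/andP; split; lra.
Unshelve. all: by end_near. Qed.

End levy_continuity.

(** * Lebesgue measure on matrices *)

Section lebesgue_matrix.
Context (R : realType).
Notation leb := (@lebesgue_measure R).

Lemma prode_lty (I : Type) (s : seq I) (F : I -> \bar R) :
  (forall i, (0 <= F i < +oo)%E) -> (\prod_(i <- s) F i < +oo)%E.
Proof.
move=> h; suff : (0 <= \prod_(i <- s) F i < +oo)%E by case/andP.
elim: s => [|i s /andP[ih1 ih2]]; first by rewrite big_nil lee01 ltry.
have /andP[h1 h2] := h i.
by rewrite big_cons mule_ge0// lte_mul_pinfty// ge0_fin_numE.
Qed.

Lemma lebesgue_tuple_box k (B : 'I_k -> set R) : (forall i, measurable (B i)) ->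
  lebesgue_tuple R k [set t | forall i, B i (tnth t i)] = (\prod_(i < k) leb (B i))%E.
Proof.
elim: k B => [|k ih] B mB.
  rewrite big_ord0 /= /dirac/= indicE mem_set//; by case.
rewrite big_ord_recl /= /mpushforward /= /pushforward.
rewrite -(ih (fun i => B (lift ord0 i)))//.
have mE : measurable [set t : k.-tuple R | forall i, B (lift ord0 i) (tnth t i)].
  rewrite (_ : [set t | _] = \bigcap_(i in [set: 'I_k]) ((@tnth k R ^~ i) @^-1` B (lift ord0 i))).
    apply: fin_bigcap_measurable; first exact: finite_finset.
    move=> i _; rewrite -[X in measurable X]setTI.
    by apply: measurable_tnth => //; exact: mB.
  by apply/seteqP; split=> t /= h i; [move=> _|]; exact: h.
rewrite -(product_measure2E leb (lebesgue_tuple R k) (mB ord0) mE).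
congr (_ _); apply/seteqP; split=> -[x t] /=.
  move=> h; split; first by have := h ord0.
  by move=> i; have := h (lift ord0 i); rewrite (tnth_nth x)/= -tnth_nth.
move=> [h1 h2] i; case: (unliftP ord0 i) => [j|] ->//.
by rewrite (tnth_nth x)/= -tnth_nth.
Qed.

Definition mx_box m n (B : 'I_m -> 'I_n -> set R) : set 'M[R]_(m, n) :=
  [set A | forall i j, B i j (A i j)].

Lemma measurable_mx_box m n (B : 'I_m -> 'I_n -> set R) :
  (forall i j, measurable (B i j)) -> measurable (mx_box B).
Proof.
move=> mB; rewrite (_ : mx_box B = \bigcap_(ij in [set: 'I_m * 'I_n])
    ((fun A : 'M[R]_(m, n) => A ij.1 ij.2) @^-1` B ij.1 ij.2)).
  apply: fin_bigcap_measurable; first exact: finite_finset.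
  move=> ij _; rewrite -[X in measurable X]setTI.
  by apply: measurable_mx_entry => //; exact: mB.
by apply/seteqP; split=> A h; [move=> ij _; exact: h|move=> i j; exact: (h (i, j))].
Qed.

Lemma lebesgue_mx_box m n (B : 'I_m -> 'I_n -> set R) :
  (forall i j, measurable (B i j)) ->
  lebesgue_mx (mx_box B) = (\prod_(i < m) \prod_(j < n) leb (B i j))%E.
Proof.
move=> mB; have [g gK Kg] := curry_mxvec_bij m n.
rewrite /lebesgue_mx /mpushforward /= /pushforward.
rewrite (_ : _ @^-1` _ = [set t | forall k, B (g k).1 (g k).2 (tnth t k)]).
  rewrite (@lebesgue_tuple_box _ (fun k => B (g k).1 (g k).2))//.
  rewrite pair_big /= (reindex (uncurry (@mxvec_index m n)))/=; last first.
    by exists g => x _; [exact: gK|exact: Kg].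
  by apply: eq_bigr => -[i j] _; have := gK (i, j) => /= ->.
apply/seteqP; split=> t /= h.
  move=> k; have := h (g k).1 (g k).2; rewrite /mx_of_tuple mxE.
  by have := Kg k; case: (g k) => i j /= ->.
move=> i j; rewrite /mx_of_tuple mxE.
by have := h (mxvec_index i j); have := gK (i, j) => /= ->.
Qed.

Lemma lebesgue_mx_unique m n (nu : {measure set 'M[R]_(m, n) -> \bar R}) :
  (forall B, (forall i j, measurable (B i j)) ->
     nu (mx_box B) = (\prod_(i < m) \prod_(j < n) leb (B i j))%E) ->
  forall A, measurable A -> lebesgue_mx A = nu A.
Proof.
move=> nuB A mA.
pose G := [set U : set 'M[R]_(m, n) | exists2 B, (forall i j, measurable (B i j)) & U = mx_box B].
have Gm : G `<=` measurable by move=> _ [B mB ->]; exact: measurable_mx_box.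
pose b k : 'I_m -> 'I_n -> set R := fun _ _ => `[- k%:R, k%:R]%classic.
have sG : measurable `<=` <<s G >>.
  apply: smallest_sub; first exact: smallest_sigma_algebra.
  move=> _ [[i j] _ [B mB <-]]; apply: sub_sigma_algebra.
  exists (fun i' j' => if (i' == i) && (j' == j) then B else setT).
    by move=> i' j'; case: ifP.
  rewrite setTI; apply/seteqP; split=> C /= h.
    by move=> i' j'; case: ifP => // /andP[/eqP -> /eqP ->].
  by have := h i j; rewrite !eqxx.
apply: (@g_sigma_algebra_measure_unique _ _ _ G Gm (fun k => mx_box (b k))) => //.
- by move=> k; exists (b k) => // i j; exact: measurable_itv.
- apply/seteqP; split=> // C _.
  pose M := \big[Num.max/0]_ij `|C ij.1 ij.2|.
  exists (Num.truncn M).+1 => // i j; rewrite /b /= in_itv/= -ler_norml.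
  apply: (le_trans _ (ltW (truncnS_gt _))).
  by rewrite /M (bigD1 (i, j))//= le_max lexx.
- move=> _ _ [B mB ->] [C mC ->]; exists (fun i j => B i j `&` C i j).
    by move=> i j; exact: measurableI.
  apply/seteqP; split=> D /=; first by move=> [h1 h2] i j; split; [exact: h1|exact: h2].
  by move=> h; split=> i j; have [] := h i j.
- by move=> _ [B mB ->]; rewrite lebesgue_mx_box// nuB.
- move=> k; rewrite lebesgue_mx_box//; last by move=> i j; exact: measurable_itv.
  apply: prode_lty => i; apply/andP; split; first by apply: prode_ge0.
  apply: prode_lty => j; rewrite measure_ge0/= /b lebesgue_measure_itv/=.
  by case: ifP => // _; rewrite ltry.
- exact: sG.
Qed.

(** A copy of [lebesgue_mx] with a head constant of its own, on which the sigma-finite structure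
    required by Fubini is declared. *)
Definition lebmx m n : set 'M[R]_(m, n) -> \bar R := lebesgue_mx.

HB.instance Definition _ m n := Measure.on (@lebmx m n).

Lemma lebmx_sigma_finite m n : sigma_finite setT (@lebmx m n).
Proof.
exists (fun k => mx_box (fun (_ : 'I_m) (_ : 'I_n) => `[- k%:R, k%:R]%classic : set R)).
  apply/esym/seteqP; split=> // C _.
  pose M := \big[Num.max/0]_ij `|C ij.1 ij.2|.
  exists (Num.truncn M).+1 => // i j; rewrite /= in_itv/= -ler_norml.
  apply: (le_trans _ (ltW (truncnS_gt _))).
  by rewrite /M (bigD1 (i, j))//= le_max lexx.
move=> k; split; first by apply: measurable_mx_box => i j; exact: measurable_itv.
rewrite /lebmx lebesgue_mx_box//.
apply: prode_lty => i; apply/andP; split; first by apply: prode_ge0.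
apply: prode_lty => j; rewrite measure_ge0/= lebesgue_measure_itv/=.
by case: ifP => // _; rewrite ltry.
Qed.

HB.instance Definition _ m n := Measure_isSigmaFinite.Build _ _ _ (@lebmx m n) (@lebmx_sigma_finite m n).

Definition insert_row n d (k : 'I_n.+1) (xA : 'rV[R]_d * 'M[R]_(n, d)) : 'M[R]_(n.+1, d) :=
  \matrix_(i, j) if unlift k i is Some i' then xA.2 i' j else xA.1 0 j.

Lemma row_insert_row n d k xA : row k (@insert_row n d k xA) = xA.1.
Proof. by apply/rowP => j; rewrite !mxE unlift_none. Qed.

Lemma row_insert_row_lift n d k i xA :
  row (lift k i) (@insert_row n d k xA) = row i xA.2.
Proof. by apply/rowP => j; rewrite !mxE liftK. Qed.

Lemma measurable_insert_row n d k : measurable_fun setT (@insert_row n d k).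
Proof.
apply: measurable_mx => i j; case: (unliftP k i) => [i'|] ->.
  under eq_fun do rewrite mxE liftK.
  by apply: (measurableT_comp (f := fun A : 'M[R]_(n, d) => A i' j)) => //; exact: measurable_mx_entry.
under eq_fun do rewrite mxE unlift_none.
by apply: (measurableT_comp (f := fun A : 'rV[R]_d => A 0 j)) => //; exact: measurable_mx_entry.
Qed.

(** Singles out the [k]-th of [n.+1] points. Both measures give boxes the same product of side
    lengths. *)
Lemma lebmx_insert_row n d (k : 'I_n.+1) (A : set 'M[R]_(n.+1, d)) : measurable A ->
  @lebmx n.+1 d A = (@lebmx 1 d \x @lebmx n d)%E (insert_row k @^-1` A).
Proof.
move=> mA; have mI := @measurable_insert_row n d k.
pose nu := @mpushforward _ _ _ _ R ((@lebmx 1 d \x @lebmx n d)%E : {measure set ('rV[R]_d * 'M[R]_(n, d)) -> \bar R}) _ mI.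
rewrite /lebmx (@lebesgue_mx_unique _ _ nu)// => B mB.
rewrite /nu /mpushforward /= /pushforward.
rewrite (_ : _ @^-1` _ = mx_box (fun _ : 'I_1 => B k) `*` mx_box (fun i => B (lift k i))).
  rewrite product_measure1E; [|exact: measurable_mx_box|exact: measurable_mx_box].
  rewrite /lebmx !lebesgue_mx_box// big_ord1 (bigD1_ord k)//=.
apply/seteqP; split=> -[x C] /= h.
  split=> i j; first by have := h k j; rewrite (ord1 i) mxE unlift_none.
  by have := h (lift k i) j; rewrite mxE liftK.
have [h1 h2] := h => i j; rewrite mxE; case: (unliftP k i) => [i'|] -> /=.
  exact: h2.
exact: h1.
Qed.

Lemma ge0_integral_insert_row n d (k : 'I_n.+1) (F : 'M[R]_(n.+1, d) -> \bar R) :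
  measurable_fun setT F -> (forall x, 0 <= F x)%E ->
  (\int[@lebmx n.+1 d]_x F x =
   \int[@lebmx 1 d]_x \int[@lebmx n d]_A F (insert_row k (x, A)))%E.
Proof.
move=> mF F0; have mI := @measurable_insert_row n d k.
transitivity (\int[pushforward (@lebmx 1 d \x @lebmx n d)%E (insert_row k)]_x F x)%E.
  by apply: eq_measure_integral => A mA _; exact: lebmx_insert_row.
rewrite ge0_integral_pushforward// preimage_setT fubini_tonelli1//.
  exact: measurableT_comp.
by move=> x /=; exact: F0.
Qed.

Lemma lebmx0T d : @lebmx 0 d setT = 1%E.
Proof.
rewrite (_ : setT = mx_box (fun _ _ => setT)); first by rewrite /lebmx lebesgue_mx_box// big_ord0.
by apply/seteqP; split.
Qed.

Lemma lebesgue_measure_shift (a : R) (A : set R) : measurable A ->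
  leb ((fun x => x + a) @^-1` A) = leb A.
Proof.
move=> mA.
have mS : measurable_fun setT ((fun x => x + a) : measurableTypeR R -> measurableTypeR R).
  exact: measurable_funD.
rewrite -[LHS]/(mpushforward leb mS A); apply/esym/lebesgue_measure_unique => //= _ [[x y]] _ <-.
rewrite /pushforward (_ : _ @^-1` _ = `]x - a, y - a]%classic).
  rewrite !lebesgue_measure_itv/= !lte_fin ltrD2r; case: ifP => // _.
  by rewrite -!EFinB; congr EFin; ring.
by apply/seteqP; split=> z /=; rewrite !in_itv/= ltrBlDr lerBrDr.
Qed.

Lemma lebesgue_measure_reflect (a : R) (A : set R) : measurable A ->
  leb ((fun x => a - x) @^-1` A) = leb A.
Proof.
move=> mA; rewrite -(lebesgue_measureN mA) -(lebesgue_measure_shift a).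
  by rewrite /pushforward; congr (leb _); apply/seteqP; split=> z /=; rewrite opprD addrCA subrr addr0.
rewrite -[X in measurable X]setTI.
by apply: (measurable_funB (measurable_cst a) (@measurable_id _ _ setT)).
Qed.

(** Serves translations and reflections alike: the preimage of a box is a box with sides of the same
    measures. *)
Lemma lebmx_entrywise m n (f : 'I_m -> 'I_n -> R -> R) :
  (forall i j, measurable_fun setT (f i j)) ->
  (forall i j A, measurable A -> leb (f i j @^-1` A) = leb A) ->
  forall F : 'M[R]_(m, n) -> \bar R, measurable_fun setT F -> (forall x, 0 <= F x)%E ->
  (\int[@lebmx m n]_x F (\matrix_(i, j) f i j (x i j)) = \int[@lebmx m n]_x F x)%E.
Proof.
move=> mf lf F mF F0.
have mh : measurable_fun setT (fun x : 'M[R]_(m, n) => \matrix_(i, j) f i j (x i j)).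
  apply: measurable_mx => i j; under eq_fun do rewrite mxE.
  by apply: (measurableT_comp (mf i j)); exact: measurable_mx_entry.
transitivity (\int[pushforward (@lebmx m n) (fun x => \matrix_(i, j) f i j (x i j))]_x F x)%E.
  by have := @ge0_integral_pushforward _ _ _ _ R _ mh (@lebmx m n) setT F measurableT mF (fun x _ => F0 x); rewrite preimage_setT => ->.
apply: eq_measure_integral => A mA _; apply/esym.
rewrite /lebmx (@lebesgue_mx_unique _ _ (mpushforward (@lebesgue_mx R m n) mh))// => B mB.
rewrite -[LHS]/(lebesgue_mx ((fun x : 'M[R]_(m, n) => \matrix_(i, j) f i j (x i j)) @^-1` mx_box B)).
rewrite (_ : _ @^-1` _ = mx_box (fun i j => f i j @^-1` B i j)).
  rewrite lebesgue_mx_box.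
    by apply: eq_bigr => i _; apply: eq_bigr => j _; exact: lf.
  by move=> i j; rewrite -[X in measurable X]setTI; exact: mf.
by apply/seteqP; split=> C /= h i j; have := h i j; rewrite mxE.
Qed.

Lemma lebmx_shift d (a : 'rV[R]_d) (F : 'rV[R]_d -> \bar R) :
  measurable_fun setT F -> (forall x, 0 <= F x)%E ->
  (\int[@lebmx 1 d]_x F (x + a)%R = \int[@lebmx 1 d]_x F x)%E.
Proof.
move=> mF F0; rewrite -[RHS](@lebmx_entrywise 1 d (fun i j r => r + a i j))//.
- by apply: eq_integral => x _; congr F; apply/matrixP => i j; rewrite !mxE.
- by move=> i j; exact: measurable_funD.
- by move=> i j A mA; exact: lebesgue_measure_shift.
Qed.

Lemma lebmx_reflect d (a : 'rV[R]_d) (F : 'rV[R]_d -> \bar R) :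
  measurable_fun setT F -> (forall x, 0 <= F x)%E ->
  (\int[@lebmx 1 d]_x F (a - x)%R = \int[@lebmx 1 d]_x F x)%E.
Proof.
move=> mF F0; rewrite -[RHS](@lebmx_entrywise 1 d (fun i j r => a i j - r))//.
- by apply: eq_integral => x _; congr F; apply/matrixP => i j; rewrite !mxE.
- by move=> i j; exact: measurable_funB.
- by move=> i j A mA; exact: lebesgue_measure_reflect.
Qed.

End lebesgue_matrix.

(** * Cycle integrals *)

(* AM-GM: [f g <= (s f^2 + g^2 / s) / 2]. *)
Section cauchy_schwarz.
Local Open Scope ereal_scope.
Context d (T : measurableType d) (R : realType) (mu : {measure set T -> \bar R}).

Lemma amgm_ereal (s : R) (x y : \bar R) : (0 < s)%R -> 0 <= x -> 0 <= y ->
  x * y <= (2^-1 * s)%:E * (x * x) + (2^-1 * s^-1)%:E * (y * y).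
Proof.
move=> s0; have h1 : (0 < 2^-1 * s)%R by rewrite mulr_gt0.
have h2 : (0 < 2^-1 * s^-1)%R by rewrite mulr_gt0// invr_gt0.
case: x => [x| |]; case: y => [y| |]// x0 y0; last 3 first.
- by rewrite mulyy [(2^-1 / s)%:E * +oo]gt0_muley ?lte_fin// -!EFinM addey// leey.
- by rewrite mulyy [(2^-1 * s)%:E * +oo]gt0_muley ?lte_fin// -!EFinM addye// leey.
- by rewrite mulyy [(2^-1 * s)%:E * +oo]gt0_muley ?lte_fin// [(2^-1 / s)%:E * +oo]gt0_muley ?lte_fin// leey.
rewrite -!EFinM -EFinD lee_fin.
have s20 : (0 <= (Num.sqrt s * x - (Num.sqrt s)^-1 * y) ^+ 2)%R by exact: sqr_ge0.
have : ((Num.sqrt s * x - (Num.sqrt s)^-1 * y) ^+ 2 =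
  s * (x * x) + s^-1 * (y * y) - 2 * (x * y))%R.
  rewrite -[in RHS](sqr_sqrtr (ltW s0)); field.
  by rewrite gt_eqF// sqrtr_gt0.
by move: s20; move: (s^-1)%R (_ ^+ 2)%R => ? ?; lra.
Qed.

Lemma ge0_cauchy_schwarz (f g : T -> \bar R) (a b : R) :
  measurable_fun setT f -> measurable_fun setT g ->
  (forall x, 0 <= f x) -> (forall x, 0 <= g x) -> (0 <= a)%R -> (0 <= b)%R ->
  \int[mu]_x (f x * f x) <= (a ^+ 2)%:E -> \int[mu]_x (g x * g x) <= (b ^+ 2)%:E ->
  \int[mu]_x (f x * g x) <= (a * b)%:E.
Proof.
move=> mf mg f0 g0 a0 b0 fa gb.
have f20 x : 0 <= f x * f x by rewrite mule_ge0.
have g20 x : 0 <= g x * g x by rewrite mule_ge0.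
have mf2 : measurable_fun setT (fun x => f x * f x) by exact: emeasurable_funM.
have mg2 : measurable_fun setT (fun x => g x * g x) by exact: emeasurable_funM.
(* The weighted inequality of means, integrated for each weight [s]; the weight is optimised at the
   end. *)
have key (s : R) : (0 < s)%R ->
    \int[mu]_x (f x * g x) <= (2^-1 * (s * a ^+ 2 + s^-1 * b ^+ 2))%:E.
  move=> s0.
  have c1 : (0 <= 2^-1 * s)%R by rewrite mulr_ge0// ltW.
  have c2 : (0 <= 2^-1 * s^-1)%R by rewrite mulr_ge0// invr_ge0 ltW.
  apply: (@le_trans _ _ (\int[mu]_x ((2^-1 * s)%:E * (f x * f x) + (2^-1 * s^-1)%:E * (g x * g x)))).
    apply: ge0_le_integral => //.
    - by move=> x _; rewrite mule_ge0.
    - exact: emeasurable_funM.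
    - by apply: emeasurable_funD; apply: emeasurable_funM.
    - by move=> x _; exact: amgm_ereal.
  rewrite ge0_integralD//; last 4 first.
  - by move=> x _; rewrite mule_ge0.
  - exact: emeasurable_funM.
  - by move=> x _; rewrite mule_ge0.
  - exact: emeasurable_funM.
  rewrite mulrDr EFinD !ge0_integralZl_EFin//.
  by apply: leeD; rewrite [in leRHS]mulrA [in leRHS]EFinM lee_wpmul2l.
have lim0 (c : R) : (0 <= c)%R -> (forall e : R, (0 < e)%R -> \int[mu]_x (f x * g x) <= (a * b + e * c)%:E) ->
    \int[mu]_x (f x * g x) <= (a * b)%:E.
  move=> c0 H; apply/lee_addgt0Pr => e e0; rewrite -EFinD.
  apply: (le_trans (H (e / (c + 1))%R _)); first by rewrite divr_gt0// ltr_wpDl.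
  rewrite lee_fin lerD2l mulrAC ler_pdivrMr ?ltr_wpDl//.
  by rewrite ler_wpM2l ?lerDl// ltW.
apply: (lim0 (2^-1 * (a + b))%R); first by rewrite mulr_ge0// addr_ge0.
(* The optimal weight is [b / a]; adding [e] to both terms keeps it positive and defined when [a] or
   [b] is 0, at a cost proportional to [e]. *)
move=> e e0; apply: (le_trans (key ((b + e) / (a + e))%R _)).
  by rewrite divr_gt0// ltr_wpDl.
rewrite lee_fin invf_div.
have ae : (0 < a + e)%R by rewrite ltr_wpDl.
have be : (0 < b + e)%R by rewrite ltr_wpDl.
have h1 : ((b + e) / (a + e) * a ^+ 2 <= (b + e) * a)%R.
  rewrite mulrAC ler_pdivrMr// expr2 -!mulrA ler_pM2l// ler_wpM2l// lerDl ltW//.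
have h2 : ((a + e) / (b + e) * b ^+ 2 <= (a + e) * b)%R.
  rewrite mulrAC ler_pdivrMr// expr2 -!mulrA ler_pM2l// ler_wpM2l// lerDl ltW//.
lra.
Qed.

(** Infinite integrals are allowed because this is applied to sections of kernels, which may fail to
    be square integrable for exceptional points. With the convention [0 * +oo = 0], a vanishing
    factor has to be treated first: the corresponding function is then zero almost everywhere. *)
Lemma ge0_cauchy_schwarz_sqr (f g : T -> \bar R) :
  measurable_fun setT f -> measurable_fun setT g ->
  (forall x, 0 <= f x) -> (forall x, 0 <= g x) ->
  (\int[mu]_x (f x * g x)) * (\int[mu]_x (f x * g x)) <=
  (\int[mu]_x (f x * f x)) * (\int[mu]_x (g x * g x)).
Proof.
move=> mf mg f0 g0.
have f20 x : 0 <= f x * f x by rewrite mule_ge0.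
have g20 x : 0 <= g x * g x by rewrite mule_ge0.
have fg0 x : 0 <= f x * g x by rewrite mule_ge0.
have zero (h k : T -> \bar R) : measurable_fun setT h -> measurable_fun setT k ->
    (forall x, 0 <= h x) -> (forall x, 0 <= k x) ->
    \int[mu]_x (h x * h x) = 0 -> \int[mu]_x (h x * k x) = 0.
  move=> mh mk h0 k0 hh; have hh0 x : 0 <= h x * h x by rewrite mule_ge0.
  have : ae_eq mu setT (fun x => h x * h x) (cst 0).
    apply/ae_eq_integral_abs => //; first exact: emeasurable_funM.
    by rewrite -[RHS]hh; apply: eq_integral => x _; exact: gee0_abs.
  move=> ae0; rewrite (@ae_eq_integral _ _ _ mu setT (cst 0) (fun x => h x * k x))//.
  - by rewrite integral0.
  - exact: emeasurable_funM.
  - apply: filterS ae0 => x + _ => /(_ Logic.I) /eqP; rewrite mule_eq0 orbb => /eqP ->.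
    by rewrite mul0e.
have if0 : 0 <= \int[mu]_x (f x * f x) by exact: integral_ge0.
have ig0 : 0 <= \int[mu]_x (g x * g x) by exact: integral_ge0.
have [f2|f2] := eqVneq (\int[mu]_x (f x * f x)) 0.
  by rewrite (zero f g)// mul0e mule_ge0.
have [g2|g2] := eqVneq (\int[mu]_x (g x * g x)) 0.
  under eq_integral do rewrite muleC.
  by rewrite (zero g f)// mul0e mule_ge0.
have fp : 0 < \int[mu]_x (f x * f x) by rewrite lt0e f2.
have gp : 0 < \int[mu]_x (g x * g x) by rewrite lt0e g2.
have [fy|fy] := eqVneq (\int[mu]_x (f x * f x)) +oo; first by rewrite fy gt0_mulye// leey.
have [gy|gy] := eqVneq (\int[mu]_x (g x * g x)) +oo; first by rewrite gy gt0_muley// leey.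
have ff : \int[mu]_x (f x * f x) \is a fin_num by rewrite ge0_fin_numE// ltey.
have gf : \int[mu]_x (g x * g x) \is a fin_num by rewrite ge0_fin_numE// ltey.
move: ff gf => /fineK ff /fineK gf.
set a := fine _ in ff; set b := fine _ in gf.
have a0 : (0 <= a)%R by exact: fine_ge0.
have b0 : (0 <= b)%R by exact: fine_ge0.
have H := @ge0_cauchy_schwarz f g (Num.sqrt a) (Num.sqrt b) mf mg f0 g0 (sqrtr_ge0 _) (sqrtr_ge0 _).
rewrite -ff -gf.
have {}H : \int[mu]_x (f x * g x) <= (Num.sqrt a * Num.sqrt b)%:E.
  by apply: H; rewrite sqr_sqrtr// ?ff ?gf.
have i0 : 0 <= \int[mu]_x (f x * g x) by exact: integral_ge0.
apply: (le_trans (lee_pmul i0 i0 H H)).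
by rewrite -!EFinM lee_fin mulrACA -!expr2 !sqr_sqrtr.
Qed.

End cauchy_schwarz.

Lemma emeasurable_prod d (T : measurableType d) (R : realType) (I : Type) (s : seq I)
  (f : I -> T -> \bar R) : (forall i, measurable_fun setT (f i)) ->
  measurable_fun setT (fun x => \prod_(i <- s) f i x)%E.
Proof.
move=> mf; elim: s => [|i s ih]; first by under eq_fun do rewrite big_nil; exact: measurable_cst.
by under eq_fun do rewrite big_cons; exact: emeasurable_funM.
Qed.

(** * Integrals of kernel products along the cycles of a permutation *)

Section permutation_bound.
Context (R : realType) (d : nat).
Local Notation V := 'rV[R]_d.
Local Notation lam n := (@lebmx R n d).
Local Open Scope ereal_scope.
Implicit Types (F G : V * V -> \bar R).

(** For [a >= 0]: the Hilbert-Schmidt norm of the kernel [F] is at most [a]. *)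
Definition hs_le F (a : R) := \int[lam 1 \x lam 1]_z (F z * F z) <= (a ^+ 2)%:E.

Definition trace_le F (a : R) := \int[lam 1]_x F (x, x) <= a%:E.

Definition nonneg_kernel F := measurable_fun setT F /\ forall z, 0 <= F z.

Definition comp_kernel F G : V * V -> \bar R :=
  fun z => \int[lam 1]_v (F (z.1, v) * G (v, z.2)).

Lemma measurable_row n (i : 'I_n) : measurable_fun setT (fun A : 'M[R]_(n, d) => row i A).
Proof.
apply: measurable_mx => i' j; under eq_fun do rewrite mxE.
exact: measurable_mx_entry.
Qed.

Lemma measurable_kernel_rows n F (i j : 'I_n) : measurable_fun setT F ->
  measurable_fun setT (fun A : 'M[R]_(n, d) => F (row i A, row j A)).
Proof.
move=> mF; apply: (measurableT_comp mF (g := fun A => (row i A, row j A))).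
by apply/measurable_fun_pairP; split; exact: measurable_row.
Qed.

Lemma measurable_comp_integrand F G : measurable_fun setT F -> measurable_fun setT G ->
  measurable_fun setT (fun zv : (V * V) * V => F (zv.1.1, zv.2) * G (zv.2, zv.1.2)).
Proof.
move=> mF mG; apply: emeasurable_funM.
  apply: (measurableT_comp mF (g := fun zv : (V * V) * V => (zv.1.1, zv.2))).
  apply/measurable_fun_pairP; split; last exact: measurable_snd.
  exact: (measurableT_comp measurable_fst measurable_fst).
apply: (measurableT_comp mG (g := fun zv : (V * V) * V => (zv.2, zv.1.2))).
apply/measurable_fun_pairP; split; first exact: measurable_snd.
exact: (measurableT_comp measurable_snd measurable_fst).
Qed.

Lemma nonneg_kernel_comp F G : nonneg_kernel F -> nonneg_kernel G ->
  nonneg_kernel (comp_kernel F G).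
Proof.
move=> [mF F0] [mG G0]; split.
  apply: (@measurable_fun_fubini_tonelli_F _ _ _ _ R (lam 1)
    (fun zv : (V * V) * V => F (zv.1.1, zv.2) * G (zv.2, zv.1.2))).
  - exact: measurable_comp_integrand.
  - by move=> z; rewrite mule_ge0.
by move=> z; apply: integral_ge0 => v _; rewrite mule_ge0.
Qed.

(** Cauchy-Schwarz in the middle variable bounds the squared composition at [(x, y)] by [f x * g y],
    whose double integral factors. *)
Lemma hs_le_comp F G a b : nonneg_kernel F -> nonneg_kernel G ->
  (0 <= a)%R -> (0 <= b)%R -> hs_le F a -> hs_le G b -> hs_le (comp_kernel F G) (a * b).
Proof.
move=> kF kG a0 b0 Fa Gb; have [mC C0] := nonneg_kernel_comp kF kG.
have [mF F0] := kF; have [mG G0] := kG.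
have mF2 : measurable_fun setT (fun z => F z * F z) by exact: emeasurable_funM.
have mG2 : measurable_fun setT (fun z => G z * G z) by exact: emeasurable_funM.
have F20 z : 0 <= F z * F z by rewrite mule_ge0.
have G20 z : 0 <= G z * G z by rewrite mule_ge0.
pose f x := \int[lam 1]_v (F (x, v) * F (x, v)).
pose g y := \int[lam 1]_v (G (v, y) * G (v, y)).
have mf : measurable_fun setT f by exact: (@measurable_fun_fubini_tonelli_F _ _ _ _ R (lam 1) (fun z => F z * F z)).
have mg : measurable_fun setT g by exact: (@measurable_fun_fubini_tonelli_G _ _ _ _ R (lam 1) (fun z => G z * G z)).
have f0 x : 0 <= f x by exact: integral_ge0.
have g0 x : 0 <= g x by exact: integral_ge0.
have Ff : \int[lam 1]_x f x <= (a ^+ 2)%:E.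
  by move: Fa; rewrite /hs_le fubini_tonelli1.
have Gg : \int[lam 1]_x g x <= (b ^+ 2)%:E.
  by move: Gb; rewrite /hs_le fubini_tonelli2.
rewrite /hs_le fubini_tonelli1//; last 2 first.
- exact: emeasurable_funM.
- by move=> z; rewrite mule_ge0.
apply: (@le_trans _ _ (\int[lam 1]_x \int[lam 1]_y (f x * g y))).
  apply: ge0_le_integral => //.
  - by move=> x _; apply: integral_ge0 => y _; rewrite mule_ge0.
  - apply: (@measurable_fun_fubini_tonelli_F _ _ _ _ R (lam 1) (fun z => comp_kernel F G z * comp_kernel F G z)).
      exact: emeasurable_funM.
    by move=> z; rewrite mule_ge0.
  - apply: (@measurable_fun_fubini_tonelli_F _ _ _ _ R (lam 1) (fun z => f z.1 * g z.2)).
      by apply: emeasurable_funM; [exact: (measurableT_comp mf)|exact: (measurableT_comp mg)].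
    by move=> z; rewrite mule_ge0.
  - move=> x _; apply: ge0_le_integral => //.
    + by move=> y _; rewrite mule_ge0.
    + by apply: emeasurable_funM; apply: (measurableT_comp mC); exact: pair1_measurable.
    + by apply: emeasurable_funM.
    + move=> y _; apply: ge0_cauchy_schwarz_sqr => //.
      * by apply: (measurableT_comp mF); exact: pair1_measurable.
      * by apply: (measurableT_comp mG); exact: pair2_measurable.
under eq_integral do rewrite ge0_integralZl//.
rewrite ge0_integralZr//; last exact: integral_ge0.
by rewrite exprMn EFinM lee_pmul//; exact: integral_ge0.
Qed.

(** The trace of a composition is the scalar product of [F] with the transpose of [G], so
    Cauchy-Schwarz on the product space applies. *)
Lemma trace_le_comp F G a b : nonneg_kernel F -> nonneg_kernel G ->
  (0 <= a)%R -> (0 <= b)%R -> hs_le F a -> hs_le G b -> trace_le (comp_kernel F G) (a * b).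
Proof.
move=> [mF F0] [mG G0] a0 b0 Fa Gb.
have mS : measurable_fun setT (fun z : V * V => G (z.2, z.1)).
  apply: (measurableT_comp mG (g := fun z : V * V => (z.2, z.1))).
  by apply/measurable_fun_pairP; split; [exact: measurable_snd|exact: measurable_fst].
have mG2 : measurable_fun setT (fun z => G z * G z) by exact: emeasurable_funM.
have G20 z : 0 <= G z * G z by rewrite mule_ge0.
have := @ge0_cauchy_schwarz _ _ R (lam 1 \x lam 1) F (fun z => G (z.2, z.1)) a b mF mS F0
  (fun z => G0 _) a0 b0 Fa.
rewrite fubini_tonelli1; [|exact: emeasurable_funM|by move=> z; rewrite mule_ge0].
rewrite fubini_tonelli1; [|exact: emeasurable_funM|by move=> z; rewrite mule_ge0].
apply; move: Gb; rewrite /hs_le fubini_tonelli2//.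
Qed.

Lemma ge0_integral_insert_rowC n (k : 'I_n.+1) (F : 'M[R]_(n.+1, d) -> \bar R) :
  measurable_fun setT F -> (forall x, 0 <= F x) ->
  \int[lam n.+1]_x F x = \int[lam n]_A \int[lam 1]_x F (insert_row k (x, A)).
Proof.
move=> mF F0; rewrite (ge0_integral_insert_row k)//.
have mI := @measurable_insert_row R n d k.
exact: (@fubini_tonelli _ _ _ _ R (lam 1) (lam n) (fun z => F (insert_row k z))
  (measurableT_comp mF mI) (fun z => F0 _)).
Qed.

(* A vertex [v] lying on an edge [p -> v -> q] is integrated out by composing
   the kernels of its two edges, which removes it from its cycle. *)
Lemma injection_integral_bound n (s : 'I_n -> 'I_n) (F : 'I_n -> V * V -> \bar R)
    (a : 'I_n -> R) : injective s -> (forall i, nonneg_kernel (F i)) ->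
  (forall i, (0 <= a i)%R) ->
  (forall i, if s i == i then trace_le (F i) (a i) else hs_le (F i) (a i)) ->
  \int[lam n]_A \prod_(i < n) F i (row i A, row (s i) A) <= (\prod_(i < n) a i)%:E.
Proof.
elim: n s F a => [|n ih] s F a sI kF a0 Fa.
  under eq_integral do rewrite big_ord0; rewrite big_ord0 integral_cst//.
  by rewrite mul1e -[X in _ <= X](@lebmx0T R d).
have mP m (s' : 'I_m -> 'I_m) (F' : 'I_m -> V * V -> \bar R) : (forall i, nonneg_kernel (F' i)) ->
    measurable_fun setT (fun A : 'M[R]_(m, d) => \prod_(i < m) F' i (row i A, row (s' i) A)).
  by move=> kF'; apply: emeasurable_prod => i; apply: measurable_kernel_rows; have [] := kF' i.
have P0 m (s' : 'I_m -> 'I_m) (F' : 'I_m -> V * V -> \bar R) (A : 'M[R]_(m, d)) :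
    (forall i, nonneg_kernel (F' i)) -> 0 <= \prod_(i < m) F' i (row i A, row (s' i) A).
  by move=> kF'; apply: prode_ge0 => i; have [_] := kF' i; exact.
(* The map with vertex 0 bypassed: an edge into 0 is redirected to [s ord0]. The inner default [i]
   would require both [s ord0] and [s (lift ord0 i)] to be 0, which injectivity excludes. *)
pose s' (i : 'I_n) : 'I_n := odflt (odflt i (unlift ord0 (s ord0))) (unlift ord0 (s (lift ord0 i))).
have s'I : injective s'.
  move=> i j; rewrite /s'.
  case: (unliftP ord0 (s (lift ord0 i))) => [i1|] e1 /=;
    case: (unliftP ord0 (s (lift ord0 j))) => [j1|] e2 /=.
  - by move=> ij; apply/(@lift_inj _ ord0)/sI; rewrite e1 e2 ij.
  - case: (unliftP ord0 (s ord0)) => [q|] e3 /=; first by move=> iq; have := sI ord0 (lift ord0 i); rewrite e1 e3 iq => /(_ erefl).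
    by have := sI _ _ (etrans e2 (esym e3)).
  - case: (unliftP ord0 (s ord0)) => [q|] e3 /=; first by move=> iq; have := sI ord0 (lift ord0 j); rewrite e2 e3 iq => /(_ erefl).
    by have := sI _ _ (etrans e1 (esym e3)).
  - by move=> _; apply/(@lift_inj _ ord0)/sI; rewrite e1 e2.
(* A fixed point at 0 shares no variable with the other factors, so its trace splits off. *)
have [s0|s0] := eqVneq (s ord0) ord0.
  have sl i : s (lift ord0 i) = lift ord0 (s' i).
    rewrite /s'; case: (unliftP ord0 (s (lift ord0 i))) => [j|] e //=.
    by have := sI _ _ (etrans e (esym s0)).
  have F00 x : 0 <= F ord0 (x, x) by have [_] := kF ord0; exact.
  have mF00 : measurable_fun setT (fun x => F ord0 (x, x)).
    have [mF0 _] := kF ord0; apply: (measurableT_comp mF0 (g := fun x : V => (x, x))).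
    by apply/measurable_fun_pairP; split; exact: measurable_id.
  rewrite (ge0_integral_insert_row ord0); [|exact: mP|by move=> A; exact: P0].
  pose I := \int[lam n]_A (\prod_(i < n) F (lift ord0 i) (row i A, row (s' i) A)).
  have I0 : 0 <= I.
    by apply: integral_ge0 => A _; apply: (P0 _ s' (fun i => F (lift ord0 i))).
  have E x : \int[lam n]_A \prod_(i < n.+1)
      F i (row i (insert_row ord0 (x, A)), row (s i) (insert_row ord0 (x, A))) = F ord0 (x, x) * I.
    rewrite -ge0_integralZl//; last 2 first.
    - exact: (mP _ s' (fun i => F (lift ord0 i))).
    - by move=> A _; apply: (P0 _ s' (fun i => F (lift ord0 i))).
    apply: eq_integral => A _; rewrite big_ord_recl s0 !row_insert_row; congr (_ * _).
    by apply: eq_bigr => i _; rewrite sl !row_insert_row_lift.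
  under eq_integral do rewrite E.
  rewrite ge0_integralZr// big_ord_recl EFinM lee_pmul//; first exact: integral_ge0.
  - by have := Fa ord0; rewrite s0 eqxx.
  - apply: (ih s' (fun i => F (lift ord0 i)) (fun i => a (lift ord0 i))) => //.
    move=> i; have := Fa (lift ord0 i); rewrite sl (inj_eq (@lift_inj _ ord0)); exact.
have [sinv sK Ks] : bijective s by exact: injF_bij.
case: (unliftP ord0 (s ord0)) s0 => [q|] e0; last by rewrite e0 eqxx.
move=> _; case: (unliftP ord0 (sinv ord0)) => [p|] ep; last first.
  by have := Ks ord0; rewrite ep e0.
have sp : s (lift ord0 p) = ord0 by rewrite -ep Ks.
have s'p : s' p = q by rewrite /s' sp unlift_none e0 liftK.
have s'i i : i != p -> s (lift ord0 i) = lift ord0 (s' i).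
  move=> ip; rewrite /s'; case: (unliftP ord0 (s (lift ord0 i))) => [j|] e //=.
  have := sI _ _ (etrans e (esym sp)) => /lift_inj ij.
  by move: ip; rewrite ij eqxx.
(* The edges [p -> 0] and [0 -> q] become one edge [p -> q], and their bounds are multiplied
   accordingly in [a']. *)
pose F' i := if i == p then comp_kernel (F (lift ord0 p)) (F ord0) else F (lift ord0 i).
pose a' i := if i == p then (a (lift ord0 p) * a ord0)%R else a (lift ord0 i).
have kF' i : nonneg_kernel (F' i).
  by rewrite /F'; case: ifP => _; [exact: nonneg_kernel_comp|exact: kF].
rewrite (ge0_integral_insert_rowC ord0); [|exact: mP|by move=> A; exact: P0].
have -> : (\prod_(i < n.+1) a i = \prod_(i < n) a' i)%R.
  rewrite big_ord_recl (bigD1 p)//= [RHS](bigD1 p)//= /a' eqxx mulrCA mulrA.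
  by congr (_ * _)%R; apply: eq_bigr => i /negbTE ->.
apply: le_trans (ih s' F' a' s'I kF' _ _).
- rewrite le_eqVlt; apply/orP; left; apply/eqP; apply: eq_integral => A _.
  rewrite [RHS](bigD1 p)//= {1}/F' eqxx s'p /comp_kernel /=.
  rewrite -ge0_integralZr//; last 3 first.
  + have [m1 _] := kF (lift ord0 p); have [m2 _] := kF ord0; apply: emeasurable_funM.
      by apply: (measurableT_comp m1); exact: pair1_measurable.
    by apply: (measurableT_comp m2); exact: pair2_measurable.
  + by move=> v _; rewrite mule_ge0//; have [_ h1] := kF (lift ord0 p); have [_ h2] := kF ord0.
  + by apply: prode_ge0 => i; have [_] := kF' i; exact.
  apply: eq_integral => v _; rewrite big_ord_recl (bigD1 p)//= e0 sp.
  rewrite !row_insert_row !row_insert_row_lift muleA; congr (_ * _).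
    by rewrite muleC.
  apply: eq_bigr => i ip; rewrite s'i// !row_insert_row_lift /F'.
  by rewrite (negbTE ip).
- by move=> i; rewrite /a'; case: ifP => // _; rewrite mulr_ge0.
- move=> i; rewrite /F' /a'; have [->|ip] := eqVneq i p; last first.
    by have := Fa (lift ord0 i); rewrite s'i// (inj_eq (@lift_inj _ ord0)).
  have hp : hs_le (F (lift ord0 p)) (a (lift ord0 p)).
    by have := Fa (lift ord0 p); rewrite sp.
  have h0 : hs_le (F ord0) (a ord0).
    by have := Fa ord0; rewrite e0.
  (* If [p = q] the removed vertex belonged to a cycle of length 2, which closes up into a loop and
     calls for a trace bound; otherwise the composed edge is still a proper edge. *)
  by case: ifP => _; [exact: trace_le_comp|exact: hs_le_comp].
Qed.

End permutation_bound.

Import ComplexField.Normc.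

(** * Complex-valued functions and integrals, through real and imaginary parts *)

Section complex_modulus.
Context (R : realType).
Implicit Types z w : R[i].

Lemma cReM z w : complex.Re (z * w) = complex.Re z * complex.Re w - complex.Im z * complex.Im w.
Proof. by case: z; case: w. Qed.

Lemma cImM z w : complex.Im (z * w) = complex.Re z * complex.Im w + complex.Im z * complex.Re w.
Proof. by case: z; case: w. Qed.

Lemma cReD z w : complex.Re (z + w) = complex.Re z + complex.Re w.
Proof. by case: z; case: w. Qed.

Lemma cImD z w : complex.Im (z + w) = complex.Im z + complex.Im w.
Proof. by case: z; case: w. Qed.

Lemma normcE2 z : normc z = Num.sqrt (complex.Re z ^+ 2 + complex.Im z ^+ 2).
Proof. by case: z. Qed.

Lemma normc_ge0 z : 0 <= normc z.
Proof. by rewrite normcE2 sqrtr_ge0. Qed.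

Lemma normr_Re_le z : `|complex.Re z| <= normc z.
Proof. by rewrite normcE2 -sqrtr_sqr ler_sqrt ?addr_ge0 ?sqr_ge0// lerDl sqr_ge0. Qed.

Lemma normr_Im_le z : `|complex.Im z| <= normc z.
Proof. by rewrite normcE2 -sqrtr_sqr ler_sqrt ?addr_ge0 ?sqr_ge0// lerDr sqr_ge0. Qed.

Lemma normc_le_ReIm z : normc z <= `|complex.Re z| + `|complex.Im z|.
Proof.
rewrite normcE2 -[leRHS]ger0_norm ?addr_ge0// -sqrtr_sqr ler_sqrt ?sqr_ge0//.
rewrite sqrrD !real_normK ?num_real// -addrA lerD2l lerDr.
by rewrite mulrn_wge0// mulr_ge0.
Qed.

Lemma normc_prod (I : Type) (s : seq I) (P : pred I) (F : I -> R[i]) :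
  normc (\prod_(i <- s | P i) F i) = \prod_(i <- s | P i) normc (F i).
Proof. by elim/big_ind2 : _ => //; [exact: normc1|move=> ? ? ? ? <- <-; exact: normcM]. Qed.

Lemma normc_sum_le (I : Type) (s : seq I) (P : pred I) (F : I -> R[i]) :
  normc (\sum_(i <- s | P i) F i) <= \sum_(i <- s | P i) normc (F i).
Proof.
elim/big_ind2 : _ => //; first by rewrite normc0.
by move=> x1 x2 y1 y2 h1 h2; rewrite (le_trans (le_normcD _ _))// lerD.
Qed.

Lemma normc_sign n : normc ((-1) ^+ n : R[i]) = 1.
Proof.
elim: n => [|n ih]; first by rewrite expr0 normc1.
by rewrite exprS normcM normcN normc1 ih mulr1.
Qed.

Lemma normc_det_le n (M : 'M[R[i]]_n) :
  normc (\det M) <= \sum_(s : 'S_n) \prod_i normc (M i (s i)).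
Proof.
rewrite /determinant; apply: (le_trans (normc_sum_le _ _ _)).
by apply: ler_sum => s _; rewrite normcM normc_sign mul1r normc_prod.
Qed.

End complex_modulus.

Section complex_integral.
Context (R : realType).

Definition cmeasurable d (T : measurableType d) (f : T -> R[i]) :=
  measurable_fun setT (fun x => complex.Re (f x)) /\
  measurable_fun setT (fun x => complex.Im (f x)).

Definition cintegrable d (T : measurableType d) (mu : {measure set T -> \bar R})
    (f : T -> R[i]) :=
  mu.-integrable setT (fun x => (complex.Re (f x))%:E) /\
  mu.-integrable setT (fun x => (complex.Im (f x))%:E).

Definition cint d (T : measurableType d) (mu : {measure set T -> \bar R})
    (f : T -> R[i]) : R[i] :=
  (\int[mu]_x complex.Re (f x) +i* \int[mu]_x complex.Im (f x))%C.

Section basics.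
Context d (T : measurableType d) (mu : {measure set T -> \bar R}).
Implicit Types f g : T -> R[i].

Lemma cmeasurable_cst c : cmeasurable (fun _ : T => c).
Proof. by split; exact: measurable_cst. Qed.

Lemma cmeasurableD f g : cmeasurable f -> cmeasurable g -> cmeasurable (fun x => f x + g x).
Proof.
move=> [f1 f2] [g1 g2]; split.
  by under eq_fun do rewrite cReD; exact: measurable_funD.
by under eq_fun do rewrite cImD; exact: measurable_funD.
Qed.

Lemma cmeasurableM f g : cmeasurable f -> cmeasurable g -> cmeasurable (fun x => f x * g x).
Proof.
move=> [f1 f2] [g1 g2]; split.
  by under eq_fun do rewrite cReM; apply: measurable_funB; exact: measurable_funM.
by under eq_fun do rewrite cImM; apply: measurable_funD; exact: measurable_funM.
Qed.

Lemma cmeasurable_sum (I : Type) (s : seq I) (P : pred I) (F : I -> T -> R[i]) :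
  (forall i, cmeasurable (F i)) -> cmeasurable (fun x => \sum_(i <- s | P i) F i x).
Proof.
move=> mF; elim: s => [|i s ih].
  by under eq_fun do rewrite big_nil; exact: cmeasurable_cst.
under eq_fun do rewrite big_cons; case: (P i) => //; exact: cmeasurableD.
Qed.

Lemma cmeasurable_prod (I : Type) (s : seq I) (P : pred I) (F : I -> T -> R[i]) :
  (forall i, cmeasurable (F i)) -> cmeasurable (fun x => \prod_(i <- s | P i) F i x).
Proof.
move=> mF; elim: s => [|i s ih].
  by under eq_fun do rewrite big_nil; exact: cmeasurable_cst.
under eq_fun do rewrite big_cons; case: (P i) => //; exact: cmeasurableM.
Qed.

Lemma cmeasurable_det n (M : T -> 'M[R[i]]_n) :
  (forall i j, cmeasurable (fun x => M x i j)) -> cmeasurable (fun x => \det (M x)).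
Proof.
move=> mM; apply: cmeasurable_sum => s; apply: cmeasurableM; first exact: cmeasurable_cst.
by apply: cmeasurable_prod => i; exact: mM.
Qed.

Lemma measurable_normc f : cmeasurable f -> measurable_fun setT (fun x => normc (f x)).
Proof.
move=> [f1 f2]; under eq_fun do rewrite normcE2.
apply: measurableT_comp; last by apply: measurable_funD; exact: measurable_funX.
by apply: continuous_measurable_fun; exact: sqrt_continuous.
Qed.

Lemma cintegrable_lty f : cmeasurable f ->
  (\int[mu]_x (normc (f x))%:E < +oo)%E -> cintegrable mu f.
Proof.
move=> mf fy; have := mf => -[f1 f2].
have ni : mu.-integrable setT (fun x => (normc (f x))%:E).
  apply/integrableP; split; first by apply/measurable_EFinP; exact: measurable_normc.
  by under eq_integral do rewrite gee0_abs ?lee_fin ?normc_ge0//.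
by split; apply: le_integrable_R ni => // x; [exact: normr_Re_le|exact: normr_Im_le].
Qed.

(** The factor 2 comes from bounding the real and the imaginary part separately; it only affects
    constants. *)
Lemma normc_cint_le f (M : R) : cmeasurable f ->
  (\int[mu]_x (normc (f x))%:E <= M%:E)%E -> normc (cint mu f) <= 2 * M.
Proof.
move=> mf fM; have [i1 i2] := cintegrable_lty mf (le_lt_trans fM (ltry _)).
have mn := measurable_normc mf.
have h (g : T -> R) : measurable_fun setT g -> mu.-integrable setT (fun x => (g x)%:E) ->
    (forall x, `|g x| <= normc (f x)) -> `|\int[mu]_x g x| <= M.
  move=> mg gi gf; rewrite -lee_fin EFin_normr_Rintegral//.
  apply: (le_trans (le_abse_integral _ _ _)) => //; first exact/measurable_EFinP.
  apply: le_trans fM; apply: ge0_le_integral => //.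
  - by apply/measurable_EFinP; exact: measurableT_comp.
  - exact/measurable_EFinP.
  - by move=> x _; rewrite lee_fin.
have [f1 f2] := mf.
rewrite (le_trans (normc_le_ReIm _))//= mulr2n mulrDl mul1r; apply: lerD.
  by apply: h => // x; exact: normr_Re_le.
by apply: h => // x; exact: normr_Im_le.
Qed.

Lemma cintD f g : cintegrable mu f -> cintegrable mu g ->
  cint mu (fun x => f x + g x) = cint mu f + cint mu g.
Proof.
move=> [f1 f2] [g1 g2]; rewrite /cint.
under eq_Rintegral do rewrite cReD.
under [X in (_ +i* X)%C]eq_Rintegral do rewrite cImD.
by rewrite !RintegralD.
Qed.

Lemma cintegrableD f g : cintegrable mu f -> cintegrable mu g ->
  cintegrable mu (fun x => f x + g x).
Proof.
move=> [f1 f2] [g1 g2]; split.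
  by under eq_fun do rewrite cReD; exact: integrable_RD.
by under eq_fun do rewrite cImD; exact: integrable_RD.
Qed.

Lemma cintegrableZ c f : cintegrable mu f -> cintegrable mu (fun x => c * f x).
Proof.
move=> [f1 f2]; split.
  by under eq_fun do rewrite cReM; apply: integrable_RB; exact: integrable_RZ.
by under eq_fun do rewrite cImM; apply: integrable_RD; exact: integrable_RZ.
Qed.

Lemma cintZ c f : cintegrable mu f -> cint mu (fun x => c * f x) = c * cint mu f.
Proof.
move=> [f1 f2]; rewrite /cint.
under eq_Rintegral do rewrite cReM.
under [X in (_ +i* X)%C]eq_Rintegral do rewrite cImM.
rewrite RintegralB//; [|exact: integrable_RZ|exact: integrable_RZ].
rewrite RintegralD//; [|exact: integrable_RZ|exact: integrable_RZ].
by rewrite !RintegralZl//; case: c.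
Qed.

Lemma eq_cint f g : f =1 g -> cint mu f = cint mu g.
Proof. by move=> fg; congr cint; exact/funext. Qed.

Lemma cintegrable_sum (I : Type) (s : seq I) (P : pred I) (F : I -> T -> R[i]) :
  (forall i, P i -> cintegrable mu (F i)) ->
  cintegrable mu (fun x => \sum_(i <- s | P i) F i x).
Proof.
move=> iF; elim: s => [|i s ih].
  by split; under eq_fun do rewrite big_nil; exact: integrable0.
under eq_fun do rewrite big_cons; case Pi : (P i) => //.
by apply: cintegrableD => //; exact: iF.
Qed.

Lemma cint_sum (I : Type) (s : seq I) (P : pred I) (F : I -> T -> R[i]) :
  (forall i, P i -> cintegrable mu (F i)) ->
  cint mu (fun x => \sum_(i <- s | P i) F i x) = \sum_(i <- s | P i) cint mu (F i).
Proof.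
move=> iF; elim: s => [|i s ih].
  rewrite big_nil /cint; under eq_Rintegral do rewrite big_nil.
  under [X in (_ +i* X)%C]eq_Rintegral do rewrite big_nil.
  by rewrite /Rintegral integral0.
rewrite big_cons -ih; case: ifPn => Pi; last first.
  by apply: eq_cint => x; rewrite big_cons (negbTE Pi).
rewrite -cintD//; [|exact: iF|exact: cintegrable_sum].
by apply: eq_cint => x; rewrite big_cons Pi.
Qed.

End basics.

Lemma cmeasurable_comp d1 d2 (T1 : measurableType d1) (T2 : measurableType d2)
  (f : T2 -> R[i]) (g : T1 -> T2) : cmeasurable f -> measurable_fun setT g ->
  cmeasurable (fun x => f (g x)).
Proof. by move=> [f1 f2] mg; split; [exact: measurableT_comp f1 mg|exact: measurableT_comp f2 mg]. Qed.

Section product.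
Context d1 d2 (T1 : measurableType d1) (T2 : measurableType d2).
Variables (m1 : {sigma_finite_measure set T1 -> \bar R})
          (m2 : {sigma_finite_measure set T2 -> \bar R}).

Lemma integrable_tensor (f : T1 -> R) (g : T2 -> R) :
  m1.-integrable setT (fun x => (f x)%:E) -> m2.-integrable setT (fun x => (g x)%:E) ->
  (m1 \x m2)%E.-integrable setT (fun z => (f z.1 * g z.2)%:E).
Proof.
move=> fi gi.
have mf : measurable_fun setT f by exact/measurable_EFinP/(measurable_int _ fi).
have mg : measurable_fun setT g by exact/measurable_EFinP/(measurable_int _ gi).
have m12 : measurable_fun setT (fun z : T1 * T2 => (f z.1 * g z.2)%:E).
  apply/measurable_EFinP; apply: measurable_funM.
    exact: (measurableT_comp mf).
  exact: (measurableT_comp mg).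
apply/integrable12ltyP => //.
under eq_integral do under eq_integral do rewrite /= normrM EFinM.
under eq_integral.
  move=> x _; rewrite ge0_integralZl//; last first.
    by apply/measurable_EFinP; exact: measurableT_comp.
  over.
have /integrableP[_ fy] := fi; have /integrableP[_ gy] := gi.
rewrite ge0_integralZr//; last 2 first.
- by apply/measurable_EFinP; exact: measurableT_comp.
- exact: integral_ge0.
by rewrite lte_mul_pinfty// ?ge0_fin_numE//; exact: integral_ge0.
Qed.

Lemma Rintegral_tensor (f : T1 -> R) (g : T2 -> R) :
  m1.-integrable setT (fun x => (f x)%:E) -> m2.-integrable setT (fun x => (g x)%:E) ->
  \int[(m1 \x m2)%E]_z (f z.1 * g z.2) = (\int[m1]_x f x) * (\int[m2]_y g y).
Proof.
move=> fi gi; have fgi := integrable_tensor fi gi.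
rewrite /Rintegral -(integral12_prod_meas1 fgi) /fubini_F /=.
under eq_integral.
  move=> x _; under eq_integral do rewrite EFinM.
  rewrite integralZl//.
  rewrite -[X in (_ * X)%E]fineK; last exact: integrable_fin_num.
  over.
by rewrite integralZr// fineM// ; exact: integrable_fin_num.
Qed.

Lemma cint_tensor (f : T1 -> R[i]) (g : T2 -> R[i]) :
  cintegrable m1 f -> cintegrable m2 g ->
  cint (m1 \x m2)%E (fun z => f z.1 * g z.2) = cint m1 f * cint m2 g.
Proof.
move=> [f1 f2] [g1 g2]; rewrite /cint.
under eq_Rintegral do rewrite cReM.
under [X in (_ +i* X)%C]eq_Rintegral do rewrite cImM.
rewrite (RintegralB measurableT (integrable_tensor f1 g1) (integrable_tensor f2 g2)).
rewrite (RintegralD measurableT (integrable_tensor f1 g2) (integrable_tensor f2 g1)).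
rewrite (Rintegral_tensor f1 g1) (Rintegral_tensor f2 g2).
by rewrite (Rintegral_tensor f1 g2) (Rintegral_tensor f2 g1).
Qed.

End product.

Lemma cint_insert_row n d (k : 'I_n.+1) (f : 'M[R]_(n.+1, d) -> R[i]) :
  cintegrable (@lebmx R n.+1 d) f ->
  cint (@lebmx R n.+1 d) f =
  cint (@lebmx R 1 d \x @lebmx R n d)%E (fun z => f (insert_row k z)).
Proof.
move=> [f1 f2]; have mI := @measurable_insert_row R n d k.
have E (g : 'M[R]_(n.+1, d) -> R) : (@lebmx R n.+1 d).-integrable setT (fun x => (g x)%:E) ->
    \int[@lebmx R n.+1 d]_x g x = \int[(@lebmx R 1 d \x @lebmx R n d)%E]_z g (insert_row k z).
  move=> gi; have mg := measurable_int _ gi.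
  have EP (h : 'M[R]_(n.+1, d) -> \bar R) : (\int[@lebmx R n.+1 d]_x h x =
      \int[pushforward (@lebmx R 1 d \x @lebmx R n d)%E (insert_row k)]_x h x)%E.
    by apply: eq_measure_integral => A mA _; exact: lebmx_insert_row.
  congr fine; rewrite EP integral_pushforward//.
  apply/integrableP; split; first exact: measurableT_comp.
  move/integrableP: gi => [_]; rewrite EP ge0_integral_pushforward//.
  exact: measurableT_comp.
by rewrite /cint !E.
Qed.

End complex_integral.

(** * Determinantal expectations *)

Section determinant_expansion.
Context (R : realType) (d : nat).
Local Notation V := 'rV[R]_d.
Local Notation lam n := (@lebmx R n d).
Variables (lm : R) (K : V -> V -> R[i]) (u : V -> R[i]).
Hypotheses (lm0 : 0 <= lm) (mK : cmeasurable (fun z : V * V => K z.1 z.2)).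
Hypothesis mu : cmeasurable u.

(* The kernel matrix with the diagonal entries of index [>= k] erased; the
   expansion of its determinant restores them one at a time. *)
Definition kernel_mx k n (A : 'M[R]_(n, d)) : 'M[R[i]]_n :=
  \matrix_(i, j) if i == j then (if (i < k)%N then (lm%:C)%C else 0)
                 else K (row i A) (row j A).

Definition kernel_integrand k n (A : 'M[R]_(n, d)) : R[i] :=
  (\prod_i u (row i A)) * \det (kernel_mx k A).

Definition kernel_coeff n k : R[i] := cint (lam n) (@kernel_integrand k n).

Lemma normc_real (x : R) : normc (x%:C)%C = `|x|.
Proof. by rewrite normcE2 /= expr0n addr0 sqrtr_sqr. Qed.

(** The threshold stays [k]: the indices below [k] are kept, and those above it shift down by one
    but remain at least [k], hence erased. *)
Lemma kernel_mx_minor k n (x : V) (A : 'M[R]_(n, d)) (kn : (k < n.+1)%N) :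
  row' (Ordinal kn) (col' (Ordinal kn) (kernel_mx k (insert_row (Ordinal kn) (x, A)))) =
  kernel_mx k A.
Proof.
apply/matrixP => i j; rewrite !mxE (inj_eq (@lift_inj _ (Ordinal kn))).
rewrite !row_insert_row_lift; case: eqP => // _; congr (if _ then _ else _).
by rewrite /= /bump; case: leqP => ki; lia.
Qed.

(** The two matrices differ only in the diagonal entry [k], so expansion along row [k] involves the
    same cofactors; the sign of the diagonal one is [(-1)^(k + k) = 1]. *)
Lemma det_kernel_mxS k n (B : 'M[R]_(n.+1, d)) (kn : (k < n.+1)%N) :
  \det (kernel_mx k.+1 B) = \det (kernel_mx k B) +
    (lm%:C)%C * \det (row' (Ordinal kn) (col' (Ordinal kn) (kernel_mx k B))).
Proof.
have rE : row' (Ordinal kn) (kernel_mx k.+1 B) = row' (Ordinal kn) (kernel_mx k B).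
  apply/matrixP => i j; rewrite !mxE; case: eqP => // _; congr (if _ then _ else _).
  by rewrite /= /bump; case: leqP => ki; lia.
have cE j : cofactor (kernel_mx k.+1 B) (Ordinal kn) j = cofactor (kernel_mx k B) (Ordinal kn) j.
  rewrite /cofactor; congr (_ * \det _); apply/matrixP => a b.
  by move/matrixP/(_ a (lift j b)) : rE; rewrite !mxE.
rewrite !(expand_det_row _ (Ordinal kn)) (bigD1 (Ordinal kn))//= [X in X + _ = _](_ : _ =
  (lm%:C)%C * cofactor (kernel_mx k B) (Ordinal kn) (Ordinal kn)); last first.
  by rewrite cE mxE eqxx /= ltnSn.
rewrite [X in _ = X + _](bigD1 (Ordinal kn))//= [X in _ = X + _ + _](_ : _ = 0); last first.
  by rewrite mxE eqxx /= ltnn mul0r.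
rewrite add0r; apply: (etrans (addrC _ _)); congr (_ + _).
  by apply: eq_bigr => j jk; rewrite cE !mxE eq_sym (negbTE jk).
by rewrite /cofactor -signr_odd addnn odd_double expr0 mul1r.
Qed.

Local Notation w x := (normc (u x)).

Lemma cmeasurable_kernel_rows n (i j : 'I_n) :
  cmeasurable (fun A : 'M[R]_(n, d) => K (row i A) (row j A)).
Proof.
apply: (cmeasurable_comp (f := fun z : V * V => K z.1 z.2) (g := fun A : 'M[R]_(n, d) => (row i A, row j A))) => //.
by apply/measurable_fun_pairP; split; exact: measurable_row.
Qed.

Lemma cmeasurable_kernel_integrand k n : cmeasurable (@kernel_integrand k n).
Proof.
apply: cmeasurableM.
  by apply: cmeasurable_prod => i; apply: cmeasurable_comp => //; exact: measurable_row.
apply: cmeasurable_det => i j; under eq_fun do rewrite mxE.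
case: eqP => _; last exact: cmeasurable_kernel_rows.
exact: cmeasurable_cst.
Qed.

Variables U h : R.
Hypotheses (U0 : 0 <= U) (h0 : 0 <= h).
Hypothesis uU : (\int[lam 1]_x (w x)%:E <= U%:E)%E.
Hypothesis uh : (\int[(lam 1 \x lam 1)%E]_z
  (w z.1 * normc (K z.1 z.2) ^+ 2 * w z.2)%:E <= (h ^+ 2)%:E)%E.

(** Each permutation is bounded along its cycles. A fixed point contributes a trace, [lm * U] if its
    diagonal entry is restored and 0 if it is erased; any other index contributes the
    Hilbert-Schmidt bound [h] of the weighted kernel. *)
Lemma kernel_integrand_bound k n :
  (\int[lam n]_A (normc (@kernel_integrand k n A))%:E <=
   (\sum_(s : 'S_n) \prod_i
      (if s i == i then (if (i < k)%N then lm * U else 0) else h))%:E)%E.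
Proof.
have mw : measurable_fun setT (fun x => w x) := measurable_normc mu.
have w0 x : 0 <= w x := normc_ge0 _.
pose g (s : 'S_n) (i : 'I_n) (z : V * V) : R :=
  if s i == i then (if (i < k)%N then lm * w z.1 else 0)
  else Num.sqrt (w z.1) * normc (K z.1 z.2) * Num.sqrt (w z.2).
have msw : measurable_fun setT (fun x => Num.sqrt (w x)).
  by apply: measurableT_comp => //; apply: continuous_measurable_fun; exact: sqrt_continuous.
have m1 (f : V -> R) : measurable_fun setT f -> measurable_fun setT (fun z : V * V => f z.1).
  by move=> mf; exact: (measurableT_comp mf).
have m2 (f : V -> R) : measurable_fun setT f -> measurable_fun setT (fun z : V * V => f z.2).
  by move=> mf; exact: (measurableT_comp mf).
have kg s i : nonneg_kernel (fun z => (g s i z)%:E).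
  split=> [|z]; rewrite /g.
    apply/measurable_EFinP; case: (s i == i); [case: (i < k)%N => //|].
      by apply: measurable_funM => //; exact: (m1 (fun x => w x)).
    apply: measurable_funM; last exact: (m2 (fun x => Num.sqrt (w x))).
    by apply: measurable_funM; [exact: (m1 (fun x => Num.sqrt (w x)))|exact: measurable_normc].
  rewrite lee_fin; case: ifP => _; [case: ifP => _ //|]; first exact: mulr_ge0.
  by rewrite !mulr_ge0// ?sqrtr_ge0 ?normc_ge0.
have pw A : normc (@kernel_integrand k n A) <= \sum_(s : 'S_n) \prod_i g s i (row i A, row (s i) A).
  rewrite normcM normc_prod; apply: le_trans.
    by apply: ler_wpM2l; [apply: prodr_ge0 => i _|exact: normc_det_le].
  rewrite mulr_sumr; apply: ler_sum => s _; rewrite le_eqVlt; apply/orP; left; apply/eqP.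
  (* Every vertex has one outgoing and one incoming edge, so its weight can be shared as a square
     root between the two. *)
  have -> : \prod_i w (row i A) = \prod_i (Num.sqrt (w (row i A)) * Num.sqrt (w (row (s i) A))).
    rewrite [RHS]big_split /= [X in _ = _ * X](_ : _ = \prod_i Num.sqrt (w (row i A))).
      by rewrite -big_split; apply: eq_bigr => i _ /=; rewrite -expr2 sqr_sqrtr.
    by rewrite [RHS](reindex_inj (@perm_inj _ s)).
  rewrite -big_split; apply: eq_bigr => i _; rewrite /g mxE [i == _]eq_sym /=.
  case: eqP => [->|_]; last by rewrite mulrAC.
  rewrite -expr2 sqr_sqrtr//; case: ifP => _; last by rewrite normc0 mulr0.
  by rewrite normc_real ger0_norm// mulrC.
have gprod s (A : 'M[R]_(n, d)) : ((\prod_i g s i (row i A, row (s i) A))%:E =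
   \prod_(i < n) (g s i (row i A, row (s i) A))%:E)%E by rewrite prodEFin.
have mP s : measurable_fun setT (fun A : 'M[R]_(n, d) => (\prod_(i < n) (g s i (row i A, row (s i) A))%:E)%E).
  by apply: emeasurable_prod => i; apply: (measurable_kernel_rows (F := fun z => (g s i z)%:E)); have [] := kg s i.
have P0 s (A : 'M[R]_(n, d)) : (0 <= \prod_(i < n) (g s i (row i A, row (s i) A))%:E)%E.
  by apply: prode_ge0 => i; have [_] := kg s i; exact.
pose G (A : 'M[R]_(n, d)) := (\sum_(s : 'S_n) \prod_(i < n) (g s i (row i A, row (s i) A))%:E)%E.
apply: (@le_trans _ _ (\int[lam n]_A G A)%E).
  apply: ge0_le_integral => //.
  - by move=> A _; rewrite lee_fin normc_ge0.
  - by apply/measurable_EFinP/measurable_normc; exact: cmeasurable_kernel_integrand.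
  - by apply: emeasurable_sum => s.
  - move=> A _; rewrite /G; under eq_bigr do rewrite -gprod.
    by rewrite sumEFin lee_fin.
rewrite /G ge0_integral_sum//.
rewrite -sumEFin; apply: lee_sum => s _.
apply: (injection_integral_bound (s := s) (F := fun i z => (g s i z)%:E)
  (a := fun i => if s i == i then (if (i < k)%N then lm * U else 0) else h)) => //.
- exact: perm_inj.
- by move=> i; case: ifP => _ //; case: ifP => _ //; exact: mulr_ge0.
move=> i; rewrite /trace_le /hs_le /g; case: (s i == i).
  case: (i < k)%N; last by rewrite integral0.
  under eq_integral do rewrite EFinM.
  rewrite ge0_integralZl//; try by [exact/measurable_EFinP|move=> x _; rewrite lee_fin].
  by rewrite [leRHS]EFinM lee_wpmul2l// lee_fin.
apply: le_trans uh; rewrite le_eqVlt; apply/orP; left; apply/eqP; apply: eq_integral => z _.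
rewrite -EFinM; congr EFin.
rewrite -[w z.1 in RHS](sqr_sqrtr (w0 _)) -[w z.2 in RHS](sqr_sqrtr (w0 _)).
by rewrite !expr2; ring.
Qed.

Lemma cintegrable_kernel k n : cintegrable (lam n) (@kernel_integrand k n).
Proof.
apply: cintegrable_lty; first exact: cmeasurable_kernel_integrand.
exact: le_lt_trans (kernel_integrand_bound k n) (ltry _).
Qed.

Let c : R[i] := (lm%:C)%C * cint (lam 1) u.

(** In the extra term of the determinant identity the point [k] no longer occurs in the minor;
    integrating it out alone gives the factor [c]. *)
Lemma kernel_coeffS n k : (k <= n)%N ->
  kernel_coeff n.+1 k.+1 = kernel_coeff n.+1 k + c * kernel_coeff n k.
Proof.
move=> kn; have kn1 : (k < n.+1)%N by [].
pose E (B : 'M[R]_(n.+1, d)) := kernel_integrand k.+1 B + (-1) * kernel_integrand k B.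
have iE : cintegrable (lam n.+1) E.
  by apply: cintegrableD; [|apply: cintegrableZ]; exact: cintegrable_kernel.
have -> : kernel_coeff n.+1 k.+1 = cint (lam n.+1) (fun B => kernel_integrand k B + E B).
  by apply: eq_cint => B; rewrite /E mulN1r addrC subrK.
rewrite cintD//; last exact: cintegrable_kernel.
congr (_ + _); rewrite (cint_insert_row (Ordinal kn1))//.
have iu : cintegrable (lam 1) u by apply: cintegrable_lty => //; exact: le_lt_trans uU (ltry _).
rewrite /c -cintZ// -[RHS](cint_tensor (cintegrableZ _ iu) (cintegrable_kernel k n)).
apply: eq_cint => -[x A]; rewrite /E /kernel_integrand (det_kernel_mxS _ kn1) kernel_mx_minor /=.
rewrite (bigD1_ord (Ordinal kn1))//= row_insert_row /=.
under eq_bigr do rewrite row_insert_row_lift.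
by ring.
Qed.

(** A recursion of Pascal type. The index [j] counts the restored diagonal entries that are
    selected, each worth [c]; the remaining [n - j] points carry permutations without fixed
    points. *)
Lemma kernel_coeff_binomial k n : (k <= n)%N -> kernel_coeff n k =
  \sum_(j < k.+1) c ^+ j * kernel_coeff (n - j) 0 *+ 'C(k, j).
Proof.
elim: k n => [|k ih] n kn; first by rewrite big_ord1 subn0 expr0 mul1r bin0 mulr1n.
case: n kn => // n kn; rewrite kernel_coeffS// (ih n.+1); last exact: ltnW.
rewrite ih//.
rewrite [in RHS]big_ord_recl /= subn0 bin0 expr0 mul1r mulr1n.
rewrite [X in X + _ = _]big_ord_recl /= subn0 bin0 expr0 mul1r mulr1n -addrA; congr (_ + _).
under [RHS]eq_bigr do rewrite /bump /= add1n subSS binS mulrnDr.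
rewrite big_split /= mulr_sumr; congr (_ + _).
  rewrite [RHS]big_ord_recr /= bin_small// mulr0n addr0.
  by apply: eq_bigr => j _; rewrite /bump /= add1n subSS.
by apply: eq_bigr => j _; rewrite mulrnAr exprS mulrA.
Qed.

Lemma kernel_coeff00 : kernel_coeff 0 0 = 1.
Proof.
rewrite /kernel_coeff (eq_cint _ (g := fun=> 1)); last first.
  by move=> A; rewrite /kernel_integrand big_ord0 det_mx00 mulr1.
have e : fine (lam 0 setT) = 1 by rewrite lebmx0T.
by rewrite /cint /= !Rintegral_cst// e mulr1 mul0r.
Qed.

(** A single point has no permutation without fixed point. This is why the correction to the
    exponential starts at order [h ^+ 2]. *)
Lemma kernel_coeff10 : kernel_coeff 1 0 = 0.
Proof.
rewrite /kernel_coeff (eq_cint _ (g := fun=> 0)); last first.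
  by move=> A; rewrite /kernel_integrand det_mx11 mxE eqxx /= mulr0.
by rewrite /cint /= /Rintegral integral0.
Qed.

(** With the whole diagonal erased, each of the [n!] permutations is bounded by [h ^+ n], or by 0 if
    it has a fixed point. The factorial is cancelled later by the [1 / n!] of the series. *)
Lemma normc_kernel_coeff0 n : normc (kernel_coeff n 0) <= 2 * (n`!%:R * h ^+ n).
Proof.
apply: normc_cint_le; first exact: cmeasurable_kernel_integrand.
apply: (le_trans (kernel_integrand_bound 0 n)); rewrite lee_fin.
apply: (@le_trans _ _ (\sum_(s : 'S_n) h ^+ n)).
  apply: ler_sum => s _; rewrite -[in leRHS](card_ord n) -prodr_const.
  by apply: ler_prod => i _; case: ifP => _; rewrite lexx h0.
by rewrite sumr_const card_Sn mulr_natl.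
Qed.

End determinant_expansion.

(** * The complex exponential and Cauchy products *)

Section complex_exponential.
Context (R : realType).
Implicit Types (b g : nat -> R[i]) (z : R[i]).

Lemma complex_eq z w : complex.Re z = complex.Re w -> complex.Im z = complex.Im w -> z = w.
Proof. by case: z; case: w => a b c e /= -> ->. Qed.

Lemma cvg0_le (f g : nat -> R) : (forall n, 0 <= f n <= g n) ->
  g n @[n --> \oo] --> (0 : R) -> f n @[n --> \oo] --> (0 : R).
Proof.
move=> fg g0; apply: (squeeze_cvgr (f := fun=> 0) (h := g)) => //; last exact: cvg_cst.
by near=> n; exact: fg.
Unshelve. all: by end_near.
Qed.

Definition cexp z : R[i] :=
  (expR (complex.Re z) * cos (complex.Im z) +i* (expR (complex.Re z) * sin (complex.Im z)))%C.

Lemma normc_cexp z : normc (cexp z) = expR (complex.Re z).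
Proof.
rewrite normcE2 /= !exprMn -mulrDr cos2Dsin2 mulr1 sqrtr_sqr ger0_norm// expR_ge0.
Qed.

Definition cauchy_product b g n : R[i] := \sum_(m < n.+1) b m * g (n - m)%N.

(** Once [e] is at most [eps / 4], the recursion gives [v (N + k) <= eps / 2 + v N / 2^k]. It serves
    convolutions of a geometric weight with a null sequence. *)
Lemma cvg_half_recursion (v e : nat -> R) : (forall n, 0 <= v n) ->
  (forall n, v n.+1 <= v n / 2 + e n) -> e n @[n --> \oo] --> (0 : R) ->
  v n @[n --> \oo] --> (0 : R).
Proof.
move=> v0 ve e0; apply/cvgrPdist_le => eps eps0.
have eps4 : 0 < eps / 4 by rewrite divr_gt0.
have /cvgrPdist_le/(_ _ eps4)[N _ Ne] := e0.
have step k : v (N + k)%N <= eps / 2 + v N * 2^-1 ^+ k.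
  elim: k => [|k ih]; first by rewrite addn0 expr0 mulr1 lerDr; lra.
  rewrite addnS; apply: (le_trans (ve _)).
  have := Ne (N + k)%N (leq_addr _ _); rewrite sub0r normrN => /(le_trans (ler_norm _)) h.
  rewrite exprS; set q := 2^-1 ^+ k in ih *; lra.
have : v N * 2^-1 ^+ k @[k --> \oo] --> v N * 0.
  by apply: cvgMr; apply: cvg_expr; rewrite ger0_norm; lra.
rewrite mulr0 => /cvgrPdist_le/(_ _ (divr_gt0 eps0 (ltr0n _ 2)))[M _ Mv].
exists (N + M)%N => //= n Nn; rewrite sub0r normrN ger0_norm//.
have nE : n = (N + (n - N))%N by rewrite /= in Nn; lia.
have := Mv (n - N)%N; rewrite sub0r normrN => /(_ _)/(le_trans (ler_norm _)) h.
have {}h := h _; rewrite nE; apply: (le_trans (step _)).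
have : v N * 2^-1 ^+ (n - N) <= eps / 2 by apply: h; rewrite /= in Nn *; lia.
by move=> ?; lra.
Qed.

(** A form of Mertens' theorem: [b] is geometrically dominated and the series of [g] just converges.
    The series of [b] is kept through its partial sums, so that its limit need not be named. The
    error is at most a convolution [v] of the remainders of [g] with powers of 1/2, which satisfies
    the recursion above. *)
Lemma cauchy_product_cvg b g (C : R) (G : R[i]) :
  (forall m, normc (b m) <= C * 2^-1 ^+ m) ->
  normc (\sum_(n < N) g n - G) @[N --> \oo] --> (0 : R) ->
  normc (\sum_(n < N) cauchy_product b g n - (\sum_(n < N) b n) * G) @[N --> \oo] --> (0 : R).
Proof.
move=> bC gG; have C0 : 0 <= C.
  by have := bC 0%N; rewrite expr0 mulr1; apply: le_trans; exact: normc_ge0.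
pose e k := normc (\sum_(n < k) g n - G).
have SE N : \sum_(n < N) cauchy_product b g n = \sum_(m < N) b m * \sum_(j < N - m) g j.
  elim: N => [|N ih]; first by rewrite !big_ord0.
  rewrite big_ord_recr /= ih /cauchy_product big_ord_recr /= [RHS]big_ord_recr /= subnn addrA.
  rewrite subSnn big_ord1; congr (_ + _).
  rewrite -big_split; apply: eq_bigr => m _ /=; rewrite subSn; last exact: ltnW.
  by rewrite big_ord_recr /= mulrDr.
pose v N := C * \sum_(m < N) 2^-1 ^+ m * e (N - m)%N.
have vS N : v N.+1 = v N / 2 + C * e N.+1.
  rewrite /v big_ord_recl /= expr0 mul1r subn0 mulrDr addrC; congr (_ + _).
  rewrite -mulrA; congr (_ * _); rewrite mulr_suml; apply: eq_bigr => m _.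
  by rewrite /bump /= add1n subSS exprS -mulrA mulrC.
have e0 k : 0 <= e k := normc_ge0 _.
have v0 : v n @[n --> \oo] --> (0 : R).
  apply: (@cvg_half_recursion _ (fun N => C * e N.+1)).
  - by move=> n; rewrite mulr_ge0// sumr_ge0// => i _; rewrite mulr_ge0// exprn_ge0.
  - by move=> n; rewrite vS.
  - rewrite -[X in _ --> X](mulr0 C); apply: cvgMr.
    by have := gG; rewrite -[X in X -> _](cvg_shiftS e).
apply: cvg0_le v0 => N; rewrite normc_ge0 /= SE mulr_suml -sumrB.
apply: (le_trans (normc_sum_le _ _ _)); rewrite /v mulr_sumr; apply: ler_sum => m _.
rewrite -mulrBr normcM mulrA; apply: ler_wpM2r; first exact: normc_ge0.
exact: bC.
Qed.

Definition cexp_coeff z n : R[i] := z ^+ n / (n`!%:R).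

Lemma normc_natr n : normc (n%:R : R[i]) = n%:R.
Proof. by rewrite -(rmorph_nat (@real_complex R)) normcE2 /= expr0n addr0 sqrtr_sqr ger0_norm. Qed.

Lemma normcX z n : normc (z ^+ n) = normc z ^+ n.
Proof. by elim: n => [|n ih]; rewrite ?expr0 ?normc1// !exprS normcM ih. Qed.

Lemma normc_cexp_coeff z n : normc (cexp_coeff z n) = normc z ^+ n / n`!%:R.
Proof.
have f0 : n`!%:R != 0 :> R by rewrite pnatr_eq0 -lt0n fact_gt0.
have f1 : n`!%:R != 0 :> R[i] by rewrite pnatr_eq0 -lt0n fact_gt0.
apply: (mulIf f0); rewrite -normc_natr -normcM normc_natr /cexp_coeff.
by rewrite (divfK f1) normcX divfK.
Qed.

Lemma exp_coeff_le (x : R) n : 0 <= x -> x ^+ n / n`!%:R <= expR (2 * x) * 2^-1 ^+ n.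
Proof.
move=> x0; have h : (2 * x) ^+ n / n`!%:R <= expR (2 * x).
  case: n => [|n]; first by rewrite expr0 mul1r fact0 invr1 -expR0 ler_expR mulr_ge0.
  by apply: le_trans (expR_ge1Dxn n _); [rewrite lerDr|exact: mulr_ge0].
have -> : x ^+ n = (2 * x) ^+ n * 2^-1 ^+ n.
  by rewrite -exprMn [2 * x]mulrC -mulrA divff// mulr1.
by rewrite mulrAC; apply: ler_wpM2r => //; rewrite exprn_ge0.
Qed.

Lemma cexp_coeffD (a b : R) n : cexp_coeff (a +i* b)%C n =
  cauchy_product (cexp_coeff (0 +i* b)%C) (cexp_coeff a%:C%C) n.
Proof.
have -> : (a +i* b)%C = a%:C%C + (0 +i* b)%C.
  by apply: complex_eq; rewrite ?cReD ?cImD /= ?addr0 ?add0r.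
rewrite /cexp_coeff exprDn mulr_suml /cauchy_product; apply: eq_bigr => m _.
have mn : (m <= n)%N by rewrite -ltnS.
have f0 k : k`!%:R != 0 :> R[i] by rewrite pnatr_eq0 -lt0n fact_gt0.
rewrite -(bin_fact mn) !natrM -mulr_natr.
have b0 : 'C(n, m)%:R != 0 :> R[i] by rewrite pnatr_eq0 -lt0n bin_gt0.
have := f0 m; have := f0 (n - m)%N => h1 h2.
by field; rewrite h1 h2 b0.
Qed.

Lemma imag_exp (b : R) n : (0 +i* b)%C ^+ n =
  ((~~ odd n)%:R * (-1) ^+ n./2 * b ^+ n +i* ((odd n)%:R * (-1) ^+ n.-1./2 * b ^+ n))%C.
Proof.
elim: n => [|n ih]; first by rewrite !expr0 /= !mul1r !mul0r.
rewrite exprSr ih {ih} /= negbK uphalf_half exprSr; apply: complex_eq;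
  rewrite ?cReM ?cImM /= !mulr0 ?addr0 ?sub0r;
  case on: (odd n) => /=; rewrite ?mul0r ?mul1r ?sub0r ?add0n ?add1n ?oppr0 ?mulrA//.
have -> : n.-1./2 = n./2 by case: n on => //= n /negbTE; rewrite uphalf_half => ->.
by rewrite exprS mulN1r !mulNr.
Qed.

Lemma cvg_cexp_imag (b : R) :
  normc (\sum_(n < N) cexp_coeff (0 +i* b)%C n - (cos b +i* sin b)%C) @[N --> \oo] --> (0 : R).
Proof.
have SE N : \sum_(n < N) cexp_coeff (0 +i* b)%C n =
    (series (cos_coeff b) N +i* series (sin_coeff b) N)%C.
  elim: N => [|N ih]; first by rewrite big_ord0 !seriesEnat /= !big_geq.
  rewrite big_ord_recr /= ih !seriesEnat /= !big_nat_recr//= /cexp_coeff imag_exp.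
  have -> : (N`!%:R : R[i])^-1 = ((N`!%:R : R)^-1)%:C%C by rewrite fmorphV rmorph_nat.
  apply: complex_eq; rewrite ?cReD ?cImD ?cReM ?cImM /= !mulr0 ?subr0 ?add0r//.
have hc : series (cos_coeff b) n - cos b @[n --> \oo] --> (0 : R).
  rewrite -(subrr (cos b)); apply: cvgB; last exact: cvg_cst.
  by rewrite unlock; exact: is_cvg_series_cos_coeff.
have hs : series (sin_coeff b) n - sin b @[n --> \oo] --> (0 : R).
  rewrite -(subrr (sin b)); apply: cvgB; last exact: cvg_cst.
  by rewrite unlock; exact: is_cvg_series_sin_coeff.
have hcs : `|series (cos_coeff b) n - cos b| + `|series (sin_coeff b) n - sin b| @[n --> \oo] --> (0 : R).
  by rewrite -[X in _ --> X](addr0 0) -{1 2}(@normr0 _ R); apply: cvgD; apply: cvg_norm.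
apply: cvg0_le hcs => N; rewrite normc_ge0 /= SE; apply: (le_trans (normc_le_ReIm _)).
by rewrite cReD cImD.
Qed.

(** The coefficients at [a + i b] are the Cauchy product of those at [i b], summed by the cosine and
    sine series, and those at [a], summed by the real exponential series. *)
Lemma cvg_cexp z : normc (\sum_(n < N) cexp_coeff z n - cexp z) @[N --> \oo] --> (0 : R).
Proof.
case: z => a b.
have ha : normc (\sum_(n < N) cexp_coeff a%:C%C n - (expR a)%:C%C) @[N --> \oo] --> (0 : R).
  have SE N : \sum_(n < N) cexp_coeff a%:C%C n = (series (exp_coeff a) N)%:C%C.
    rewrite seriesEord rmorph_sum; apply: eq_bigr => n _.
    by rewrite /cexp_coeff /exp_coeff /= rmorphM rmorphXn fmorphV rmorph_nat.
  have : `|series (exp_coeff a) n - expR a| @[n --> \oo] --> (0 : R).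
    rewrite -(@normr0 _ R) -(subrr (expR a)); apply: cvg_norm; apply: cvgB; last exact: cvg_cst.
    exact: is_cvg_series_exp_coeff.
  apply: cvg_trans; apply: near_eq_cvg; near=> n.
  by rewrite SE -rmorphB normcE2 /= expr0n addr0 sqrtr_sqr.
have bC m : normc (cexp_coeff (0 +i* b)%C m) <= expR (2 * `|b|) * 2^-1 ^+ m.
  rewrite normc_cexp_coeff normcE2 /= expr0n add0r sqrtr_sqr; exact: exp_coeff_le.
have h1 := cauchy_product_cvg bC ha.
have h2 := cvg_cexp_imag b.
have h3 : normc (\sum_(n < N) cauchy_product (cexp_coeff (0 +i* b)%C) (cexp_coeff a%:C%C) n - \sum_(n < N) cexp_coeff (0 +i* b)%C n * (expR a)%:C%C)
   + normc (\sum_(n < N) cexp_coeff (0 +i* b)%C n - (cos b +i* sin b)%C) * expR a @[N --> \oo] --> (0 : R).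
  rewrite -[X in _ --> X](addr0 0); apply: cvgD; first by under eq_fun do rewrite -mulr_suml.
  by rewrite -[X in _ --> X](mul0r (expR a)); exact: cvgMl h2.
apply: cvg0_le h3 => N; rewrite normc_ge0 /= -mulr_suml.
have eE : expR a = normc (expR a)%:C%C :> R.
  by rewrite normcE2 /= expr0n addr0 sqrtr_sqr ger0_norm// expR_ge0.
rewrite [X in _ + _ * X]eE -normcM.
under eq_bigr do rewrite cexp_coeffD.
have -> : cexp (a +i* b)%C = (cos b +i* sin b)%C * (expR a)%:C%C.
  by apply: complex_eq; rewrite ?cReM ?cImM /= !mulr0 ?subr0 ?add0r mulrC.
apply: le_trans (le_normcD _ _); rewrite le_eqVlt; apply/orP; left; apply/eqP; congr normc.
by rewrite mulrBl addrA subrK.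
Unshelve. all: by end_near.
Qed.

End complex_exponential.

(** * Summation of the determinantal series *)

Section determinant_series.
Context (R : realType) (d : nat).
Local Notation V := 'rV[R]_d.
Local Notation lam n := (@lebmx R n d).
Variables (lm : R) (K : V -> V -> R[i]) (u : V -> R[i]).
Hypotheses (lm0 : 0 <= lm) (mK : cmeasurable (fun z : V * V => K z.1 z.2)).
Hypothesis mu : cmeasurable u.
Variables U h : R.
Hypotheses (U0 : 0 <= U) (h0 : 0 <= h) (h2 : h <= 2^-1).
Hypothesis uU : (\int[lam 1]_x (normc (u x))%:E <= U%:E)%E.
Hypothesis uh : (\int[(lam 1 \x lam 1)%E]_z
  (normc (u z.1) * normc (K z.1 z.2) ^+ 2 * normc (u z.2))%:E <= (h ^+ 2)%:E)%E.

Local Notation coeff := (kernel_coeff lm K u).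
Let c : R[i] := (lm%:C)%C * cint (lam 1) u.
Let a n : R[i] := coeff n n / n`!%:R.
Let b n : R[i] := coeff n 0 / n`!%:R.

Let fact_neq0 n : n`!%:R != 0 :> R[i].
Proof. by rewrite pnatr_eq0 -lt0n fact_gt0. Qed.

(** The binomial expansion with all [n] diagonal entries restored, divided by [n!]: the exponential
    generating series is that of the permutations without fixed points times [exp c]. *)
Let coeff_cauchy n : a n = cauchy_product b (cexp_coeff c) n.
Proof.
rewrite /a (kernel_coeff_binomial lm0 mK mu U0 h0 uU uh)// /cauchy_product.
rewrite (reindex_inj rev_ord_inj) mulr_suml; apply: eq_bigr => m _ /=.
have mn : (m <= n)%N by rewrite -ltnS.
rewrite subSS subKn// /b /cexp_coeff -(bin_fact mn) bin_sub// !natrM -mulr_natr.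
have b0 : 'C(n, m)%:R != 0 :> R[i] by rewrite pnatr_eq0 -lt0n bin_gt0.
have f1 := fact_neq0 m; have f2 := fact_neq0 (n - m).
by field; rewrite f1 f2 b0.
Qed.

Let normc_divf z n : normc (z / n`!%:R : R[i]) = normc z / n`!%:R.
Proof.
have f0 : n`!%:R != 0 :> R by rewrite pnatr_eq0 -lt0n fact_gt0.
by apply: (mulIf f0); rewrite -[in LHS](normc_natr R) -normcM !divfK.
Qed.

Let normc_b n : normc (b n) <= 2 * h ^+ n.
Proof.
rewrite normc_divf ler_pdivrMr ?ltr0n ?fact_gt0// -mulrA [h ^+ n * _]mulrC.
exact: (normc_kernel_coeff0 lm0 mK mu U0 h0 uU uh).
Qed.

Let geometric_tail k N : \sum_(n < N) h ^+ (k + n) <= 2 * h ^+ k.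
Proof.
under eq_bigr do rewrite exprD; rewrite -mulr_sumr mulrC; apply: ler_wpM2r; first exact: exprn_ge0.
have : \sum_(n < N) h ^+ n <= (1 - h ^+ N) * 2.
  elim: N => [|N ih]; first by rewrite big_ord0 expr0 subrr mul0r.
  rewrite big_ord_recr /= exprS; have := exprn_ge0 N h0; move: (h ^+ N) ih => q ih q0.
  by have := ler_wpM2r q0 h2; lra.
by have := exprn_ge0 N h0; lra.
Qed.

(** The partial sums [B] of [b] are [1 + 0] plus a tail of at most [2 h^2 / (1 - h) <= 4 h^2], and
    the partial sums of [a] approach [B * cexp c]. The error is relative to the exponential,
    whatever the size of [c]. *)
Lemma kernel_series_near_exp (L : R[i]) :
  normc (\sum_(n < N) coeff n n / n`!%:R - L) @[N --> \oo] --> (0 : R) ->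
  normc (L - cexp c) <= normc (cexp c) * (4 * h ^+ 2).
Proof.
move=> aL; have bC m : normc (b m) <= 2 * 2^-1 ^+ m.
  by apply: (le_trans (normc_b m)); apply: ler_wpM2l => //; apply: lerXn2r; rewrite ?nnegrE//; lra.
have := cauchy_product_cvg bC (cvg_cexp c).
under eq_fun do under eq_bigr do rewrite -coeff_cauchy.
move=> /(cvgD aL); rewrite addr0 => h3.
apply/ler_addgt0Pr => e e0.
have /cvgrPdist_lt/(_ _ e0)[N _ Ne] := h3.
(* Two terms beyond [N], so that [b 0 = 1] and [b 1 = 0] can be detached from the sum. *)
have := Ne N.+2 (leq_trans (leqnSn _) (leqnSn _)).
rewrite sub0r normrN ger0_norm ?addr_ge0 ?normc_ge0// => lt_e.
have B1 : normc (\sum_(n < N.+2) b n - 1) <= 4 * h ^+ 2.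
  rewrite 2!big_ord_recl /= {1}/b kernel_coeff00 fact0 divr1 {1}/b kernel_coeff10 mul0r add0r.
  rewrite addrC addKr; apply: (le_trans (normc_sum_le _ _ _)).
  apply: (@le_trans _ _ (\sum_(n < N) 2 * h ^+ (2 + n))); first by apply: ler_sum => i _; exact: normc_b.
  by rewrite -mulr_sumr; have := geometric_tail 2 N; lra.
set S := \sum_(n < N.+2) a n in lt_e; set B := \sum_(n < N.+2) b n in lt_e B1.
have -> : L - cexp c = (B - 1) * cexp c + (- (S - L) + (S - B * cexp c)).
  by rewrite /S; ring.
apply: (le_trans (le_normcD _ _)); rewrite normcM; apply: lerD.
  by rewrite mulrC; apply: ler_wpM2l => //; exact: normc_ge0.
by apply: (le_trans (le_normcD _ _)); rewrite normcN; exact: ltW.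
Qed.

(** Absolute summability. Applied with [|u|] in place of [u], it supplies the dominating series for
    the interchange of limit and sum. *)
Lemma kernel_series_bound N :
  \sum_(n < N) normc (coeff n n) / n`!%:R <= 4 * expR (normc c).
Proof.
have e1 n : normc (coeff n n) / n`!%:R <= \sum_(m < n.+1) normc (b m) * normc (cexp_coeff c (n - m)).
  rewrite -normc_divf -/(a n) coeff_cauchy; apply: (le_trans (normc_sum_le _ _ _)).
  by apply: ler_sum => i _; rewrite normcM.
have SE M : \sum_(n < M) \sum_(m < n.+1) normc (b m) * normc (cexp_coeff c (n - m)) =
    \sum_(m < M) normc (b m) * \sum_(j < M - m) normc (cexp_coeff c j).
  elim: M => [|M ih]; first by rewrite !big_ord0.
  rewrite big_ord_recr /= ih big_ord_recr /= [RHS]big_ord_recr /= subnn addrA.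
  rewrite subSnn big_ord1; congr (_ + _).
  rewrite -big_split; apply: eq_bigr => m _ /=; rewrite subSn; last exact: ltnW.
  by rewrite big_ord_recr /= mulrDr.
apply: (@le_trans _ _ (\sum_(m < N) normc (b m) * expR (normc c))).
  apply: (@le_trans _ _ (\sum_(n < N) \sum_(m < n.+1) normc (b m) * normc (cexp_coeff c (n - m)))).
    by apply: ler_sum => i _; exact: e1.
  rewrite SE; apply: ler_sum => m _; apply: ler_wpM2l; first exact: normc_ge0.
  have -> : \sum_(j < N - m) normc (cexp_coeff c j) = series (exp_coeff (normc c)) (N - m)%N.
    by rewrite seriesEord; apply: eq_bigr => j _; rewrite normc_cexp_coeff.
  have nd : nondecreasing_seq (series (exp_coeff (normc c))).
    apply/nondecreasing_seqP => k; rewrite !seriesEord /= big_ord_recr /= lerDl.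
    exact: (exp_coeff_ge0 _ (normc_ge0 c)).
  exact: (nondecreasing_cvgn_le nd (is_cvg_series_exp_coeff (normc c)) (N - m)%N).
rewrite -mulr_suml; apply: ler_wpM2r; first exact: expR_ge0.
apply: (@le_trans _ _ (\sum_(n < N) 2 * h ^+ (0 + n))); first by apply: ler_sum => i _; exact: normc_b.
by rewrite -mulr_sumr; have := geometric_tail 0 N; rewrite expr0; lra.
Qed.

End determinant_series.

(** * Expansion of a finite product over distinct indices *)

Section elementary_symmetric.
Context (R : realType).

(** Factorial moments run over ordered tuples, whereas the product expands over subsets; a subset
    with [k] elements is listed by [k!] tuples without repetition. *)
Lemma prod_add1_uniq_tuples N (v : 'I_N -> R[i]) :
  \prod_n (1 + v n) =
  \sum_(k < N.+1) (\sum_(s : k.-tuple 'I_N | uniq s) \prod_(i < k) v (tnth s i)) / k`!%:R.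
Proof.
have -> : \prod_n (1 + v n) = \sum_(A : {set 'I_N}) \prod_(n in A) v n.
  under eq_bigr do rewrite addrC.
  rewrite (bigA_distr 1 +%R v (fun=> 1)); apply: eq_bigr => A _.
  by rewrite [RHS]big_mkcond.
have cN (A : {set 'I_N}) : (#|A| < N.+1)%N by rewrite ltnS (leq_trans (max_card _))// card_ord.
rewrite (partition_big (fun A : {set 'I_N} => Ordinal (cN A)) xpredT)//=.
apply: eq_bigr => k _.
have f0 : k`!%:R != 0 :> R[i] by rewrite pnatr_eq0 -lt0n fact_gt0.
apply: (mulIf f0); rewrite divfK// mulr_suml.
rewrite [RHS](partition_big (fun s : k.-tuple 'I_N => [set x in s]) (fun A : {set 'I_N} => #|A| == k))/=; last first.
  by move=> s us; rewrite cardsE (card_uniqP us) size_tuple.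
apply: eq_big => [A|A /eqP[Ak]]; first by rewrite -(inj_eq val_inj).
have Ak' : #|A| = k by rewrite -Ak.
rewrite [RHS](eq_bigr (fun _ => \prod_(n in A) v n)); last first.
  move=> s /andP[us /eqP <-]; rewrite -(big_tuple _ _ s xpredT v) big_uniq//=.
  by apply: eq_bigl => x; rewrite inE.
rewrite [RHS](eq_bigl (fun s : k.-tuple 'I_N => s \in [set t : k.-tuple 'I_N | all (mem A) t & uniq t])); last first.
  move=> s; rewrite inE; case us : (uniq s) => /=; last by rewrite andbF.
  rewrite andbT eqEcard cardsE (card_uniqP us) size_tuple Ak' leqnn andbT.
  apply/idP/idP => [/fintype.subsetP h|/allP h].
    by apply/allP => x xs; apply: h; rewrite inE.
  by apply/fintype.subsetP => x; rewrite inE => /h.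
by rewrite sumr_const (card_uniq_tuples k (mem A)) Ak' ffactnn mulr_natr.
Qed.

End elementary_symmetric.

(** * Campbell's formula for the factorial moment measures *)

Section campbell.
Context (R : realType) (d : nat).
Context (dO : measure_display) (Omega : measurableType dO).
Variables (P : probability Omega R) (X : nat -> Omega -> 'rV[R]_d).
Hypothesis mX : forall n, measurable_fun setT (X n).

Definition point_mx k (s : k.-tuple nat) (w : Omega) : 'M[R]_(k, d) :=
  \matrix_(i < k, j < d) X (tnth s i) w 0 j.

Lemma row_point_mx k (s : k.-tuple nat) w i : row i (point_mx s w) = X (tnth s i) w.
Proof. by apply/rowP => j; rewrite !mxE. Qed.

Lemma measurable_point_mx k (s : k.-tuple nat) : measurable_fun setT (point_mx s).
Proof.
apply: measurable_mx => i j; under eq_fun do rewrite mxE.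
exact: (measurableT_comp (measurable_mx_entry _ _) (mX _)).
Qed.

(** The tuples with entries below [N] form finite sets that increase with [N] and exhaust all
    tuples. They are the ones produced by a product over the first [N] points. *)
Lemma esum_uniq_tuples_cvg k (g : k.-tuple nat -> \bar R) : (forall s, (0 <= g s)%E) ->
  (forall N, (\sum_(s : k.-tuple 'I_N | uniq s) g (map_tuple (@nat_of_ord N) s) <=
     \esum_(s in [set s : k.-tuple nat | uniq s]) g s)%E) /\
  (\sum_(s : k.-tuple 'I_N | uniq s) g (map_tuple (@nat_of_ord N) s))%E @[N --> \oo] -->
  (\esum_(s in [set s : k.-tuple nat | uniq s]) g s)%E.
Proof.
move=> g0.
pose r N : seq (k.-tuple nat) :=
  [seq map_tuple (@nat_of_ord N) s | s : k.-tuple 'I_N in [pred s : k.-tuple 'I_N | uniq s]].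
have ur N : uniq (r N).
  rewrite map_inj_uniq ?enum_uniq// => s t /(congr1 val) /= /inj_map st.
  by apply: val_inj; apply: st; exact: val_inj.
have rP N s : (s \in r N) = uniq s && all (fun n => n < N)%N s.
  apply/mapP/andP => [[t]|[us /allP sN]].
    rewrite mem_enum inE => ut -> /=; rewrite map_inj_uniq; last exact: val_inj.
    by split=> //; apply/allP => x /mapP[y _ ->].
  have {}sN x : x \in tval s -> (x < N)%N := sN x.
  (* [inord] needs a nonempty ordinal type; for [N = 0] only the empty tuple is left. *)
  have [N0|N0] := posnP N.
    subst N; have s0 : tval s = [::].
      by case: (tval s) sN => // x l /(_ x); rewrite mem_head => /(_ isT).
    have k0 : k = 0%N by rewrite -(size_tuple s) s0.
    subst k; exists [tuple]; first by rewrite mem_enum.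
    by apply: val_inj; rewrite /= s0.
  case: N N0 sN => // N _ sN.
  exists (map_tuple (fun n => inord n : 'I_N.+1) s).
    rewrite mem_enum inE /= map_inj_in_uniq// => x y xs ys /(congr1 val) /=.
    by rewrite !inordK ?sN.
  apply: val_inj => /=; rewrite -map_comp -[LHS]map_id; apply/eq_in_map => x xs /=.
  by rewrite inordK ?sN.
have SE N : (\sum_(s : k.-tuple 'I_N | uniq s) g (map_tuple (@nat_of_ord N) s) =
    \sum_(s \in [set` r N]) g s)%E.
  rewrite -(fsbig_seq _ _ (ur N)) /r big_map big_enum /=.
  by apply: eq_bigl => s; rewrite inE.
have -> : (fun N => (\sum_(s : k.-tuple 'I_N | uniq s) g (map_tuple (@nat_of_ord N) s))%E) =
    (fun N => (\sum_(s \in [set` r N]) g s)%E) by exact/funext.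
have fr N : finite_set [set` r N] by exact: finite_seq.
have nd : nondecreasing_seq (fun N => (\sum_(s \in [set` r N]) g s)%E).
  move=> m n mn; apply: lee_fsum_nneg_subset => //.
  move=> s; rewrite !inE /= !rP => /andP[-> /allP h] /=.
  by apply/allP => x /h; move/leq_trans; apply.
have -> : (\esum_(s in [set s : k.-tuple nat | uniq s]) g s)%E =
    ereal_sup (range (fun N => (\sum_(s \in [set` r N]) g s)%E)).
  apply/eqP; rewrite eq_le; apply/andP; split.
    apply: ge_ereal_sup => _ [A [fA Au] <-].
    have /finite_seqP[l lA] := fA.
    (* One more than every entry of the finitely many tuples of [A]. *)
    pose N := (\max_(s <- l) \max_(x <- s) x).+1.
    apply: (@le_trans _ _ (\sum_(s \in [set` r N]) g s)%E); last first.
      by apply: ereal_sup_ubound; exists N.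
    apply: lee_fsum_nneg_subset => // s; rewrite !inE /= rP => As.
    rewrite (Au _ As); apply/allP => x xs; rewrite ltnS.
    have sl : (\max_(y <- s) y <= \max_(t <- l) \max_(y <- t) y)%N.
      by apply: (leq_bigmax_seq (F := fun t : k.-tuple nat => \max_(y <- t) y)) => //; move: As; rewrite lA.
    by apply: leq_trans sl; exact: (leq_bigmax_seq (F := id)).
  apply: ge_ereal_sup => _ [N _ <-]; apply: esum_ge; exists [set` r N] => //.
  by split=> // s /=; rewrite rP => /andP[].
split; last exact: ereal_nondecreasing_cvgn.
by move=> N; rewrite SE; apply: ereal_sup_ubound; exists N.
Qed.

(** Turns the sum over tuples into a series over codes, the format of countable sums of measures.
    The strict inverse [pickle_inv] returns nothing on integers that are not codes, so no tuple is
    counted twice. *)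
Lemma esum_uniq_tuples_nneseries k (g : k.-tuple nat -> \bar R) : (forall s, (0 <= g s)%E) ->
  (\esum_(s in [set s : k.-tuple nat | uniq s]) g s =
   \sum_(0 <= j <oo) (if (pickle_inv j : option (k.-tuple nat)) is Some s then if uniq s then g s else 0 else 0))%E.
Proof.
move=> g0.
pose a j : \bar R :=
  (if (pickle_inv j : option (k.-tuple nat)) is Some s then if uniq s then g s else 0 else 0)%E.
rewrite -[RHS]/(\sum_(0 <= j <oo) a j)%E nneseries_esumT; last first.
  by move=> n; rewrite /a; case: pickle_inv => // s; case: ifP.
rewrite [RHS](_ : _ = (\esum_(j in pickle @` [set s : k.-tuple nat | uniq s]) a j)%E); last first.
  rewrite [RHS]esum_mkcond; apply: eq_esum => j _; case: ifPn => //.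
  rewrite notin_setE /= /a => nj.
  move: (pickle_invK j : oapp pickle j (pickle_inv j : option (k.-tuple nat)) = j).
  case: (pickle_inv j : option (k.-tuple nat)) => [s|]//= sj; case: ifP => // us.
  by exfalso; apply: nj; exists s.
rewrite (reindex_esum [set s : k.-tuple nat | uniq s] _ pickle); last first.
  split; first by move=> s us; exists s.
  - by move=> s t _ _; exact: (pcan_inj pickleK_inv).
  - by move=> j [s us <-]; exists s.
by apply: eq_esum => s us; rewrite /a pickleK_inv us.
Qed.

(** The law of the points indexed by the tuple of code [j]; the series of these measures is the
    factorial moment measure. *)
Let term k j : {measure set 'M[R]_(k, d) -> \bar R} :=
  if (pickle_inv j : option (k.-tuple nat)) is Some s then
    if uniq s then mpushforward P (@measurable_point_mx k s) else mzero
  else mzero.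

Variables (k : nat) (rho : 'M[R]_(k, d) -> R).
Hypothesis Xrho : product_density P X rho.

(** The product density gives the factorial moments of sets, i.e. says that the series of the
    measures [term] has density [rho]; integration against a density and against a series of
    measures extends this to functions. *)
Lemma campbell_ge0 (F : 'M[R]_(k, d) -> \bar R) : measurable_fun setT F ->
  (forall A, (0 <= F A)%E) ->
  (\esum_(s in [set s : k.-tuple nat | uniq s]) \int[P]_w F (point_mx s w) =
   \int[@lebmx R k d]_A (F A * (rho A)%:E))%E.
Proof.
move=> mF F0; have [mrho rho0 Xr] := Xrho.
have mserE B : measurable B -> mseries (@term k) 0 B = (\int[@lebmx R k d]_(x in B) (rho x)%:E)%E.
  move=> mB; rewrite -[RHS]/(\int[@lebesgue_mx R k d]_(x in B) (rho x)%:E)%E -Xr// /factorial_moment.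
  pose ind (s : k.-tuple nat) w : \bar R := (\1_B (point_mx s w))%:E.
  have mind s : measurable_fun setT (ind s).
    apply/measurable_EFinP; apply: measurableT_comp; first exact: measurable_indic.
    exact: measurable_point_mx.
  have ind0 w s : (0 <= ind s w)%E by rewrite lee_fin.
  have E w := esum_uniq_tuples_nneseries (ind0 w).
  under [RHS]eq_integral do rewrite E.
  rewrite integral_nneseries//; last 2 first.
  - by move=> j; case: pickle_inv => // s; case: (uniq s).
  - by move=> j w _; case: pickle_inv => // s; case: ifP => // _; rewrite lee_fin.
  rewrite /mseries; apply: eq_eseriesr => j _; rewrite /term.
  case: pickle_inv => [s|]; last by rewrite integral0.
  case: (uniq s); last by rewrite integral0.
  rewrite -[RHS]/(\int[P]_w (\1_(point_mx s @^-1` B) w)%:E)%E integral_indic ?setIT//.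
  by rewrite -[X in measurable X]setTI; exact: measurable_point_mx.
rewrite -(ge0_integral_density mrho rho0 mserE)// ge0_integral_measure_series//.
rewrite esum_uniq_tuples_nneseries; last by move=> s; exact: integral_ge0.
apply: eq_eseriesr => j _; rewrite /term.
case: pickle_inv => [s|]; last by rewrite integral_measure_zero.
case: (uniq s); last by rewrite integral_measure_zero.
by rewrite ge0_integral_pushforward//; exact: measurable_point_mx.
Qed.

Lemma campbell_ge0_cvg (G : 'M[R]_(k, d) -> R) : measurable_fun setT G -> (forall A, 0 <= G A) ->
  (\int[@lebmx R k d]_A (G A * rho A)%:E < +oo)%E ->
  [/\ forall s : k.-tuple nat, uniq s -> P.-integrable setT (fun w => (G (point_mx s w))%:E),
    (forall N, \sum_(s : k.-tuple 'I_N | uniq s)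
        \int[P]_w G (point_mx (map_tuple (@nat_of_ord N) s) w) <= \int[@lebmx R k d]_A (G A * rho A)) &
    \sum_(s : k.-tuple 'I_N | uniq s) \int[P]_w G (point_mx (map_tuple (@nat_of_ord N) s) w)
      @[N --> \oo] --> \int[@lebmx R k d]_A (G A * rho A)].
Proof.
have [mrho rho0 Xr] := Xrho.
move=> mG G0 Gy.
have mEG : measurable_fun setT (fun A => (G A)%:E) by exact/measurable_EFinP.
have C : (\esum_(s in [set s : k.-tuple nat | uniq s]) \int[P]_w (G (point_mx s w))%:E =
    \int[@lebmx R k d]_A (G A * rho A)%:E)%E.
  by rewrite (campbell_ge0 mEG)//; under [RHS]eq_integral do rewrite EFinM.
have i0 (s : k.-tuple nat) : (0 <= \int[P]_w (G (point_mx s w))%:E)%E by apply: integral_ge0 => w _; rewrite lee_fin.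
have sint (s : k.-tuple nat) : uniq s -> P.-integrable setT (fun w => (G (point_mx s w))%:E).
  move=> us; apply/integrableP; split.
    by apply/measurable_EFinP; apply: measurableT_comp => //; exact: measurable_point_mx.
  under eq_integral do rewrite gee0_abs ?lee_fin//.
  apply: le_lt_trans Gy; rewrite -C; apply: esum_ge; exists [set s].
    by split=> // t ->.
  by rewrite fsbig_set1.
have SE N : (\sum_(s : k.-tuple 'I_N | uniq s)
    \int[P]_w (G (point_mx (map_tuple (@nat_of_ord N) s) w))%:E)%E =
    (\sum_(s : k.-tuple 'I_N | uniq s) \int[P]_w G (point_mx (map_tuple (@nat_of_ord N) s) w))%:E.
  rewrite (eq_bigr (fun s => (\int[P]_w G (point_mx (map_tuple (@nat_of_ord N) s) w))%:E)).
    by rewrite sumEFin.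
  move=> s us; rewrite /Rintegral fineK//; apply: integrable_fin_num => //; apply: sint.
  by rewrite /= map_inj_uniq//; exact: val_inj.
have IE : (\int[@lebmx R k d]_A (G A * rho A))%:E = (\int[@lebmx R k d]_A (G A * rho A)%:E)%E.
  rewrite /Rintegral fineK// ge0_fin_numE//; apply: integral_ge0 => A _.
  by rewrite lee_fin mulr_ge0.
have [le_es cvg_es] := esum_uniq_tuples_cvg i0.
split=> // [N|].
  by rewrite -lee_fin IE -SE -C; exact: le_es.
have /fine_cvgP[_] : (\sum_(s : k.-tuple 'I_N | uniq s) \int[P]_w (G (point_mx (map_tuple (@nat_of_ord N) s) w))%:E)%E
    @[N --> \oo] --> (\int[@lebmx R k d]_A (G A * rho A))%:E by rewrite IE -C.
apply: cvg_trans; apply: near_eq_cvg; near=> N => /=.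
by rewrite SE.
Unshelve. all: by end_near.
Qed.

(** The nonnegative case is applied to [|F| + F] and to [|F|], and the two limits are subtracted. *)
Lemma campbell_cvg (F : 'M[R]_(k, d) -> R) : measurable_fun setT F ->
  (\int[@lebmx R k d]_A (`|F A| * rho A)%:E < +oo)%E ->
  \sum_(s : k.-tuple 'I_N | uniq s) \int[P]_w F (point_mx (map_tuple (@nat_of_ord N) s) w)
    @[N --> \oo] --> \int[@lebmx R k d]_A (F A * rho A).
Proof.
move=> mF Fy; have [mrho rho0 Xr] := Xrho.
have mn : measurable_fun setT (fun A => `|F A|) by exact: measurableT_comp.
have mr (G : 'M[R]_(k, d) -> R) : measurable_fun setT G ->
    measurable_fun setT (fun A => (G A * rho A)%:E).
  by move=> mG; apply/measurable_EFinP; exact: measurable_funM.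
have [i1 _ c1] := campbell_ge0_cvg mn (fun A => normr_ge0 _) Fy.
have Fn A : 0 <= `|F A| + F A by rewrite -[F A in X in _ + X]opprK subr_ge0 -normrN ler_norm.
have i1r : (@lebmx R k d).-integrable setT (fun A => (`|F A| * rho A)%:E).
  apply/integrableP; split; first exact: mr.
  by under eq_integral do rewrite gee0_abs ?lee_fin ?mulr_ge0//.
have iFr : (@lebmx R k d).-integrable setT (fun A => (F A * rho A)%:E).
  apply: le_integrable_R i1r; first exact: measurable_funM.
  by move=> A; rewrite normrM (ger0_norm (rho0 _)).
have [|i2 _ c2] := campbell_ge0_cvg (measurable_funD mn mF) Fn.
  under eq_integral do rewrite mulrDl EFinD.
  have /integrableP[_] := integrableD measurableT i1r iFr; apply: le_lt_trans.
  apply: ge0_le_integral => //.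
  - by move=> A _; rewrite -EFinD lee_fin -mulrDl mulr_ge0.
  - by apply: emeasurable_funD; exact: mr.
  - by apply: measurableT_comp => //; apply: emeasurable_funD; exact: mr.
  - by move=> A _; exact: lee_abs.
move: c1 => /(cvgB c2).
have -> : \int[@lebmx R k d]_A ((`|F A| + F A) * rho A) - \int[@lebmx R k d]_A (`|F A| * rho A) =
    \int[@lebmx R k d]_A (F A * rho A).
  under eq_Rintegral do rewrite mulrDl.
  by rewrite RintegralD// addrAC subrr add0r.
apply: cvg_trans; apply: near_eq_cvg; near=> N => /=.
rewrite !fctE -sumrB; apply: eq_bigr => s us.
have us' : uniq (map_tuple (@nat_of_ord N) s) by rewrite map_inj_uniq//; exact: val_inj.
have iF : P.-integrable setT (fun w => (F (point_mx (map_tuple (@nat_of_ord N) s) w))%:E).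
  apply: le_integrable_R (i1 _ us') => //.
  by apply: measurableT_comp => //; exact: measurable_point_mx.
by rewrite RintegralD//; [rewrite addrAC subrr add0r|exact: i1].
Unshelve. all: by end_near.
Qed.

End campbell.

(** * Interchange of a limit and a series *)

Section tannery.
Context (R : realType).

(** Here the limit [L] of the sums is known beforehand, and what is derived is that the series of
    termwise limits converges to it. For each [M] the error is at most the tail of [b] beyond [M],
    up to a quantity vanishing with [N]. *)
Lemma tannery (E : nat -> R[i]) (t : nat -> nat -> R[i]) (a : nat -> R[i]) (b : nat -> R)
    (B : R) (L : R[i]) :
  (forall N, E N = \sum_(k < N.+1) t N k) ->
  (forall N k, normc (t N k) <= b k) -> (forall N, \sum_(k < N) b k <= B) ->
  (forall k, normc (t N k - a k) @[N --> \oo] --> (0 : R)) ->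
  normc (E N - L) @[N --> \oo] --> (0 : R) ->
  normc (\sum_(k < M) a k - L) @[M --> \oo] --> (0 : R).
Proof.
move=> Et tb bB ta EL.
have b0 k : 0 <= b k by apply: le_trans (tb 0%N k); exact: normc_ge0.
pose s M := \sum_(k < M) b k.
have nds : nondecreasing_seq s.
  by apply/nondecreasing_seqP => n; rewrite /s big_ord_recr /= lerDl.
have ubs : has_ubound (range s) by exists B => _ [n _ <-]; exact: bB.
have cs := nondecreasing_cvgn nds ubs.
set A := sup _ in cs.
have sA n : s n <= A by apply: ub_le_sup => //; exists n.
apply: (@cvg0_le _ _ (fun M => A - s M)); last first.
  by rewrite -(subrr A); apply: cvgB => //; exact: cvg_cst.
move=> M; rewrite normc_ge0 /=; apply/ler_addgt0Pr => e e0.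
have v0 : \sum_(k < M) normc (t N k - a k) + normc (E N - L) @[N --> \oo] --> (0 : R).
  rewrite -[X in _ --> X](addr0 0); apply: cvgD => //.
  elim: M => [|M ih]; first by under eq_fun do rewrite big_ord0; exact: cvg_cst.
  move: (ta M) => /(cvgD ih); rewrite addr0.
  by apply: cvg_trans; apply: near_eq_cvg; near=> N; rewrite big_ord_recr.
have /cvgrPdist_lt/(_ _ e0)[N0 _ Ne] := v0.
pose N := maxn N0 M.
have := Ne N (leq_maxl _ _).
rewrite sub0r normrN ger0_norm ?addr_ge0 ?normc_ge0 ?sumr_ge0// => [lt_e|k _]; last exact: normc_ge0.
have MN : (M <= N.+1)%N by rewrite leqW// leq_maxr.
have split_sum (V : nmodType) (f : nat -> V) :
    \sum_(k < N.+1) f k = \sum_(k < M) f k + \sum_(M <= k < N.+1) f k.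
  by rewrite -!(big_mkord xpredT f) (@big_cat_nat _ _ _ M).
have tail : normc (\sum_(M <= k < N.+1) t N k) <= A - s M.
  apply: (@le_trans _ _ (s N.+1 - s M)); last by rewrite lerD2r.
  rewrite /s (split_sum _ b) addrAC subrr add0r.
  by apply: (le_trans (normc_sum_le _ _ _)); apply: ler_sum.
have -> : \sum_(k < M) a k - L =
    - \sum_(k < M) (t N k - a k) + ((E N - L) - \sum_(M <= k < N.+1) t N k).
  by rewrite Et (split_sum _ (t N)) sumrB; ring.
apply: (le_trans (le_normcD _ _)); rewrite normcN.
have h1 := le_normcD (E N - L) (- \sum_(M <= k < N.+1) t N k).
rewrite normcN in h1.
have h2 := normc_sum_le (index_enum 'I_M) xpredT (fun k => t N k - a k).
lra.
Unshelve. all: by end_near.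
Qed.

End tannery.

(** * Expectations of products over the points of a determinantal process *)

Section determinantal_products.
Context (R : realType) (d : nat).
Context (dO : measure_display) (Omega : measurableType dO).
Local Notation V := 'rV[R]_d.
Local Notation lam n := (@lebmx R n d).
Variables (P : probability Omega R) (X : nat -> Omega -> V).
Hypothesis mX : forall n, measurable_fun setT (X n).
Variables (lm : R) (K : V -> V -> R[i]) (u : V -> R[i]).
Hypotheses (lm0 : 0 <= lm) (mK : cmeasurable (fun z : V * V => K z.1 z.2)).
Hypotheses (KX : determinantal P X K) (Kdiag : forall x, K x x = (lm%:C)%C).
Hypothesis mu : cmeasurable u.
Variables U h : R.
Hypotheses (U0 : 0 <= U) (h0 : 0 <= h) (h2 : h <= 2^-1).
Hypothesis uU : (\int[lam 1]_x (normc (u x))%:E <= U%:E)%E.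
Hypothesis uh : (\int[(lam 1 \x lam 1)%E]_z
  (normc (u z.1) * normc (K z.1 z.2) ^+ 2 * normc (u z.2))%:E <= (h ^+ 2)%:E)%E.

(** [|u|] regarded as complex, so that the expansion also applies to it; its coefficients, integrals
    of [|u|] products against the densities, dominate those of [u]. *)
Let w x : R[i] := ((normc (u x))%:C)%C.

Let normc_w x : normc (w x) = normc (u x).
Proof. by rewrite normc_real ger0_norm// normc_ge0. Qed.

Let mw : cmeasurable w.
Proof. by split=> /=; [exact: measurable_normc|exact: measurable_cst]. Qed.

Let wU : (\int[lam 1]_x (normc (w x))%:E <= U%:E)%E.
Proof. by under eq_integral do rewrite normc_w. Qed.

Let wh : (\int[(lam 1 \x lam 1)%E]_z
  (normc (w z.1) * normc (K z.1 z.2) ^+ 2 * normc (w z.2))%:E <= (h ^+ 2)%:E)%E.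
Proof. by under eq_integral do rewrite !normc_w. Qed.

Let alpha k : R := complex.Re (kernel_coeff lm K w k k).

Let prodn k (A : 'M[R]_(k, d)) : R := \prod_i normc (u (row i A)).
Let produ k (A : 'M[R]_(k, d)) : R[i] := \prod_i u (row i A).

Let normc_produ k (A : 'M[R]_(k, d)) : normc (produ A) = prodn A.
Proof. exact: normc_prod. Qed.

Let mprodu k : cmeasurable (@produ k).
Proof. by apply: cmeasurable_prod => i; apply: cmeasurable_comp => //; exact: measurable_row. Qed.

Let mprodn k : measurable_fun setT (@prodn k).
Proof.
rewrite (_ : @prodn k = fun A => normc (produ A)); first exact: measurable_normc.
by apply/funext => A; rewrite normc_produ.
Qed.

Let prodn_ge0 k (A : 'M[R]_(k, d)) : 0 <= prodn A.
Proof. by apply: prodr_ge0 => i _; exact: normc_ge0. Qed.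

Section fixed_order.
Variables (k : nat) (k0 : (0 < k)%N).

(** At threshold [k] all diagonal entries of a matrix of size [k] are restored, and they equal
    [K x x], so the matrix is that of the kernel. *)
Let rho_exists : exists rho : 'M[R]_(k, d) -> R, product_density P X rho /\
  forall A, ((rho A)%:C)%C = \det (kernel_mx lm K k A).
Proof.
have [rho [Xr rE]] := KX k0; exists rho; split=> // A; rewrite rE; congr (\det _).
apply/matrixP => i j; rewrite !mxE; case: eqP => [->|//].
by rewrite Kdiag ltn_ord.
Qed.

Let alphaE (rho : 'M[R]_(k, d) -> R) : (forall A, ((rho A)%:C)%C = \det (kernel_mx lm K k A)) ->
  alpha k = \int[lam k]_A (prodn A * rho A).
Proof.
move=> rE; rewrite /alpha /kernel_coeff /cint /=; apply: eq_Rintegral => A _.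
by rewrite /kernel_integrand -rE /w -rmorph_prod -rmorphM.
Qed.

Let alpha_lty (rho : 'M[R]_(k, d) -> R) : product_density P X rho ->
  (forall A, ((rho A)%:C)%C = \det (kernel_mx lm K k A)) ->
  (\int[lam k]_A (prodn A * rho A)%:E < +oo)%E.
Proof.
move=> [_ rho0 _] rE; apply: (le_lt_trans _ (ltry _)).
apply: (le_trans _ (kernel_integrand_bound lm0 mK mw U0 h0 wU wh k k)).
rewrite le_eqVlt; apply/orP; left; apply/eqP; apply: eq_integral => A _; congr EFin.
rewrite /kernel_integrand -rE normcM normc_prod normc_real ger0_norm//; congr (_ * _).
by apply: eq_bigr => i _; rewrite normc_w.
Qed.

Let idx N (s : k.-tuple 'I_N) : k.-tuple nat := map_tuple (@nat_of_ord N) s.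
Let uX (s : k.-tuple nat) (w : Omega) : R[i] := produ (point_mx X s w).

Lemma point_product_cvg :
  normc (\sum_(s : k.-tuple 'I_N | uniq s) cint P (uX (idx s)) - kernel_coeff lm K u k k)
    @[N --> \oo] --> (0 : R).
Proof.
have [rho [Xr rE]] := rho_exists; have [mrho rho0 _] := Xr.
have fin (F : 'M[R]_(k, d) -> R) : measurable_fun setT F -> (forall A, `|F A| <= prodn A) ->
    (\int[lam k]_A (`|F A| * rho A)%:E < +oo)%E.
  move=> mF Fp; apply: le_lt_trans (alpha_lty Xr rE); apply: ge0_le_integral => //.
  - by move=> A _; rewrite lee_fin mulr_ge0.
  - by apply/measurable_EFinP; apply: measurable_funM => //; exact: measurableT_comp.
  - by apply/measurable_EFinP; apply: measurable_funM => //; exact: mprodn.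
  - by move=> A _; rewrite lee_fin; exact: ler_wpM2r.
have [m1 m2] := @mprodu k.
have bRe (A : 'M[R]_(k, d)) : `|complex.Re (produ A)| <= prodn A by rewrite -(@normc_produ k); exact: normr_Re_le.
have bIm (A : 'M[R]_(k, d)) : `|complex.Im (produ A)| <= prodn A by rewrite -(@normc_produ k); exact: normr_Im_le.
have c1 := campbell_cvg mX Xr m1 (fin _ m1 bRe).
have c2 := campbell_cvg mX Xr m2 (fin _ m2 bIm).
have d0 (f : nat -> R) (l : R) : f N @[N --> \oo] --> l -> `|f N - l| @[N --> \oo] --> (0 : R).
  by move=> fl; rewrite -(@normr0 _ R) -(subrr l); apply: cvg_norm; apply: cvgB => //; exact: cvg_cst.
move: (d0 _ _ c2) => /(cvgD (d0 _ _ c1)); rewrite addr0; apply: cvg0_le => N.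
rewrite normc_ge0 /=; apply: (le_trans (normc_le_ReIm _)).
have -> : kernel_coeff lm K u k k =
    (\int[lam k]_A (complex.Re (produ A) * rho A) +i* \int[lam k]_A (complex.Im (produ A) * rho A))%C.
  apply: complex_eq; rewrite /kernel_coeff /cint /=; apply: eq_Rintegral => A _.
    by rewrite /kernel_integrand -rE cReM mulr0 subr0.
  by rewrite /kernel_integrand -rE cImM mulr0 add0r.
by rewrite !raddfB /= !raddf_sum.
Qed.

Lemma alpha_ge0 : 0 <= alpha k.
Proof.
have [rho [Xr rE]] := rho_exists; have [mrho rho0 _] := Xr.
by rewrite (alphaE rE); apply: Rintegral_ge0 => A _; rewrite mulr_ge0.
Qed.

Lemma point_product_bound N :
  (forall s : k.-tuple 'I_N, uniq s -> cintegrable P (uX (idx s))) /\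
  \sum_(s : k.-tuple 'I_N | uniq s) normc (cint P (uX (idx s))) <= 2 * alpha k.
Proof.
have [rho [Xr rE]] := rho_exists; have [mrho rho0 _] := Xr.
have [ip bp _] := campbell_ge0_cvg mX Xr (@mprodn k) (@prodn_ge0 k) (alpha_lty Xr rE).
have mi (s : k.-tuple nat) : cmeasurable (uX s).
  by apply: cmeasurable_comp; [exact: mprodu|exact: measurable_point_mx].
have ni (s : k.-tuple nat) : uniq s -> cintegrable P (uX s) /\
    normc (cint P (uX s)) <= 2 * \int[P]_w prodn (point_mx X s w).
  move=> us; have /integrableP[_ fy] := ip _ us.
  have E : (\int[P]_w (normc (uX s w))%:E = (\int[P]_w prodn (point_mx X s w))%:E)%E.
    rewrite /Rintegral fineK; last exact: integrable_fin_num (ip _ us).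
    by apply: eq_integral => w' _; rewrite /uX normc_produ.
  split; first by apply: cintegrable_lty => //; rewrite E ltry.
  by apply: normc_cint_le => //; rewrite E.
have us (s : k.-tuple 'I_N) : uniq s -> uniq (idx s).
  by move=> us; rewrite /= map_inj_uniq//; exact: val_inj.
split=> [s /us /ni[]//|].
apply: (@le_trans _ _ (\sum_(s : k.-tuple 'I_N | uniq s) 2 * \int[P]_w prodn (point_mx X (idx s) w))).
  by apply: ler_sum => s /us /ni[].
by rewrite -mulr_sumr (alphaE rE); apply: ler_wpM2l.
Qed.

End fixed_order.

Let c : R[i] := (lm%:C)%C * cint (lam 1) u.

(** For the first [N] points the product expands into the terms [t N k]. Campbell's formula gives
    their limits in [N], the expansion for [|u|] dominates them, and the limit of the expectations
    is thereby the sum of the determinantal series. *)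
Lemma determinantal_product_limit (L : R[i]) :
  normc (cint P (fun w => \prod_(n < N) (1 + u (X n w))) - L) @[N --> \oo] --> (0 : R) ->
  normc (L - cexp c) <= normc (cexp c) * (4 * h ^+ 2).
Proof.
pose t N k : R[i] := (\sum_(s : k.-tuple 'I_N | uniq s)
  cint P (fun w => \prod_(i < k) u (X (tnth s i) w))) / k`!%:R.
have uXE N k (s : k.-tuple 'I_N) w' :
    \prod_(i < k) u (X (tnth s i) w') = produ (point_mx X (map_tuple (@nat_of_ord N) s) w').
  by apply: eq_bigr => i _; rewrite row_point_mx tnth_map.
have tE N k : t N k = (\sum_(s : k.-tuple 'I_N | uniq s)
    cint P (fun w => produ (point_mx X (map_tuple (@nat_of_ord N) s) w))) / k`!%:R.
  by congr (_ / _); apply: eq_bigr => s _; apply: eq_cint => w'; rewrite uXE.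
have f0 k : k`!%:R != 0 :> R[i] by rewrite pnatr_eq0 -lt0n fact_gt0.
have f0R k : k`!%:R != 0 :> R by rewrite pnatr_eq0 -lt0n fact_gt0.
have normc_divf z k : normc (z / k`!%:R : R[i]) = normc z / k`!%:R.
  by apply: (mulIf (f0R k)); rewrite -[in LHS](normc_natr R) -normcM !divfK.
have cint1 : cint P (fun=> 1) = 1.
  by rewrite /cint /= !Rintegral_probability_cst.
have t0 N : t N 0%N = 1.
  rewrite /t fact0 divr1 (big_pred1 [tuple])//; last by move=> s /=; rewrite [s]tuple0; apply/esym/eqP.
  by rewrite -[RHS]cint1; apply: eq_cint => w'; rewrite big_ord0.
move=> EL; apply: (kernel_series_near_exp lm0 mK mu U0 h0 h2 uU uh).
pose b k := 2 * (normc (kernel_coeff lm K w k k) / k`!%:R).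
pose E N := cint P (fun w => \prod_(n < N) (1 + u (X n w))).
apply: (@tannery _ E t (fun n => kernel_coeff lm K u n n / n`!%:R) b
  (2 * (4 * expR (normc ((lm%:C)%C * cint (lam 1) w)))) L _ _ _ _ EL).
- move=> N; rewrite /E (eq_cint _ (g := fun w' => \sum_(k < N.+1) (k`!%:R)^-1 *
      \sum_(s : k.-tuple 'I_N | uniq s) \prod_(i < k) u (X (tnth s i) w'))); last first.
    by move=> w'; rewrite prod_add1_uniq_tuples; apply: eq_bigr => k _; rewrite mulrC.
  have ci k (s : k.-tuple 'I_N) : uniq s -> cintegrable P (fun w' => \prod_(i < k) u (X (tnth s i) w')).
    move=> us; case: k s us => [|k] s us.
      under eq_fun do rewrite big_ord0.
      by split; exact: finite_measure_integrable_cst.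
    have [/(_ s us) si _] := point_product_bound (ltn0Sn k) N.
    rewrite (_ : (fun w' => _) = (fun w => produ (point_mx X (map_tuple (@nat_of_ord N) s) w)))//.
    by apply/funext => w'; exact: uXE.
  have cis k : cintegrable P (fun w' => \sum_(s : k.-tuple 'I_N | uniq s) \prod_(i < k) u (X (tnth s i) w')).
    apply: (cintegrable_sum (index_enum _) (P := fun s : k.-tuple 'I_N => uniq s)
      (F := fun (s : k.-tuple 'I_N) w' => \prod_(i < k) u (X (tnth s i) w'))) => s us.
    exact: ci.
  rewrite cint_sum; last by move=> k _; exact: cintegrableZ.
  apply: eq_bigr => k _; rewrite cintZ// /t [LHS]mulrC; congr (_ / _).
  rewrite (cint_sum (index_enum _) (P := fun s : k.-tuple 'I_N => uniq s)
    (F := fun (s : k.-tuple 'I_N) w' => \prod_(i < k) u (X (tnth s i) w')))// => s us.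
  exact: ci.
- move=> N k; rewrite tE normc_divf /b mulrA; apply: ler_wpM2r; first by rewrite invr_ge0 ler0n.
  (* Product densities are given in positive order only; the term of order 0 is equal to 1. *)
  have [->|k0] := posnP k.
    have := t0 N; rewrite tE fact0 divr1 => ->; rewrite normc1 kernel_coeff00 normc1; lra.
  apply: (le_trans (normc_sum_le _ _ _)); have [_ /le_trans] := point_product_bound k0 N; apply.
  by apply: ler_wpM2l => //; apply: le_trans (normr_Re_le _); exact: ler_norm.
- by move=> N; rewrite -mulr_sumr; apply: ler_wpM2l => //; exact: kernel_series_bound wU wh N.
- move=> k; have [->|k0] := posnP k.
    rewrite fact0 divr1 kernel_coeff00; under eq_fun do rewrite t0 subrr normc0.
    exact: cvg_cst.
  under eq_fun do rewrite tE -mulrBl normc_divf.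
  by rewrite -(mul0r (k`!%:R^-1)); apply: cvgMl; exact: point_product_cvg.
Qed.

End determinantal_products.

(** * Shot noise *)

Section laws.
Context d d' (T : measurableType d) (T' : measurableType d') (R : realType).
Variables (P : probability T R) (f : T -> T') (mf : measurable_fun setT f).

Definition law : probability T' R := distribution P (mfun_Sub (mem_set mf)).

Lemma lawE B : law B = P (f @^-1` B).
Proof. by []. Qed.

Lemma Rintegral_law (g : T' -> R) (M : R) : measurable_fun setT g -> (forall y, `|g y| <= M) ->
  \int[law]_y g y = \int[P]_x g (f x).
Proof.
move=> mg gM; congr fine.
have ig : P.-integrable (f @^-1` setT) ((EFin \o g) \o f).
  by rewrite preimage_setT; apply: (@bounded_integrable _ _ _ P (g \o f) M);
    [exact: (measurableT_comp mg mf)|move=> x; exact: gM].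
have mg' : measurable_fun setT (EFin \o g) by exact/measurable_EFinP.
by rewrite -[LHS]/(\int[pushforward P f]_y (EFin \o g) y)%E (integral_pushforward mf mg' ig measurableT).
Qed.

End laws.

Section independence_integrals.
Context d (T : measurableType d) (R : realType) (P : probability T R).
Context d1 d2 (T1 : measurableType d1) (T2 : measurableType d2).
Variables (Y : T -> T1) (Z : T -> T2).
Hypotheses (mY : measurable_fun setT Y) (mZ : measurable_fun setT Z).
Hypothesis YZ : forall B C, measurable B -> measurable C ->
  (P (Y @^-1` B `&` Z @^-1` C) = P (Y @^-1` B) * P (Z @^-1` C))%E.

(** The joint law agrees with the product of the laws on rectangles, hence everywhere, and Fubini
    applies. The conditional expectation given [Z] appears as an integral over a second copy [w'] of
    the sample point. *)
Lemma Rintegral_indep (F : T1 * T2 -> R) (M : R) : measurable_fun setT F ->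
  (forall z, `|F z| <= M) ->
  \int[P]_w F (Y w, Z w) = \int[P]_w \int[P]_w' F (Y w', Z w).
Proof.
move=> mF FM; have mYZ : measurable_fun setT (fun w => (Y w, Z w)).
  exact/measurable_fun_pairP.
rewrite -(@Rintegral_law _ _ _ _ _ P _ mYZ F M)//.
have -> : \int[law P mYZ]_z F z = \int[(law P mY \x law P mZ)%E]_z F z.
  congr fine; apply: eq_measure_integral => A mA _; apply/esym.
  by apply: product_measure_unique => // B C mB mC; rewrite !lawE -YZ.
rewrite (Rintegral_prod _ _ mF FM) (Rintegral_swap _ _ mF FM).
rewrite (@Rintegral_law _ _ _ _ _ P _ mZ (fun z => \int[law P mY]_y F (y, z)) M).
- apply: eq_Rintegral => w _; apply: (@Rintegral_law _ _ _ _ _ P _ mY (fun y => F (y, Z w)) M) => //.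
  by apply: measurableT_comp mF _; exact: pair2_measurable.
- exact: (@measurable_Rintegral2 _ _ _ _ _ (law P mY) (law P mZ) F M mF FM).
- move=> z; apply: normr_Rintegral_le => //.
  by apply: measurableT_comp mF _; exact: pair2_measurable.
Qed.

Lemma cint_indep (F : T1 * T2 -> R[i]) (M : R) : cmeasurable F ->
  (forall z, normc (F z) <= M) ->
  cint P (fun w => F (Y w, Z w)) = cint P (fun w => cint P (fun w' => F (Y w', Z w))).
Proof.
move=> [m1 m2] FM; rewrite /cint /=.
rewrite (@Rintegral_indep _ M m1); last by move=> z; apply: le_trans (normr_Re_le _) _.
by rewrite (@Rintegral_indep _ M m2)// => z; apply: le_trans (normr_Im_le _) _.
Qed.

End independence_integrals.

Lemma mx_measure_unique (R : realType) m n (m1 m2 : {measure set 'M[R]_(m, n) -> \bar R}) :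
  (m1 setT < +oo)%E ->
  (forall B, (forall i j, measurable (B i j)) -> m1 (mx_box B) = m2 (mx_box B)) ->
  forall A, measurable A -> m1 A = m2 A.
Proof.
move=> m1y m12 A mA.
pose G := [set U : set 'M[R]_(m, n) | exists2 B, (forall i j, measurable (B i j)) & U = mx_box B].
have Gm : G `<=` measurable by move=> _ [B mB ->]; exact: measurable_mx_box.
have boxT : mx_box (fun _ _ => setT) = setT :> set 'M[R]_(m, n) by exact/seteqP.
have sG : measurable `<=` <<s G >>.
  apply: smallest_sub; first exact: smallest_sigma_algebra.
  move=> _ [[i j] _ [B mB <-]]; apply: sub_sigma_algebra.
  exists (fun i' j' => if (i' == i) && (j' == j) then B else setT).
    by move=> i' j'; case: ifP.
  rewrite setTI; apply/seteqP; split=> C /= h.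
    by move=> i' j'; case: ifP => // /andP[/eqP -> /eqP ->].
  by have := h i j; rewrite !eqxx.
apply: (@g_sigma_algebra_measure_unique _ _ _ G Gm (fun _ => setT)) => //.
- by move=> k; exists (fun _ _ => setT).
- by rewrite bigcup_const.
- move=> _ _ [B mB ->] [C mC ->]; exists (fun i j => B i j `&` C i j).
    by move=> i j; exact: measurableI.
  apply/seteqP; split=> D /=; first by move=> [h1 h2] i j; split; [exact: h1|exact: h2].
  by move=> h; split=> i j; have [] := h i j.
- by move=> _ [B mB ->]; exact: m12.
- exact: sG.
Qed.

Section unit_phase.
Context (R : realType).

Definition cis (x : R) : R[i] := (cos x +i* sin x)%C.

Lemma cisD x y : cis (x + y) = cis x * cis y.
Proof. by apply: complex_eq; rewrite ?cReM ?cImM /= ?cosD ?sinD// addrC. Qed.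

Lemma normc_cis x : normc (cis x) = 1.
Proof. by rewrite normcE2 /= cos2Dsin2 sqrtr1. Qed.

Lemma cis0 : cis 0 = 1.
Proof. by rewrite /cis cos0 sin0. Qed.

Lemma cmeasurable_cis d (T : measurableType d) (f : T -> R) : measurable_fun setT f ->
  cmeasurable (fun x => cis (f x)).
Proof.
move=> mf; split=> /=; first exact: (measurableT_comp (@measurable_cosR R) mf).
exact: (measurableT_comp (@measurable_sinR R) mf).
Qed.

Lemma cis_sum (I : Type) (s : seq I) (P : pred I) (f : I -> R) :
  cis (\sum_(i <- s | P i) f i) = \prod_(i <- s | P i) cis (f i).
Proof. by rewrite (big_morph cis cisD cis0). Qed.

Lemma normc_cint_bounded d (T : measurableType d) (P : probability T R) (f : T -> R[i]) (M : R) :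
  cmeasurable f -> (forall x, normc (f x) <= M) -> cintegrable P f.
Proof.
move=> [m1 m2] fM; split; apply: (@bounded_integrable _ _ _ _ _ M) => // x.
  exact: le_trans (normr_Re_le _) _.
exact: le_trans (normr_Im_le _) _.
Qed.

End unit_phase.

(** * Averaging over the amplitudes *)

Section shot_noise_transform.
Context (R : realType) (d : nat).
Context (dO : measure_display) (Omega : measurableType dO).
Local Notation V := 'rV[R]_d.
Variables (P : probability Omega R) (X : nat -> Omega -> V) (A : nat -> Omega -> R).
Variable muP : probability R R.
Hypotheses (mX : forall n, measurable_fun setT (X n)) (mA : forall n, measurable_fun setT (A n)).
Hypothesis A_law : forall n B, measurable B -> P (A n @^-1` B) = muP B.
Hypothesis A_indep : mutually_independent P A.
Hypothesis AX_indep : independent_sequences P A X.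

Definition char_fun (t : R) : R[i] := cint muP (fun s => cis (s * t)).

Let Avec N (w : Omega) : 'rV[R]_N := \row_(i < N) A i w.
Let Xvec N (w : Omega) : 'M[R]_(N, d) := \matrix_(i < N, j < d) X i w 0 j.

Let mAvec N : measurable_fun setT (Avec N).
Proof. by apply: measurable_mx => i j; under eq_fun do rewrite mxE; exact: mA. Qed.

Let mXvec N : measurable_fun setT (Xvec N).
Proof.
apply: measurable_mx => i j; under eq_fun do rewrite mxE.
exact: (measurableT_comp (measurable_mx_entry _ _) (mX _)).
Qed.

(** Mutual independence speaks of events of single amplitudes. As functions of [C] both sides are
    finite measures that agree on boxes, hence on all measurable sets. *)
Let A_prefix_indep N B (C : set 'rV[R]_N) : measurable B -> measurable C ->
  (P (A N @^-1` B `&` Avec N @^-1` C) = P (A N @^-1` B) * P (Avec N @^-1` C))%E.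
Proof.
move=> mB mC.
have mAB : measurable (A N @^-1` B) by rewrite -[X in measurable X]setTI; exact: mA.
have r0 : 0 <= fine (P (A N @^-1` B)) by exact: fine_ge0.
pose m1 := mpushforward (mrestr P mAB) (@mAvec N).
pose m2 := mscale (NngNum r0) (mpushforward P (@mAvec N)).
have rE : (fine (P (A N @^-1` B)))%:E = P (A N @^-1` B).
  by rewrite fineK//; exact: fin_num_measure.
have m1E D : m1 D = P (Avec N @^-1` D `&` A N @^-1` B) by [].
have m2E D : (m2 D = P (A N @^-1` B) * P (Avec N @^-1` D))%E by rewrite /m2 /mscale /= rE.
rewrite setIC -m1E -m2E; apply: (@mx_measure_unique R 1 N m1 m2) => //.
  by rewrite m1E preimage_setT setTI (le_lt_trans (probability_le1 _ _)) ?ltry.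
move=> D mD; rewrite m1E [RHS]m2E.
(* The sides of the box followed by [B] in position [N]: the joint event becomes a single
   intersection over the first [N.+1] indices. *)
pose E k := if (k < N)%N =P true is ReflectT kN then D 0 (Ordinal kN) else B.
have EN : E N = B by rewrite /E; case: eqP => // h; exfalso; move: h; rewrite ltnn.
have Ei (i : 'I_N) : E i = D 0 i.
  rewrite /E; case: eqP => [h|]; last by rewrite ltn_ord.
  by congr (D 0 _); exact: val_inj.
have mE k : measurable (E k) by rewrite /E; case: eqP.
have boxE : Avec N @^-1` mx_box D = \bigcap_(k in [set` iota 0 N]) (A k @^-1` E k).
  apply/seteqP; split=> w /= h.
    move=> k /=; rewrite mem_iota add0n => /= kN; have := h 0 (Ordinal kN); rewrite mxE /=.
    by rewrite -(Ei (Ordinal kN)).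
  move=> i j; rewrite ord1 mxE -Ei; apply: (h j).
  by rewrite /= mem_iota add0n ltn_ord.
have boxE2 : A N @^-1` B `&` Avec N @^-1` mx_box D =
    \bigcap_(k in [set` iota 0 N.+1]) (A k @^-1` E k).
  rewrite boxE -addn1 iotaD /= add0n; apply/seteqP; split=> w /=.
    move=> [hB h] k /=; rewrite mem_cat inE => /orP[kN|/eqP ->]; first exact: h.
    by rewrite EN.
  move=> h; split; first by have := h N; rewrite EN; apply; rewrite /= mem_cat inE eqxx orbT.
  by move=> k /= kN; apply: h; rewrite /= mem_cat kN.
rewrite setIC boxE2 boxE !A_indep// ?iota_uniq// -addn1 iotaD big_cat big_seq1 /= add0n EN.
by rewrite muleC.
Qed.

Lemma cint_prod_cis N (t : nat -> R) :
  cint P (fun w => \prod_(n < N) cis (A n w * t n)) = \prod_(n < N) char_fun (t n).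
Proof.
elim: N => [|N ih].
  rewrite big_ord0 (eq_cint _ (g := fun=> 1)); last by move=> w; rewrite big_ord0.
  by rewrite /cint /= !Rintegral_probability_cst.
pose F (z : R * 'rV[R]_N) : R[i] := (\prod_(n < N) cis (z.2 0 n * t n)) * cis (z.1 * t N).
have mF : cmeasurable F.
  apply: cmeasurableM.
    apply: cmeasurable_prod => i; apply: cmeasurable_cis; apply: measurable_funM => //.
    exact: (measurableT_comp (measurable_mx_entry _ _)).
  by apply: cmeasurable_cis; apply: measurable_funM.
have FM z : normc (F z) <= 1.
  by rewrite /F -cis_sum -cisD normc_cis.
have mcis n : cintegrable P (fun w => cis (A n w * t n)).
  apply: (@normc_cint_bounded _ _ _ _ _ 1) => [|x]; last by rewrite normc_cis.
  by apply: cmeasurable_cis; apply: measurable_funM.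
rewrite (eq_cint _ (g := fun w => F (A N w, Avec N w))); last first.
  move=> w; rewrite big_ord_recr /= /F /=; congr (_ * _).
  by apply: eq_bigr => i _; rewrite mxE.
rewrite (cint_indep (mA N) (@mAvec N) (@A_prefix_indep N) mF FM).
have cE : cint P (fun w => cis (A N w * t N)) = char_fun (t N).
  rewrite /char_fun.
  have mg := cmeasurable_cis (measurable_funM (@measurable_id _ R setT) (measurable_cst (t N))).
  have [mc ms] := mg.
  have e (g : R -> R) : measurable_fun setT g -> (forall x, `|g x| <= 1) ->
      \int[P]_w g (A N w) = \int[muP]_s g s.
    move=> mg' gM; rewrite -(@Rintegral_law _ _ _ _ _ P _ (mA N) g 1)//.
    by congr fine; apply: eq_measure_integral => B mB _; rewrite /= -(A_law N mB).
  apply: complex_eq; rewrite /cint /=.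
    by apply: (e (fun s => cos (s * t N))) => // x; rewrite -(normc_cis (x * t N)); exact: (normr_Re_le (cis _)).
  by apply: (e (fun s => sin (s * t N))) => // x; rewrite -(normc_cis (x * t N)); exact: (normr_Im_le (cis _)).
rewrite (eq_cint _ (g := fun w => char_fun (t N) * \prod_(n < N) cis (A n w * t n))); last first.
  move=> w; rewrite /F /= cintZ// cE mulrC; congr (_ * _).
  by apply: eq_bigr => i _; rewrite mxE.
rewrite cintZ; first by rewrite ih big_ord_recr mulrC.
apply: (@normc_cint_bounded _ _ _ _ _ 1) => [|x]; last by rewrite -cis_sum normc_cis.
by apply: cmeasurable_prod => i; apply: cmeasurable_cis; apply: measurable_funM.
Qed.

(** The sets whose preimage belongs to the sigma-algebra of the sequence form a sigma-algebra, which
    contains the generators by assumption. *)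
Let sigma_of_seq_mx d' (T : measurableType d') (Y : nat -> Omega -> T) m n
    (g : Omega -> 'M[R]_(m, n)) (C : set 'M[R]_(m, n)) :
  (forall i j (B : set R), measurable B -> sigma_of_seq Y ((fun w => g w i j) @^-1` B)) ->
  measurable C -> sigma_of_seq Y (g @^-1` C).
Proof.
move=> gY; suff : measurable `<=` [set C | sigma_of_seq Y (g @^-1` C)] by apply.
apply: smallest_sub; last first.
  by move=> _ [[i j] _ [B mB <-]]; rewrite setTI; exact: gY.
split.
- by rewrite /= preimage_set0; exact: sigma_algebra0.
- by move=> U /= hU; rewrite setTD preimage_setC; exact: sigma_algebraC.
- by move=> F hF; rewrite /= preimage_bigcup; exact: sigma_algebra_bigcup.
Qed.

Let AX_vec_indep N (B : set 'rV[R]_N) (C : set 'M[R]_(N, d)) : measurable B -> measurable C ->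
  (P (Avec N @^-1` B `&` Xvec N @^-1` C) = P (Avec N @^-1` B) * P (Xvec N @^-1` C))%E.
Proof.
move=> mB mC; apply: AX_indep.
  apply: sigma_of_seq_mx mB => i j D mD; apply: sub_sigma_algebra; exists (j : nat) => //.
  by exists D => //; rewrite setTI; apply/seteqP; split=> w /=; rewrite mxE.
apply: sigma_of_seq_mx mC => i j D mD; apply: sub_sigma_algebra; exists (i : nat) => //.
exists [set x : V | D (x 0 j)].
  by rewrite -[X in measurable X]setTI; exact: measurable_mx_entry.
by rewrite setTI; apply/seteqP; split=> w /=; rewrite mxE.
Qed.

Variable theta : V -> R.
Hypothesis mtheta : measurable_fun setT theta.

(** Amplitudes and points being independent, the points are frozen and the amplitudes integrated out
    one by one. *)
Lemma cint_shot_noise_sum N :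
  cint P (fun w => cis (\sum_(n < N) A n w * theta (X n w))) =
  cint P (fun w => \prod_(n < N) char_fun (theta (X n w))).
Proof.
pose F (z : 'rV[R]_N * 'M[R]_(N, d)) : R[i] := cis (\sum_(n < N) z.1 0 n * theta (row n z.2)).
have mF : cmeasurable F.
  apply: cmeasurable_cis; apply: measurable_sum => n; apply: measurable_funM.
    exact: (measurableT_comp (measurable_mx_entry _ _)).
  by apply: (measurableT_comp mtheta); apply: (measurableT_comp (@measurable_row _ _ _ n)).
have FM z : normc (F z) <= 1 by rewrite normc_cis.
have rX N' n (w : Omega) : row n (Xvec N' w) = X n w by apply/rowP => j; rewrite !mxE.
rewrite (eq_cint _ (g := fun w => F (Avec N w, Xvec N w))); last first.
  by move=> w; congr cis; apply: eq_bigr => i _; rewrite mxE rX.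
rewrite (cint_indep (@mAvec N) (@mXvec N) (@AX_vec_indep N) mF FM).
apply: eq_cint => w; pose t n : R := theta (X n w).
rewrite -(cint_prod_cis N t); apply: eq_cint => w'; rewrite /F /= cis_sum.
by apply: eq_bigr => i _; rewrite mxE rX.
Qed.

End shot_noise_transform.

Lemma cvg_sum_seq (R : realType) (I : Type) (r : seq I) (f : I -> nat -> R) (l : I -> R) :
  (forall j, f j N @[N --> \oo] --> l j) ->
  \sum_(j <- r) f j N @[N --> \oo] --> \sum_(j <- r) l j.
Proof.
move=> fl; elim: r => [|j r ih].
  by under eq_fun do rewrite big_nil; rewrite big_nil; exact: cvg_cst.
rewrite big_cons; move: ih => /(cvgD (fl j)).
by apply: cvg_trans; apply: near_eq_cvg; near=> N; rewrite big_cons.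
Unshelve. all: by end_near.
Qed.

Section ge0_independence.
Context d (T : measurableType d) (R : realType) (P : probability T R).
Context d1 d2 (T1 : measurableType d1) (T2 : measurableType d2).
Variables (Y : T -> T1) (Z : T -> T2).
Hypotheses (mY : measurable_fun setT Y) (mZ : measurable_fun setT Z).
Hypothesis YZ : forall B C, measurable B -> measurable C ->
  (P (Y @^-1` B `&` Z @^-1` C) = P (Y @^-1` B) * P (Z @^-1` C))%E.

Lemma ge0_integral_indep (F : T1 * T2 -> \bar R) : measurable_fun setT F ->
  (forall z, (0 <= F z)%E) ->
  (\int[P]_w F (Y w, Z w) = \int[P]_w \int[P]_w' F (Y w', Z w))%E.
Proof.
move=> mF F0; have mYZ : measurable_fun setT (fun w => (Y w, Z w)).
  exact/measurable_fun_pairP.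
rewrite -[LHS](ge0_integral_pushforward mYZ _ measurableT mF)//.
have -> : (\int[pushforward P (fun w => (Y w, Z w))]_z F z =
    \int[(law P mY \x law P mZ)]_z F z)%E.
  apply: eq_measure_integral => A mA _; apply/esym.
  by rewrite -[RHS]/(law P mYZ A); apply: product_measure_unique => // B C mB mC; rewrite !lawE -YZ.
rewrite (fubini_tonelli2 (m1 := law P mY) (m2 := law P mZ) _ mF F0) /fubini_G /=.
rewrite (ge0_integral_pushforward mZ _ measurableT)//; last first.
- by move=> y _; apply: integral_ge0.
- exact: (measurable_fun_fubini_tonelli_G (m1 := law P mY) _ mF F0).
apply: eq_integral => w _ /=.
rewrite (ge0_integral_pushforward mY _ measurableT)//.
by apply: measurableT_comp mF _; exact: pair2_measurable.
Qed.

End ge0_independence.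

Section char_fun_theory.
Context (R : realType) (muP : probability R R).

Let mcis_mul : cmeasurable (fun z : R * R => cis (z.2 * z.1)).
Proof. by apply: cmeasurable_cis; apply: measurable_funM. Qed.

Lemma cmeasurable_char_fun : cmeasurable (char_fun muP).
Proof.
have [m1 m2] := mcis_mul; split.
  apply: (@measurable_Rintegral1 _ _ _ _ R muP muP (fun z => cos (z.2 * z.1)) 1 m1) => z.
  by rewrite -(normc_cis (z.2 * z.1)); exact: (normr_Re_le (cis _)).
apply: (@measurable_Rintegral1 _ _ _ _ R muP muP (fun z => sin (z.2 * z.1)) 1 m2) => z.
by rewrite -(normc_cis (z.2 * z.1)); exact: (normr_Im_le (cis _)).
Qed.

End char_fun_theory.

(** * Shot noise as a limit of finite sums *)

Section shot_noise_law.
Context (R : realType) (d : nat).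
Context (dO : measure_display) (Omega : measurableType dO).
Local Notation V := 'rV[R]_d.
Local Notation lam n := (@lebmx R n d).
Variables (P : probability Omega R) (X : nat -> Omega -> V) (A : nat -> Omega -> R).
Variable muP : probability R R.
Hypotheses (mX : forall n, measurable_fun setT (X n)) (mA : forall n, measurable_fun setT (A n)).
Hypothesis A_ge0 : forall n w, 0 <= A n w.
Hypothesis A_law : forall n B, measurable B -> P (A n @^-1` B) = muP B.
Hypothesis A_indep : mutually_independent P A.
Hypothesis AX_indep : independent_sequences P A X.
Variables (lm : R).
Hypothesis lm0 : 0 <= lm.
Hypothesis X_intensity : has_intensity P X lm.

(** The sum of the laws of the points is a measure with constant density [lm], by the definition of
    the intensity. *)
Lemma intensity_integral (F : V -> \bar R) : measurable_fun setT F -> (forall x, (0 <= F x)%E) ->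
  (\sum_(0 <= k <oo) \int[P]_w F (X k w) = lm%:E * \int[lam 1]_x F x)%E.
Proof.
move=> mF F0.
pose nu := mseries (fun k => mpushforward P (mX k)) 0.
have nuE B : measurable B -> nu B = (\int[lam 1]_(x in B) (lm)%:E)%E.
  move=> mB; rewrite integral_cst//; rewrite -[RHS]X_intensity// /count_points.
  rewrite integral_nneseries//; last first.
    move=> k; apply/measurable_EFinP; apply: measurableT_comp; last exact: mX.
    exact: measurable_indic.
  rewrite /nu /mseries; apply: eq_eseriesr => k _.
  rewrite -[RHS]/(\int[P]_w (\1_(X k @^-1` B) w)%:E)%E integral_indic ?setIT//.
  by rewrite -[X in measurable X]setTI; exact: mX.
have := ge0_integral_density (@measurable_cst _ _ _ _ setT lm) (fun _ => lm0) nuE mF F0.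
rewrite /nu ge0_integral_measure_series// => h.
transitivity (\sum_(0 <= k <oo) \int[mpushforward P (mX k)]_x F x)%E.
  apply: eq_eseriesr => k _; rewrite ge0_integral_pushforward//.
have {}h : (\sum_(0 <= k <oo) \int[mpushforward P (mX k)]_x F x =
  \int[lam 1]_x (F x * lm%:E))%E := h.
rewrite h ge0_integralZr//; first by rewrite muleC.
Qed.

Let A_X_indep k B C : measurable B -> measurable C ->
  (P (A k @^-1` B `&` X k @^-1` C) = P (A k @^-1` B) * P (X k @^-1` C))%E.
Proof.
move=> mB mC; apply: AX_indep; apply: sub_sigma_algebra; exists k => //.
  by exists B => //; rewrite setTI.
by exists C => //; rewrite setTI.
Qed.

(** The amplitudes are nonnegative, but [muP] lives on the whole line; the absolute value keeps the
    integrand nonnegative there. *)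
Let integral_A k : (\int[P]_w (A k w)%:E = \int[muP]_s `|s|%:E)%E.
Proof.
have mn : measurable_fun setT (fun s : R => `|s|%:E) by apply/measurable_EFinP; exact: normr_measurable.
transitivity (\int[pushforward P (A k)]_s `|s|%:E)%E; last first.
  by apply: eq_measure_integral => B mB _; exact: A_law.
rewrite ge0_integral_pushforward//.
by apply: eq_integral => w _ /=; rewrite ger0_norm.
Qed.

Let mAg k (g : V -> R) : measurable_fun setT g -> measurable_fun setT (fun w => A k w * g (X k w)).
Proof. by move=> mg; apply: measurable_funM => //; exact: (measurableT_comp mg). Qed.

Hypothesis P_int : (\int[muP]_s `|s|%:E < +oo)%E.

Lemma integral_shot_noise (g : V -> R) : measurable_fun setT g -> (forall x, 0 <= g x) ->
  (\int[P]_w (\sum_(0 <= k <oo) (A k w * g (X k w))%:E) =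
   (\int[muP]_s `|s|%:E) * (lm%:E * \int[lam 1]_x (g x)%:E))%E.
Proof.
move=> mg g0; rewrite integral_nneseries//; last 2 first.
- by move=> k; apply/measurable_EFinP; exact: mAg.
- by move=> k w _; rewrite lee_fin mulr_ge0.
rewrite -intensity_integral//; [|exact/measurable_EFinP].
have pE : (fine (\int[muP]_s `|s|%:E))%:E = (\int[muP]_s `|s|%:E)%E.
  by rewrite fineK// ge0_fin_numE//; exact: integral_ge0.
rewrite -pE -nneseriesZl; last by move=> k _; apply: integral_ge0 => w _; rewrite lee_fin.
apply: eq_eseriesr => k _.
pose F (z : R * V) : \bar R := (`|z.1| * g z.2)%:E.
have mF : measurable_fun setT F.
  apply/measurable_EFinP; apply: measurable_funM; first exact: measurableT_comp.
  exact: (measurableT_comp mg).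
transitivity (\int[P]_w F (A k w, X k w))%E.
  by apply: eq_integral => w _; rewrite /F /= ger0_norm.
rewrite (ge0_integral_indep (mA k) (mX k) (@A_X_indep k) mF); last first.
  by move=> z; rewrite lee_fin mulr_ge0.
rewrite pE -(integral_A k) -ge0_integralZl//; last 3 first.
- by apply/measurable_EFinP; exact: (measurableT_comp mg).
- by move=> w _; rewrite lee_fin.
- by apply: integral_ge0 => w _; rewrite lee_fin.
apply: eq_integral => w _; rewrite -ge0_integralZr//; last 3 first.
- exact/measurable_EFinP.
- by move=> w' _; rewrite lee_fin.
- by rewrite lee_fin.
by apply: eq_integral => w' _; rewrite /F /= ger0_norm.
Qed.

Variable ell : V -> R.
Hypotheses (mell : measurable_fun setT ell) (ell0 : forall x, 0 <= ell x).
Hypothesis ell_int : (\int[lam 1]_x (ell x)%:E < +oo)%E.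

Let mellz (z : V) : measurable_fun setT (fun x : V => ell (z - x)).
Proof.
apply: (measurableT_comp mell); apply: measurable_mx => i j.
under eq_fun do rewrite !mxE; apply: measurable_funB => //; exact: measurable_mx_entry.
Qed.

Let snE z w : shot_noise A ell X z w = (\sum_(0 <= k <oo) (A k w * ell (z - X k w))%:E)%E.
Proof. by []. Qed.

Let term_ge0 z k w : 0 <= A k w * ell (z - X k w).
Proof. by rewrite mulr_ge0. Qed.

Lemma measurable_shot_noise z : measurable_fun setT (shot_noise A ell X z).
Proof.
apply: (@ge0_emeasurable_sum _ _ _ setT (fun k w => (A k w * ell (z - X k w))%:E) xpredT).
  by move=> k w _ _; rewrite lee_fin.
by move=> k _; apply/measurable_EFinP; exact: (mAg _ (mellz z)).
Qed.

Lemma mean_shot_noise z :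
  (\int[P]_w shot_noise A ell X z w =
   (\int[muP]_s `|s|%:E) * (lm%:E * \int[lam 1]_x (ell x)%:E))%E.
Proof.
under eq_integral do rewrite snE.
rewrite (integral_shot_noise (g := fun x => ell (z - x)))//.
by rewrite (lebmx_reflect z (F := fun x => (ell x)%:E))//; exact/measurable_EFinP.
Qed.

Let sn_partial z w : (shot_noise A ell X z w < +oo)%E ->
  \sum_(n < N) A n w * ell (z - X n w) @[N --> \oo] --> fine (shot_noise A ell X z w).
Proof.
move=> fy; have sn0 : (0 <= shot_noise A ell X z w)%E.
  by apply: nneseries_ge0 => k _ _; rewrite lee_fin.
have : (\sum_(0 <= k < N) (A k w * ell (z - X k w))%:E)%E @[N --> \oo] -->
    (fine (shot_noise A ell X z w))%:E.
  rewrite fineK ?ge0_fin_numE//; apply: is_cvg_nneseries => k _ _; by rewrite lee_fin.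
move=> /fine_cvgP[_]; apply: cvg_trans; apply: near_eq_cvg; near=> N => /=.
by rewrite sumEFin big_mkord.
Unshelve. all: by end_near.
Qed.

Lemma ae_shot_noise_lty z : {ae P, forall w, (shot_noise A ell X z w < +oo)%E}.
Proof.
have sn0 w : (0 <= shot_noise A ell X z w)%E.
  by apply: nneseries_ge0 => k _ _; rewrite lee_fin.
have i : P.-integrable setT (shot_noise A ell X z).
  apply/integrableP; split; first exact: measurable_shot_noise.
  under eq_integral do rewrite gee0_abs//.
  rewrite mean_shot_noise; apply: lte_mul_pinfty => //.
  - exact: integral_ge0.
  - by rewrite ge0_fin_numE//; exact: integral_ge0.
  - apply: lte_mul_pinfty => //.
have := integrable_ae measurableT i.
by apply: filterS => w h; rewrite -ge0_fin_numE//; exact: h.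
Qed.

Variables (m : nat) (z : 'I_m -> V) (s : 'I_m -> R).

Let f x : R := \sum_(j < m) s j * ell (z j - x).
Let S w : R := \sum_(j < m) s j * fine (shot_noise A ell X (z j) w).

Let mf : measurable_fun setT f.
Proof. by apply: measurable_sum => j; apply: measurable_funM => //; exact: mellz. Qed.

Let mS : measurable_fun setT S.
Proof.
apply: measurable_sum => j; apply: measurable_funM => //.
by apply: measurableT_comp => //; exact: measurable_shot_noise.
Qed.

(** Each of the [m] shot noises is almost surely finite, so there [fine] does not alter it and the
    series may be combined linearly. *)
Let S_cvg : {ae P, forall w, \sum_(n < N) A n w * f (X n w) @[N --> \oo] --> S w}.
Proof.
have : {ae P, forall w, forall j, (shot_noise A ell X (z j) w < +oo)%E}.
  by apply: filter_forall => j; exact: ae_shot_noise_lty.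
apply: filterS => w h.
have hj j : s j * (\sum_(n < N) A n w * ell (z j - X n w)) @[N --> \oo] -->
    s j * fine (shot_noise A ell X (z j) w) by apply: cvgMr; exact: (sn_partial (h j)).
have := @cvg_sum_seq R _ (index_enum 'I_m) _ _ hj.
apply: cvg_trans; apply: near_eq_cvg; near=> N.
under [LHS]eq_bigr do rewrite mulr_sumr.
rewrite exchange_big; apply: eq_bigr => n _; rewrite /f mulr_sumr; apply: eq_bigr => j _.
by rewrite mulrCA.
Unshelve. all: by end_near.
Qed.

Let phase_cvg :
  normc (cint P (fun w => cis (\sum_(n < N) A n w * f (X n w))) - cint P (fun w => cis (S w)))
    @[N --> \oo] --> (0 : R).
Proof.
pose SN N w := \sum_(n < N) A n w * f (X n w).
have mSN N : measurable_fun setT (SN N).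
  by apply: measurable_sum => n; exact: mAg.
have i1 : P.-integrable setT (EFin \o cst (1 : R)) by exact: finite_measure_integrable_cst.
have hc (g : R -> R) : continuous g -> (forall x, `|g x| <= 1) ->
    `|\int[P]_w g (SN N w) - \int[P]_w g (S w)| @[N --> \oo] --> (0 : R).
  move=> cg g1; have mg : measurable_fun setT g by exact: continuous_measurable_fun.
  rewrite -(@normr0 _ R) -(subrr (\int[P]_w g (S w))); apply: cvg_norm; apply: cvgB; last exact: cvg_cst.
  apply: (@dominated_Rintegral _ _ _ P (fun N w => g (SN N w)) _ (cst 1)) => //.
  - by move=> N; exact: (measurableT_comp mg (mSN N)).
  - exact: (measurableT_comp mg mS).
  - by apply: filterS S_cvg => w; apply: continuous_cvg; exact: cg.
move: (hc _ (@continuous_sin R) (fun x => le_trans (normr_Im_le (cis x)) (eq_ind_r (fun y => y <= 1) (lexx 1) (normc_cis x)))).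
move=> /(cvgD (hc _ (@continuous_cos R) (fun x => le_trans (normr_Re_le (cis x)) (eq_ind_r (fun y => y <= 1) (lexx 1) (normc_cis x))))).
rewrite addr0; apply: cvg0_le => N; rewrite normc_ge0 andTb.
apply: (le_trans (normc_le_ReIm _)).
by rewrite !raddfB.
Qed.

Variables (K : V -> V -> R[i]).
Hypotheses (mK : cmeasurable (fun z : V * V => K z.1 z.2)).
Hypotheses (KX : determinantal P X K) (Kdiag : forall x, K x x = (lm%:C)%C).

Let u x : R[i] := char_fun muP (f x) - 1.

Lemma cmeasurable_char_fun_sub1 : cmeasurable u.
Proof.
apply: cmeasurableD; last exact: cmeasurable_cst.
by apply: cmeasurable_comp => //; exact: cmeasurable_char_fun.
Qed.

Variables (U h : R).
Hypotheses (U0 : 0 <= U) (h0 : 0 <= h) (h2 : h <= 2^-1).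
Hypothesis uU : (\int[lam 1]_x (normc (u x))%:E <= U%:E)%E.
Hypothesis uh : (\int[(lam 1 \x lam 1)%E]_z
  (normc (u z.1) * normc (K z.1 z.2) ^+ 2 * normc (u z.2))%:E <= (h ^+ 2)%:E)%E.

(** Averaging over the amplitudes turns the phase of each finite sum into a product of the factors
    [1 + u (X n w)]; these expectations converge to that of the phase of [S], which identifies the
    limit. *)
Lemma shot_noise_transform_near_exp :
  let c := (lm%:C)%C * cint (lam 1) u in
  normc (cint P (fun w => cis (S w)) - cexp c) <= normc (cexp c) * (4 * h ^+ 2).
Proof.
apply: (determinantal_product_limit mX lm0 mK KX Kdiag cmeasurable_char_fun_sub1 U0 h0 h2 uU uh).
apply: cvg0_le phase_cvg => N; rewrite normc_ge0 andTb le_eqVlt; apply/orP; left; apply/eqP.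
congr (normc (_ - _)); rewrite (cint_shot_noise_sum mX mA A_law A_indep AX_indep mf).
by apply: eq_cint => w; apply: eq_bigr => n _; rewrite /u addrC subrK.
Qed.

End shot_noise_law.

(** * Taylor bounds for sine and cosine *)

Section trigonometric_bounds.
Context (R : realType).
Implicit Types x y : R.

(** The mean value theorem raises the exponent by one. The factorials of Taylor's formula are lost,
    but only the exponents matter below. *)
Lemma derivative_power_bound (g g' : R -> R) (k : nat) :
  (forall x, is_derive x 1 g (g' x)) -> (forall x, `|g' x| <= `|x| ^+ k) -> g 0 = 0 ->
  forall x, `|g x| <= `|x| ^+ k.+1.
Proof.
move=> dg g'k g0 x.
have cg : continuous g.
  by move=> y; apply: differentiable_continuous; apply/derivable1_diffP; have [] := dg y.
have [x0|x0|->] := ltgtP x 0; last by rewrite g0 normr0 expr0n.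
- have [c] := MVT x0 (fun y _ => dg y) (continuous_subspaceT cg).
  rewrite in_itv/= => /andP[xc c0]; rewrite g0 !sub0r => gE.
  rewrite -[g x]opprK gE mulrN opprK normrM exprSr; apply: ler_wpM2r => //.
  apply: (le_trans (g'k c)); apply: lerXn2r; rewrite ?nnegrE//.
  by rewrite !ltr0_norm// lerN2 ltW.
- have [c] := MVT x0 (fun y _ => dg y) (continuous_subspaceT cg).
  rewrite in_itv/= => /andP[c0 cx]; rewrite g0 !subr0 => gE.
  rewrite gE normrM exprSr; apply: ler_wpM2r => //.
  apply: (le_trans (g'k c)); apply: lerXn2r; rewrite ?nnegrE//.
  by rewrite !gtr0_norm// ltW.
Qed.

Lemma normr_sin_le x : `|sin x| <= `|x|.
Proof.
have := @derivative_power_bound sin cos 0 (fun x => is_derive_sin x) _ (sin0 R) x.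
rewrite expr1; apply=> y; rewrite expr0.
by rewrite -(normc_cis y); exact: (normr_Re_le (cis y)).
Qed.

Lemma normr_cosB1_sqr x : `|cos x - 1| <= `|x| ^+ 2.
Proof.
apply: (@derivative_power_bound (fun x => cos x - 1) (fun x => - sin x) 1); last by rewrite cos0 subrr.
- move=> y; have h : is_derive y (1 : R) (cst 1 : R -> R) 0 by exact: is_derive_cst.
  by have := is_deriveB (is_derive_cos y) h; rewrite subr0.
- by move=> y; rewrite normrN expr1; exact: normr_sin_le.
Qed.

(** The linear bound enters the estimate of [u] by the first moment of the amplitudes; the quadratic
    ones provide dominations by the second moment. *)
Lemma normr_cosB1 x : `|cos x - 1| <= 2 * `|x|.
Proof.
have [x1|x1] := lerP `|x| 1.
  apply: (le_trans (normr_cosB1_sqr x)); rewrite expr2; apply: ler_wpM2r => //; lra.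
have := normr_Re_le (cis x); rewrite normc_cis /= ler_norml => /andP[h1 h2].
by rewrite ler_norml; apply/andP; split; lra.
Qed.

Lemma normr_sinB x : `|sin x - x| <= `|x| ^+ 3.
Proof.
apply: (@derivative_power_bound (fun x => sin x - x) (fun x => cos x - 1) 2); last by rewrite sin0 subrr.
exact: normr_cosB1_sqr.
Qed.

Lemma normr_sinB_sqr x : `|sin x - x| <= 2 * `|x| ^+ 2.
Proof.
have [x1|x1] := lerP `|x| 1.
  apply: (le_trans (normr_sinB x)); rewrite exprS; apply: ler_wpM2r; [exact: sqr_ge0|lra].
apply: (le_trans (ler_normB _ _)); have := normr_sin_le x; rewrite expr2 => h.
have : `|x| * 1 <= `|x| * `|x| by apply: ler_wpM2l => //; exact: ltW.
lra.
Qed.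

Lemma normr_cos_taylor x : `|cos x - 1 + x ^+ 2 / 2| <= `|x| ^+ 4.
Proof.
apply: (@derivative_power_bound (fun x => cos x - 1 + x ^+ 2 / 2) (fun x => - sin x + x) 3).
- move=> y; have h : is_derive y (1 : R) (cst 1 : R -> R) 0 by exact: is_derive_cst.
  have h1 := is_deriveB (is_derive_cos y) h.
  have h2 : is_derive y (1 : R) (fun x : R => x ^+ 2 / 2) y.
    apply: trigger_derive; rewrite /GRing.scale /= ; by field.
  by have := is_deriveD h1 h2; rewrite subr0.
- by move=> y; rewrite addrC -opprB normrN; exact: normr_sinB.
- by rewrite cos0 subrr expr0n mul0r addr0.
Qed.

End trigonometric_bounds.

(** * Asymptotics of the exponent *)

Section char_fun_bounds.
Context (R : realType) (muP : probability R R).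
Hypothesis sqr_int : muP.-integrable setT (fun s => (s ^+ 2)%:E).

Let p : R := \int[muP]_s `|s|.
Let q : R := \int[muP]_s s ^+ 2.

Lemma integrable_normr_of_sqr : muP.-integrable setT (fun s => `|s|%:E).
Proof.
have i1 : muP.-integrable setT (fun=> 1%:E) by exact: finite_measure_integrable_cst.
apply: le_integrable_R (integrable_RD i1 sqr_int); first exact: normr_measurable.
move=> s; rewrite normr_id -(real_normK (num_real s)).
have := sqr_ge0 (`|s| - 1); rewrite sqrrB expr1n mulr1; have := sqr_ge0 `|s|; lra.
Qed.

Let integrable_scaled (G : R -> R) (t : R) : measurable_fun setT G ->
  (forall y, `|G y| <= 2 * `|y| \/ `|G y| <= 2 * `|y| ^+ 2) ->
  muP.-integrable setT (fun s => (G (s * t))%:E).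
Proof.
move=> mG Gb.
have i1 := integrable_RD (integrable_RZ (2 * `|t|) integrable_normr_of_sqr)
  (integrable_RZ (2 * `|t| ^+ 2) sqr_int).
apply: le_integrable_R i1.
  by apply: (measurableT_comp mG); exact: measurable_funM.
move=> s; have a0 : 0 <= 2 * `|t| * `|s| by rewrite !mulr_ge0.
have b0 : 0 <= 2 * `|t| ^+ 2 * s ^+ 2 by rewrite mulr_ge0 ?sqr_ge0// mulr_ge0 ?sqr_ge0.
have e2 : `|s * t| ^+ 2 = `|t| ^+ 2 * s ^+ 2.
  by rewrite normrM exprMn (real_normK (num_real s)) mulrC.
by have [|] := Gb (s * t); rewrite ?e2 ?normrM; lra.
Qed.

Let scaled_lin (G : R -> R) (t : R) : measurable_fun setT G -> (forall y, `|G y| <= 2 * `|y|) ->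
  `|\int[muP]_s G (s * t)| <= 2 * p * `|t|.
Proof.
move=> mG Gb; have iG := integrable_scaled t mG (fun y => or_introl (Gb y)).
apply: (le_trans (le_normr_Rintegral measurableT iG)).
have -> : 2 * p * `|t| = \int[muP]_s (2 * `|t| * `|s|).
  by rewrite (RintegralZl _ measurableT integrable_normr_of_sqr) -/p mulrAC.
apply: le_Rintegral => //.
- by have := iG => /integrable_abse.
- exact: integrable_RZ integrable_normr_of_sqr.
- by move=> s _; apply: (le_trans (Gb _)); rewrite normrM mulrA mulrAC.
Qed.

Let scaled_sqr (G : R -> R) (t : R) : measurable_fun setT G -> (forall y, `|G y| <= 2 * `|y| ^+ 2) ->
  `|\int[muP]_s G (s * t)| <= 2 * q * t ^+ 2.
Proof.
move=> mG Gb; have iG := integrable_scaled t mG (fun y => or_intror (Gb y)).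
apply: (le_trans (le_normr_Rintegral measurableT iG)).
have -> : 2 * q * t ^+ 2 = \int[muP]_s (2 * t ^+ 2 * s ^+ 2).
  by rewrite (RintegralZl _ measurableT sqr_int) -/q mulrAC.
apply: le_Rintegral => //.
- by have := iG => /integrable_abse.
- exact: integrable_RZ sqr_int.
- by move=> s _; apply: (le_trans (Gb _)); rewrite real_normK ?num_real// exprMn mulrA mulrAC.
Qed.

Let mcosB1 : measurable_fun setT (fun y : R => cos y - 1).
Proof. by apply: measurable_funB => //; exact: measurable_cosR. Qed.

Let msinB : measurable_fun setT (fun y : R => sin y - y).
Proof. by apply: measurable_funB => //; exact: measurable_sinR. Qed.

Let cosB1_sqr (y : R) : `|cos y - 1| <= 2 * `|y| ^+ 2.
Proof. by apply: (le_trans (normr_cosB1_sqr y)); have := sqr_ge0 `|y|; lra. Qed.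

Let sin_lin (y : R) : `|sin y| <= 2 * `|y|.
Proof. by apply: (le_trans (normr_sin_le y)); have := normr_ge0 y; lra. Qed.

Lemma Re_char_funB1 t : complex.Re (char_fun muP t - 1) = \int[muP]_s (cos (s * t) - 1).
Proof.
rewrite cReD /= RintegralB//; last 2 first.
- apply: (@bounded_integrable _ _ _ _ _ 1) => [|s].
    by apply: (measurableT_comp (@measurable_cosR R)); exact: measurable_funM.
  by rewrite -(normc_cis (s * t)); exact: (normr_Re_le (cis _)).
- exact: finite_measure_integrable_cst.
by rewrite Rintegral_probability_cst.
Qed.

Lemma Im_char_funB1 t : complex.Im (char_fun muP t - 1) = \int[muP]_s sin (s * t).
Proof. by rewrite cImD /= oppr0 addr0. Qed.

(** Keeps the modulus of the exponential factor at most 1, which turns the relative error of the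
    expansion into an absolute one. *)
Lemma Re_char_funB1_le0 t : complex.Re (char_fun muP t - 1) <= 0.
Proof.
rewrite Re_char_funB1 -[leRHS](_ : \int[muP]_s (0 : R) = 0); last by rewrite Rintegral_probability_cst.
apply: le_Rintegral => //.
- exact: (integrable_scaled t mcosB1 (fun y => or_introl (normr_cosB1 y))).
- exact: finite_measure_integrable_cst.
Qed.

Lemma normc_char_funB1 t : normc (char_fun muP t - 1) <= 4 * p * `|t|.
Proof.
apply: (le_trans (normc_le_ReIm _)); rewrite Re_char_funB1 Im_char_funB1.
have := scaled_lin t mcosB1 (@normr_cosB1 R).
by have := scaled_lin t (@measurable_sinR R) sin_lin; lra.
Qed.

Context d (T : measurableType d) (nu : {measure set T -> \bar R}).
Variables (f : T -> R) (M : R).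
Hypotheses (mf : measurable_fun setT f) (fM : forall x, `|f x| <= M).
Hypothesis fi : nu.-integrable setT (fun x => (f x)%:E).

Let f2i : nu.-integrable setT (fun x => (f x ^+ 2)%:E).
Proof.
have fa : nu.-integrable setT (fun x => `|f x|%:E) by have := fi => /integrable_abse.
apply: le_integrable_R (integrable_RZ M fa); first exact: measurable_funX.
by move=> x; rewrite normrX expr2; apply: ler_wpM2r.
Qed.

Variable l : nat -> R.
Hypotheses (l0 : forall n, 0 < l n) (loo : l n @[n --> \oo] --> +oo%R).

Let r n : R := Num.sqrt (l n).
Let r0 n : 0 < r n. Proof. by rewrite sqrtr_gt0. Qed.
Let rr n : r n ^+ 2 = l n. Proof. by rewrite sqr_sqrtr// ltW. Qed.

Let rinv : (r n)^-1 @[n --> \oo] --> (0 : R).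
Proof.
apply/cvgrPdist_lt => e e0.
have e20 : 0 < (e ^+ 2)^-1 by rewrite invr_gt0 exprn_gt0.
move/cvgryPgt : loo => /(_ (e ^+ 2)^-1); apply: filterS => n ln.
rewrite sub0r normrN gtr0_norm ?invr_gt0// -[e]invrK ltf_pV2 ?posrE ?invr_gt0//.
rewrite -(ltr_pXn2r (n := 2))// ?nnegrE ?invr_ge0 ?ltW//.
by rewrite rr exprVn.
Qed.

(** Since [l n = r n ^+ 2], the left-hand side is at most [|y|^k / r n^(k - 2)]: any order above 2
    is negligible. *)
Let small_o (G : R -> R) (k : nat) (y : R) : (2 < k)%N -> (forall x, `|G x| <= `|x| ^+ k) ->
  l n * G (y / r n) @[n --> \oo] --> (0 : R).
Proof.
move=> k2 Gk.
have bnd n : `|l n * G (y / r n)| <= `|y| ^+ k * ((r n)^-1) ^+ (k - 2).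
  rewrite normrM (gtr0_norm (l0 n)); apply: (@le_trans _ _ (l n * (`|y| ^+ k * (r n)^-1 ^+ k))).
    apply: ler_wpM2l; first exact: ltW.
    by apply: (le_trans (Gk _)); rewrite normrM exprMn normfV (gtr0_norm (r0 n)).
  rewrite le_eqVlt; apply/orP; left; apply/eqP; rewrite mulrCA; congr (_ * _).
  rewrite -[in LHS](subnK (ltnW k2)) exprD mulrCA -rr -exprMn divff ?expr1n ?mulr1//.
  by rewrite gt_eqF.
have z0 : `|y| ^+ k * ((r n)^-1) ^+ (k - 2) @[n --> \oo] --> (0 : R).
  rewrite -(mulr0 (`|y| ^+ k)); apply: cvgMr.
  have -> : (0 : R) = 0 ^+ (k - 2) by rewrite expr0n subn_eq0 leqNgt k2.
  elim: (k - 2)%N => [|j ih]; first by under eq_fun do rewrite expr0; rewrite expr0; exact: cvg_cst.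
  move: ih => /(cvgM rinv); rewrite -exprS; apply: cvg_trans; apply: near_eq_cvg; near=> n.
  by rewrite exprS.
apply/cvgrPdist_lt => e e0; move/cvgrPdist_lt : z0 => /(_ e e0); apply: filterS => n.
rewrite !sub0r !normrN => h; apply: le_lt_trans (bnd n) _.
by apply: le_lt_trans h; exact: ler_norm.
Unshelve. all: by end_near.
Qed.

(** A quadratic bound exactly absorbs the factor [l n], so the domination is uniform in [n]. *)
Let inner_bound (G : R -> R) n x : measurable_fun setT G -> (forall y, `|G y| <= 2 * `|y| ^+ 2) ->
  `|l n * \int[muP]_s G (s * (f x / r n))| <= 2 * q * f x ^+ 2.
Proof.
move=> mG Gb; rewrite normrM (gtr0_norm (l0 n)).
apply: (@le_trans _ _ (l n * (2 * q * (f x / r n) ^+ 2))).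
  by apply: ler_wpM2l; [exact: ltW|exact: scaled_sqr].
rewrite le_eqVlt; apply/orP; left; apply/eqP; rewrite exprMn exprVn rr.
by field; rewrite gt_eqF.
Qed.

Let inner_meas (G : R -> R) n : measurable_fun setT G -> (exists B, forall y, `|G y| <= B) ->
  measurable_fun setT (fun x => l n * \int[muP]_s G (s * (f x / r n))).
Proof.
move=> mG [B GB]; apply: measurable_funM => //.
have mF : measurable_fun setT (fun z : R * R => G (z.2 * z.1)).
  by apply: (measurableT_comp mG); exact: measurable_funM.
have := measurable_Rintegral1 muP muP mF (fun z => GB _).
move=> h; apply: (measurableT_comp h); exact: measurable_funM.
Qed.

(** Dominated convergence twice: in the amplitude [s] with bound [2 f(x)^2 s^2], then in [x] with
    bound [2 q f(x)^2]. The pointwise limit is [- s^2 f(x)^2 / 2], with a remainder of order 4. *)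
Lemma Re_exponent_cvg :
  l n * \int[nu]_x complex.Re (char_fun muP (f x / Num.sqrt (l n)) - 1) @[n --> \oo] -->
  - (q / 2 * \int[nu]_x f x ^+ 2).
Proof.
have -> : - (q / 2 * \int[nu]_x f x ^+ 2) = \int[nu]_x (- (q / 2) * f x ^+ 2).
  by rewrite RintegralZl// mulNr.
have bG (y : R) : `|cos y - 1| <= 2.
  have := normr_Re_le (cis y); rewrite normc_cis /= ler_norml => /andP[h1 h2].
  by rewrite ler_norml; apply/andP; split; lra.
have E n : l n * \int[nu]_x complex.Re (char_fun muP (f x / Num.sqrt (l n)) - 1) =
    \int[nu]_x (l n * \int[muP]_s (cos (s * (f x / r n)) - 1)).
  rewrite -RintegralZl//; first by apply: eq_Rintegral => x _; rewrite Re_char_funB1.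
  apply: (le_integrable_R _ _ (integrable_RZ (2 * q / l n) f2i)).
    under eq_fun do rewrite Re_char_funB1.
    have := inner_meas n mcosB1 (ex_intro _ 2 bG).
    move=> /(measurable_funM (measurable_cst (l n)^-1)).
    apply: eq_measurable_fun => x _ /=; rewrite mulrA mulVf ?mul1r// gt_eqF//.
  move=> x; rewrite Re_char_funB1; have := inner_bound n x mcosB1 cosB1_sqr.
  rewrite normrM (gtr0_norm (l0 n)) -ler_pdivlMl// => h; apply: (le_trans h).
  by rewrite le_eqVlt; apply/orP; left; apply/eqP; ring.
under eq_fun do rewrite E.
apply: (@dominated_Rintegral _ _ _ nu _ _ (fun x => 2 * q * f x ^+ 2)).
- by move=> n; exact: (inner_meas n mcosB1 (ex_intro _ 2 bG)).
- by apply: measurable_funM => //; exact: measurable_funX.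
- apply: aeW => x.
  have -> : - (q / 2) * f x ^+ 2 = \int[muP]_s (- (f x ^+ 2 / 2) * s ^+ 2).
    by rewrite RintegralZl//; rewrite -/q; ring.
  have E2 n : l n * \int[muP]_s (cos (s * (f x / r n)) - 1) =
      \int[muP]_s (l n * (cos (s * (f x / r n)) - 1)).
    by rewrite RintegralZl//; exact: (integrable_scaled _ mcosB1 (fun y => or_introl (normr_cosB1 y))).
  under eq_fun do rewrite E2.
  apply: (@dominated_Rintegral _ _ _ muP _ _ (fun s => 2 * f x ^+ 2 * s ^+ 2)).
  + move=> n; apply: measurable_funM => //.
    by apply: (measurableT_comp mcosB1); exact: measurable_funM.
  + by apply: measurable_funM => //; exact: measurable_funX.
  + apply: aeW => s.
    have := small_o (s * f x) (isT : (2 < 4)%N) (@normr_cos_taylor R).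
    have hc : - (f x ^+ 2 / 2) * s ^+ 2 @[_ --> \oo] --> - (f x ^+ 2 / 2) * s ^+ 2 by exact: cvg_cst.
    move=> /(cvgD hc); rewrite addr0; apply: cvg_trans; apply: near_eq_cvg; near=> n => /=.
    rewrite !fctE mulrDr.
    have -> : l n * ((s * f x / r n) ^+ 2 / 2) = f x ^+ 2 / 2 * s ^+ 2.
      by rewrite !exprMn exprVn rr; field; rewrite gt_eqF.
    by rewrite mulrA; ring.
  + exact: integrable_RZ sqr_int.
  + move=> n s; rewrite normrM (gtr0_norm (l0 n)).
    apply: (@le_trans _ _ (l n * (2 * `|s * (f x / r n)| ^+ 2))).
      by apply: ler_wpM2l; [exact: ltW|exact: cosB1_sqr].
    rewrite le_eqVlt; apply/orP; left; apply/eqP.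
    rewrite real_normK ?num_real// !exprMn exprVn rr.
    by field; rewrite gt_eqF.
- exact: integrable_RZ f2i.
- by move=> n x; exact: (inner_bound n x mcosB1 cosB1_sqr).
Unshelve. all: by end_near.
Qed.

(** The subtracted term, of order [sqrt (l n)], is the linear part of the sine and will cancel
    against the centering. What remains is [sin y - y], which is quadratically dominated and of
    order 3. *)
Lemma Im_exponent_cvg :
  l n * \int[nu]_x complex.Im (char_fun muP (f x / Num.sqrt (l n)) - 1) -
    Num.sqrt (l n) * (\int[muP]_s s) * \int[nu]_x f x @[n --> \oo] --> (0 : R).
Proof.
have idi : muP.-integrable setT (fun s : R => s%:E).
  by apply: le_integrable_R integrable_normr_of_sqr.
have isin t : muP.-integrable setT (fun s => (sin (s * t))%:E).
  exact: (integrable_scaled t (@measurable_sinR R) (fun y => or_introl (sin_lin y))).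
have ids t : muP.-integrable setT (fun s : R => (s * t)%:E).
  by under eq_fun do rewrite mulrC; exact: integrable_RZ idi.
have E1 n x : l n * \int[muP]_s (sin (s * (f x / r n)) - s * (f x / r n)) =
    l n * complex.Im (char_fun muP (f x / r n) - 1) - r n * (\int[muP]_s s) * f x.
  rewrite Im_char_funB1 (RintegralB measurableT (isin _) (ids _)).
  rewrite mulrBr; congr (_ - _); under eq_Rintegral do rewrite mulrC.
  by rewrite RintegralZl// -rr; field; rewrite gt_eqF.
have mI n : measurable_fun setT (fun x => complex.Im (char_fun muP (f x / r n) - 1)).
  have [_ h] := cmeasurableD (cmeasurable_char_fun muP) (cmeasurable_cst _ (- 1)).
  by apply: (measurableT_comp h); exact: measurable_funM.
have iI n : nu.-integrable setT (fun x => (complex.Im (char_fun muP (f x / r n) - 1))%:E).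
  have fa : nu.-integrable setT (fun x => `|f x|%:E) by have := fi => /integrable_abse.
  apply: le_integrable_R (integrable_RZ (4 * p / r n) fa) => // x.
  apply: (le_trans (normr_Im_le _)); apply: (le_trans (normc_char_funB1 _)).
  by rewrite normrM normfV (gtr0_norm (r0 n)) mulrA mulrAC.
have E n : l n * \int[nu]_x complex.Im (char_fun muP (f x / Num.sqrt (l n)) - 1) -
    Num.sqrt (l n) * (\int[muP]_s s) * \int[nu]_x f x =
    \int[nu]_x (l n * \int[muP]_s (sin (s * (f x / r n)) - s * (f x / r n))).
  under [RHS]eq_Rintegral do rewrite E1.
  rewrite (RintegralB measurableT (integrable_RZ _ (iI n)) (integrable_RZ _ fi)).
  by rewrite (RintegralZl _ measurableT (iI n)) (RintegralZl _ measurableT fi).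
have sinB_sqr := @normr_sinB_sqr R.
have z0 : \int[nu]_x (0 : R) = 0 by rewrite /Rintegral integral0.
rewrite -[X in _ --> X]z0; under eq_fun do rewrite E.
apply: (@dominated_Rintegral _ _ _ nu _ _ (fun x => 2 * q * f x ^+ 2)).
- move=> n; under eq_fun do rewrite E1.
  by apply: measurable_funB; apply: measurable_funM.
- exact: measurable_cst.
- apply: aeW => x.
  rewrite -[X in _ --> X](Rintegral_probability_cst muP 0).
  have E2 n : l n * \int[muP]_s (sin (s * (f x / r n)) - s * (f x / r n)) =
      \int[muP]_s (l n * (sin (s * (f x / r n)) - s * (f x / r n))).
    by rewrite RintegralZl//; exact: (integrable_scaled _ msinB (fun y => or_intror (sinB_sqr y))).
  under eq_fun do rewrite E2.
  apply: (@dominated_Rintegral _ _ _ muP _ _ (fun s => 2 * f x ^+ 2 * s ^+ 2)).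
  + move=> n; apply: measurable_funM => //.
    by apply: (measurableT_comp msinB); exact: measurable_funM.
  + exact: measurable_cst.
  + apply: aeW => s.
    have := small_o (s * f x) (isT : (2 < 3)%N) (@normr_sinB R).
    by under eq_fun do rewrite -mulrA.
  + exact: integrable_RZ sqr_int.
  + move=> n s; rewrite normrM (gtr0_norm (l0 n)).
    apply: (@le_trans _ _ (l n * (2 * `|s * (f x / r n)| ^+ 2))).
      by apply: ler_wpM2l; [exact: ltW|exact: sinB_sqr].
    rewrite le_eqVlt; apply/orP; left; apply/eqP.
    rewrite real_normK ?num_real// !exprMn exprVn rr.
    by field; rewrite gt_eqF.
- exact: integrable_RZ f2i.
- by move=> n x; exact: (inner_bound n x msinB sinB_sqr).
Qed.

End char_fun_bounds.

Lemma Rintegral_sum_seq d (T : measurableType d) (R : realType) (mu : {measure set T -> \bar R})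
    (I : Type) (s : seq I) (f : I -> T -> R) :
  (forall i, mu.-integrable setT (fun x => (f i x)%:E)) ->
  \int[mu]_x (\sum_(i <- s) f i x) = \sum_(i <- s) \int[mu]_x f i x.
Proof.
move=> fi; elim: s => [|i s ih].
  by under eq_Rintegral do rewrite big_nil; rewrite big_nil /Rintegral integral0.
under eq_Rintegral do rewrite big_cons.
by rewrite (RintegralD measurableT (fi i) (integrable_R_sum s fi)) ih big_cons.
Qed.

Lemma continuous_normc_ball (R : realType) (T : pseudoMetricType R) (k : T -> R[i]^o) :
  continuous k -> forall x e, 0 < e ->
  exists2 r, 0 < r & forall y, ball x r y -> normc (k x - k y) < e.
Proof.
move=> ck x e e0; have e0C : 0 < (e%:C)%C :> R[i] by rewrite ltcR.
have /cvgrPdist_lt/(_ _ e0C) := ck x.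
rewrite -nbhs_ballE => -[r /= r0 hr]; exists r => // y /hr.
by rewrite ltcR.
Qed.

(** * Measurability and mass of the kernel *)

Section continuous_kernels.
Context (R : realType) (d : nat).
Local Notation V := 'rV[R]_d.
Local Notation lam n := (@lebmx R n d).
Variable K : V -> V -> R[i].

(** Pairs of points are encoded as matrices with two rows, for which continuity is known to imply
    measurability; the encoding is measurable for the product sigma-algebra. *)
Lemma continuous_kernel_cmeasurable :
  continuous (fun xy : V * V => K xy.1 xy.2 : R[i]^o) ->
  cmeasurable (fun z : V * V => K z.1 z.2).
Proof.
move=> cK.
pose KA (A : 'M[R]_(2, d)) := K (row ord0 A) (row ord_max A).
have close (A : 'M[R]_(2, d)) e : 0 < e -> exists2 r, 0 < r & forall B, ball A r B -> normc (KA A - KA B) < e.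
  move=> e0; have [r r0 hr] := continuous_normc_ball cK (row ord0 A, row ord_max A) e0.
  exists r => // B AB.
  apply: (hr (row ord0 B, row ord_max B)).
  by split; split=> // i j; rewrite !mxE; have [_ AB'] := AB; exact: AB'.
have meas (g : R[i] -> R) : (forall z w, `|g z - g w| <= normc (z - w)) ->
    measurable_fun setT (fun z : V * V => g (K z.1 z.2)).
  move=> g1.
  have cg : continuous (fun A : 'M[R]_(2, d) => g (KA A)).
    apply: ball_continuous_mx => A e e0; have [r r0 hr] := close A e e0.
    by exists r => // B /hr; apply: le_lt_trans; exact: g1.
  pose J (z : V * V) : 'M[R]_(2, d) := \matrix_(i < 2, j < d) if i == ord0 then z.1 0 j else z.2 0 j.
  have mJ : measurable_fun setT J.
    apply: measurable_mx => i j; under eq_fun do rewrite mxE.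
    case: (i == ord0); first exact: (measurableT_comp (measurable_mx_entry _ _)).
    exact: (measurableT_comp (measurable_mx_entry _ _)).
  have := measurableT_comp (continuous_measurable_mx cg) mJ.
  apply: eq_measurable_fun => z _ /=; congr (g (K _ _)); apply/rowP => j; rewrite !mxE //.
split; apply: meas => z w.
  by rewrite -raddfB; exact: normr_Re_le.
by rewrite -raddfB; exact: normr_Im_le.
Qed.

Hypothesis mK : cmeasurable (fun z : V * V => K z.1 z.2).
Hypothesis Kinv : forall x y, normc (K x y) ^+ 2 = normc (K 0 (y - x)) ^+ 2.

Lemma measurable_kernel_sqr : measurable_fun setT (fun z : V * V => normc (K z.1 z.2) ^+ 2).
Proof. by apply: measurable_funX; exact: measurable_normc. Qed.

Lemma measurable_kernel_section x : measurable_fun setT (fun y => normc (K x y) ^+ 2).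
Proof. exact: (measurableT_comp measurable_kernel_sqr (pair1_measurable x)). Qed.

Lemma kernel_mass x : (\int[lam 1]_y (normc (K x y) ^+ 2)%:E =
  \int[lam 1]_y (normc (K 0 y) ^+ 2)%:E)%E.
Proof.
under eq_integral do rewrite Kinv.
rewrite (lebmx_shift (- x) (F := fun y => (normc (K 0 y) ^+ 2)%:E))//.
  by apply/measurable_EFinP; exact: measurable_kernel_section.
by move=> y; rewrite lee_fin exprn_ge0 ?normc_ge0.
Qed.

(** One weight is bounded by its supremum [B], the kernel then integrates to [kap] whatever the
    other point, and the remaining weight has mass at most [U]. *)
Lemma weighted_kernel_bound (u : V -> R[i]) (kap U B : R) : cmeasurable u ->
  0 <= B -> 0 <= kap ->
  (\int[lam 1]_y (normc (K 0 y) ^+ 2)%:E)%E = kap%:E ->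
  (\int[lam 1]_x (normc (u x))%:E <= U%:E)%E -> (forall x, normc (u x) <= B) ->
  (\int[(lam 1 \x lam 1)%E]_z (normc (u z.1) * normc (K z.1 z.2) ^+ 2 * normc (u z.2))%:E <=
   (U * (B * kap))%:E)%E.
Proof.
move=> mu B0 k0 kE uU uB.
have mn := measurable_normc mu.
have m1 : measurable_fun setT (fun z : V * V => normc (u z.1)) by exact: (measurableT_comp mn).
have m2 : measurable_fun setT (fun z : V * V => normc (u z.2)) by exact: (measurableT_comp mn).
pose F (z : V * V) : \bar R := (normc (u z.1) * normc (K z.1 z.2) ^+ 2 * normc (u z.2))%:E.
have mF : measurable_fun setT F.
  apply/measurable_EFinP; apply: measurable_funM => //; apply: measurable_funM => //.
  exact: measurable_kernel_sqr.
have F0 z : (0 <= F z)%E.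
  by rewrite lee_fin !mulr_ge0 ?exprn_ge0 ?normc_ge0.
rewrite (fubini_tonelli1 (m1 := lam 1) (m2 := lam 1) _ mF F0) /fubini_F.
apply: (@le_trans _ _ (\int[lam 1]_x ((normc (u x))%:E * (B * kap)%:E))%E); last first.
  rewrite ge0_integralZr//; last 3 first.
  - by apply/measurable_EFinP.
  - by move=> x _; rewrite lee_fin normc_ge0.
  - by rewrite lee_fin mulr_ge0.
  by rewrite [leRHS]EFinM lee_wpmul2r// lee_fin mulr_ge0.
apply: ge0_le_integral => //.
- by move=> x _; exact: integral_ge0.
- exact: (measurable_fun_fubini_tonelli_F (m2 := lam 1) _ mF F0).
- by apply: emeasurable_funM => //; apply/measurable_EFinP.
move=> x _; apply: (@le_trans _ _ (\int[lam 1]_y ((normc (u x) * B)%:E * (normc (K x y) ^+ 2)%:E))%E).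
  apply: ge0_le_integral => //.
  - by apply: (measurableT_comp mF); exact: pair1_measurable.
  - by apply: emeasurable_funM => //; apply/measurable_EFinP; exact: measurable_kernel_section.
  - move=> y _; rewrite /F /= -EFinM lee_fin mulrAC; apply: ler_wpM2r.
      by rewrite exprn_ge0 ?normc_ge0.
    by apply: ler_wpM2l => //; exact: normc_ge0.
rewrite ge0_integralZl//; last 3 first.
- by apply/measurable_EFinP; exact: measurable_kernel_section.
- by move=> y _; rewrite lee_fin exprn_ge0 ?normc_ge0.
- by rewrite lee_fin mulr_ge0 ?normc_ge0.
by rewrite kernel_mass kE -!EFinM mulrA.
Qed.

End continuous_kernels.

(** * The characteristic function at a fixed intensity *)

Section cf_at_intensity.
Context (R : realType) (d : nat).
Context (dO : measure_display) (Omega : measurableType dO).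
Local Notation V := 'rV[R]_d.
Local Notation lam n := (@lebmx R n d).
Variables (P : probability Omega R) (X : nat -> {RV P >-> V}) (A : nat -> {RV P >-> R}).
Variables (muP : probability R R) (lm : R) (K : V -> V -> R[i]).
Hypothesis lm0 : 0 < lm.
Hypothesis hX : stationary_isotropic_dpp P X lm K.
Hypothesis A_ge0 : forall n w, 0 <= A n w.
Hypothesis A_law : forall n (B : set R), measurable B -> distribution P (A n) B = muP B.
Hypothesis A_indep : mutually_independent P A.
Hypothesis AX_indep : independent_sequences P A X.
Hypothesis sqr_int : muP.-integrable setT (fun s => (s ^+ 2)%:E).
Variable ell : V -> R.
Hypotheses (mell : measurable_fun setT ell) (ell0 : forall x, 0 <= ell x).
Hypothesis ell_int : (\int[lam 1]_x (ell x)%:E < +oo)%E.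

Let p : R := \int[muP]_s `|s|.

Let mX n : measurable_fun setT (X n). Proof. exact: measurable_funPT. Qed.
Let mA n : measurable_fun setT (A n). Proof. exact: measurable_funPT. Qed.

Let P_int : (\int[muP]_s `|s|%:E < +oo)%E.
Proof.
have /integrableP[_] := integrable_normr_of_sqr sqr_int.
by under eq_integral do rewrite /= normr_id.
Qed.

Variables (m : nat) (z : 'I_m -> V) (t : 'I_m -> R).

Let f x : R := \sum_(j < m) t j * ell (z j - x).
Let u x : R[i] := char_fun muP (f x / Num.sqrt lm) - 1.

Variables (M kap : R).
Hypothesis fM : forall x, `|f x| <= M.
Hypothesis kap_E : (\int[lam 1]_y (normc (K 0 y) ^+ 2)%:E)%E = kap%:E.

Let mellz (y : V) : measurable_fun setT (fun x : V => ell (y - x)).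
Proof.
apply: (measurableT_comp mell); apply: measurable_mx => i j.
under eq_fun do rewrite !mxE; apply: measurable_funB => //; exact: measurable_mx_entry.
Qed.

Let ellz_int (y : V) : (lam 1).-integrable setT (fun x : V => (ell (y - x))%:E).
Proof.
apply/integrableP; split; first by apply/measurable_EFinP.
under eq_integral do rewrite gee0_abs ?lee_fin//.
by rewrite (lebmx_reflect y (F := fun x => (ell x)%:E))//; apply/measurable_EFinP.
Qed.

Lemma measurable_response_comb : measurable_fun setT f.
Proof. by apply: measurable_sum => j; apply: measurable_funM => //; exact: mellz. Qed.

Lemma integrable_response_comb : (lam 1).-integrable setT (fun x => (f x)%:E).
Proof. by apply: integrable_R_sum => j; apply: integrable_RZ; exact: ellz_int. Qed.

Let F1 : R := \int[lam 1]_x `|f x|.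

Lemma integral_response_comb :
  \int[lam 1]_x f x = (\sum_(j < m) t j) * fine (\int[lam 1]_x (ell x)%:E)%E.
Proof.
rewrite /f (Rintegral_sum_seq _ (fun j : 'I_m => integrable_RZ (t j) (ellz_int (z j)))).
rewrite mulr_suml; apply: eq_bigr => j _; rewrite (RintegralZl (t j) measurableT (ellz_int (z j))); congr (_ * _).
by rewrite /Rintegral (lebmx_reflect (z j) (F := fun x => (ell x)%:E))//; apply/measurable_EFinP.
Qed.

Let mean_E (y : V) : fine (\int[P]_w shot_noise A ell X y w)%E =
  p * lm * fine (\int[lam 1]_x (ell x)%:E)%E.
Proof.
have [_ _ _ Xi _] := hX.
rewrite (mean_shot_noise mX mA A_ge0 A_law AX_indep (ltW lm0) Xi P_int mell ell0 y).
rewrite fineM; last 2 first.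
- by rewrite ge0_fin_numE//; exact: integral_ge0.
- rewrite ge0_fin_numE; first by apply: lte_mul_pinfty => //; rewrite lee_fin ltW.
  by apply: mule_ge0; [rewrite lee_fin ltW|apply: integral_ge0 => x _; rewrite lee_fin].
by rewrite fineM// ?mulrA// ge0_fin_numE//; apply: integral_ge0 => x _; rewrite lee_fin.
Qed.

Let Y w : R := \sum_(j < m) t j * normalized_shot_noise P lm A ell X (z j) w.
Let b : R := Num.sqrt lm * p * \int[lam 1]_x f x.
Let S w : R := \sum_(j < m) (t j / Num.sqrt lm) * fine (shot_noise A ell X (z j) w).

Let YE w : Y w = S w - b.
Proof.
have r0 : Num.sqrt lm != 0 by rewrite gt_eqF// sqrtr_gt0.
have rr : Num.sqrt lm * Num.sqrt lm = lm by rewrite -expr2 sqr_sqrtr// ltW.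
have -> : b = \sum_(j < m) t j / Num.sqrt lm * (p * lm * fine (\int[lam 1]_x (ell x)%:E)%E).
  rewrite -mulr_suml /b integral_response_comb -mulr_suml.
  by move: rr r0; move: (Num.sqrt lm) => r <- r0; field.
rewrite -sumrB; apply: eq_bigr => j _.
by rewrite /normalized_shot_noise mean_E -mulrBr; ring.
Qed.

Let rc : R := lm * \int[lam 1]_x complex.Re (u x).
Let ic : R := lm * \int[lam 1]_x complex.Im (u x).

(** The quantity in the hypothesis is the bound for [h ^+ 2] obtained from the sizes of [u]; being
    at most 1/4 means [h <= 1 / 2]. *)
Lemma cf_estimate (th : R) :
  16 * p ^+ 2 * M * F1 * kap / lm <= 4^-1 ->
  `|\int[P]_w cos (Y w + th) - expR rc * cos (ic - b + th)| <=
  4 * (16 * p ^+ 2 * M * F1 * kap / lm).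
Proof.
move=> h14; set H := 16 * _ * _ * _ * _ / _ in h14 *.
have [_ _ _ Xi [[[cK Kd] _ _ Kinv _] KX]] := hX.
have mK := continuous_kernel_cmeasurable cK.
have rl0 : 0 < Num.sqrt lm by rewrite sqrtr_gt0.
have M0 : 0 <= M by apply: le_trans (fM 0).
have p0 : 0 <= p by apply: Rintegral_ge0.
have F10 : 0 <= F1 by apply: Rintegral_ge0.
have kap0 : 0 <= kap.
  by rewrite -lee_fin -kap_E; apply: integral_ge0 => y _; rewrite lee_fin exprn_ge0 ?normc_ge0.
have H0 : 0 <= H by rewrite /H divr_ge0 ?(ltW lm0)// !mulr_ge0 ?exprn_ge0.
pose B := 4 * p * M / Num.sqrt lm.
pose U := 4 * p * F1 / Num.sqrt lm.
have mu : cmeasurable u.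
  apply: cmeasurableD; last exact: cmeasurable_cst.
  apply: (cmeasurable_comp (cmeasurable_char_fun muP)); apply: measurable_funM => //.
  exact: measurable_response_comb.
have u1 x : normc (u x) <= 4 * p / Num.sqrt lm * `|f x|.
  apply: (le_trans (normc_char_funB1 sqr_int _)).
  by rewrite normrM normfV (gtr0_norm rl0) mulrA mulrAC.
have uB x : normc (u x) <= B.
  apply: (le_trans (u1 x)); rewrite /B [leRHS]mulrAC; apply: ler_wpM2l => //.
  by rewrite divr_ge0 ?(ltW rl0)// mulr_ge0.
have fa : (lam 1).-integrable setT (fun x => `|f x|%:E).
  exact: (integrable_norm integrable_response_comb).
have uU : (\int[lam 1]_x (normc (u x))%:E <= U%:E)%E.
  have -> : U%:E = (\int[lam 1]_x (4 * p / Num.sqrt lm * `|f x|)%:E)%E.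
    rewrite /U [_ * F1 / _]mulrAC; under eq_integral do rewrite EFinM.
    by rewrite integralZl// EFinM /F1 /Rintegral fineK//; exact: integrable_fin_num.
  apply: ge0_le_integral => //.
  - by move=> x _; rewrite lee_fin normc_ge0.
  - by apply/measurable_EFinP; exact: measurable_normc.
  - apply/measurable_EFinP; apply: measurable_funM => //; apply: measurableT_comp => //.
    exact: measurable_response_comb.
  - by move=> x _; rewrite lee_fin.
have B0 : 0 <= B by rewrite /B divr_ge0 ?(ltW rl0)// !mulr_ge0.
have U0 : 0 <= U by rewrite /U divr_ge0 ?(ltW rl0)// !mulr_ge0.
have uh := weighted_kernel_bound mK Kinv mu B0 kap0 kap_E uU uB.
have HE : U * (B * kap) = Num.sqrt H ^+ 2.
  rewrite sqr_sqrtr// /H /U /B -[in RHS](sqr_sqrtr (ltW lm0)); field.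
  by rewrite gt_eqF.
rewrite HE in uh.
have h2 : Num.sqrt H <= 2^-1.
  have -> : 2^-1 = Num.sqrt (4^-1) :> R.
    by rewrite (_ : 4^-1 = 2^-1 ^+ 2 :> R) ?sqrtr_sqr ?ger0_norm//; field.
  by rewrite ler_sqrt.
have fE x : f x / Num.sqrt lm = \sum_(j < m) (t j / Num.sqrt lm) * ell (z j - x).
  by rewrite /f mulr_suml; apply: eq_bigr => j _; rewrite mulrAC.
have uE : u = (fun x => char_fun muP (\sum_(j < m) (t j / Num.sqrt lm) * ell (z j - x)) - 1).
  by apply/funext => x; rewrite /u fE.
have uU' := uU; have uh' := uh; rewrite uE in uU' uh'.
pose c := (lm%:C)%C * cint (lam 1) u.
pose L := cint P (fun w => cis (S w)).
have Lc : normc (L - cexp c) <= normc (cexp c) * (4 * H).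
  have := @shot_noise_transform_near_exp R d dO Omega P (fun n => X n) (fun n => A n) muP mX mA
    A_ge0 A_law A_indep AX_indep lm (ltW lm0) Xi P_int ell mell ell0 ell_int m z
    (fun j => t j / Num.sqrt lm) K mK KX Kd U (Num.sqrt H) U0 (sqrtr_ge0 _) h2 uU' uh'.
  by rewrite -uE sqr_sqrtr.
have cr : complex.Re c = rc by rewrite /c cReM /= mul0r subr0.
have ci : complex.Im c = ic by rewrite /c cImM /= mul0r addr0.
have mS : measurable_fun setT S.
  apply: measurable_sum => j; apply: measurable_funM => //.
  by apply: measurableT_comp => //; exact: (measurable_shot_noise mX mA A_ge0 mell ell0).
have LE : \int[P]_w cos (Y w + th) = complex.Re (L * cis (th - b)).
  rewrite cReM /L /cint /=.
  have iC : P.-integrable setT (fun w => (cos (S w))%:E).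
    apply: (@bounded_integrable _ _ _ _ _ 1); first exact: (measurableT_comp (@measurable_cosR R)).
    by move=> w; rewrite -(normc_cis (S w)); exact: (normr_Re_le (cis _)).
  have iS : P.-integrable setT (fun w => (sin (S w))%:E).
    apply: (@bounded_integrable _ _ _ _ _ 1); first exact: (measurableT_comp (@measurable_sinR R)).
    by move=> w; rewrite -(normc_cis (S w)); exact: (normr_Im_le (cis _)).
  rewrite ![_ * _ (th - b)]mulrC -!RintegralZl// -RintegralB//; [|exact: integrable_RZ|exact: integrable_RZ].
  apply: eq_Rintegral => w _; rewrite YE -addrA [- b + _]addrC (cosD (S w)).
  by ring.
have RE : expR rc * cos (ic - b + th) = complex.Re (cexp c * cis (th - b)).
  have eR : complex.Re (cexp c) = expR rc * cos ic by rewrite -cr -ci.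
  have eI : complex.Im (cexp c) = expR rc * sin ic by rewrite -cr -ci.
  by rewrite cReM eR eI -addrA [- b + _]addrC (cosD ic) /=; ring.
rewrite LE RE -raddfB -mulrBl; apply: (le_trans (normr_Re_le _)).
rewrite normcM normc_cis mulr1; apply: (le_trans Lc); rewrite normc_cexp cr.
rewrite -[leRHS]mul1r; apply: ler_wpM2r; first by rewrite mulr_ge0.
(* The modulus of the exponential is at most 1 because the real part of [u] is nonpositive. *)
rewrite -expR0 ler_expR /rc; apply: mulr_ge0_le0; first exact: ltW.
have iRe : (lam 1).-integrable setT (fun x => (complex.Re (u x))%:E).
  by have [] := cintegrable_lty mu (le_lt_trans uU (ltry _)).
rewrite -[leRHS](_ : \int[lam 1]_x (0 : R) = 0); last by rewrite /Rintegral integral0.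
apply: le_Rintegral => //; first exact: integrable0.
by move=> x _; exact: Re_char_funB1_le0.
Qed.

End cf_at_intensity.

(** * Convergence of characteristic functions along a sequence of intensities *)

Section cf_limit.
Context (R : realType) (d : nat).
Local Notation V := 'rV[R]_d.
Local Notation lam n := (@lebmx R n d).
Variables (dO : R -> measure_display) (Omega : forall lm, measurableType (dO lm)).
Variables (P : forall lm, probability (Omega lm) R).
Variables (X : forall lm, nat -> {RV (P lm) >-> V}) (K : R -> V -> V -> R[i]).
Hypothesis hX : forall lm : R, 0 < lm -> stationary_isotropic_dpp (P lm) (X lm) lm (K lm).
Variables (A : forall lm, nat -> {RV (P lm) >-> R}) (muP : probability R R).
Hypothesis A_ge0 : forall lm : R, 0 < lm -> forall n w, 0 <= A lm n w.
Hypothesis A_law : forall lm : R, 0 < lm -> forall n (B : set R), measurable B ->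
  distribution (P lm) (A lm n) B = muP B.
Hypothesis A_indep : forall lm : R, 0 < lm -> mutually_independent (P lm) (A lm).
Hypothesis AX_indep : forall lm : R, 0 < lm -> independent_sequences (P lm) (A lm) (X lm).
Hypothesis sqr_int : muP.-integrable setT (fun s => (s ^+ 2)%:E).
Variables (ell : V -> R) (L : R).
Hypotheses (mell : measurable_fun setT ell) (ell0 : forall x, 0 <= ell x).
Hypothesis ellL : forall x, ell x <= L.
Hypothesis ell_int : (\int[lam 1]_x (ell x)%:E < +oo)%E.
Hypothesis hK : ((\int[lebesgue_mx]_x (normc (K lm 0 x) ^+ 2)%:E) * (lm^-1)%:E)%E
  @[lm --> +oo%R] --> 0%E.

(** The mean of the shot noise was computed with [|s|], the linear term of the exponent with [s];
    they have to agree for the centering to cancel it. *)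
Lemma amplitude_mean_abs : \int[muP]_s s = \int[muP]_s `|s|.
Proof.
have neg0 : muP [set s : R | s < 0] = 0%E.
  have ms : measurable [set s : R | s < 0].
    by rewrite (_ : [set s : R | s < 0] = `]-oo, 0[%classic) //; apply/seteqP; split => s; rewrite /= in_itv.
  (* Nonnegativity is transferred to [muP] through the amplitudes at intensity 1. *)
  rewrite -(A_law ltr01 0%N ms) /distribution /= /pushforward.
  rewrite (_ : _ @^-1` _ = set0) ?measure0//; apply/seteqP; split=> w //=.
  by rewrite ltNge A_ge0.
congr fine; apply: ae_eq_integral => //.
- by apply: measurableT_comp.
- exists [set s : R | s < 0]; split => //.
    by rewrite (_ : [set s : R | s < 0] = `]-oo, 0[%classic) //; apply/seteqP; split => s; rewrite /= in_itv.
  move=> s /= h; rewrite ltNge; apply/negP => s0; apply: h => _.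
  by rewrite ger0_norm.
Qed.

Variables (l : nat -> R).
Hypotheses (l0 : forall n, 0 < l n) (loo : l n @[n --> \oo] --> +oo%R).

Let kapE n := (\int[lam 1]_y (normc (K (l n) 0 y) ^+ 2)%:E)%E.

Let kapE0 n : (0 <= kapE n)%E.
Proof. by apply: integral_ge0 => y _; rewrite lee_fin exprn_ge0 ?normc_ge0. Qed.

Let hKl : (kapE n * ((l n)^-1)%:E)%E @[n --> \oo] --> 0%E.
Proof. exact: (cvg_comp l _ loo hK). Qed.

(** The hypothesis is a limit in the extended reals; an infinite mass times a positive number would
    stay infinite, so the masses are eventually finite. *)
Let kap_cvg : (\forall n \near \oo, kapE n = (fine (kapE n))%:E) /\
  fine (kapE n) / l n @[n --> \oo] --> (0 : R).
Proof.
have := @fine_cvgP R nat \oo _ (fun n => (kapE n * ((l n)^-1)%:E)%E) 0.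
case=> /(_ hKl)[h1 h2] _.
have hf : \forall n \near \oo, kapE n = (fine (kapE n))%:E.
  apply: filterS h1 => n; move: (kapE0 n); case: (kapE n) => [r _ _//|_|//].
  by rewrite mulyr gtr0_sg ?invr_gt0// mul1e.
split => //; apply: cvg_trans h2; apply: near_eq_cvg; apply: filterS hf => n h /=.
by rewrite [in LHS]h -EFinM.
Qed.

Lemma shot_noise_cf_cvg m (z : 'I_m -> V) (t : 'I_m -> R) (th : R) :
  \int[P (l n)]_w cos (\sum_(j < m)
      t j * normalized_shot_noise (P (l n)) (l n) (A (l n)) ell (X (l n)) (z j) w + th)
    @[n --> \oo] -->
  expR (- ((\int[muP]_s s ^+ 2) / 2 * \int[lam 1]_x (\sum_(j < m) t j * ell (z j - x)) ^+ 2)) * cos th.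
Proof.
pose f x := \sum_(j < m) t j * ell (z j - x).
pose M := \sum_(j < m) `|t j| * L.
have fM x : `|f x| <= M.
  apply: (le_trans (ler_norm_sum _ _ _)); apply: ler_sum => j _.
  by rewrite normrM (ger0_norm (ell0 _)); apply: ler_wpM2l.
have mf : measurable_fun setT f by exact: measurable_response_comb.
have fi : (lam 1).-integrable setT (fun x => (f x)%:E) by exact: integrable_response_comb.
have hre := Re_exponent_cvg sqr_int mf fM fi l0 loo.
have him := Im_exponent_cvg sqr_int mf fM fi l0 loo.
have [kfin k0] := kap_cvg.
pose p : R := \int[muP]_s `|s|.
pose C := 16 * p ^+ 2 * M * \int[lam 1]_x `|f x|.
have Hto0 : C * (fine (kapE n) / l n) @[n --> \oo] --> (0 : R).
  by rewrite -(mulr0 C); apply: cvgMr.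
have H4 : \forall n \near \oo, C * (fine (kapE n) / l n) <= 4^-1.
  have q4 : 0 < 4^-1 :> R by lra.
  have /cvgrPdist_le/(_ _ q4) := Hto0.
  by apply: filterS => n; rewrite sub0r normrN; apply: le_trans; exact: ler_norm.
pose rc n := l n * \int[lam 1]_x complex.Re (char_fun muP (f x / Num.sqrt (l n)) - 1).
pose ic n := l n * \int[lam 1]_x complex.Im (char_fun muP (f x / Num.sqrt (l n)) - 1).
pose b n := Num.sqrt (l n) * p * \int[lam 1]_x f x.
have lim : expR (rc n) * cos (ic n - b n + th) @[n --> \oo] -->
    expR (- ((\int[muP]_s s ^+ 2) / 2 * \int[lam 1]_x f x ^+ 2)) * cos th.
  apply: cvgM; first by apply: continuous_cvg => //; exact: continuous_expR.
  apply: continuous_cvg; first exact: continuous_cos.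
  have hth : th @[_ --> \oo] --> th by exact: cvg_cst.
  by move: him; rewrite amplitude_mean_abs => /cvgD/(_ hth); rewrite add0r.
have dif : `|\int[P (l n)]_w cos (\sum_(j < m)
      t j * normalized_shot_noise (P (l n)) (l n) (A (l n)) ell (X (l n)) (z j) w + th)
    - expR (rc n) * cos (ic n - b n + th)| @[n --> \oo] --> (0 : R).
  have H0 : 4 * (C * (fine (kapE n) / l n)) @[n --> \oo] --> (0 : R).
    by rewrite -(mulr0 4); apply: cvgMr.
  apply: (@squeeze_cvgr _ _ _ _ (fun=> 0) (fun n => 4 * (C * (fine (kapE n) / l n)))) => //; last exact: cvg_cst.
  near=> n; rewrite normr_ge0 /=.
  have kE : kapE n = (fine (kapE n))%:E by near: n; exact: kfin.
  have h4 : C * (fine (kapE n) / l n) <= 4^-1 by near: n; exact: H4.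
  have e : C * (fine (kapE n) / l n) = 16 * p ^+ 2 * M * (\int[lam 1]_x `|f x|) * fine (kapE n) / l n.
    by rewrite /C mulrA.
  rewrite e in h4 *.
  exact: (@cf_estimate R d _ _ (P (l n)) (X (l n)) (A (l n)) muP (l n) (K (l n)) (l0 n) (hX (l0 n))
    (A_ge0 (l0 n)) (A_law (l0 n)) (A_indep (l0 n)) (AX_indep (l0 n)) sqr_int ell mell ell0 ell_int
    m z t M (fine (kapE n)) fM kE th h4).
move: dif => /norm_cvg0 dif.
move: lim => /(cvgD dif); rewrite add0r; apply: cvg_trans; apply: near_eq_cvg; near=> n.
by rewrite !fctE subrK.
Unshelve. all: by end_near. Qed.

End cf_limit.

(** * Coordinates in L^2 *)

Section cholesky.
Context (R : realType) (E : lmodType R) (D : E -> Prop) (B : E -> E -> R).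
Hypothesis DD : forall a f g, D f -> D g -> D (a *: f + g).
Hypothesis Bsym : forall f g, B f g = B g f.
Hypothesis Blin : forall a f g h, D f -> D g -> D h -> B (a *: f + g) h = a * B f h + B g h.
Hypothesis Bge0 : forall f, D f -> 0 <= B f f.
Variable e : nat -> E.
Hypothesis De : forall n, D (e n).

(* Gram matrix of the components orthogonal to [e 0], ..., [e n.-1]; a zero pivot
   divides to 0, which is right since its row then vanishes by Cauchy-Schwarz. *)
Fixpoint residual n f g : R :=
  if n is n'.+1 then
    residual n' f g - residual n' f (e n') * residual n' g (e n') / residual n' (e n') (e n')
  else B f g.

Definition chol n f : R := residual n f (e n) / Num.sqrt (residual n (e n) (e n)).

Lemma residual_sym n f g : residual n f g = residual n g f.
Proof. by elim: n f g => [|n ih] f g /=; [exact: Bsym|rewrite ih; congr (_ - _ / _); exact: mulrC]. Qed.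

Lemma residual_lin n a f g h : D f -> D g -> D h ->
  residual n (a *: f + g) h = a * residual n f h + residual n g h.
Proof.
move=> Df Dg Dh; elim: n h Dh => [|n ih] h Dh /=; first exact: Blin.
by rewrite !ih//; ring.
Qed.

(** Stated for an arbitrary form because it is needed for every residual form, and already inside
    the induction that proves their positivity. *)
Let cauchy_schwarz (C : E -> E -> R) f g : (forall f g, C f g = C g f) ->
  (forall a f g h, D f -> D g -> D h -> C (a *: f + g) h = a * C f h + C g h) ->
  (forall f, D f -> 0 <= C f f) -> D f -> D g -> C f g ^+ 2 <= C f f * C g g.
Proof.
move=> Cs Cl C0 Df Dg.
have key a : 0 <= a ^+ 2 * C f f + 2 * a * C f g + C g g.
  have := C0 _ (DD a Df Dg); rewrite Cl//; last exact: DD.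
  rewrite (Cs f) (Cs g) !Cl// (Cs g f); lra.
have := C0 _ Df; rewrite le_eqVlt => /orP[/eqP f0|f0].
  rewrite -f0 mul0r; rewrite -f0 in key.
  have [->|nz] := eqVneq (C f g) 0; first by rewrite expr0n.
  (* When [C f f = 0] the quadratic in [a] is affine; this value of [a] makes it [- 1], a
     contradiction unless [C f g = 0]. *)
  have := key (- (C g g + 1) / (2 * C f g)); rewrite mulr0 add0r.
  have -> : 2 * (- (C g g + 1) / (2 * C f g)) * C f g + C g g = - 1 by field.
  by rewrite lerNr oppr0 ler10.
have := key (- (C f g / C f f)).
rewrite -(pmulr_rge0 _ f0).
have -> : C f f * ((- (C f g / C f f)) ^+ 2 * C f f + 2 * - (C f g / C f f) * C f g + C g g) =
  C f f * C g g - C f g ^+ 2 by field; rewrite gt_eqF.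
by rewrite subr_ge0.
Qed.

Lemma residual_ge0 n f : D f -> 0 <= residual n f f.
Proof.
elim: n f => [|n ih] f Df /=; first exact: Bge0.
have := cauchy_schwarz (residual_sym n) (@residual_lin n) ih Df (De n).
have := ih _ (De n); rewrite le_eqVlt => /orP[/eqP <- _|e0 cs].
  by rewrite invr0 mulr0 subr0 ih.
by rewrite subr_ge0 ler_pdivrMr.
Qed.

Lemma residual_cauchy_schwarz n f g : D f -> D g ->
  residual n f g ^+ 2 <= residual n f f * residual n g g.
Proof. exact: cauchy_schwarz (residual_sym n) (@residual_lin n) (@residual_ge0 n). Qed.

Lemma residual_le n f : D f -> residual n f f <= B f f.
Proof.
move=> Df; elim: n => [//|n ih] /=; apply: le_trans ih.
by rewrite gerBl -expr2 divr_ge0 ?sqr_ge0 ?residual_ge0.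
Qed.

Lemma residual_normr_le n f g : D f -> D g ->
  `|residual n f g| <= Num.sqrt (B f f) * Num.sqrt (B g g).
Proof.
move=> Df Dg; rewrite -sqrtrM ?Bge0// -sqrtr_sqr ler_wsqrtr//.
apply: le_trans (residual_cauchy_schwarz _ Df Dg) _.
by apply: ler_pM; rewrite ?residual_ge0 ?residual_le.
Qed.

(** Once [e i] has served as pivot, residuals are orthogonal to it. A zero pivot is covered by
    Cauchy-Schwarz. *)
Lemma residual_eq0 n i f : D f -> (i < n)%N -> residual n f (e i) = 0.
Proof.
elim: n f => // n ih f Df; rewrite ltnS leq_eqVlt => /orP[/eqP -> /=|ilt /=].
  have [e0|e0] := eqVneq (residual n (e n) (e n)) 0.
    have := residual_cauchy_schwarz n Df (De n); rewrite e0 mulr0.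
    by rewrite exprn_even_le0//= => /eqP ->; rewrite !mul0r subr0.
  by rewrite mulfK// subrr.
by rewrite (residual_sym n (e i)) !ih// mulr0 mul0r subr0.
Qed.

Lemma residualE n f g : residual n f g = B f g - \sum_(k < n) chol k f * chol k g.
Proof.
elim: n => [|n ih] /=; first by rewrite big_ord0 subr0.
rewrite ih big_ord_recr /= opprD addrA; congr (_ - _).
rewrite /chol mulrACA -invfM -expr2 sqr_sqrtr //; exact: residual_ge0.
Qed.

Lemma chol_parseval f g : residual n f g @[n --> \oo] --> (0 : R) ->
  \sum_(k < n) chol k f * chol k g @[n --> \oo] --> B f g.
Proof.
have hB : B f g @[_ --> \oo] --> B f g by exact: cvg_cst.
move=> /(cvgB hB); rewrite subr0; apply: cvg_trans; apply: near_eq_cvg.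
by apply: nearW => n /=; rewrite !fctE residualE subKr.
Qed.

End cholesky.

(** * Completeness of the Cholesky coordinates *)

Section square_integrable_functions.
Context (R : realType) d (T : measurableType d) (mu : {measure set T -> \bar R}).

Definition square_integrable (f : T -> R) :=
  measurable_fun setT f /\ mu.-integrable setT (fun x => (f x ^+ 2)%:E).

Definition inner (f g : T -> R) : R := \int[mu]_x (f x * g x).

Lemma integrable_inner f g : square_integrable f -> square_integrable g ->
  mu.-integrable setT (fun x => (f x * g x)%:E).
Proof.
move=> [mf f2] [mg g2]; apply: (le_integrable_R _ _ (integrable_RD f2 g2)).
  exact: measurable_funM.
move=> x; rewrite ler_norml; apply/andP.
by have := sqr_ge0 (f x + g x); have := sqr_ge0 (f x - g x);
  have := sqr_ge0 (f x); have := sqr_ge0 (g x); split; nra.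
Qed.

Lemma square_integrable_lin a f g : square_integrable f -> square_integrable g ->
  square_integrable (a *: f + g).
Proof.
move=> sf sg; have [mf f2] := sf; have [mg g2] := sg; split.
  by apply: measurable_funD => //; exact: measurable_funM.
have -> : (fun x => ((a *: f + g) x ^+ 2)%:E) =
    (fun x => (a ^+ 2 * f x ^+ 2 + (2 * a * (f x * g x) + g x ^+ 2))%:E).
  apply/funext => x; congr EFin; rewrite (_ : (a *: f + g) x = a * f x + g x)//.
  by ring.
apply: integrable_RD; first exact: integrable_RZ.
by apply: integrable_RD => //; apply: integrable_RZ; exact: integrable_inner.
Qed.

Lemma square_integrable_le (f g : T -> R) : square_integrable g -> measurable_fun setT f ->
  (forall x, `|f x| <= `|g x|) -> square_integrable f.
Proof.
move=> [mg g2] mf fg; split => //; apply: (le_integrable_R _ _ g2); first exact: measurable_funX.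
move=> x; rewrite normrX -[g x ^+ 2]real_normK ?num_real//.
by rewrite ler_sqr ?nnegrE.
Qed.

Lemma inner_sym f g : inner f g = inner g f.
Proof. by apply: eq_Rintegral => x _; rewrite mulrC. Qed.

Lemma inner_lin a f g h : square_integrable f -> square_integrable g -> square_integrable h ->
  inner (a *: f + g) h = a * inner f h + inner g h.
Proof.
move=> sf sg sh; have ifh := integrable_inner sf sh; have igh := integrable_inner sg sh.
rewrite /inner -(RintegralZl a measurableT ifh) -(RintegralD measurableT (integrable_RZ a ifh) igh).
by apply: eq_Rintegral => x _; rewrite mulrA -mulrDl.
Qed.

Lemma inner_ge0 f : 0 <= inner f f.
Proof. by apply: Rintegral_ge0 => x _; rewrite -expr2 sqr_ge0. Qed.

Lemma square_integrable_indic (A : set T) : measurable A -> (mu A < +oo)%E ->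
  square_integrable \1_A.
Proof.
move=> mA Ay; split => //; rewrite (_ : (fun x => (\1_A x ^+ 2)%:E) = (fun x => (\1_A x : R)%:E)).
  apply/integrableP; split; first exact/measurable_EFinP.
  by under eq_integral do rewrite gee0_abs ?lee_fin//; rewrite integral_indic// setIT.
by apply/funext => x; rewrite indicE -natrX; case: (x \in A).
Qed.

Variables (G : nat -> set T) (C : nat -> nat).
Hypothesis mG : forall i, measurable (G i).
Hypothesis G_fin : forall i, (mu (G i) < +oo)%E.
Hypothesis GI : forall i j, exists k, G i `&` G j = G k.
Hypothesis gen : @measurable _ T = <<s range G >>.
Hypothesis C_cover : forall x, \forall k \near \oo, G (C k) x.

Let e k : T -> R := \1_(G k).
Let De k : square_integrable (e k). Proof. exact: square_integrable_indic. Qed.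

Let res := residual inner e.

Variable f : T -> R.
Hypothesis Df : square_integrable f.

(** The functions whose scalar product with [f] is exhausted by the coordinates. [W] is stable under
    linear combinations and dominated limits and contains the indicators of the sets [G i], so a
    Dynkin argument enlarges it. *)
Let W (h : T -> R) := square_integrable h /\ res n f h @[n --> \oo] --> (0 : R).

Let W_lin a g h : W g -> W h -> W (a *: g + h).
Proof.
move=> [Dg g0] [Dh h0]; split; first exact: square_integrable_lin.
have E n : res n f (a *: g + h) = a * res n f g + res n f h.
  by rewrite /res !(residual_sym inner_sym e n f) (residual_lin inner_lin De).
under eq_fun do rewrite E; rewrite -(addr0 (0 : R)) -{1}(mulr0 a).
by apply: cvgD => //; exact: cvgMr.
Qed.

Let W_lim (h_ : nat -> T -> R) (h g : T -> R) : (forall k, W (h_ k)) -> measurable_fun setT h ->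
  square_integrable g -> (forall k x, `|h_ k x| <= g x) ->
  (forall x, h_ k x @[k --> \oo] --> h x) -> W h.
Proof.
move=> Wh mh Dg hg hl.
have hg' x : `|h x| <= g x.
  apply: (ler_cvg_to (cvg_norm (hl x)) (cvg_cst (g x))).
  by apply: nearW => k.
have Dh : square_integrable h.
  apply: (square_integrable_le Dg mh) => x; apply: le_trans (hg' x) (ler_norm _).
split => //; apply/cvgrPdist_le => eps eps0.
pose D k := inner (h - h_ k) (h - h_ k).
have DE k : (h - h_ k : T -> R) = - 1 *: h_ k + h by rewrite scaleN1r addrC.
have Dk k : square_integrable (h - h_ k : T -> R).
  by rewrite DE; apply: square_integrable_lin => //; exact: (Wh k).1.
have D0 : D k @[k --> \oo] --> (0 : R).
  have -> : 0 = \int[mu]_x (0 : R) by rewrite /Rintegral integral0.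
  have [mg g2] := Dg.
  apply: (@dominated_Rintegral _ _ _ mu _ _ (fun x => 4 * g x ^+ 2)).
  - by move=> k; have [mk _] := Dk k; exact: measurable_funM.
  - exact: measurable_cst.
  - apply: aeW => x; have hx : h x @[_ --> \oo] --> h x by exact: cvg_cst.
    have := hl x => /(cvgB hx); rewrite subrr => h0.
    by rewrite -[X in _ --> X](mul0r (0 : R)); exact: (cvgM h0 h0).
  - exact: integrable_RZ.
  - move=> k x; rewrite fctE normrM.
    have hk : `|h x - h_ k x| <= 2 * g x.
      by apply: (le_trans (ler_normB _ _)); have := hg k x; have := hg' x; lra.
    have -> : 4 * g x ^+ 2 = 2 * g x * (2 * g x) by ring.
    exact: ler_pM.
pose F := Num.sqrt (inner f f).
have F0 : 0 <= F by exact: sqrtr_ge0.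
(* The residual of [h - h_ k] is at most [F] times its norm, uniformly in [n]; [F + 1] covers the
   case [F = 0]. *)
have e1 : 0 < (eps / 2 / (F + 1)) ^+ 2 by rewrite exprn_gt0// !divr_gt0//; lra.
have /cvgrPdist_lt/(_ _ e1)[k _ /(_ k (leqnn k))] := D0.
rewrite sub0r normrN (ger0_norm (inner_ge0 _)) => Dsmall.
have e2 : 0 < eps / 2 by rewrite divr_gt0.
have [_ /cvgrPdist_le/(_ _ e2)] := Wh k.
apply: filterS => n; rewrite !sub0r !normrN => small.
have -> : res n f h = res n f (h - h_ k : T -> R) + res n f (h_ k).
  have hE : h = 1 *: (h - h_ k : T -> R) + h_ k by rewrite scale1r subrK.
  rewrite {1}hE /res !(residual_sym inner_sym e n f).
  by rewrite (residual_lin inner_lin De n 1 (Dk k) (Wh k).1 Df) mul1r.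
have bnd := residual_normr_le square_integrable_lin inner_sym inner_lin (fun f _ => inner_ge0 f) De n Df (Dk k).
apply: (le_trans (ler_normD _ _)).
have sq : Num.sqrt (D k) <= eps / 2 / (F + 1).
  have p0 : 0 <= eps / 2 / (F + 1) by rewrite divr_ge0 ?ltW//; lra.
  by rewrite -(ger0_norm p0) -sqrtr_sqr ler_wsqrtr// ltW.
have : F * Num.sqrt (D k) <= eps / 2.
  apply: (@le_trans _ _ (F * (eps / 2 / (F + 1)))); first exact: ler_wpM2l.
  rewrite mulrCA ger_pMr// ler_pdivrMr; lra.
by move: bnd small; rewrite -/F -/(D k) -/res; lra.
Qed.

(** The Dynkin argument takes complements, so it is run inside a fixed set [G (C k)] of finite
    measure, where indicators remain square integrable. *)
Let W_cell (A : set T) k : measurable A -> W (\1_(A `&` G (C k))).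
Proof.
move=> mA.
pose Q (A : set T) := W (\1_(A `&` G (C k))).
have siI (B : set T) : measurable B -> square_integrable (\1_(B `&` G (C k))).
  move=> mB; apply: square_integrable_indic; first exact: measurableI.
  by apply: le_lt_trans (G_fin (C k)); apply: le_measure; rewrite ?inE//; exact: measurableI.
have WG i : W (\1_(G i)).
  split; first exact: De.
  apply: cvg_near_cst; exists i.+1 => // n /= ilt.
  exact: (residual_eq0 square_integrable_lin inner_sym inner_lin (fun f _ => inner_ge0 f) De Df).
apply: (@dynkin_induction _ T (range G) Q) => //.
- by move=> _ _ [i _ <-] [j _ <-]; have [l ->] := GI i j; exists l.
- by rewrite /Q setTI.
- by move=> _ [i _ <-]; rewrite /Q; have [l ->] := GI i (C k).
- move=> S mS QS; rewrite /Q.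
  have -> : \1_(~` S `&` G (C k)) = - 1 *: \1_(S `&` G (C k)) + \1_(G (C k)) :> (T -> R).
    apply/funext => x; rewrite !fctE /= /GRing.scale /= !indicE !in_setI in_setC.
    by case: (x \in S) => /=; rewrite ?mulr1 ?mulr0 ?add0r ?addNr//; case: (x \in _); rewrite ?mulr0 ?mulr1 ?addNr ?addr0.
  by apply: W_lin => //; exact: WG.
- move=> F mF tF QF; rewrite /Q.
  pose h_ n : T -> R := \sum_(i < n) \1_(F i `&` G (C k)).
  have hE n x : h_ n x = (`[< exists2 i, (i < n)%N & F i x >] && (x \in G (C k)))%:R.
    rewrite /h_ fct_sumE; case: asboolP => [[i ilt Fi]|nF].
      rewrite (bigD1 (Ordinal ilt))//= big1 => [|j ji]; rewrite indicE in_setI.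
        by rewrite mem_set// addr0.
      rewrite memNset//= => Fj; move/negP: ji; apply; apply/eqP/val_inj => /=.
      by apply: (tF j i) => //; exists x.
    by rewrite big1// => i _; rewrite indicE in_setI memNset//= => Fi; apply: nF; exists i.
  apply: (@W_lim h_ _ (\1_(G (C k)))).
  + elim => [|n ih]; rewrite /h_.
      rewrite big_ord0; have := W_lin (- 1) (WG (C k)) (WG (C k)).
      by rewrite scaleN1r addNr.
    by rewrite big_ord_recr /= -[X in W (X + _)]scale1r; apply: W_lin => //; exact: QF.
  + apply: measurable_indic; apply: measurableI => //; exact: bigcup_measurable.
  + exact: De.
  + by move=> n x; rewrite hE indicE; case: `[< _ >]; case: (_ \in _); rewrite /= ?normr0 ?normr1.
  + move=> x; apply: cvg_near_cst.
    have [[i Fi]|nF] := pselect (exists i, F i x).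
      exists i.+1 => // n /= ilt; rewrite hE indicE in_setI.
      have -> : (x \in \bigcup_k0 F k0) = true by rewrite mem_set//; exists i.
      by rewrite asboolT//; exists i.
    apply: nearW => n; rewrite hE indicE in_setI.
    rewrite (memNset (A := \bigcup_k0 F k0)); last by move=> -[i _ Fi]; apply: nF; exists i.
    by rewrite asboolF// => -[i _ Fi]; apply: nF; exists i.
- by rewrite -gen.
Qed.

Import HBNNSimple.

(** Simple functions increasing to [h], cut off outside [G (C k)], are finite combinations of the
    indicators just treated; they are dominated by [h], and the cutoff disappears pointwise because
    each point eventually lies in [G (C k)]. *)
Lemma residual_cvg0 h : square_integrable h -> (forall x, 0 <= h x) ->
  residual inner e n f h @[n --> \oo] --> (0 : R).
Proof.
move=> Dh h0; have [mh h2] := Dh.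
have mhE : measurable_fun setT (EFin \o h) by exact/measurable_EFinP.
pose a_ := nnsfun_approx measurableT mhE.
pose h_ k : T -> R := fun x => a_ k x * \1_(G (C k)) x.
have hh0 x : setT x -> (0 <= (EFin \o h) x)%E by move=> _; rewrite lee_fin.
have [] : W h; last by [].
apply: (@W_lim h_ _ h) => //.
- move=> k.
  pose s := finmap.enum_fset (fset_set (range (a_ k))).
  have -> : h_ k = \sum_(y <- s) y *: \1_(a_ k @^-1` [set y] `&` G (C k)).
    apply/funext => x; rewrite /h_ (fimfunE (a_ k) x) fsbig_finite//= -/s.
    rewrite fct_sumE mulr_suml; apply: eq_bigr => y _.
    by rewrite !fctE /= /GRing.scale /= indicI mulrA.
  elim: s => [|y s ih].
    rewrite big_nil; have := W_lin (- 1) (W_cell 0 measurableT) (W_cell 0 measurableT).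
    by rewrite scaleN1r addNr.
  by rewrite big_cons; apply: W_lin => //; exact: W_cell.
- move=> k x; rewrite /h_ ger0_norm; last first.
    by rewrite mulr_ge0// indicE; case: (_ \in _).
  apply: (@le_trans _ _ (a_ k x)).
    by apply: ler_piMr => //; rewrite indicE; case: (_ \in _).
  rewrite /a_ nnsfun_approxE -lee_fin.
  exact: (le_approx k hh0).
- move=> x; rewrite -[X in _ --> X]mulr1; apply: cvgM; last first.
    by apply: cvg_near_cst; apply: filterS (C_cover x) => k Gx; rewrite indicE mem_set.
  by have := cvg_nnsfun_approx measurableT mhE hh0 (I : setT x) => /fine_cvgP[].
Qed.

End square_integrable_functions.

(** * A countable family of cells generating the Borel sets *)

Section rational_cells.
Context (R : realType) (d : nat).
Local Notation V := 'rV[R]_d.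

(** A rational lower corner and one common upper bound: countably many bounded sets, stable under
    intersection by taking the maximum of the corners and the minimum of the bounds. *)
Definition rational_cell (c : 'rV[rat]_d * nat) : set V :=
  mx_box (fun _ j => `]ratr (c.1 0 j), c.2%:R]%classic).

Definition cell (k : nat) : set V := rational_cell (odflt (0, 0%N) (unpickle k)).

Lemma cell_pickle c : cell (pickle c) = rational_cell c.
Proof. by rewrite /cell pickleK. Qed.

Lemma measurable_cell k : measurable (cell k).
Proof. by apply: measurable_mx_box => i j; exact: measurable_itv. Qed.

Lemma cell_fin k : (@lebmx R 1 d (cell k) < +oo)%E.
Proof.
rewrite /lebmx lebesgue_mx_box; last by move=> i j; exact: measurable_itv.
apply: prode_lty => i; apply/andP; split; first by apply: prode_ge0.
apply: prode_lty => j; rewrite measure_ge0/= lebesgue_measure_itv/=.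
by case: ifP => // _; rewrite ltry.
Qed.

Lemma cellI i j : exists k, cell i `&` cell j = cell k.
Proof.
rewrite /cell; move: (odflt _ _) (odflt _ _) => [u N] [v M].
exists (pickle ((\row_l Num.max (u 0 l) (v 0 l)) : 'rV[rat]_d, minn N M)).
rewrite pickleK /=; apply/seteqP; split=> x /=.
  move=> [h1 h2] r l; have := h1 r l; have := h2 r l.
  rewrite /= !in_itv /= mxE => /andP[a1 a2] /andP[b1 b2]; apply/andP; split.
    by case: (leP (u 0 l) (v 0 l)).
  by case: (leqP N M).
move=> h; split=> r l; have := h r l; rewrite /= !in_itv /= mxE => /andP[a1 a2].
  apply/andP; split.
    by apply: le_lt_trans a1; rewrite ler_rat le_max lexx orbT.
  by apply: le_trans a2 _; rewrite ler_nat geq_minr.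
apply/andP; split.
  by apply: le_lt_trans a1; rewrite ler_rat le_max lexx.
by apply: le_trans a2 _; rewrite ler_nat geq_minl.
Qed.

Lemma near_cell_cover (x : V) :
  \forall k \near \oo, rational_cell (const_mx (- k.+1%:R), k) x.
Proof.
pose M := \sum_j `|x 0 j|.
exists (Num.truncn M).+1 => // k /= Mk i j; rewrite ord1 /= in_itv /= mxE rmorphN /= ratr_nat.
have xM : `|x 0 j| <= k%:R.
  apply: (@le_trans _ _ M); first by rewrite /M (bigD1 j)//= lerDl sumr_ge0.
  by apply: (le_trans (ltW (truncnS_gt _))); rewrite ler_nat.
move: xM; rewrite ler_norml => /andP[h1 ->]; rewrite andbT.
by apply: lt_le_trans h1; rewrite ltrN2 ltr_nat.
Qed.

Lemma cell_generates : @measurable _ V = <<s range cell >>.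
Proof.
apply/seteqP; split; last first.
  apply: smallest_sub; first exact: sigma_algebra_measurable.
  by move=> _ [k _ <-]; exact: measurable_cell.
apply: smallest_sub; first exact: smallest_sigma_algebra.
move=> _ [[i j] _ [B mB <-]]; rewrite setTI /=.
have mj : @measurable_fun _ _ (g_sigma_algebraType (range cell)) R setT (fun x : V => x i j).
  apply: (measurability _ (RGenOInfty.measurableE R)) => //.
  move=> _ [_ [a ->] <-]; rewrite setTI.
  (* The open half-space is the union of the cells that it contains. *)
  pose F k := if `[< cell k `<=` [set x : V | a < x i j] >] then cell k else set0.
  rewrite (_ : _ @^-1` _ = \bigcup_k F k).
    apply: bigcupT_measurable => k; rewrite /F; case: ifP => _ //.
    by apply: sub_sigma_algebra; exists k.
  apply/seteqP; split=> x /=.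
    rewrite in_itv /= andbT => ax.
    have [q] := rat_in_itvoo ax; rewrite in_itv /= => /andP[aq qx].
    have [N _ /(_ N (leqnn N)) hN] := near_cell_cover x.
    (* Only coordinate [j] has to be cut at a rational between [a] and [x i j]; elsewhere the cell
       around [x] of index [N] is kept. *)
    pose u : 'rV[rat]_d := \row_l if l == j then q else - N.+1%:R.
    exists (pickle (u, N)) => //; rewrite /F cell_pickle.
    have -> : `[< rational_cell (u, N) `<=` [set x : V | a < x i j] >].
      apply/asboolP => y /(_ i j); rewrite /= in_itv /= mxE eqxx => /andP[qy _].
      exact: lt_trans qy.
    move=> r l; have := hN r l; rewrite /= !in_itv /= !mxE => /andP[h1 ->]; rewrite andbT.
    by case: eqP => [->|//]; rewrite ord1 -(ord1 i).
  move=> [k _]; rewrite /F; case: asboolP => // h /h /=.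
  by rewrite in_itv /= andbT.
by have := mj (measurableT) B mB; rewrite setTI.
Qed.

(** Coordinates in which the scalar product of L^2 becomes a sum over integers, so that a Gaussian
    field can be written as a random series. *)
Lemma exists_features : exists c : (V -> R) -> nat -> R, forall f g,
  square_integrable (@lebmx R 1 d) f -> square_integrable (@lebmx R 1 d) g ->
  (forall x, 0 <= g x) ->
  \sum_(k < n) c f k * c g k @[n --> \oo] --> inner (@lebmx R 1 d) f g.
Proof.
pose e k : V -> R := \1_(cell k).
have De k : square_integrable (@lebmx R 1 d) (e k).
  by apply: square_integrable_indic; [exact: measurable_cell|exact: cell_fin].
exists (fun f k => chol (inner (@lebmx R 1 d)) e k f) => f g sf sg g0.
apply: (chol_parseval (@square_integrable_lin _ _ _ _) (@inner_sym _ _ _ _)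
  (@inner_lin _ _ _ _) (fun f _ => inner_ge0 _ f) De).
apply: (residual_cvg0 (C := fun k => pickle ((const_mx (- k.+1%:R), k) : 'rV[rat]_d * nat))) => //.
- exact: measurable_cell.
- exact: cell_fin.
- exact: cellI.
- exact: cell_generates.
- by move=> x; apply: filterS (near_cell_cover x) => k; rewrite cell_pickle.
Qed.

End rational_cells.

(** * Uniqueness of characteristic functions *)

Section characteristic_uniqueness.
Context (R : realType).

Lemma cvg_ramp (T : Type) (F : set_system T) (FF : Filter F) (f : T -> R) (a l : R) :
  f x @[x --> F] --> l ->
  Num.min 1 (a * Num.max 0 (f x)) @[x --> F] --> Num.min 1 (a * Num.max 0 l).
Proof.
have E z : Num.min 1 (a * Num.max 0 z) =
    (1 + a * ((0 + z + `|0 - z|) / 2) - `|1 - a * ((0 + z + `|0 - z|) / 2)|) / 2.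
  by rewrite minr_absE maxr_absE.
move=> fl; under eq_fun do rewrite E; rewrite E.
have c0 : (0 : R) @[_ --> F] --> (0 : R) by exact: cvg_cst.
have c1 : (1 : R) @[_ --> F] --> (1 : R) by exact: cvg_cst.
have ca : a @[_ --> F] --> a by exact: cvg_cst.
have c2 : (2^-1 : R) @[_ --> F] --> (2^-1 : R) by exact: cvg_cst.
have cn : `|0 - f x| @[x --> F] --> `|0 - l| by apply: cvg_norm; exact: cvgB.
have cz : a * ((0 + f x + `|0 - f x|) / 2) @[x --> F] --> a * ((0 + l + `|0 - l|) / 2).
  by apply: cvgM => //; apply: cvgM => //; apply: cvgD => //; exact: cvgD.
have cm : `|1 - a * ((0 + f x + `|0 - f x|) / 2)| @[x --> F] --> `|1 - a * ((0 + l + `|0 - l|) / 2)|.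
  by apply: cvg_norm; exact: cvgB.
by apply: cvgM => //; apply: cvgB => //; exact: cvgD.
Qed.

Lemma continuous_prod_seq (T : topologicalType) (I : Type) (s : seq I) (f : I -> T -> R) :
  (forall i, continuous (f i)) -> continuous (fun x => \prod_(i <- s) f i x).
Proof.
move=> cf x; rewrite /continuous_at; elim: s => [|i s ih].
  by under eq_fun do rewrite big_nil; rewrite big_nil; exact: cvg_cst.
by under eq_fun do rewrite big_cons; rewrite big_cons; apply: cvgM => //; exact: cf.
Qed.

Lemma cell_indicator_lim (m : nat) (u x : 'rV[R]_m) :
  \prod_(j < m) Num.min 1 (n%:R * Num.max 0 (x 0 j - u 0 j)) @[n --> \oo] -->
  (\1_(mx_box (fun _ j => `]u 0 j, +oo[%classic)) x : R).
Proof.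
rewrite indicE; have [h|h] := pselect (mx_box (fun _ j => `]u 0 j, +oo[%classic) x).
  rewrite mem_set//; apply: cvg_near_cst.
  have : \forall n \near \oo, forall j, 1 <= n%:R * (x 0 j - u 0 j).
    apply: filter_forall => j; have := h 0 j; rewrite /= in_itv /= andbT -subr_gt0 => uj.
    exists (Num.truncn (x 0 j - u 0 j)^-1).+1 => // n /= jn.
    rewrite -ler_pdivrMr// mul1r; apply: le_trans (ltW (truncnS_gt _)) _.
    by rewrite ler_nat.
  apply: filterS => n hn; rewrite big1// => j _; apply/min_idPl.
  apply: le_trans (hn j) _; apply: ler_wpM2l => //; by rewrite le_max lexx orbT.
rewrite memNset//; apply: cvg_near_cst; apply: nearW => n.
have [j hj] : exists j, x 0 j <= u 0 j.
  apply: contrapT => nj; apply: h => i j; rewrite ord1 /= in_itv /= andbT ltNge; apply/negP => hj.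
  by apply: nj; exists j.
rewrite (bigD1 j)//= (_ : Num.max 0 (x 0 j - u 0 j) = 0); last by apply/max_idPl; rewrite subr_le0.
by rewrite mulr0 (min_idPr ler01) mul0r.
Qed.

(** The continuity theorem for the constant sequence [mu] gives equality of the integrals of bounded
    continuous functions. Products of ramps tend to indicators of open orthants, which are stable
    under intersection and generate the sigma-algebra. *)
Lemma mx_probability_unique_cos m (mu nu : probability 'rV[R]_m R) :
  (forall t th, \int[mu]_x cos (dotv t x + th) = \int[nu]_x cos (dotv t x + th)) ->
  forall A, measurable A -> mu A = nu A.
Proof.
move=> cf A mA.
pose box (u : 'rV[R]_m) : set 'rV[R]_m := mx_box (fun _ j => `]u 0 j, +oo[%classic).
have mbox u : measurable (box u) by apply: measurable_mx_box => i j; exact: measurable_itv.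
pose G := range box.
have Gm : G `<=` measurable by move=> _ [u _ <-].
pose h (u : 'rV[R]_m) n (x : 'rV[R]_m) : R := \prod_(j < m) Num.min 1 (n%:R * Num.max 0 (x 0 j - u 0 j)).
have h01 u n x : 0 <= h u n x <= 1.
  rewrite /h; apply/andP; split.
    by apply: prodr_ge0 => j _; rewrite le_min ler01 mulr_ge0// le_max lexx.
  apply: prodr_ile1 => j _; rewrite ge_min lexx andbT.
  by rewrite le_min ler01 mulr_ge0// le_max lexx.
have ch u n : continuous (h u n).
  have c1 j : continuous (fun x : 'rV[R]_m => Num.min 1 (n%:R * Num.max 0 (x 0 j - u 0 j))).
    move=> x; apply: (@continuous_comp _ _ _ (fun y : 'rV[R]_m => y 0 j)
      (fun z : R => Num.min 1 (n%:R * Num.max 0 (z - u 0 j))) x); first exact: coord_continuous.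
    by apply: cvg_ramp; apply: cvgB; [exact: cvg_id|exact: cvg_cst].
  by apply: continuous_prod_seq => j; exact: c1.
have Rh u n : \int[mu]_x h u n x = \int[nu]_x h u n x.
  have cf' t th : \int[mu]_x cos (dotv t x + th) @[_ --> \oo] --> \int[nu]_x cos (dotv t x + th).
    by rewrite cf; exact: cvg_cst.
  have bh : exists M, forall x, `|h u n x| <= M.
    by exists 1 => x; have /andP[a b] := h01 u n x; rewrite ger0_norm.
  have := @levy_continuity R m (fun=> mu) nu cf' (h u n) (ch u n) bh.
  by move=> l; apply: (cvg_unique _ (cvg_cst _) l).
have boxE u : mu (box u) = nu (box u).
  have lim (P : probability 'rV[R]_m R) : \int[P]_x h u n x @[n --> \oo] --> \int[P]_x (\1_(box u) x : R).
    apply: (@dominated_Rintegral _ _ _ P _ _ (fun=> 1)).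
    - by move=> n; exact: continuous_measurable_mx.
    - exact: measurable_indic.
    - by apply: aeW => x; exact: cell_indicator_lim.
    - exact: finite_measure_integrable_cst.
    - by move=> n x; have /andP[a b] := h01 u n x; rewrite ger0_norm.
  have e : \int[mu]_x (\1_(box u) x : R) = \int[nu]_x (\1_(box u) x : R).
    have E : (fun n => \int[mu]_x h u n x) = (fun n => \int[nu]_x h u n x) by apply/funext.
    by have := lim mu; rewrite E => /cvg_unique; apply => //; exact: lim.
  have {}e := congr1 EFin e; move: e; rewrite /Rintegral !integral_indic// !setIT.
  by rewrite !fineK// fin_num_measure.
apply: (@g_sigma_algebra_measure_unique _ _ _ G Gm (fun k => box (const_mx (- k%:R)))) => //.
- by move=> k; exists (const_mx (- k%:R)).
- apply/seteqP; split=> // x _.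
  pose M := \sum_j `|x 0 j|.
  exists (Num.truncn M).+1 => // i j; rewrite ord1 /= in_itv /= mxE andbT.
  apply: (@lt_le_trans _ _ (- `|x 0 j|)); last by rewrite lerNl -normrN ler_norm.
  rewrite ltrN2; apply: le_lt_trans (truncnS_gt _).
  by rewrite /M (bigD1 j)//= lerDl sumr_ge0.
- move=> _ _ [u _ <-] [v _ <-]; exists (\row_j Num.max (u 0 j) (v 0 j)) => //.
  apply/seteqP; split=> x /=.
    move=> h2; split=> i j; have := h2 i j; rewrite /= !in_itv /= mxE !andbT gt_max => /andP[]//.
  by move=> [h1 h2] i j; have := h1 i j; have := h2 i j; rewrite /= !in_itv /= mxE !andbT gt_max => -> ->.
- by move=> _ [u _ <-]; exact: boxE.
- by move=> k; apply: le_lt_trans (probability_le1 _ _) _ => //; rewrite ltry.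
have sub : @measurable _ 'rV[R]_m `<=` <<s G >>.
  apply: smallest_sub; first exact: smallest_sigma_algebra.
  move=> _ [[i j] _ [B mB <-]]; rewrite setTI /=.
  have mj : @measurable_fun _ _ (g_sigma_algebraType G) R setT (fun x : 'rV[R]_m => x i j).
    apply: (measurability _ (RGenOInfty.measurableE R)) => //.
    move=> _ [_ [a ->] <-]; rewrite setTI.
    rewrite (_ : _ @^-1` _ = \bigcup_n box (\row_l if l == j then a else - n%:R)).
      by apply: bigcupT_measurable => n; apply: sub_sigma_algebra; eexists.
    apply/seteqP; split=> x /=; rewrite in_itv /= andbT.
      move=> ax; pose M := \sum_j `|x 0 j|.
      exists (Num.truncn M).+1 => // r l; rewrite ord1 /= in_itv /= mxE andbT.
      case: eqP => [->|_]; first by rewrite -(ord1 i).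
      apply: (@lt_le_trans _ _ (- `|x 0 l|)); last by rewrite lerNl -normrN ler_norm.
      rewrite ltrN2; apply: le_lt_trans (truncnS_gt _).
      by rewrite /M (bigD1 l)//= lerDl sumr_ge0.
    by move=> [n _] /(_ i j); rewrite /= in_itv /= mxE eqxx andbT.
  by have := mj (measurableT) B mB; rewrite setTI.
exact: sub.
Qed.

Lemma probability_unique_cos (mu nu : probability R R) :
  (forall t th, \int[mu]_x cos (t * x + th) = \int[nu]_x cos (t * x + th)) ->
  forall A, measurable A -> mu A = nu A.
Proof.
move=> cf A mA.
pose J (x : R) : 'rV[R]_1 := \row_(_ < 1) x.
have mJ : measurable_fun setT J.
  by apply: measurable_mx => i j; under eq_fun do rewrite mxE; exact: measurable_id.
have mB : measurable [set x : 'rV[R]_1 | A (x 0 0)].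
  by rewrite -[X in measurable X]setTI; apply: measurable_mx_entry.
have E (P : probability R R) : law P mJ [set x : 'rV[R]_1 | A (x 0 0)] = P A.
  by rewrite lawE; congr (P _); apply/seteqP; split=> x /=; rewrite mxE.
rewrite -(E mu) -(E nu); apply: mx_probability_unique_cos => // t th.
have D (P : probability R R) : \int[law P mJ]_x cos (dotv t x + th) = \int[P]_x cos (t 0 0 * x + th).
  rewrite (@Rintegral_law _ _ _ _ _ P _ mJ _ 1); last 2 first.
  - exact: measurable_cos_dotv.
  - by move=> x; exact: normr_cos_le1.
  by apply: eq_Rintegral => x _; rewrite /dotv big_ord1 mxE.
by rewrite !D.
Qed.

End characteristic_uniqueness.

Lemma ray_measure_unique (R : realType) (m1 m2 : {measure set R -> \bar R}) :
  (m1 setT < +oo)%E -> (forall x, m1 `]x, +oo[%classic = m2 `]x, +oo[%classic) ->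
  forall A, measurable A -> m1 A = m2 A.
Proof.
move=> m1y m12 A mA.
have Gm : @RGenOInfty.G R `<=` measurable by move=> _ [x ->]; exact: measurable_itv.
apply: (@g_sigma_algebra_measure_unique _ _ _ (@RGenOInfty.G R) Gm (fun k => `]- k%:R, +oo[%classic)) => //.
- by move=> k; exists (- k%:R).
- apply/seteqP; split=> // x _; exists (Num.truncn `|x|).+1 => //=.
  rewrite in_itv /= andbT; apply: (@lt_le_trans _ _ (- `|x|)); last by rewrite lerNl -normrN ler_norm.
  by rewrite ltrN2 truncnS_gt.
- move=> _ _ [x ->] [y ->]; exists (Num.max x y); apply/seteqP; split=> z /=; rewrite !in_itv /= !andbT gt_max.
    by move=> [-> ->].
  by move=> /andP[].
- by move=> _ [x ->].
- by move=> k; apply: le_lt_trans m1y; apply: le_measure; rewrite ?inE//; exact: measurable_itv.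
- suff: (RGenOInfty.G (R:=R)).-sigma.-measurable A by [].
  by rewrite -RGenOInfty.measurableE.
Qed.

(** * Independent normal variables on the unit interval *)

Section uniform_bits.
Context (R : realType).
(* [law _ measurable_id] moves a measure from the Lebesgue-generated
   structure to the Borel structure carried by [R] itself. *)
Definition uniform01 : probability R R :=
  law (uniform_prob (@ltr01 R)) (@measurable_id _ R setT).

Local Notation U := uniform01.

Lemma uniform01E (A : set R) : measurable A -> U A = lebesgue_measure (A `&` `[0, 1]%classic).
Proof.
move=> mA; have := @integral_uniform R 0 1 ltr01 (EFin \o \1_A).
rewrite integral_indic// setIT => ->; last 2 first.
- by apply/measurable_EFinP; exact: measurable_indic.
- by move=> x; rewrite /= lee_fin.
by rewrite subr0 invr1 mul1e integral_indic//; exact: measurable_itv.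
Qed.

Lemma uniform01_ray (x : R) : U `]x, +oo[%classic = (Num.max 0 (Num.min 1 (1 - x)))%:E.
Proof.
rewrite uniform01E; last exact: measurable_itv.
have [x0|x0] := ltP x 0.
  rewrite (_ : _ `&` _ = `[0, 1]%classic); last first.
    apply/seteqP; split=> y /=; rewrite !in_itv /= ?andbT; first by case.
    by move=> /andP[y0 y1]; split; [exact: lt_le_trans y0|rewrite y0].
  rewrite lebesgue_measure_itv /= lte_fin ltr01 -EFinB subr0; congr EFin.
  by rewrite min_l; [rewrite max_r|lra].
have [x1|x1] := ltP x 1.
  rewrite (_ : _ `&` _ = `]x, 1]%classic); last first.
    apply/seteqP; split=> y /=; rewrite !in_itv /= ?andbT; first by move=> [-> /andP[_ ->]].
    by move=> /andP[y0 y1]; split=> //; rewrite y1 andbT; apply: (le_trans x0); exact: ltW.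
  rewrite lebesgue_measure_itv /= lte_fin x1 -EFinB; congr EFin.
  by rewrite min_r; [rewrite max_r//; lra|lra].
rewrite (_ : _ `&` _ = set0); last first.
  apply/seteqP; split=> y //=; rewrite !in_itv /= ?andbT; lra.
by rewrite measure0 max_l//; rewrite ge_min; apply/orP; right; lra.
Qed.

(** For [k] equal to 0 and 1, the two inverse branches of the doubling map. *)
Let half (k : R) (y : R) : R := (y + k) / 2.
Let mhalf k : measurable_fun setT (half k).
Proof. by apply: measurable_funM => //; exact: measurable_funD. Qed.

Let half_ge0 : 0 <= 2^-1 :> R. Proof. by rewrite invr_ge0. Qed.

Let nu : {measure set R -> \bar R} :=
  measure_add (mscale (NngNum half_ge0) (law U (mhalf 0))) (mscale (NngNum half_ge0) (law U (mhalf 1))).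

Let nuE B : nu B = ((2^-1)%:E * U (half 0 @^-1` B) + (2^-1)%:E * U (half 1 @^-1` B))%E.
Proof. exact: measure_addE. Qed.

(** Self-similarity of the uniform law: it is the equal mixture of its images under the two
    branches. It suffices to compare rays. *)
Let U_nu (A : set R) : measurable A -> U A = nu A.
Proof.
have U1 : (U setT < +oo)%E by rewrite probability_setT ltry.
apply: (@ray_measure_unique R U nu U1) => // x; rewrite nuE.
have pre k : half k @^-1` `]x, +oo[%classic = `]2 * x - k, +oo[%classic.
  by apply/seteqP; split=> y /=; rewrite !in_itv /= !andbT /half; lra.
pose r y : R := Num.max 0 (Num.min 1 (1 - y)).
have e k : U (half k @^-1` `]x, +oo[%classic) = (r (2 * x - k))%:E.
  by rewrite -[RHS]uniform01_ray; congr (U _); exact: pre.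
transitivity ((2^-1)%:E * (r (2 * x - 0))%:E + (2^-1)%:E * (r (2 * x - 1))%:E)%E; last first.
  by congr (_ * _ + _ * _)%E; apply: esym; exact: e.
apply: (etrans (uniform01_ray x)); rewrite -!EFinM -EFinD; apply: (congr1 EFin).
have r1 y : y <= 0 -> r y = 1 by move=> y0; rewrite /r min_l ?max_r; lra.
have r2 y : 0 <= y -> y <= 1 -> r y = 1 - y by move=> y0 y1; rewrite /r min_r ?max_r; lra.
have r3 y : 1 <= y -> r y = 0 by move=> y1; rewrite /r min_r ?max_l; lra.
rewrite -/(r x); have [x0|x0] := leP x 0; first by rewrite !r1; lra.
have [x1|x1] := leP x 2^-1; first by rewrite (r2 x) ?(r2 (2 * x - 0)) ?r1; lra.
have [x2|x2] := leP x 1; first by rewrite (r2 x) ?(r2 (2 * x - 1)) ?r3; lra.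
by rewrite !r3; lra.
Qed.

Lemma uniform01_halves (F : R -> R) (M : R) : measurable_fun setT F -> (forall x, `|F x| <= M) ->
  \int[U]_x F x = 2^-1 * \int[U]_x F (x / 2) + 2^-1 * \int[U]_x F ((x + 1) / 2).
Proof.
(* Integration against a sum of measures is applied to nonnegative functions, hence the shift by
   [M]. *)
move=> mF FM; pose G x := F x + M.
have G0 x : 0 <= G x by have := FM x; rewrite /G ler_norml; lra.
have mG : measurable_fun setT G by exact: measurable_funD.
have iF k : U.-integrable setT (fun x => (F (half k x))%:E).
  by apply: (@bounded_integrable _ _ _ U _ M) => //; exact: (measurableT_comp mF (mhalf k)).
have iFi : U.-integrable setT (fun x => (F x)%:E) by exact: (@bounded_integrable _ _ _ U _ M).
have GE : (\int[U]_x (G x)%:E = (2^-1)%:E * \int[U]_x (G (half 0 x))%:E + (2^-1)%:E * \int[U]_x (G (half 1 x))%:E)%E.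
  transitivity (\int[nu]_x (G x)%:E)%E.
    by apply: (@eq_measure_integral _ _ R setT nu) => A mA _; exact: U_nu.
  rewrite ge0_integral_measure_add//; last 2 first.
  - by move=> x _; rewrite lee_fin.
  - by apply/measurable_EFinP.
  rewrite !ge0_integral_mscale//; try (by apply/measurable_EFinP); try (by move=> x _; rewrite lee_fin).
  have pw k : (\int[law U (mhalf k)]_x (G x)%:E = \int[U]_x (G (half k x))%:E)%E.
    have mGE : measurable_fun setT (fun x => (G x)%:E) by exact/measurable_EFinP.
    have GE0 : {in setT, forall y : R, (0 <= (G y)%:E)%E} by move=> y _; rewrite lee_fin.
    exact: (@ge0_integral_pushforward _ _ _ _ R _ (mhalf k) U _ _ measurableT mGE GE0).
  by congr (_ * _ + _ * _)%E; exact: pw.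
have GR (H : R -> R) : U.-integrable setT (fun x => (H x)%:E) ->
    (\int[U]_x (H x + M)%:E)%E = (\int[U]_x H x + M)%:E.
  move=> iH; have iM : U.-integrable setT (fun=> M%:E) by exact: finite_measure_integrable_cst.
  rewrite -[in RHS](Rintegral_probability_cst U M) -(RintegralD measurableT iH iM) /Rintegral fineK//.
  by apply: integrable_fin_num => //; exact: integrable_RD.
move: GE; rewrite /G (GR _ iFi) (GR _ (iF 0)) (GR _ (iF 1)) -!EFinM -EFinD => -[].
have -> : \int[U]_x F (half 0 x) = \int[U]_x F (x / 2).
  by apply: eq_Rintegral => x _; rewrite /half addr0.
by rewrite /half; lra.
Qed.

End uniform_bits.

Lemma Rintegral_cosD d (T : measurableType d) (R : realType) (P : probability T R)
    (Y : T -> R) (th : R) : measurable_fun setT Y ->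
  \int[P]_x cos (Y x + th) = complex.Re (cint P (fun x => cis (Y x)) * cis th).
Proof.
move=> mY; rewrite cReM /cint /=.
have b1 x : normc (cis (Y x)) <= 1 by rewrite normc_cis.
have [iC iS] := normc_cint_bounded P (cmeasurable_cis mY) b1.
have iC' : P.-integrable setT (fun x => (cos (Y x))%:E) by exact: iC.
have iS' : P.-integrable setT (fun x => (sin (Y x))%:E) by exact: iS.
rewrite [_ * cos th]mulrC [_ * sin th]mulrC -(RintegralZl _ measurableT iC') -(RintegralZl _ measurableT iS').
rewrite -(RintegralB measurableT (integrable_RZ _ iC') (integrable_RZ _ iS')).
by apply: eq_Rintegral => w _; rewrite cosD; ring.
Qed.

(** * Independence of the binary digits *)

Section binary_digits.
Context (R : realType).
Local Notation U := (@uniform01 R).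

Definition bit (x : R) : bool := 2^-1 <= x.

Definition doubling (x : R) : R := 2 * x - (bit x)%:R.

Definition digit (i : nat) (x : R) : bool := bit (iter i doubling x).

Lemma bitE x : (bit x)%:R = \1_(`[2^-1, +oo[%classic) x :> R.
Proof. by rewrite indicE; congr (_%:R); apply/esym; rewrite mem_setE in_itv /= andbT. Qed.

Lemma measurable_bit : measurable_fun setT (fun x => (bit x)%:R : R).
Proof.
rewrite (_ : (fun x => _) = \1_(`[2^-1, +oo[%classic)); last by apply/funext => x; exact: bitE.
by apply: measurable_indic; exact: measurable_itv.
Qed.

Lemma measurable_doubling : measurable_fun setT doubling.
Proof. by apply: measurable_funB; [exact: measurable_funM|exact: measurable_bit]. Qed.

Lemma measurable_digit i : measurable_fun setT (fun x => (digit i x)%:R : R).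
Proof.
apply: (measurableT_comp measurable_bit); elim: i => [|i ih]; first exact: measurable_id.
exact: (measurableT_comp measurable_doubling ih).
Qed.

Lemma cmeasurable_digit (w : bool -> R[i]) i : cmeasurable (fun x => w (digit i x)).
Proof.
rewrite (_ : (fun x => _) = fun x => w false + ((digit i x)%:R%:C)%C * (w true - w false)).
  apply: cmeasurableD; first exact: cmeasurable_cst.
  apply: cmeasurableM; last exact: cmeasurable_cst.
  by split=> /=; [exact: measurable_digit|exact: measurable_cst].
apply/funext => x; case: (digit i x).
  by rewrite (_ : ((true%:R : R)%:C)%C = 1)// mul1r addrC subrK.
by rewrite (_ : ((false%:R : R)%:C)%C = 0)// mul0r addr0.
Qed.

Lemma uniform01_ae : {ae U, forall x, 0 < x < 1}.
Proof.
exists (~` `]0, 1[%classic); split.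
- by apply: measurableC; exact: measurable_itv.
- rewrite [LHS]uniform01E; last by apply: measurableC; exact: measurable_itv.
  rewrite (_ : _ `&` _ = [set 0; 1]).
    by apply: countable_lebesgue_measure0; apply: finite_set_countable; exact: finite_set2.
  apply/seteqP; split=> x /=; rewrite !in_itv /=.
    move=> [/negP h /andP[x0 x1]]; move: h; rewrite negb_and -!leNgt => /orP[h|h].
      by left; apply/eqP; rewrite eq_le h x0.
    by right; apply/eqP; rewrite eq_le h x1.
  by move=> [] ->; rewrite ?lexx ?ler01 ?ltxx ?andbF.
- by move=> x /= h; rewrite in_itv.
Qed.

Lemma uniform01_eq (A B : set R) : measurable A -> measurable B ->
  (forall x, 0 < x < 1 -> A x <-> B x) -> U A = U B.
Proof.
have le (A' B' : set R) : measurable A' -> measurable B' ->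
    (forall x : R, 0 < x < 1 -> A' x -> B' x) -> (U A' <= U B')%E.
  move=> mA' mB' AB; have [N [mN N0 sN]] := uniform01_ae.
  apply: (@le_trans _ _ (U (B' `|` N))).
    apply: le_measure; rewrite ?inE//; first exact: measurableU.
    move=> x A'x; have [x01|x01] := boolP (0 < x < 1); first by left; exact: AB.
    by right; apply: sN; exact/negP.
  by rewrite measureU0.
move=> mA mB AB; apply/eqP; rewrite eq_le.
by apply/andP; split; apply: le => // x x01; have [] := AB x x01.
Qed.

Let cint_ae (f g : R -> R[i]) : cmeasurable f -> cmeasurable g ->
  (forall x, 0 < x < 1 -> f x = g x) -> cint U f = cint U g.
Proof.
move=> [f1 f2] [g1 g2] fg; rewrite /cint; congr (_ +i* _)%C; congr fine;
  apply: ae_eq_integral => //; try (by apply/measurable_EFinP);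
  have [N [mN N0 sN]] := uniform01_ae; exists N; split => // x /= h; apply: sN => /= h2; apply: h => _; by rewrite fg.
Qed.

(** The first digit is independent of the rest: on each half the digit is constant and [doubling]
    inverts the corresponding branch. The endpoints, where this may fail, have measure 0. *)
Lemma cint_bit_doubling (w : bool -> R[i]) (G : R -> R[i]) (M : R) : cmeasurable G ->
  (forall x, normc (G x) <= M) ->
  cint U (fun x => w (bit x) * G (doubling x)) = (w false + w true) * (2^-1%:C)%C * cint U G.
Proof.
move=> mG GM; pose F x := w (bit x) * G (doubling x).
have mF : cmeasurable F.
  apply: cmeasurableM; first exact: (cmeasurable_digit w 0).
  exact: (cmeasurable_comp mG measurable_doubling).
have M0 : 0 <= M by apply: le_trans (normc_ge0 _) (GM 0).
pose W := normc (w false) + normc (w true).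
have FM x : normc (F x) <= W * M.
  rewrite normcM; apply: ler_pM; rewrite ?normc_ge0//.
  by case: (bit x); rewrite /W ?lerDl ?lerDr normc_ge0.
have mh k : measurable_fun setT (fun x : R => (x + k) / 2).
  by apply: measurable_funM => //; exact: measurable_funD.
have mh0 : measurable_fun setT (fun x : R => x / 2) by exact: measurable_funM.
have split2 : cint U F = (2^-1%:C)%C * (cint U (fun x => F (x / 2)) + cint U (fun x => F ((x + 1) / 2))).
  have [F1 F2] := mF; rewrite /cint.
  rewrite (uniform01_halves F1 (fun x => le_trans (normr_Re_le _) (FM x))).
  rewrite (uniform01_halves F2 (fun x => le_trans (normr_Im_le _) (FM x))).
  by apply: complex_eq; rewrite ?cReM ?cImM ?cReD ?cImD /=; ring.
have iG : cintegrable U G by exact: (normc_cint_bounded _ mG GM).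
rewrite [LHS]split2.
have -> : cint U (fun x => F (x / 2)) = w false * cint U G.
  rewrite -(cintZ _ iG); apply: cint_ae.
  - exact: (cmeasurable_comp mF mh0).
  - by apply: cmeasurableM => //; exact: cmeasurable_cst.
  - move=> x /andP[x0 x1]; have b0 : bit (x / 2) = false by apply/negbTE; rewrite -ltNge; lra.
    by rewrite /F /doubling b0 subr0; congr (_ * G _); lra.
have -> : cint U (fun x => F ((x + 1) / 2)) = w true * cint U G.
  rewrite -(cintZ _ iG); apply: cint_ae.
  - exact: (cmeasurable_comp mF (mh 1)).
  - by apply: cmeasurableM => //; exact: cmeasurable_cst.
  - move=> x /andP[x0 x1]; have b0 : bit ((x + 1) / 2) = true by rewrite /bit; lra.
    by rewrite /F /doubling b0; congr (_ * G _); rewrite /=; lra.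
by rewrite -mulrDl mulrA [_ * (w false + _)]mulrC.
Qed.

Lemma cint_prod_digits (w : nat -> bool -> R[i]) n :
  cint U (fun x => \prod_(i < n) w i (digit i x)) =
  \prod_(i < n) ((w i false + w i true) * (2^-1%:C)%C).
Proof.
elim: n w => [|n ih] w.
  rewrite big_ord0 (eq_cint _ (g := fun=> 1)); last by move=> x; rewrite big_ord0.
  by rewrite /cint /= !Rintegral_probability_cst.
rewrite big_ord_recl -(ih (fun i => w i.+1)).
pose G x := \prod_(i < n) w i.+1 (digit i x).
pose M := \prod_(i < n) (normc (w i.+1 false) + normc (w i.+1 true)).
rewrite -(@cint_bit_doubling (w 0%N) G M).
- apply: eq_cint => x; rewrite big_ord_recl; congr (_ * _).
  by apply: eq_bigr => i _; rewrite /digit /bump /= -iterSr.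
- by apply: cmeasurable_prod => i; exact: cmeasurable_digit.
- move=> x; rewrite normc_prod; apply: ler_prod => i _; rewrite normc_ge0 /=.
  by case: (digit i x); rewrite ?lerDl ?lerDr normc_ge0.
Qed.

End binary_digits.

Lemma big_ord_double (R : Type) (idx : R) (op : Monoid.law idx) (F : nat -> R) n :
  \big[op/idx]_(j < n.*2) F j = \big[op/idx]_(i < n) op (F i.*2) (F i.*2.+1).
Proof.
elim: n => [|n ih]; first by rewrite !big_ord0.
by rewrite doubleS !big_ord_recr /= ih Monoid.mulmA.
Qed.

(** * Splitting one uniform variable into two *)

Section binary_expansions.
Context (R : realType).
Local Notation U := (@uniform01 R).

Definition partial_binary (s : nat -> bool) n : R := \sum_(i < n) (s i)%:R * 2^-1 ^+ i.+1.

Definition binary (s : nat -> bool) : R := limn (partial_binary s).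

Lemma cvg_partial_binary s : partial_binary s n @[n --> \oo] --> binary s.
Proof.
apply: nondecreasing_is_cvgn.
  apply/nondecreasing_seqP => n; rewrite /partial_binary big_ord_recr /= lerDl.
  by rewrite mulr_ge0// exprn_ge0.
exists 1 => _ [n _ <-]; apply: (@le_trans _ _ (1 - 2^-1 ^+ n)); last by rewrite gerBl exprn_ge0.
elim: n => [|n ih]; first by rewrite /partial_binary big_ord0 expr0 subrr.
rewrite /partial_binary big_ord_recr /=; rewrite -/(partial_binary s n).
have h : (s n)%:R * 2^-1 ^+ n.+1 <= 2^-1 ^+ n.+1 :> R.
  by apply: ler_piMl; [exact: exprn_ge0|case: (s n)].
have e : 2^-1 ^+ n.+1 = 2^-1 * 2^-1 ^+ n :> R by rewrite exprS.
by move: h; rewrite e; move: ih; move: (2^-1 ^+ n) (partial_binary s n) ((s n)%:R : R) => a b c; lra.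
Qed.

Lemma binary_expansion (x : R) n :
  x = partial_binary (fun i => digit i x) n + 2^-1 ^+ n * iter n (@doubling R) x.
Proof.
elim: n => [|n ih]; first by rewrite /partial_binary big_ord0 expr0 mul1r add0r.
rewrite {1}ih /partial_binary big_ord_recr /= -addrA; congr (_ + _).
rewrite /digit /doubling exprS; move: (iter n _ x) (2^-1 ^+ n) => y a.
by rewrite /doubling; field.
Qed.

Lemma binary_digits (x : R) : 0 <= x < 1 -> binary (fun i => digit i x) = x.
Proof.
move=> x01; apply: cvg_lim => //.
have it n : 0 <= iter n (@doubling R) x < 1.
  elim: n => // n; rewrite iterS; move: (iter n _ _) => y /andP[y0 y1].
  by rewrite /doubling /bit; case: (leP 2^-1 y) => h; rewrite ?mulr1n ?mulr0n; apply/andP; split; lra.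
have g0 : 2^-1 ^+ n @[n --> \oo] --> (0 : R) by apply: cvg_expr; rewrite ger0_norm//; lra.
apply/cvgrPdist_le => e e0; have /cvgrPdist_le/(_ _ e0) := g0.
apply: filterS => n; rewrite sub0r normrN ger0_norm ?exprn_ge0// => h.
rewrite {1}(binary_expansion x n) addrAC subrr add0r normrM (ger0_norm (exprn_ge0 n _))//.
have /andP[i0 i1] := it n; rewrite (ger0_norm i0); apply: le_trans h.
by apply: ler_piMr; [exact: exprn_ge0|exact: ltW].
Qed.

(** Digits in even and in odd positions are disjoint families of independent fair bits, so the two
    numbers they form are independent and uniform. *)
Definition even_part (x : R) : R := binary (fun i => digit i.*2 x).
Definition odd_part (x : R) : R := binary (fun i => digit i.*2.+1 x).
(** The identity on [[0, 1[], hence almost surely. Writing it as a binary expansion lets both sides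
    of the comparison below be truncated alike. *)
Let whole (x : R) : R := binary (fun i => digit i x).

Let measurable_partial (k : nat -> nat) n :
  measurable_fun setT (fun x : R => partial_binary (fun i => digit (k i) x) n).
Proof. by apply: measurable_sum => i; apply: measurable_funM => //; exact: measurable_digit. Qed.

Let measurable_binary (k : nat -> nat) : measurable_fun setT (fun x : R => binary (fun i => digit (k i) x)).
Proof.
apply: (measurable_fun_cvg (measurable_partial k)) => x _; exact: cvg_partial_binary.
Qed.

Lemma measurable_even_part : measurable_fun setT even_part.
Proof. exact: measurable_binary. Qed.

Lemma measurable_odd_part : measurable_fun setT odd_part.
Proof. exact: measurable_binary. Qed.

Let mwhole : measurable_fun setT whole.
Proof. exact: (measurable_binary id). Qed.

Let w (s : R) (i : nat) (b : bool) : R[i] := cis (s * (b%:R * 2^-1 ^+ i.+1)).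

Let cis_partial (s : R) (a : nat -> bool) n :
  cis (s * partial_binary a n) = \prod_(i < n) w s i (a i).
Proof. by rewrite /partial_binary mulr_sumr cis_sum. Qed.

Let partial_joint (s t : R) n :
  cint U (fun x => cis (s * partial_binary (fun i => digit i.*2 x) n +
                        t * partial_binary (fun i => digit i.*2.+1 x) n)) =
  cint (U \x U)%E (fun z => cis (s * partial_binary (fun i => digit i z.1) n +
                        t * partial_binary (fun i => digit i z.2) n)).
Proof.
(* The first [n] digits of both parts are the first [n.*2] digits of [x], with the weights for [s]
   and [t] interlaced. *)
pose W j b := if odd j then w t j./2 b else w s j./2 b.
transitivity (cint U (fun x => \prod_(j < n.*2) W j (digit j x))).
  apply: eq_cint => x; rewrite cisD !cis_partial -big_split /=.
  rewrite (big_ord_double _ (fun j => W j (digit j x))); apply: eq_bigr => i _.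
  by rewrite /W /= odd_double /= doubleK uphalf_double.
rewrite cint_prod_digits.
rewrite (big_ord_double _ (fun j => (W j false + W j true) * (2^-1%:C)%C)).
transitivity (cint U (fun x => \prod_(i < n) w s i (digit i x)) * cint U (fun x => \prod_(i < n) w t i (digit i x))).
  rewrite !cint_prod_digits -big_split /=; apply: eq_bigr => i _.
  by rewrite /W /= odd_double /= doubleK uphalf_double.
have iw r : cintegrable U (fun x => \prod_(i < n) w r i (digit i x)).
  apply: (@normc_cint_bounded _ _ _ _ _ 1).
    by apply: cmeasurable_prod => i; exact: cmeasurable_digit.
  by move=> x; rewrite -(cis_partial r (fun i => digit i x)) normc_cis.
rewrite -(cint_tensor (iw s) (iw t)); apply: eq_cint => z.
by rewrite cisD !cis_partial.
Qed.

Let joint_cos (s t th : R) :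
  \int[U]_x cos (s * even_part x + t * odd_part x + th) =
  \int[(U \x U)%E]_z cos (s * whole z.1 + t * whole z.2 + th).
Proof.
have lim d (T : measurableType d) (P : probability T R) (f g : T -> nat -> bool)
    (mf : forall n, measurable_fun setT (fun x => partial_binary (f x) n))
    (mg : forall n, measurable_fun setT (fun x => partial_binary (g x) n)) :
    \int[P]_x cos (s * partial_binary (f x) n + t * partial_binary (g x) n + th) @[n --> \oo] -->
    \int[P]_x cos (s * binary (f x) + t * binary (g x) + th).
  apply: (@dominated_Rintegral _ _ _ P _ _ (fun=> 1)).
  - move=> n; apply: (measurableT_comp (@measurable_cosR R)).
    by apply: measurable_funD => //; apply: measurable_funD; exact: measurable_funM.
  - apply: (measurableT_comp (@measurable_cosR R)); apply: measurable_funD => //.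
    apply: measurable_funD; apply: measurable_funM => //.
      by apply: (measurable_fun_cvg mf) => x _; exact: cvg_partial_binary.
    by apply: (measurable_fun_cvg mg) => x _; exact: cvg_partial_binary.
  - apply: aeW => x; apply: continuous_cvg; first exact: continuous_cos.
    by apply: cvgD; [apply: cvgD; apply: cvgMr; exact: cvg_partial_binary|exact: cvg_cst].
  - exact: finite_measure_integrable_cst.
  - by move=> n x; rewrite ler_norml cos_geN1 cos_le1.
have l1 := lim _ _ U (fun x i => digit i.*2 x) (fun x i => digit i.*2.+1 x)
  (measurable_partial (fun i => i.*2)) (measurable_partial (fun i => i.*2.+1)).
have m1 n := measurableT_comp (measurable_partial id n) (@measurable_fst _ _ R R).
have m2 n := measurableT_comp (measurable_partial id n) (@measurable_snd _ _ R R).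
have l2 := lim _ _ (U \x U)%E (fun z i => digit i z.1) (fun z i => digit i z.2) m1 m2.
apply: (cvg_unique _ l1) => //.
move: l2; apply: cvg_trans; apply: near_eq_cvg; apply: nearW => n /=.
rewrite !Rintegral_cosD ?partial_joint//.
  by apply: measurable_funD; apply: measurable_funM.
by apply: measurable_funD; apply: measurable_funM => //; [exact: m1|exact: m2].
Qed.

(** The joint law of the two parts and the product law have the same characteristic function:
    equality holds for truncated expansions, as products over digits, and passes to the limit. *)
Lemma uniform01_split (A B : set R) : measurable A -> measurable B ->
  U (even_part @^-1` A `&` odd_part @^-1` B) = (U A * U B)%E.
Proof.
move=> mA mB.
pose J (z : R * R) : 'rV[R]_2 := \row_(j < 2) if j == 0 then z.1 else z.2.
have mJ : measurable_fun setT J.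
  apply: measurable_mx => i j; under eq_fun do rewrite mxE.
  by case: (j == 0); [exact: measurable_fst|exact: measurable_snd].
pose D x := J (even_part x, odd_part x).
pose D' (z : R * R) := J (whole z.1, whole z.2).
have mD : measurable_fun setT D.
  apply: (measurableT_comp mJ); apply/measurable_fun_pairP; split.
    exact: measurable_even_part.
  exact: measurable_odd_part.
have mw1 : measurable_fun setT (fun z : R * R => whole z.1) by exact: (measurableT_comp mwhole).
have mw2 : measurable_fun setT (fun z : R * R => whole z.2) by exact: (measurableT_comp mwhole).
have mD' : measurable_fun setT D' by apply: (measurableT_comp mJ); exact/measurable_fun_pairP.
have same : forall C, measurable C -> law U mD C = law (U \x U)%E mD' C.
  apply: mx_probability_unique_cos => t th.
  have dJ z : dotv t (J z) = t 0 0 * z.1 + t 0 1 * z.2.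
    by rewrite /dotv big_ord_recl big_ord1 !mxE /=; congr (_ * _ + t _ _ * _); apply: val_inj.
  have mc := measurable_cos_dotv t th; have bc (x : 'rV[R]_2) : `|cos (dotv t x + th)| <= 1 by exact: normr_cos_le1.
  rewrite (@Rintegral_law _ _ _ _ _ U D mD _ 1 mc bc) (@Rintegral_law _ _ _ _ _ (U \x U)%E D' mD' _ 1 mc bc).
  transitivity (\int[U]_x cos (t 0 0 * even_part x + t 0 1 * odd_part x + th)).
    by apply: eq_Rintegral => x _; rewrite dJ.
  by rewrite joint_cos; apply: eq_Rintegral => z _; rewrite dJ.
pose C := mx_box (fun (_ : 'I_1) (j : 'I_2) => if j == 0 then A else B).
have mC : measurable C by apply: measurable_mx_box => i j; case: (j == 0).
have JC z : C (J z) <-> A z.1 /\ B z.2.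
  split=> [h|[h1 h2] i j]; first by split; [have := h 0 0|have := h 0 1]; rewrite mxE.
  by rewrite mxE; case: (j == 0).
have -> : even_part @^-1` A `&` odd_part @^-1` B = D @^-1` C.
  by apply/seteqP; split=> x h; apply/(JC (even_part x, odd_part x)).
rewrite -[LHS]/(law U mD C) same// lawE.
have mwE E : measurable E -> measurable (whole @^-1` E).
  by move=> mE; rewrite -[X in measurable X]setTI; exact: mwhole.
have wU E : measurable E -> U (whole @^-1` E) = U E.
  move=> mE; apply: uniform01_eq => //; first exact: mwE.
  by move=> x /andP[x0 x1]; rewrite /= /whole binary_digits// x1 ltW.
have -> : D' @^-1` C = (whole @^-1` A) `*` (whole @^-1` B).
  by apply/seteqP; split=> z h; apply/(JC (whole z.1, whole z.2)).
apply: (etrans (product_measure1E U U (mwE A mA) (mwE B mB))).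
by congr (_ * _)%E; exact: wU.
Qed.

End binary_expansions.

(** * The quantile transform *)

Section quantile_transform.
Context (R : realType) (mu : probability R R).
Local Notation U := (@uniform01 R).

Let X : {RV mu >-> R} := mfun_Sub (mem_set (@measurable_id _ R setT)).
Let F (r : R) : R := fine (cdf X r).

Let FE r : (F r)%:E = mu `]-oo, r]%classic.
Proof. by rewrite /F fineK ?fin_num_measure. Qed.

Let F_le r s : r <= s -> F r <= F s.
Proof.
move=> rs; rewrite -lee_fin !FE; apply: le_measure; rewrite ?inE; try exact: measurable_itv.
exact: subitvPr.
Qed.

Definition quantile (u : R) : R := if 0 < u < 1 then sup [set y | F y < u] else 0.

(** Right continuity of the distribution function gives the strict inequality from [F x < u]: then
    [F y < u] still holds for some [y > x]. The limits of [F] at infinity make the supremum a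
    genuine one. *)
Lemma quantile_gt u x : 0 < u < 1 -> (x < quantile u) = (F x < u).
Proof.
move=> /andP[u0 u1]; rewrite /quantile u0 u1 /=.
have [y0 Fy0] : exists y, F y < u.
  have /fine_cvg := cvg_cdfNy0 X; move=> /cvgrPdist_lt/(_ _ u0) h.
  have [y] := @filter_ex _ _ _ _ h; rewrite /= sub0r normrN => yu.
  by exists y; apply: le_lt_trans yu; exact: ler_norm.
have [y1 Fy1] : exists y, u <= F y.
  have /fine_cvg := cvg_cdfy1 X; move=> /cvgrPdist_lt/(_ (1 - u)).
  rewrite subr_gt0 => /(_ u1) h.
  have [y] := @filter_ex _ _ _ _ h; rewrite /= => yu; exists y.
  by move: yu; rewrite ltr_norml => /andP[_]; rewrite -/(F y); lra.
have hs : has_sup [set y | F y < u].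
  split; first by exists y0.
  exists y1 => y /= Fy; rewrite leNgt; apply/negP => /ltW /F_le; rewrite leNgt => /negP; apply.
  exact: lt_le_trans Fy Fy1.
apply/idP/idP => [xs|Fx].
  have [y /= Fy xy] := sup_gt (ex_intro _ y0 Fy0) xs.
  by apply: le_lt_trans Fy; apply: F_le; exact: ltW.
have := @cdf_right_continuous _ _ _ _ X x; rewrite -[X in _ --> X](_ : (F x)%:E = _); last first.
  by rewrite /F fineK ?fin_num_measure.
move=> /fine_cvg /cvgrPdist_lt/(_ (u - F x)); rewrite subr_gt0 => /(_ Fx) h.
have [y [/= yu xy]] : exists y, `|F x - F y| < u - F x /\ x < y.
  by apply: (@filter_ex _ x^'+); apply: filterI; [exact: h|exact: nbhs_right_gt].
apply: (lt_le_trans xy); apply: ub_le_sup; first by have [] := hs.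
by move: yu; rewrite ltr_norml /= => /andP[yu _]; lra.
Qed.

Lemma measurable_quantile : measurable_fun setT quantile.
Proof.
apply: (measurability _ (RGenOInfty.measurableE R)) => //.
move=> _ [_ [x ->] <-]; rewrite setTI.
rewrite (_ : _ @^-1` _ = (`]0, 1[%classic `&` `]F x, +oo[%classic) `|`
   (~` `]0, 1[%classic `&` [set _ | x < 0])).
  apply: measurableU; first by apply: measurableI; exact: measurable_itv.
  apply: measurableI; first by apply: measurableC; exact: measurable_itv.
  have [x0|x0] := boolP (x < 0); first by rewrite (_ : [set _ | _] = setT) //; exact/seteqP.
  by rewrite (_ : [set _ | _] = set0)//; apply/seteqP; split.
apply/seteqP; split=> u /=; rewrite !in_itv /= !andbT.
  have [u01|u01] := boolP (0 < u < 1); first by rewrite quantile_gt//; left.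
  by rewrite {1}/quantile (negbTE u01) => x0; right.
by move=> [[u01 Fx]|[/negP u01 x0]]; [rewrite quantile_gt|rewrite /quantile (negbTE u01)].
Qed.

Lemma quantile_law (A : set R) : measurable A -> U (quantile @^-1` A) = mu A.
Proof.
move=> mA; rewrite -[LHS]/(law U measurable_quantile A).
have l1 : (law U measurable_quantile setT < +oo)%E by rewrite probability_setT ltry.
apply: (ray_measure_unique l1) => // x.
have mr : measurable `]F x, +oo[%classic by exact: measurable_itv.
transitivity (U `]F x, +oo[%classic).
  apply: uniform01_eq => //.
    by rewrite -[X in measurable X]setTI; apply: measurable_quantile => //; exact: measurable_itv.
  by move=> u u01; rewrite /= !in_itv /= !andbT quantile_gt.
have F0 : 0 <= F x by rewrite fine_ge0// cdf_ge0.
have F1 : F x <= 1 by rewrite -lee_fin FE; exact: probability_le1.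
rewrite uniform01_ray min_r; last lra.
rewrite max_r; last lra.
rewrite -[`]x, +oo[%classic](_ : ~` `]-oo, x]%classic = _); last by rewrite setCitvl.
have mx : measurable `]-oo, x]%classic by exact: measurable_itv.
by apply: esym; apply: (etrans (probability_setC mu mx)); rewrite -FE.
Qed.

End quantile_transform.

Lemma cint_preserving d d' (T : measurableType d) (T' : measurableType d') (R : realType)
    (P : probability T R) (Q : probability T' R) (g : T -> T') (f : T' -> R[i]) (M : R) :
  measurable_fun setT g -> (forall A, measurable A -> P (g @^-1` A) = Q A) ->
  cmeasurable f -> (forall y, normc (f y) <= M) -> cint P (fun x => f (g x)) = cint Q f.
Proof.
move=> mg PQ [f1 f2] fM.
have E (h : T' -> R) : measurable_fun setT h -> (forall y, `|h y| <= M) ->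
    \int[P]_x h (g x) = \int[Q]_y h y.
  move=> mh hM; rewrite -(@Rintegral_law _ _ _ _ _ P _ mg h M mh hM); congr fine.
  by apply: eq_measure_integral => A mA _; exact: PQ.
rewrite /cint (E _ f1)//; last by move=> y; apply: le_trans (normr_Re_le _) _.
by rewrite (E _ f2)// => y; apply: le_trans (normr_Im_le _) _.
Qed.

(** * A sequence of independent standard normal variables *)

Section normal_sequence.
Context (R : realType).
Local Notation U := (@uniform01 R).
Definition normal01 : probability R R := law (normal_prob 0 1) (@measurable_id _ R setT).

Local Notation N01 := normal01.

Lemma cint_normal01 (t : R) : cint N01 (fun x => cis (t * x)) = ((expR (- t ^+ 2 / 2))%:C)%C.
Proof.
have E (h : R -> R) : measurable_fun setT h -> (forall x, `|h x| <= 1) ->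
    \int[N01]_x h x = \int[normal_prob 0 1]_x h x.
  move=> mh h1; exact: (@Rintegral_law _ _ _ _ R (normal_prob 0 1) _ (@measurable_id _ R setT) h 1 mh h1).
have mc th : measurable_fun setT (fun x : R => cos (t * x + th)).
  by apply: (measurableT_comp (@measurable_cosR R)); apply: measurable_funD => //; exact: measurable_funM.
rewrite /cint; congr (_ +i* _)%C.
  transitivity (\int[N01]_x cos (t * x + 0)); first by apply: eq_Rintegral => x _; rewrite addr0.
  by rewrite E// ?normal01_cosD ?cos0 ?mul1r// => x; exact: normr_cos_le1.
(* The sine is minus the cosine with phase [pi / 2], so the formula with a phase also gives the
   imaginary part. *)
rewrite -[RHS](_ : - (cos (pi / 2) * expR (- t ^+ 2 / 2)) = 0); last by rewrite cos_pihalf mul0r oppr0.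
rewrite -normal01_cosD -E//; last by move=> x; exact: normr_cos_le1.
transitivity (\int[N01]_x - cos (t * x + pi / 2)).
  by apply: eq_Rintegral => x _; rewrite cosDpihalf opprK.
under eq_Rintegral do rewrite -mulN1r; rewrite RintegralZl ?mulN1r//.
by apply: (@bounded_integrable _ _ _ N01 _ 1) => // x; exact: normr_cos_le1.
Qed.

(** Each step keeps the odd digits for the later variables and spends the even ones on the current
    variable. *)
Definition normal_sequence (k : nat) (x : R) : R :=
  quantile N01 (even_part (iter k (@odd_part R) x)).

Let meven := @measurable_even_part R.
Let modd := @measurable_odd_part R.

Let UT (A : set R) : measurable A ->
  U (@even_part R @^-1` A) = U A /\ U (@odd_part R @^-1` A) = U A.
Proof.
move=> mA; have := uniform01_split mA measurableT; have := uniform01_split measurableT mA.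
by rewrite !preimage_setT setIT setTI probability_setT mule1 mul1e.
Qed.

Lemma measurable_normal_sequence k : measurable_fun setT (normal_sequence k).
Proof.
apply: (measurableT_comp (measurable_quantile N01)); apply: (measurableT_comp meven).
elim: k => [|k ih]; first exact: measurable_id.
exact: (measurableT_comp modd ih).
Qed.

(** Independence and normality in one formula. The first variable depends on the even part and all
    the others on the odd part, which is again uniform, so the induction hypothesis applies to
    them. *)
Lemma cint_normal_sequence n (t : nat -> R) :
  cint U (fun x => cis (\sum_(k < n) t k * normal_sequence k x)) =
  ((expR (- (\sum_(k < n) t k ^+ 2) / 2))%:C)%C.
Proof.
elim: n t => [|n ih] t.
  rewrite (eq_cint _ (g := fun=> 1)); last by move=> x; rewrite big_ord0 cis0.
  by rewrite /cint /= !Rintegral_probability_cst big_ord0 oppr0 mul0r expR0.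
pose G (x : R) := \sum_(k < n) t k.+1 * normal_sequence k x.
have mG : measurable_fun setT G.
  by apply: measurable_sum => k; apply: measurable_funM => //; exact: measurable_normal_sequence.
pose H (z : R * R) := cis (t 0%N * quantile N01 z.1) * cis (G z.2).
have mq : measurable_fun setT (fun x => t 0%N * quantile N01 x).
  by apply: measurable_funM => //; exact: measurable_quantile.
transitivity (cint U (fun x => H (even_part x, odd_part x))).
  apply: eq_cint => x; rewrite /H -cisD big_ord_recl; congr (cis (_ + _)).
  by apply: eq_bigr => k _; rewrite /normal_sequence /bump /= -iterSr.
have b1 (x : R) : normc (cis x) <= 1 by rewrite normc_cis.
have mH : cmeasurable H.
  apply: cmeasurableM; apply: cmeasurable_cis; first exact: (measurableT_comp mq).
  exact: (measurableT_comp mG).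
have H1 z : normc (H z) <= 1 by rewrite /H -cisD.
have YZ B C : measurable B -> measurable C ->
    U (@even_part R @^-1` B `&` @odd_part R @^-1` C) =
    (U (@even_part R @^-1` B) * U (@odd_part R @^-1` C))%E.
  move=> mB mC; have [e1 _] := UT mB; have [_ e2] := UT mC.
  by apply: (etrans (uniform01_split mB mC)); congr (_ * _)%E; apply: esym.
rewrite (cint_indep (P := U) meven modd YZ mH H1).
have mc r : cmeasurable (fun x => cis (r * quantile N01 x)).
  by apply: cmeasurable_cis; apply: measurable_funM => //; exact: measurable_quantile.
pose c0 := cint U (fun x => cis (t 0%N * quantile N01 (even_part x))).
have c0E : c0 = ((expR (- t 0%N ^+ 2 / 2))%:C)%C.
  rewrite -cint_normal01.
  have b2 y : normc (cis (t 0%N * quantile N01 y)) <= 1 by [].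
  rewrite -[LHS]/(cint U (fun x => (fun y => cis (t 0%N * quantile N01 y)) (even_part x))).
  rewrite (cint_preserving (Q := U) meven (fun A mA => (UT mA).1) (mc _) b2).
  have mci : cmeasurable (fun y : R => cis (t 0%N * y)).
    by apply: cmeasurable_cis; exact: measurable_funM.
  exact: (cint_preserving (Q := N01) (measurable_quantile N01) (@quantile_law R N01) mci (fun y => b1 _)).
transitivity (cint U (fun x => c0 * cis (G (odd_part x)))).
  apply: eq_cint => x; rewrite [RHS]mulrC -cintZ; last first.
    apply: (normc_cint_bounded _ _ (fun y => b1 _)).
    exact: (cmeasurable_comp (mc _) meven).
  by apply: eq_cint => y; rewrite /H mulrC.
rewrite cintZ; last first.
  apply: (normc_cint_bounded _ _ (fun y => b1 _)).
  by apply: cmeasurable_cis; exact: (measurableT_comp mG modd).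
rewrite (cint_preserving (Q := U) (f := fun y => cis (G y)) modd (fun A mA => (UT mA).2) (cmeasurable_cis mG) (fun y => b1 _)).
rewrite (ih (fun k => t k.+1)) c0E -rmorphM -expRD big_ord_recl; congr (_%:C)%C; congr expR.
by rewrite opprD mulrDl.
Qed.

End normal_sequence.

Lemma integral_cstD d (T : measurableType d) (R : realType) (P : probability T R) (c : R) (f : T -> R) :
  P.-integrable setT (fun x => (f x)%:E) ->
  (\int[P]_x (c + f x)%:E = (c + \int[P]_x f x)%:E)%E.
Proof.
move=> fi; have ci : P.-integrable setT (fun=> c%:E) by exact: finite_measure_integrable_cst.
rewrite -[in RHS](Rintegral_probability_cst P c) -(RintegralD measurableT ci fi) /Rintegral fineK//.
by apply: integrable_fin_num => //; exact: integrable_RD.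
Qed.

(** * Characteristic function of a centred normal law of arbitrary variance *)

Section normal_characteristic.
Context (R : realType).
Notation leb := (@lebesgue_measure R).

Lemma integral_normal_prob (s : R) (f : R -> R) : measurable_fun setT f -> (forall x, 0 <= f x) ->
  (\int[normal_prob 0 s]_x (f x)%:E = \int[leb]_x (f x * normal_pdf 0 s x)%:E)%E.
Proof.
move=> mf f0.
rewrite (@integral_density _ (measurableTypeR R) R leb (normal_prob 0 s) (normal_pdf 0 s))//.
- exact: measurable_normal_pdf.
- by move=> x; exact: normal_pdf_ge0.
- exact/measurable_EFinP.
Qed.

Lemma normal_pdf_scale (s x : R) : 0 < s -> normal_pdf 0 s (s * x) * s = normal_pdf 0 1 x.
Proof.
move=> s0; rewrite !normal_pdfE ?gt_eqF// /normal_fun /normal_peak !subr0 !expr1n mul1r.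
rewrite -mulrnAr sqrtrM ?sqr_ge0// sqrtr_sqr gtr0_norm// exprMn invfM.
have sn : s != 0 by rewrite gt_eqF.
have -> : - (s ^+ 2 * x ^+ 2) / (s ^+ 2 *+ 2) = - x ^+ 2 / (1 *+ 2).
  by rewrite -(mulr_natr (s ^+ 2)); field.
by move: (Num.sqrt _)^-1 (expR _) => p e; field.
Qed.

(** The substitution [x = s y] is made for a nonnegative integrand, so 1 is added to the cosine and
    cancelled at the end. *)
Lemma normal_prob_cosD (s t th : R) : 0 < s ->
  \int[normal_prob 0 s]_x cos (t * x + th) = cos th * expR (- (s ^+ 2 * t ^+ 2) / 2).
Proof.
move=> s0; have mc r : measurable_fun setT (fun x : R => cos (r * x + th)).
  by apply: (measurableT_comp (@measurable_cosR R)); apply: measurable_funD => //; exact: measurable_funM.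
have c0 (y : R) : 0 <= 1 + cos y by have := cos_geN1 y; lra.
have cc r : continuous (fun x : R => cos (r * x + th)).
  move=> x; apply: (continuous_comp (f := fun x : R => r * x + th)); last exact: continuous_cos.
  by apply: cvgD; [apply: cvgMr; exact: cvg_id|exact: cvg_cst].
pose F x := s * x.
have F'E : F^`()%classic = cst s.
  apply/funext => x; rewrite derive1E.
  have h : is_derive x (1 : R) F s by apply: is_derive_eq; rewrite /GRing.scale/= mulr1.
  by rewrite (@derive_val _ _ _ _ _ _ _ h).
have key : (\int[normal_prob 0 s]_x (1 + cos (t * x + th))%:E =
    \int[normal_prob 0 1]_x (1 + cos (s * t * x + th))%:E)%E.
  rewrite !integral_normal_prob//; try by apply: measurable_funD.
  rewrite (@increasing_ge0_integration_by_substitutionT R F (fun x => (1 + cos (t * x + th)) * normal_pdf 0 s x)).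
  - apply: eq_integral => x _; rewrite F'E -(normal_pdf_scale x s0) mulrA.
    rewrite -[LHS]/(((1 + cos (t * (s * x) + th)) * normal_pdf 0 s (s * x) * s)%:E).
    by congr (((1 + cos (_ + _)) * _ * _)%:E); ring.
  - by move=> x y xy; rewrite /F ltr_pM2l.
  - by rewrite F'E => x; exact: cvg_cst.
  - by rewrite F'E; exact: is_cvg_cst.
  - by rewrite F'E; exact: is_cvg_cst.
  - by move=> x; exact: derivableM.
  - by apply: gt0_cvgMrNy => //; exact: cvg_id.
  - by apply: gt0_cvgMry => //; exact: cvg_id.
  - move=> x; apply: cvgM; last by apply: continuous_normal_pdf; rewrite gt_eqF.
    by apply: cvgD; [exact: cvg_cst|exact: cc].
  - by move=> x; rewrite mulr_ge0// normal_pdf_ge0.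
have E (r a : R) : (\int[normal_prob 0 r]_x (1 + cos (a * x + th))%:E =
    (1 + \int[normal_prob 0 r]_x cos (a * x + th))%:E)%E.
  have ic : (normal_prob 0 r).-integrable setT (fun x => (cos (a * x + th))%:E).
    have b1 (x : R) : `|cos (a * x + th)| <= 1 by exact: normr_cos_le1.
    exact: (@bounded_integrable _ _ _ (normal_prob 0 r) (fun x => cos (a * x + th)) 1 (mc a) b1).
  exact: (integral_cstD 1 ic).
have e := EFin_inj (etrans (esym (E s t)) (etrans key (E 1 (s * t)))).
by rewrite (addrI _ e) normal01_cosD exprMn.
Qed.

End normal_characteristic.

(** * Gaussian fields *)

Section gaussian_characteristic.
Context (R : realType) d (T : measurableType d) (P : probability T R).
Variables (Y : T -> R) (v : R).
Hypotheses (mY : measurable_fun setT Y) (v0 : 0 <= v).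
Hypothesis cf : forall t th, \int[P]_x cos (t * Y x + th) = cos th * expR (- (v * t ^+ 2) / 2).

(** For [v = 0] the characteristic function is that of the point mass at 0, otherwise that of a
    normal law; uniqueness concludes in both cases. *)
Lemma gaussian_law_of_cos : gaussian_law (pushforward P Y).
Proof.
exists 0, (Num.sqrt v) => B mB; rewrite -[LHS]/(law P mY B).
have lawc t th : \int[law P mY]_x cos (t * x + th) = cos th * expR (- (v * t ^+ 2) / 2).
  rewrite (@Rintegral_law _ _ _ _ _ P _ mY (fun x => cos (t * x + th)) 1)//.
    by apply: (measurableT_comp (@measurable_cosR R)); apply: measurable_funD => //; exact: measurable_funM.
  by move=> x; exact: normr_cos_le1.
have [s0|s0] := eqVneq (Num.sqrt v) 0.
  pose D0 : probability R R := @dirac _ R (0 : R) R.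
  rewrite -[RHS]/(D0 B).
  apply: probability_unique_cos => // t th; rewrite lawc.
  have -> : v = 0 by apply/eqP; rewrite eq_le v0 andbT -sqrtr_eq0 s0.
  rewrite mul0r oppr0 mul0r expR0 mulr1 /Rintegral integral_dirac//.
    by rewrite diracT mul1e /= mulr0 add0r.
  apply/measurable_EFinP; apply: (measurableT_comp (@measurable_cosR R)).
  by apply: measurable_funD => //; exact: measurable_funM.
pose N : probability R R := law (normal_prob 0 (Num.sqrt v)) (@measurable_id _ R setT).
rewrite -[RHS]/(N B); apply: probability_unique_cos => // t th; rewrite lawc.
rewrite (@Rintegral_law _ _ _ _ _ (normal_prob 0 (Num.sqrt v)) _ (@measurable_id _ R setT) (fun x => cos (t * x + th)) 1).
- by rewrite normal_prob_cosD ?sqr_sqrtr// lt_neqAle eq_sym s0 sqrtr_ge0.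
- by apply: (measurableT_comp (@measurable_cosR R)); apply: measurable_funD => //; exact: measurable_funM.
- by move=> x; exact: normr_cos_le1.
Qed.

Let r (n : nat) : R := n.+1%:R^-1.
Let r0 n : 0 < r n. Proof. by rewrite invr_gt0. Qed.
Let rlim : r n @[n --> \oo] --> (0 : R). Proof. exact: cvg_harmonic. Qed.
Let r2lim : r n ^+ 2 @[n --> \oo] --> (0 : R).
Proof. by rewrite -(mul0r (0 : R)); exact: (cvgM rlim rlim). Qed.

Let g n x : R := 2 * (1 - cos (r n * Y x)) / r n ^+ 2.
Let mg n : measurable_fun setT (g n).
Proof.
apply: measurable_funM => //; apply: measurable_funM => //; apply: measurable_funB => //.
by apply: (measurableT_comp (@measurable_cosR R)); exact: measurable_funM.
Qed.
Let g0 n x : 0 <= g n x.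
Proof. by rewrite divr_ge0 ?sqr_ge0// mulr_ge0// subr_ge0 cos_le1. Qed.
Let g_le n x : `|g n x| <= 2 * Y x ^+ 2.
Proof.
rewrite ger0_norm// ler_pdivrMr ?exprn_gt0//.
have := normr_cosB1_sqr (r n * Y x); rewrite normrM exprMn !real_normK ?num_real// => h.
have := ler_norm (1 - cos (r n * Y x)); rewrite distrC; move: h; lra.
Qed.
Let g_lim x : g n x @[n --> \oo] --> Y x ^+ 2.
Proof.
apply/cvgrPdist_le => e e0.
have l0 : 2 * Y x ^+ 4 * r n ^+ 2 @[n --> \oo] --> (0 : R) by rewrite -(mulr0 (2 * Y x ^+ 4)); exact: cvgMr.
have /cvgrPdist_le/(_ _ e0) := l0.
apply: filterS => n; rewrite sub0r normrN => h; apply: le_trans h.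
apply: le_trans (ler_norm _).
have -> : Y x ^+ 2 - g n x = 2 / r n ^+ 2 * (cos (r n * Y x) - 1 + (r n * Y x) ^+ 2 / 2).
  by rewrite /g; field; rewrite gt_eqF.
have q0 : 0 < 2 / r n ^+ 2 by rewrite divr_gt0 ?exprn_gt0.
rewrite normrM (gtr0_norm q0).
have -> : 2 * Y x ^+ 4 * r n ^+ 2 = 2 / r n ^+ 2 * `|r n * Y x| ^+ 4.
  rewrite -normrX ger0_norm; last by rewrite exprn_even_ge0.
  by field; rewrite gt_eqF.
by apply: ler_wpM2l; [exact: ltW|exact: normr_cos_taylor].
Qed.

Let a n : R := 2 * (1 - expR (- (v * r n ^+ 2) / 2)) / r n ^+ 2.
Let icos n : P.-integrable setT (fun x => (cos (r n * Y x))%:E).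
Proof.
apply: (@bounded_integrable _ _ _ P _ 1); last by move=> x; exact: normr_cos_le1.
by apply: (measurableT_comp (@measurable_cosR R)); exact: measurable_funM.
Qed.
Let gE n : \int[P]_x g n x = a n.
Proof.
have i1 : P.-integrable setT (fun=> (1 : R)%:E) by exact: finite_measure_integrable_cst.
have -> : \int[P]_x g n x = \int[P]_x (2 / r n ^+ 2 * (1 - cos (r n * Y x))).
  by apply: eq_Rintegral => x _; rewrite /g mulrAC.
rewrite (RintegralZl _ measurableT (integrable_RB i1 (icos n))) (RintegralB measurableT i1 (icos n)).
rewrite Rintegral_probability_cst /a [RHS]mulrAC; congr (_ * (_ - _)).
have := cf (r n) 0; rewrite cos0 mul1r => <-.
by apply: eq_Rintegral => x _; rewrite addr0.
Qed.

(** At [x = v r^2 / 2]: the upper bound is [exp (- x) >= 1 - x], and the lower one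
    [exp (- x) <= 1 / (1 + x) <= 1 - x + x^2]. *)
Let a_bounds n : v - v ^+ 2 / 2 * r n ^+ 2 <= a n <= v.
Proof.
have r2 : 0 < r n ^+ 2 by rewrite exprn_gt0.
rewrite /a ler_pdivlMr// ler_pdivrMr//; move: (r n ^+ 2) r2 => w w0.
have := expR_ge1Dx (- (v * w) / 2); have := expR_ge1Dx (v * w / 2).
have := expRxMexpNx_1 (v * w / 2); rewrite mulNr.
have := expR_gt0 (- (v * w / 2)).
move: (expR _) (expR _) => E1 E2 h1 h2 h3 h4.
have -> : (v - v ^+ 2 / 2 * w) * w = v * w - (v * w) ^+ 2 / 2 by ring.
have : 0 <= v * w by rewrite mulr_ge0// ltW.
move: (v * w) h3 h4 => e h3 h4 e0; apply/andP; split; last lra.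
have h5 : E2 * (1 + e / 2) <= 1 by have := ler_wpM2r (ltW h1) h3; rewrite h2 mulrC.
have e1 : 0 < 1 + e / 2 by lra.
have : E2 <= 1 - e / 2 + e ^+ 2 / 4.
  rewrite -(ler_pM2r e1); apply: (le_trans h5).
  have -> : (1 - e / 2 + e ^+ 2 / 4) * (1 + e / 2) = 1 + e ^+ 3 / 8 by field.
  by rewrite lerDl divr_ge0// exprn_ge0.
by lra.
Qed.

(* The integral of [2 (1 - cos (r Y)) / r^2] tends to [v] as [r] tends to 0;
   Fatou gives the integrability of [Y^2]. *)
Lemma gaussian_second_moment : (\int[P]_x (Y x ^+ 2)%:E = v%:E)%E.
Proof.
have mY2 : measurable_fun setT (fun x => Y x ^+ 2) by exact: measurable_funX.
have alim : a n @[n --> \oo] --> v.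
  apply: (@squeeze_cvgr _ _ _ _ (fun n => v - v ^+ 2 / 2 * r n ^+ 2) (fun=> v)).
  - by apply: nearW => n; exact: a_bounds.
  - rewrite -[X in _ --> X]subr0; apply: cvgB; first exact: cvg_cst.
    by rewrite -(mulr0 (v ^+ 2 / 2)); exact: cvgMr.
  - exact: cvg_cst.
have igE n : (\int[P]_x (g n x)%:E = (a n)%:E)%E.
  rewrite -gE /Rintegral fineK//; apply: integrable_fin_num => //.
  apply: (@bounded_integrable _ _ _ P _ (4 / r n ^+ 2)) => // x.
  rewrite ger0_norm// /g; apply: ler_wpM2r; first by rewrite invr_ge0 sqr_ge0.
  by have := cos_geN1 (r n * Y x); lra.
have iY2 : P.-integrable setT (fun x => (Y x ^+ 2)%:E).
  apply/integrableP; split; first exact/measurable_EFinP.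
  under eq_integral do rewrite gee0_abs ?lee_fin ?sqr_ge0//.
  have mgE n : measurable_fun setT (fun x => (g n x)%:E) by exact/measurable_EFinP.
  have gE0 n x : setT x -> (0 <= (g n x)%:E)%E by rewrite lee_fin.
  have E1 x : limn_einf (fun n => (g n x)%:E) = (Y x ^+ 2)%:E.
    have c : (g n x)%:E @[n --> \oo] --> (Y x ^+ 2)%:E by apply: cvg_EFin; [exact: nearW|exact: g_lim].
    by rewrite is_cvg_limn_einfE; [exact: cvg_lim|apply/cvg_ex; eexists; exact: c].
  have := @fatou _ T R P setT measurableT (fun n x => (g n x)%:E) mgE gE0.
  under eq_integral do rewrite E1.
  move=> /le_lt_trans; apply.
  have c : (\int[P]_x (g n x)%:E)%E @[n --> \oo] --> v%:E.
    by under eq_fun do rewrite igE; apply: cvg_EFin; [exact: nearW|exact: alim].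
  rewrite is_cvg_limn_einfE; last by apply/cvg_ex; eexists; exact: c.
  by rewrite (cvg_lim _ c)// ltry.
have dom := dominated_Rintegral mg mY2 (aeW _ g_lim) (integrable_RZ 2 iY2) g_le.
have e : \int[P]_x (Y x ^+ 2) = v.
  have E : (fun n => \int[P]_x g n x) = a by apply/funext.
  by move: dom; rewrite E => /cvg_unique; apply.
by rewrite -e /Rintegral fineK//; exact: integrable_fin_num.
Qed.

Lemma gaussian_integrable_sqr : P.-integrable setT (fun x => (Y x ^+ 2)%:E).
Proof.
apply/integrableP; split; first by apply/measurable_EFinP; exact: measurable_funX.
by under eq_integral do rewrite gee0_abs ?lee_fin ?sqr_ge0//; rewrite gaussian_second_moment ltry.
Qed.

(** [sin (r Y) / r] tends to [Y] and is dominated by [|Y|]; its integral vanishes, as the hypothesis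
    at phase [pi / 2] shows. *)
Lemma gaussian_mean : \int[P]_x Y x = 0.
Proof.
pose h n x : R := sin (r n * Y x) / r n.
have mh n : measurable_fun setT (h n).
  apply: measurable_funM => //; apply: (measurableT_comp (@measurable_sinR R)); exact: measurable_funM.
have iY : P.-integrable setT (fun x => `|Y x|%:E).
  have i1 : P.-integrable setT (fun=> (1 : R)%:E) by exact: finite_measure_integrable_cst.
  apply: (le_integrable_R _ _ (integrable_RD i1 gaussian_integrable_sqr)); first exact: measurableT_comp.
  move=> x; rewrite normr_id -(real_normK (num_real (Y x))).
  by have := sqr_ge0 (`|Y x| - 1); have := normr_ge0 (Y x); move: (`|Y x|) => y; nra.
have ms n : measurable_fun setT (fun x => sin (r n * Y x)).
  by apply: (measurableT_comp (@measurable_sinR R)); exact: measurable_funM.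
have hE n : \int[P]_x h n x = 0.
  have is_ : P.-integrable setT (fun x => (sin (r n * Y x))%:E).
    by apply: (@bounded_integrable _ _ _ P _ 1) => // x; rewrite ler_norml sin_geN1 sin_le1.
  have -> : \int[P]_x h n x = \int[P]_x ((- (r n)^-1) * - sin (r n * Y x)).
    by apply: eq_Rintegral => x _; rewrite /h mulrNN mulrC.
  have iN : P.-integrable setT (fun x => (- sin (r n * Y x))%:E).
    by under eq_fun do rewrite -mulN1r; exact: integrable_RZ.
  rewrite (RintegralZl _ measurableT iN).
  have := cf (r n) (pi / 2); rewrite cos_pihalf mul0r => e.
  rewrite (_ : \int[P]_x _ = 0) ?mulr0// -[RHS]e.
  by apply: eq_Rintegral => x _; rewrite cosDpihalf.
have hlim x : h n x @[n --> \oo] --> Y x.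
  apply/cvgrPdist_le => e e0.
  have l0 : `|Y x| ^+ 3 * r n ^+ 2 @[n --> \oo] --> (0 : R) by rewrite -(mulr0 (`|Y x| ^+ 3)); exact: cvgMr.
  have /cvgrPdist_le/(_ _ e0) := l0.
  apply: filterS => n; rewrite sub0r normrN => le_e; apply: le_trans le_e.
  apply: le_trans (ler_norm _).
  have -> : Y x - h n x = - (r n)^-1 * (sin (r n * Y x) - r n * Y x).
    by rewrite /h; field; rewrite gt_eqF.
  rewrite normrM normrN normfV (gtr0_norm (r0 n)).
  have -> : `|Y x| ^+ 3 * r n ^+ 2 = (r n)^-1 * `|r n * Y x| ^+ 3.
    by rewrite normrM (gtr0_norm (r0 n)); field; rewrite gt_eqF.
  by apply: ler_wpM2l; [rewrite invr_ge0 ltW|exact: normr_sinB].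
have h_le n x : `|h n x| <= `|Y x|.
  rewrite normrM normfV (gtr0_norm (r0 n)) ler_pdivrMr// mulrC -{2}(gtr0_norm (r0 n)) -normrM.
  exact: normr_sin_le.
have dom := dominated_Rintegral mh mY (aeW _ hlim) iY h_le.
have E : (fun n => \int[P]_x h n x) = fun=> 0 by apply/funext.
by move: dom; rewrite E => /cvg_unique; apply => //; exact: cvg_cst.
Qed.

End gaussian_characteristic.

(** * Gaussian series and the field they define *)

Section normal_sums.
Context (R : realType).
Local Notation U := (@uniform01 R).
Local Notation xi := (@normal_sequence R).

Definition normal_sum (c : nat -> R) (n : nat) (x : R) : R := \sum_(k < n) c k * xi k x.

Lemma measurable_normal_sum c n : measurable_fun setT (normal_sum c n).
Proof.
by apply: measurable_sum => k; apply: measurable_funM => //; exact: measurable_normal_sequence.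
Qed.

Lemma normal_sum_cos c n (t th : R) :
  \int[U]_x cos (t * normal_sum c n x + th) = cos th * expR (- ((\sum_(k < n) c k ^+ 2) * t ^+ 2) / 2).
Proof.
rewrite Rintegral_cosD; last by apply: measurable_funM => //; exact: measurable_normal_sum.
rewrite (eq_cint _ (g := fun x => cis (\sum_(k < n) (t * c k) * xi k x))); last first.
  by move=> x; rewrite /normal_sum mulr_sumr; congr cis; apply: eq_bigr => k _; rewrite mulrA.
rewrite (cint_normal_sequence n (fun k => t * c k)) cReM /= mul0r subr0 mulrC; congr (_ * expR (- _ / 2)).
by rewrite mulr_suml; apply: eq_bigr => k _; rewrite exprMn mulrC.
Qed.

(** Second moments are read off the characteristic function, which saves the orthogonality relations
    of the [xi]. *)
Lemma normal_sum_sqr c n : (\int[U]_x (normal_sum c n x ^+ 2)%:E = (\sum_(k < n) c k ^+ 2)%:E)%E.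
Proof.
apply: gaussian_second_moment; first exact: measurable_normal_sum.
  by apply: sumr_ge0 => k _; exact: sqr_ge0.
exact: normal_sum_cos.
Qed.

Lemma normal_sumB c m n x : (m <= n)%N ->
  normal_sum c n x - normal_sum c m x = normal_sum (fun k => if (k < m)%N then 0 else c k) n x.
Proof.
move=> mn; rewrite /normal_sum (big_ord_widen n (fun k => c k * xi k x) mn) [X in _ - X]big_mkcond -sumrB.
by apply: eq_bigr => k _; case: ifP; rewrite ?subrr ?mul0r ?subr0.
Qed.

Lemma normal_sumB_sqr c m n : (m <= n)%N ->
  (\int[U]_x ((normal_sum c n x - normal_sum c m x) ^+ 2)%:E =
   (\sum_(k < n) c k ^+ 2 - \sum_(k < m) c k ^+ 2)%:E)%E.
Proof.
move=> mn; under eq_integral do rewrite normal_sumB//.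
rewrite normal_sum_sqr (big_ord_widen n (fun k => c k ^+ 2) mn) [X in _ - X]big_mkcond -sumrB; congr EFin.
by apply: eq_bigr => k _; case: ifP; rewrite ?expr0n ?subrr ?subr0.
Qed.

Section almost_sure_limit.
Variables (c : nat -> R) (v : R).
Hypothesis cv : \sum_(k < n) c k ^+ 2 @[n --> \oo] --> v.

Let V n := \sum_(k < n) c k ^+ 2.

Let V_nd : nondecreasing_seq V.
Proof. by apply/nondecreasing_seqP => n; rewrite /V big_ord_recr lerDl sqr_ge0. Qed.

Let V_le n : V n <= v.
Proof.
by have := nondecreasing_cvgn_le V_nd (cvgP _ cv) n; rewrite (cvg_lim _ cv).
Qed.

(** The condition [j <= n] forces the cutoffs to infinity even if only finitely many coefficients
    are nonzero. *)
Let good j n := (j <= n)%N && (v - V n <= 4^-1 ^+ j).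

Let good_ex j : exists n, good j n.
Proof.
have e0 : 0 < 4^-1 ^+ j :> R by rewrite exprn_gt0.
have /cvgrPdist_le/(_ _ e0)[n0 _ h] := cv.
exists (maxn j n0); rewrite /good leq_maxl /=; apply: le_trans (h _ (leq_maxr _ _)).
exact: ler_norm.
Qed.

(* Along this subsequence the increments are summable in L^1, hence the partial
   sums converge almost surely. *)
Definition cutoff j := ex_minn (good_ex j).

Lemma leq_cutoff j : (j <= cutoff j)%N.
Proof. by rewrite /cutoff; case: ex_minnP => n /andP[]. Qed.

Let cutoff_small j : v - V (cutoff j) <= 4^-1 ^+ j.
Proof. by rewrite /cutoff; case: ex_minnP => n /andP[]. Qed.

(** An index good for [j.+1] is good for [j], and [cutoff j] is the least such index. *)
Let cutoff_le j : (cutoff j <= cutoff j.+1)%N.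
Proof.
rewrite {1}/cutoff; case: ex_minnP => n _; apply; apply/andP; split.
  by apply: leq_trans (leq_cutoff _); exact: leqnSn.
apply: (le_trans (cutoff_small _)); rewrite exprS; apply: ler_piMl; first exact: exprn_ge0.
by lra.
Qed.

Let Delta j x := normal_sum c (cutoff j.+1) x - normal_sum c (cutoff j) x.

Let mDelta j : measurable_fun setT (Delta j).
Proof. by apply: measurable_funB; exact: measurable_normal_sum. Qed.

(** With [a = 2^-j] the second moment of the increment is at most [a^2]; then
    [|y| <= a / 2 + y^2 / (2 a)] bounds the first one by [a]. *)
Let Delta_mean j : (\int[U]_x `|Delta j x|%:E <= (2^-1 ^+ j)%:E)%E.
Proof.
pose a : R := 2^-1 ^+ j.
have a0 : 0 < a by rewrite exprn_gt0.
have aa : a ^+ 2 = 4^-1 ^+ j by rewrite /a -exprM mulnC exprM; congr (_ ^+ _); field.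
have h : (\int[U]_x (Delta j x ^+ 2)%:E <= (a ^+ 2)%:E)%E.
  rewrite normal_sumB_sqr// lee_fin aa; apply: le_trans (cutoff_small j).
  by rewrite lerD2r V_le.
have mD2 : measurable_fun setT (fun x => Delta j x ^+ 2) by exact: measurable_funX.
apply: (@le_trans _ _ (\int[U]_x ((a / 2)%:E + ((2 * a)^-1)%:E * (Delta j x ^+ 2)%:E))%E).
  apply: ge0_le_integral => //.
  - by apply/measurable_EFinP; exact: measurableT_comp.
  - by apply: emeasurable_funD => //; apply: emeasurable_funM => //; exact/measurable_EFinP.
  - move=> x _; rewrite -EFinM -EFinD lee_fin -(real_normK (num_real (Delta j x))).
    move: (`|Delta j x|) => y; rewrite -(ler_pM2l (_ : 0 < 2 * a)); last by rewrite mulr_gt0.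
    rewrite mulrDr mulrA mulfV ?mul1r; last by rewrite gt_eqF// mulr_gt0.
    have := sqr_ge0 (y - a); nra.
rewrite ge0_integralD//; last 3 first.
- by move=> x _; rewrite lee_fin divr_ge0// ltW.
- by move=> x _; rewrite -EFinM lee_fin mulr_ge0 ?sqr_ge0// invr_ge0 mulr_ge0// ltW.
- by apply: emeasurable_funM => //; exact/measurable_EFinP.
rewrite integral_cst// [X in (_ * X)%E]probability_setT mule1.
rewrite ge0_integralZl//; last 3 first.
- exact/measurable_EFinP.
- by move=> x _; rewrite lee_fin sqr_ge0.
- by rewrite lee_fin invr_ge0 mulr_ge0// ltW.
apply: (@le_trans _ _ ((a / 2)%:E + ((2 * a)^-1)%:E * (a ^+ 2)%:E)%E).
  by apply: leeD2l; apply: lee_wpmul2l => //; rewrite lee_fin invr_ge0 mulr_ge0// ltW.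
rewrite -EFinM -EFinD lee_fin -/a le_eqVlt; apply/orP; left; apply/eqP.
by field; rewrite gt_eqF.
Qed.

Lemma ae_cvg_normal_sum : {ae U, forall x, cvgn (fun j => normal_sum c (cutoff j) x)}.
Proof.
have D0 j x : (0 <= `|Delta j x|%:E)%E by rewrite lee_fin.
have mD j : measurable_fun setT (fun x => `|Delta j x|%:E).
  by apply/measurable_EFinP; exact: measurableT_comp.
pose F x := (\sum_(0 <= j <oo) `|Delta j x|%:E)%E.
have F0 x : (0 <= F x)%E by apply: nneseries_ge0.
have mF : measurable_fun setT F by exact: ge0_emeasurable_sum.
have iF : U.-integrable setT F.
  apply/integrableP; split => //; under eq_integral do rewrite gee0_abs//.
  rewrite integral_nneseries//.
  apply: (@le_lt_trans _ _ 2%:E); last exact: ltry.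
  apply: lime_le; first by apply: is_cvg_nneseries => j _ _; apply: integral_ge0.
  apply: nearW => n; apply: (@le_trans _ _ (\sum_(0 <= j < n) (2^-1 ^+ j)%:E)%E).
    by apply: lee_sum => j _; exact: Delta_mean.
  rewrite sumEFin lee_fin big_mkord; apply: (@le_trans _ _ (2 - 2 * 2^-1 ^+ n)); last first.
    by rewrite gerBl mulr_ge0// exprn_ge0.
  elim: n => [|n ih]; first by rewrite big_ord0 expr0; lra.
  by rewrite big_ord_recr /= exprS; move: ih; move: (\sum_(_ < n) _) (2^-1 ^+ n) => s e; lra.
have := integrable_ae measurableT iF.
apply: filterS => x /(_ I) Ffin.
have cD : cvgn (series (fun j => Delta j x)).
  apply: normed_cvg.
  have -> : [normed series (Delta ^~ x)] = (fun n => \sum_(0 <= j < n) `|Delta j x|) by [].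
  apply: nondecreasing_is_cvgn; first by apply/nondecreasing_seqP => n; rewrite big_nat_recr//= lerDl.
  exists (fine (F x)) => _ [n _ <-]; rewrite -lee_fin fineK// -sumEFin.
  exact: nneseries_lim_ge.
have E : (fun j => normal_sum c (cutoff j) x) = (fun j => normal_sum c (cutoff 0) x + series (fun j => Delta j x) j).
  apply/funext => n; rewrite /series /= telescope_sumr// addrC subrK//.
rewrite E; apply: is_cvgD => //; exact: is_cvg_cst.
Qed.

(** The upper limit exists and is measurable everywhere, also on the null set where the sums do not
    converge. *)
Definition normal_limit (x : R) : R := fine (limn_esup (fun j => (normal_sum c (cutoff j) x)%:E)).

Lemma measurable_normal_limit : measurable_fun setT normal_limit.
Proof.
apply: measurableT_comp => //; apply: measurable_fun_limn_esup => j.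
by apply/measurable_EFinP; exact: measurable_normal_sum.
Qed.

Lemma ae_normal_limit : {ae U, forall x, normal_sum c (cutoff j) x @[j --> \oo] --> normal_limit x}.
Proof.
have := ae_cvg_normal_sum; apply: filterS => x /cvg_ex[l cl].
have cE : (normal_sum c (cutoff j) x)%:E @[j --> \oo] --> l%:E by apply: cvg_EFin; [exact: nearW|exact: cl].
by rewrite /normal_limit is_cvg_limn_esupE; [rewrite (cvg_lim _ cE)|apply/cvg_ex; eexists; exact: cE].
Qed.

End almost_sure_limit.

Variables (I : Type) (c : I -> nat -> R) (C : I -> I -> R).
Hypothesis cC : forall i l, \sum_(k < n) c i k * c l k @[n --> \oo] --> C i l.

Let cv i : \sum_(k < n) c i k ^+ 2 @[n --> \oo] --> C i i.
Proof. exact: cC. Qed.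

Definition normal_field i : R -> R := @normal_limit (c i) (C i i) (@cv i).

Let cut i j := @cutoff (c i) (C i i) (@cv i) j.

(** The cutoffs depend on the index of the field. Extending every truncated sum by zeros to a common
    length makes a linear combination a single normal sum, in whose variance the cross terms stop at
    the smaller of the two cutoffs. *)
Let sum_cutoff m (z : 'I_m -> I) (a : 'I_m -> R) (j : nat) : exists e n,
  (forall x, \sum_(i < m) a i * normal_sum (c (z i)) (cut (z i) j) x = normal_sum e n x) /\
  \sum_(k < n) e k ^+ 2 = \sum_(i < m) \sum_(l < m) a i * a l *
    \sum_(k < minn (cut (z i) j) (cut (z l) j)) c (z i) k * c (z l) k.
Proof.
pose p i := cut (z i) j; pose n := \sum_(i < m) p i.
have pn i : (p i <= n)%N by rewrite /n (bigD1 i)//= leq_addr.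
pose b i k : R := if (k < p i)%N then c (z i) k else 0.
exists (fun k => \sum_(i < m) a i * b i k), n; split=> [x|].
  rewrite /normal_sum; under [RHS]eq_bigr do rewrite mulr_suml.
  rewrite exchange_big; apply: eq_bigr => i _ /=.
  rewrite (big_ord_widen n (fun k => c (z i) k * xi k x) (pn i)) [X in a i * X]big_mkcond mulr_sumr.
  by apply: eq_bigr => k _; rewrite /b; case: ifP; rewrite ?mulrA// mulr0 mul0r.
under eq_bigr do rewrite expr2 mulr_suml.
rewrite exchange_big; apply: eq_bigr => i _ /=.
under eq_bigr do rewrite mulr_sumr.
rewrite exchange_big; apply: eq_bigr => l _ /=.
have mn : (minn (p i) (p l) <= n)%N by apply: leq_trans (pn i); exact: geq_minl.
rewrite (big_ord_widen n (fun k => c (z i) k * c (z l) k) mn) [X in a i * a l * X]big_mkcond mulr_sumr.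
apply: eq_bigr => k _; rewrite /b leq_min mulrACA.
by case: ltnP => _; case: ltnP => _; rewrite ?mulr0 ?mul0r ?mulr0.
Qed.

Lemma measurable_normal_field i : measurable_fun setT (normal_field i).
Proof. exact: measurable_normal_limit. Qed.

(** The formula is exact at each cutoff level [j]; the left side passes to the limit by almost sure
    convergence, the right side by convergence of the truncated covariances. *)
Lemma normal_field_cos m (z : 'I_m -> I) (a : 'I_m -> R) (t th : R) :
  \int[U]_x cos (t * (\sum_(i < m) a i * normal_field (z i) x) + th) =
  cos th * expR (- ((\sum_(i < m) \sum_(l < m) a i * a l * C (z i) (z l)) * t ^+ 2) / 2).
Proof.
pose T j x := \sum_(i < m) a i * normal_sum (c (z i)) (cut (z i) j) x.
have mT j : measurable_fun setT (T j).
  by apply: measurable_sum => i; apply: measurable_funM => //; exact: measurable_normal_sum.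
have mF : measurable_fun setT (fun x => \sum_(i < m) a i * normal_field (z i) x).
  by apply: measurable_sum => i; apply: measurable_funM => //; exact: measurable_normal_field.
have l1 : \int[U]_x cos (t * T j x + th) @[j --> \oo] -->
    \int[U]_x cos (t * (\sum_(i < m) a i * normal_field (z i) x) + th).
  apply: (@dominated_Rintegral _ _ _ U _ _ (fun=> 1)).
  - move=> j; apply: (measurableT_comp (@measurable_cosR R)).
    by apply: measurable_funD => //; exact: measurable_funM.
  - apply: (measurableT_comp (@measurable_cosR R)).
    by apply: measurable_funD => //; exact: measurable_funM.
  - have h : {ae U, forall x (i : 'I_m), normal_sum (c (z i)) (cut (z i) j) x @[j --> \oo] --> normal_field (z i) x}.
      by apply: filter_forall => i; exact: ae_normal_limit.
    apply: filterS h => x h; apply: continuous_cvg; first exact: continuous_cos.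
    apply: cvgD; last exact: cvg_cst.
    have hi i : a i * normal_sum (c (z i)) (cut (z i) j) x @[j --> \oo] --> a i * normal_field (z i) x.
      by apply: cvgMr; exact: h.
    by apply: cvgMr; exact: (@cvg_sum_seq R _ (index_enum 'I_m) _ _ hi).
  - exact: finite_measure_integrable_cst.
  - by move=> j x; exact: normr_cos_le1.
pose Q j := \sum_(i < m) \sum_(l < m) a i * a l *
    \sum_(k < minn (cut (z i) j) (cut (z l) j)) c (z i) k * c (z l) k.
have E j : \int[U]_x cos (t * T j x + th) = cos th * expR (- (Q j * t ^+ 2) / 2).
  have [e [n [h1 h2]]] := sum_cutoff z a j.
  by rewrite /Q -h2 -normal_sum_cos; apply: eq_Rintegral => x _; rewrite -h1.
have Qlim : Q j @[j --> \oo] --> \sum_(i < m) \sum_(l < m) a i * a l * C (z i) (z l).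
  have hil i l : a i * a l * (\sum_(k < minn (cut (z i) j) (cut (z l) j)) c (z i) k * c (z l) k) @[j --> \oo] -->
      a i * a l * C (z i) (z l); last first.
    have hi i := @cvg_sum_seq R _ (index_enum 'I_m) _ _ (hil i).
    exact: (@cvg_sum_seq R _ (index_enum 'I_m) _ _ hi).
  (* Both cutoffs are at least [j], so the truncated scalar products are evaluated along a sequence
     of lengths tending to infinity. *)
  have hmin : minn (cut (z i) j) (cut (z l) j) @[j --> \oo] --> \oo.
    move=> A [n0 _ An0]; exists n0 => // j /= nj; apply: An0 => /=.
    by rewrite leq_min; apply/andP; split; apply: leq_trans nj _; exact: leq_cutoff.
  by apply: cvgMr; exact: (cvg_comp _ _ hmin (@cC (z i) (z l))).
have l2 : cos th * expR (- (Q j * t ^+ 2) / 2) @[j --> \oo] -->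
    cos th * expR (- ((\sum_(i < m) \sum_(l < m) a i * a l * C (z i) (z l)) * t ^+ 2) / 2).
  apply: cvgMr; apply: continuous_cvg; first exact: continuous_expR.
  by apply: cvgMl; apply: cvgN; apply: cvgMl.
have E' : (fun j => \int[U]_x cos (t * T j x + th)) = (fun j => cos th * expR (- (Q j * t ^+ 2) / 2)) by apply/funext.
by move: l1; rewrite E' => /cvg_unique; apply.
Qed.

End normal_sums.

Lemma Rintegral_sqr_sum d (T : measurableType d) (R : realType) (mu : {measure set T -> \bar R})
    (I : Type) (s : seq I) (a : I -> R) (f : I -> T -> R) :
  (forall i l, mu.-integrable setT (fun x => (f i x * f l x)%:E)) ->
  \int[mu]_x (\sum_(i <- s) a i * f i x) ^+ 2 =
  \sum_(i <- s) \sum_(l <- s) a i * a l * \int[mu]_x (f i x * f l x).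
Proof.
move=> fi; have i1 i l : mu.-integrable setT (fun x => (a i * a l * (f i x * f l x))%:E).
  exact: integrable_RZ.
transitivity (\int[mu]_x \sum_(i <- s) \sum_(l <- s) a i * a l * (f i x * f l x)).
  apply: eq_Rintegral => x _; rewrite expr2 mulr_suml; apply: eq_bigr => i _.
  by rewrite mulr_sumr; apply: eq_bigr => l _; rewrite mulrACA.
rewrite (Rintegral_sum_seq s (fun i => integrable_R_sum s (i1 i))); apply: eq_bigr => i _.
rewrite (Rintegral_sum_seq s (i1 i)); apply: eq_bigr => l _.
by rewrite (RintegralZl _ measurableT (fi i l)).
Qed.

Lemma expectation_bounded d (T : measurableType d) (R : realType) (P : probability T R)
    (f : T -> R) (M : R) : measurable_fun setT f -> (forall x, `|f x| <= M) ->
  ('E_P[f] = (\int[P]_x f x)%:E)%E.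
Proof.
move=> mf fM; rewrite unlock /Rintegral fineK//.
by apply: integrable_fin_num => //; exact: bounded_integrable fM.
Qed.

(** * The Gaussian limit of the normalized shot noise *)

Theorem theorem2 (R : realType) (d : nat) (hd : (0 < d)%N)
    (dO : R -> measure_display) (Omega : forall lam, measurableType (dO lam))
    (P : forall lam, probability (Omega lam) R)
    (X : forall lam, nat -> {RV (P lam) >-> 'rV[R]_d})
    (K : R -> 'rV[R]_d -> 'rV[R]_d -> R[i])
    (hX : forall lam : R, 0 < lam ->
      stationary_isotropic_dpp (P lam) (X lam) lam (K lam))
    (A : forall lam, nat -> {RV (P lam) >-> R})
    (muP : probability R R)
    (hA_nonneg : forall lam : R, 0 < lam -> forall n w, 0 <= A lam n w)
    (hA_law : forall lam : R, 0 < lam -> forall n (B : set R), measurable B ->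
      distribution (P lam) (A lam n) B = muP B)
    (hA_indep : forall lam : R, 0 < lam -> mutually_independent (P lam) (A lam))
    (hAX_indep : forall lam : R, 0 < lam ->
      independent_sequences (P lam) (A lam) (X lam))
    (hP1 : ('E_muP[fun t : R => t] < +oo)%E)
    (hP2 : ('E_muP[fun t : R => (t ^+ 2)%R] < +oo)%E)
    (ell : 'rV[R]_d -> R)
    (hell_meas : measurable_fun setT ell)
    (hell_nonneg : forall x, 0 <= ell x)
    (hell_bounded : exists M : R, forall x, ell x <= M)
    (hell_int : (\int[lebesgue_mx]_x (ell x)%:E < +oo)%E)
    (hK : ((\int[lebesgue_mx]_x (Normc.normc (K lam 0 x) ^+ 2)%:E)
             * (lam^-1)%:E)%E @[lam --> +oo%R] --> 0%E) :
  exists (dO' : measure_display) (Omega' : measurableType dO')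
    (P' : probability Omega' R) (N : 'rV[R]_d -> {RV P' >-> R}),
    [/\ gaussian_field N,
        forall z, ('E_P'[N z] = 0)%E,
        forall z1 z2, covariance P' (N z1) (N z2) =
          ('E_muP[fun t : R => (t ^+ 2)%R] *
             \int[lebesgue_mx]_x (ell (z1 - x) * ell (z2 - x))%:E)%E &
        forall m (z : 'I_m -> 'rV[R]_d), (0 < m)%N ->
          cvg_in_distribution P
            (fun lam w => \row_(i < m)
               normalized_shot_noise (P lam) lam (A lam) ell (X lam) (z i) w)
            P' (fun w => \row_(i < m) N (z i) w)].
Proof.
have [L ellL] := hell_bounded.
pose leb : {measure set 'rV[R]_d -> \bar R} := @lebmx R 1 d.
have sqr_int : muP.-integrable setT (fun s : R => (s ^+ 2)%:E).
  apply/integrableP; split; first by apply/measurable_EFinP; exact: measurable_funX.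
  by under eq_integral do rewrite gee0_abs ?lee_fin ?sqr_ge0//; move: hP2; rewrite unlock.
pose q := \int[muP]_s s ^+ 2.
have qE : ('E_muP[fun t : R => (t ^+ 2)%R] = q%:E)%E.
  by rewrite unlock /q /Rintegral fineK//; exact: integrable_fin_num.
have q0 : 0 <= q by apply: Rintegral_ge0 => s _; exact: sqr_ge0.
pose f (z x : 'rV[R]_d) := ell (z - x).
have mf z : measurable_fun setT (f z).
  apply: (measurableT_comp hell_meas); apply: measurable_mx => i j.
  by under eq_fun do rewrite !mxE; apply: measurable_funB => //; exact: measurable_mx_entry.
have fi z : leb.-integrable setT (fun x => (f z x)%:E).
  apply/integrableP; split; first by apply/measurable_EFinP.
  under eq_integral do rewrite gee0_abs ?lee_fin /f ?hell_nonneg//.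
  by rewrite (lebmx_reflect z (F := fun x => (ell x)%:E))//; apply/measurable_EFinP.
have fL z x : `|f z x| <= L by rewrite ger0_norm ?ellL ?hell_nonneg.
have L0 : 0 <= L by apply: le_trans (fL 0 0).
have sf z : square_integrable leb (f z).
  split => //; apply: (le_integrable_R _ _ (integrable_RZ L (fi z))); first exact: measurable_funX.
  move=> x; have f0 : 0 <= f z x by exact: hell_nonneg.
  by rewrite ger0_norm ?sqr_ge0// expr2; apply: ler_wpM2r => //; exact: ellL.
have [c cE] := exists_features R d.
pose C z1 z2 := q * inner leb (f z1) (f z2).
(* The coordinates represent the scalar product of translates; the factor [sqrt q] in each brings in
   the second moment of the amplitudes. *)
pose c' z k := Num.sqrt q * c (f z) k.
have cC z1 z2 : \sum_(k < n) c' z1 k * c' z2 k @[n --> \oo] --> C z1 z2.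
  have -> : (fun n => \sum_(k < n) c' z1 k * c' z2 k) = (fun n => q * \sum_(k < n) c (f z1) k * c (f z2) k).
    apply/funext => n; rewrite mulr_sumr; apply: eq_bigr => k _.
    by rewrite /c' mulrACA -expr2 sqr_sqrtr.
  by apply: cvgMr; apply: cE => // x; exact: hell_nonneg.
pose P' := uniform01 R.
pose N z : {RV P' >-> R} := mfun_Sub (mem_set (measurable_normal_field cC z)).
have mN z : measurable_fun setT (N z) by exact: measurable_funPT.
pose v m (z : 'I_m -> 'rV[R]_d) (a : 'I_m -> R) := \sum_(i < m) \sum_(l < m) a i * a l * C (z i) (z l).
have vE m (z : 'I_m -> 'rV[R]_d) a : v m z a = q * \int[leb]_x (\sum_(i < m) a i * f (z i) x) ^+ 2.
  have fil (i l : 'I_m) : leb.-integrable setT (fun x => (f (z i) x * f (z l) x)%:E).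
    by exact: integrable_inner.
  rewrite (Rintegral_sqr_sum (index_enum 'I_m) a fil).
  rewrite mulr_sumr; apply: eq_bigr => i _; rewrite mulr_sumr; apply: eq_bigr => l _.
  by rewrite /C mulrCA.
have v0 m z a : 0 <= v m z a.
  by rewrite vE mulr_ge0//; apply: Rintegral_ge0 => x _; exact: sqr_ge0.
have mY m (z : 'I_m -> 'rV[R]_d) (a : 'I_m -> R) : measurable_fun setT (fun w => \sum_(i < m) a i * N (z i) w).
  by apply: measurable_sum => i; exact: measurable_funM.
have cfN m (z : 'I_m -> 'rV[R]_d) (a : 'I_m -> R) t th :
    \int[P']_x cos (t * (\sum_(i < m) a i * N (z i) x) + th) =
    cos th * expR (- (v m z a * t ^+ 2) / 2) by exact: normal_field_cos.
have cf1 z t th : \int[P']_x cos (t * N z x + th) = cos th * expR (- (C z z * t ^+ 2) / 2).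
  have := cfN 1%N (fun=> z) (fun=> 1) t th; rewrite /v !big_ord1 !mul1r => <-.
  by apply: eq_Rintegral => x _; rewrite big_ord1 mul1r.
have C0 z1 : 0 <= C z1 z1 by rewrite mulr_ge0// inner_ge0.
(* Sums of two values are needed to obtain the covariance by polarization from second moments. *)
have cf2 z1 z2 t th : \int[P']_x cos (t * (N z1 x + N z2 x) + th) =
    cos th * expR (- ((C z1 z1 + C z1 z2 + (C z1 z2 + C z2 z2)) * t ^+ 2) / 2).
  have := cfN 2%N (fun i => if i == ord0 then z1 else z2) (fun=> 1) t th.
  rewrite /v !big_ord_recl !big_ord0 !mul1r !addr0 /= [C z2 z1](_ : _ = C z1 z2); last first.
    by rewrite /C inner_sym.
  by move=> <-; apply: eq_Rintegral => x _; rewrite !big_ord_recl big_ord0 !mul1r addr0.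
have mean0 z : ('E_P'[N z] = 0)%E.
  suff iN : P'.-integrable setT (fun x => (N z x)%:E).
    rewrite unlock -[LHS]fineK; last exact: integrable_fin_num.
    exact: (congr1 EFin (gaussian_mean (mN z) (C0 z) (cf1 z))).
  have i1 : P'.-integrable setT (fun=> (1 : R)%:E) by exact: finite_measure_integrable_cst.
  have i2 := gaussian_integrable_sqr (mN z) (C0 z) (cf1 z).
  apply: (le_integrable_R _ _ (integrable_RD i1 i2)) => // x.
  rewrite -(real_normK (num_real (N z x))).
  by have := sqr_ge0 (`|N z x| - 1); have := normr_ge0 (N z x); move: (`|N z x|) => y; nra.
have C20 z1 z2 : 0 <= C z1 z1 + C z1 z2 + (C z1 z2 + C z2 z2).
  have := v0 2%N (fun i => if i == ord0 then z1 else z2) (fun=> 1).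
  rewrite /v !big_ord_recl !big_ord0 !mul1r !addr0 /= [C z2 z1](_ : _ = C z1 z2)//.
  by rewrite /C inner_sym.
exists _, _, P', N; split.
- by move=> m z a; apply: (gaussian_law_of_cos (mY m z a) (v0 m z a)); exact: cfN.
- exact: mean0.
- move=> z1 z2; rewrite qE covariance.unlock !mean0 unlock.
  have i1 := gaussian_integrable_sqr (mN z1) (C0 z1) (cf1 z1).
  have i2 := gaussian_integrable_sqr (mN z2) (C0 z2) (cf1 z2).
  have m12 : measurable_fun setT (fun x => N z1 x + N z2 x) by exact: measurable_funD.
  have i12 := gaussian_integrable_sqr m12 (C20 z1 z2) (cf2 z1 z2).
  have s1 := gaussian_second_moment (mN z1) (C0 z1) (cf1 z1).
  have s2 := gaussian_second_moment (mN z2) (C0 z2) (cf1 z2).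
  have s12 := gaussian_second_moment m12 (C20 z1 z2) (cf2 z1 z2).
  (* Polarization: the product of the two values is half of this difference of squares. *)
  have ip : P'.-integrable setT (fun x => (2^-1 * ((N z1 x + N z2 x) ^+ 2 - (N z1 x ^+ 2 + N z2 x ^+ 2)))%:E).
    by apply: integrable_RZ; apply: integrable_RB => //; exact: integrable_RD.
  transitivity (\int[P']_x (2^-1 * ((N z1 x + N z2 x) ^+ 2 - (N z1 x ^+ 2 + N z2 x ^+ 2)))%:E)%E.
    apply: eq_integral => x _; congr EFin; rewrite -[LHS]/((N z1 x - 0) * (N z2 x - 0)) !subr0.
    by field.
  rewrite -[LHS]fineK; last exact: integrable_fin_num.
  rewrite -[fine _]/(\int[P']_x (2^-1 * ((N z1 x + N z2 x) ^+ 2 - (N z1 x ^+ 2 + N z2 x ^+ 2)))).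
  have id := integrable_RD i1 i2.
  rewrite (RintegralZl _ measurableT (integrable_RB i12 id)) (RintegralB measurableT i12 id).
  rewrite (RintegralD measurableT i1 i2) /Rintegral s1 s2 s12 /=.
  rewrite -[(\int[lebesgue_mx]_x _)%E]fineK; last first.
    by apply: integrable_fin_num => //; exact: (integrable_inner (sf z1) (sf z2)).
  rewrite -EFinM; congr EFin; rewrite -[fine _]/(inner leb (f z1) (f z2)).
  by rewrite -/(C z1 z2); move: (C z1 z1) (C z1 z2) (C z2 z2) => *; field.
- move=> m z m0 g cg [M gM]; apply/cvge_pinftyP => u uoo.
  (* The limit is tested along a sequence [u] tending to infinity. The hypotheses concern positive
     intensities, so [u] is replaced by a positive sequence that eventually coincides with it. *)
  pose l n := Num.max (u n) 1.
  have l0 n : 0 < l n by rewrite lt_max ltr01 orbT.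
  have lu : \forall n \near \oo, l n = u n.
    have /cvgryPge/(_ 1) := uoo; apply: filterS => n u1; exact: max_l.
  have loo : l n @[n --> \oo] --> +oo.
    move: uoo; apply: cvg_trans; apply: near_eq_cvg.
    by apply: filterS lu => n ->.
  pose Y lm (w : Omega lm) := \row_(i < m) normalized_shot_noise (P lm) lm (A lm) ell (X lm) (z i) w.
  have mYn n : measurable_fun setT (Y (l n)).
    apply: measurable_mx => i j; under eq_fun do rewrite mxE.
    apply: measurable_funM => //; apply: measurable_funB => //; apply: measurableT_comp => //.
    have mXn k : measurable_fun setT (X (l n) k) by exact: measurable_funPT.
    have mAn k : measurable_fun setT (A (l n) k) by exact: measurable_funPT.
    exact: (measurable_shot_noise mXn mAn (hA_nonneg _ (l0 n)) hell_meas hell_nonneg).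
  have mYN : measurable_fun setT (fun w => \row_(i < m) N (z i) w).
    by apply: measurable_mx => i j; under eq_fun do rewrite mxE; exact: mN.
  have mg : measurable_fun setT g by exact: continuous_measurable_mx.
  have cf t th : \int[law (P (l n)) (mYn n)]_x cos (dotv t x + th) @[n --> \oo] -->
      \int[law P' mYN]_x cos (dotv t x + th).
    have bc (x : 'rV[R]_m) : `|cos (dotv t x + th)| <= 1 by exact: normr_cos_le1.
    have mc := measurable_cos_dotv t th.
    rewrite (@Rintegral_law _ _ _ _ _ P' _ mYN _ 1 mc bc).
    have -> : (fun n => \int[law (P (l n)) (mYn n)]_x cos (dotv t x + th)) =
        (fun n => \int[P (l n)]_w cos (\sum_(j < m)
          t 0 j * normalized_shot_noise (P (l n)) (l n) (A (l n)) ell (X (l n)) (z j) w + th)).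
      apply/funext => n; rewrite (@Rintegral_law _ _ _ _ _ _ _ (mYn n) _ 1 mc bc).
      apply: eq_Rintegral => w _; rewrite /dotv /Y; congr (cos (_ + _)).
      by apply: eq_bigr => i _; rewrite mxE.
    have -> : \int[P']_w cos (dotv t (\row_(i < m) N (z i) w) + th) =
        expR (- (q / 2 * \int[leb]_x (\sum_(j < m) t 0 j * f (z j) x) ^+ 2)) * cos th.
      have := cfN m z (fun i => t 0 i) 1 th; rewrite vE expr1n mulr1 mulrC => e.
      transitivity (expR (- (q * \int[leb]_x (\sum_(i < m) t 0 i * f (z i) x) ^+ 2) / 2) * cos th).
        rewrite -e; apply: eq_Rintegral => w _; rewrite mul1r /dotv; congr (cos (_ + _)).
        by apply: eq_bigr => i _; rewrite mxE.
      by congr (expR _ * _); rewrite mulNr mulrAC.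
    exact: (shot_noise_cf_cvg hX hA_nonneg hA_law hA_indep hAX_indep sqr_int hell_meas hell_nonneg ellL hell_int hK l0 loo).
  have lim := levy_continuity cf cg (ex_intro _ M gM).
  have E' : ('E_P'[fun w => g (\row_(i < m) N (z i) w)] = (\int[law P' mYN]_x g x)%:E)%E.
    rewrite (@expectation_bounded _ _ _ _ _ M) ?(@Rintegral_law _ _ _ _ _ P' _ mYN g M mg gM)//.
    exact: (measurableT_comp mg mYN).
  rewrite E'; apply: (@cvg_trans _ ((\int[law (P (l n)) (mYn n)]_x g x)%:E @[n --> \oo])).
    apply: near_eq_cvg; apply: filterS lu => n <-.
    rewrite (@expectation_bounded _ _ _ _ _ M) ?(@Rintegral_law _ _ _ _ _ _ _ (mYn n) g M mg gM)//.
    exact: (measurableT_comp mg (mYn n)).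
  by apply: cvg_EFin; [exact: nearW|exact: lim].
Qed.
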